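(* Under Assumption (R), for all $n\ge1$, $x_0\in\mathbb{R}$, $\theta\in\Theta$, the vector $$(U^{n,\theta},V^{n,\theta})=\left(\int_0^1\mathcal{X}^{n,\theta}_s\,d\mu(s),\ \mathcal{X}^{n,\theta}_1\right)$$ admits a density $\mathfrak{p}^n_{x_0}(\cdot,\cdot,\theta)$ on $\mathbb{R}^2$, and there exist two constants $c_1>c_2>0$ such that $$c_1^{-1}e^{-c_1(u^2+v^2)}\le\mathfrak{p}^n_{x_0}(u,v,\theta)\le c_2^{-1}e^{-c_2(u^2+v^2)} .$$ The constants $c_1$ and $c_2$ only depend on the bounds on the coefficients $a$, $b$ and their derivatives (the measure $\mu$ being fixed); in particular they do not depend on $n,x_0,\theta$.
   Context: $\Theta\subset\mathbb{R}$ is a compact interval; a dot denotes $\partial_\theta$. Assumption (R) on $a:\mathbb{R}\times\Theta\to\mathbb{R}$ and $b:\mathbb{R}\to\mathbb{R}$: 1) $a$ is $\mathcal{C}^{1+\gamma}$ on $\mathbb{R}\times\Theta$ for some $\gamma\in(0,1)$ (it admits a derivative which is $\gamma$-Hölder), and the functions $x\mapsto a(x,\theta)$, $x\mapsto\dot a(x,\theta)$, $x\mapsto b(x)$ are $\mathcal{C}^3(\mathbb{R})$; 2) $a$, $\dot a$, $b$ and all their derivatives with respect to $x$ are bounded uniformly in $\theta$; 3) there is $\underline a$ with $a(x,\theta)>\underline a>0$ for all $x,\theta$. $\mu$ is a fixed probability measure on $[0,1]$ with $\mu((0,1))>0$. For $n\ge1$, $x_0\in\mathbb{R}$, $\theta\in\Theta$,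 the process $\mathcal{X}^{n,\theta}$ solves $d\mathcal{X}^{n,\theta}_t=a_n(\mathcal{X}^{n,\theta}_t,\theta)\,dW_t+b_n(\mathcal{X}^{n,\theta}_t)\,dt$, $\mathcal{X}^{n,\theta}_0=0$, where $W$ is a standard one-dimensional Brownian motion, $a_n(x,\theta)=a(x_0+n^{-1/2}x,\theta)$ and $b_n(x)=n^{-1/2}b(x_0+n^{-1/2}x)$. *)

(* Defs.v *)
From HB Require Import structures.
From mathcomp Require Import all_boot all_order all_algebra.
From mathcomp Require Import all_classical all_reals all_analysis.
Set Implicit Arguments.
Unset Strict Implicit.
Unset Printing Implicit Defensive.
Import Order.TTheory GRing.Theory Num.Theory.
Import numFieldNormedType.Exports.
Local Open Scope classical_set_scope.
Local Open Scope ring_scope.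

Section coefficients.
Context {R : realType}.

Definition Ck (k : nat) (f : R -> R) : Prop :=
  (forall j x, (j < k)%N -> derivable (derive1n j f) x 1) /\ continuous (derive1n k f).

Definition derivs_bounded (k : nat) (f : R -> R) (K : R) : Prop :=
  forall j x, (j <= k)%N -> `|derive1n j f x| <= K.

(* (g1, g2) is the gradient at z of f restricted to D; only increments that
   stay in D matter, so that at a boundary point derivatives are one-sided. *)
Definition is_gradient_in (D : set (R * R)) (f : R * R -> R) (z : R * R)
    (g1 g2 : R) : Prop :=
  (fun w => (f w - f z - g1 * (w.1 - z.1) - g2 * (w.2 - z.2)) / `|w - z|)
    @ within D z^' --> (0 : R).

Definition holder_in (D : set (R * R)) (gamma : R) (f : R * R -> R) : Prop :=
  exists C : R, forall z w, D z -> D w -> `|f z - f w| <= C * `|z - w| `^ gamma.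

(* The regularity and ellipticity assumption on a and b, with a common bound K
   on a, its theta-derivative adot, b, and their x-derivatives (orders 0 to 3),
   and a lower bound alpha for a. *)
Definition assumption_R (Theta : set R) (K alpha : R)
    (a : R -> R -> R) (b : R -> R) : Prop :=
  exists (gamma : R) (dxa adot : R -> R -> R),
    [/\ [/\ 0 < gamma < 1,
        (forall x theta, Theta theta ->
           is_gradient_in (setT `*` Theta) (fun z => a z.1 z.2) (x, theta)
             (dxa x theta) (adot x theta)),
        holder_in (setT `*` Theta) gamma (fun z => dxa z.1 z.2) &
        holder_in (setT `*` Theta) gamma (fun z => adot z.1 z.2)],
      [/\ (forall theta, Theta theta -> Ck 3 (a ^~ theta)),
        (forall theta, Theta theta -> Ck 3 (adot ^~ theta)) &
        Ck 3 b],
      [/\ (forall theta, Theta theta -> derivs_bounded 3 (a ^~ theta) K),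
        (forall theta, Theta theta -> derivs_bounded 3 (adot ^~ theta) K) &
        derivs_bounded 3 b K] &
      0 < alpha /\ (forall x theta, Theta theta -> alpha < a x theta)].

Definition rescaled_diffusion (a : R -> R -> R) (n : nat) (x0 theta : R)
  : R -> R := fun x => a (x0 + x / Num.sqrt n%:R) theta.

Definition rescaled_drift (b : R -> R) (n : nat) (x0 : R) : R -> R :=
  fun x => b (x0 + x / Num.sqrt n%:R) / Num.sqrt n%:R.

End coefficients.

(* Processes and filtrations are indexed by R, and only times t >= 0 are
   constrained. *)
Section stochastic_calculus.
Context {R : realType} (d : measure_display) (T : measurableType d).
Variable P : probability T R.

Definition filtration (F : R -> set (set T)) : Prop :=
  [/\ (forall t : R, 0 <= t -> sigma_algebra setT (F t)),
      (forall t : R, 0 <= t -> F t `<=` measurable) &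
      (forall s t : R, 0 <= s -> s <= t -> F s `<=` F t)].

Definition measurable_wrt (G : set (set T)) (X : T -> R) : Prop :=
  forall B : set R, measurable B -> G (X @^-1` B).

Definition increment_in (W : R -> T -> R) (s t : R) (B : set R) : set T :=
  [set omega | B (W t omega - W s omega)].

Definition brownian_motion (F : R -> set (set T)) (W : R -> T -> R) : Prop :=
  [/\ (forall t : R, 0 <= t -> measurable_wrt (F t) (W t)),
      {ae P, forall omega, W 0 omega = 0},
      (forall omega, {within `[0, +oo[, continuous (W ^~ omega)}),
      (forall (s t : R) (B : set R), 0 <= s -> s < t -> measurable B ->
         P (increment_in W s t B) =
         normal_prob 0 (Num.sqrt (t - s)) B) &
      (forall (s t : R) (A : set T) (B : set R), 0 <= s -> s < t ->
         F s A -> measurable B ->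
         P (A `&` increment_in W s t B) =
         (P A * P (increment_in W s t B))%E)].

(* A simple process on [0, tau], equal to xi i on ]tt i, tt i.+1] for i < N *)
Record simple_process (F : R -> set (set T)) (tau : R) := SimpleProcess {
  sp_size : nat ;
  sp_time : nat -> R ;
  sp_val : nat -> T -> R ;
  sp_time0 : sp_time 0 = 0 ;
  sp_timeN : sp_time sp_size = tau ;
  sp_timeS : forall i, (i < sp_size)%N -> sp_time i < sp_time i.+1 ;
  sp_adapted : forall i, (i < sp_size)%N ->
    measurable_wrt (F (sp_time i)) (sp_val i) ;
  sp_bounded : forall i, (i < sp_size)%N ->
    exists M : R, forall omega, `|sp_val i omega| <= M }.

Definition sp_eval F tau (S : simple_process F tau) (s : R) (omega : T) : R :=
  \sum_(i < sp_size S)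
     sp_val S i omega * \1_(`]sp_time S i, sp_time S i.+1]) s.

Definition sp_integral F tau (S : simple_process F tau) (W : R -> T -> R)
    (omega : T) : R :=
  \sum_(i < sp_size S)
     sp_val S i omega * (W (sp_time S i.+1) omega - W (sp_time S i) omega).

(* J is (a version of) the Ito integral of H with respect to W over [0, tau]:
   the L^2 limit of the integrals of simple processes converging to H in
   L^2([0, tau] x T). *)
Definition is_ito_integral (F : R -> set (set T)) (W : R -> T -> R) (tau : R)
    (H : R -> T -> R) (J : T -> R) : Prop :=
  [/\ measurable_fun (`[0, tau] `*` setT) (fun z : R * T => H z.1 z.2),
      measurable_fun setT J &
      exists S : nat -> simple_process F tau,
        (\int[P]_omega \int[lebesgue_measure]_(s in `[0%R, tau])
             ((sp_eval (S k) s omega - H s omega) ^+ 2)%R%:E)%E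
          @[k --> \oo] --> 0%E /\
        (\int[P]_omega ((sp_integral (S k) W omega - J omega) ^+ 2)%R%:E)%E
          @[k --> \oo] --> 0%E].

(* X is a continuous F-adapted solution on [0, tau] of
   dX_t = sigma(X_t) dW_t + beta(X_t) dt,  X_0 = x *)
Definition sde_solution (F : R -> set (set T)) (W : R -> T -> R) (tau : R)
    (sigma beta : R -> R) (x : R) (X : R -> T -> R) : Prop :=
  [/\ (forall t : R, 0 <= t <= tau -> measurable_wrt (F t) (X t)),
      (forall omega, {within `[0, tau], continuous (X ^~ omega)}),
      {ae P, forall omega, X 0 omega = x} &
      (forall t : R, 0 <= t <= tau -> exists2 J : T -> R,
         is_ito_integral F W t (fun s omega => sigma (X s omega)) J &
         {ae P, forall omega, X t omega =
            X 0 omega + J omega +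
            \int[lebesgue_measure]_(s in `[0, t]) beta (X s omega)})].

Definition has_density (Z : T -> R * R) (p : R * R -> R) : Prop :=
  [/\ measurable_fun setT p, (forall z, 0 <= p z) &
      forall A : set (R * R), measurable A ->
        P (Z @^-1` A) =
        (\int[(lebesgue_measure \x lebesgue_measure)]_(z in A) (p z)%:E)%E].

End stochastic_calculus.

(* Main.v *)
Require Import Defs.
From HB Require Import structures.
From mathcomp Require Import all_boot all_order all_algebra.
From mathcomp Require Import all_classical all_reals all_analysis.
From mathcomp Require Import measurable_realfun.
From mathcomp Require Import ring lra.
Set Implicit Arguments.
Unset Strict Implicit.
Unset Printing Implicit Defensive.
Import Order.TTheory GRing.Theory Num.Theory.
Import numFieldNormedType.Exports.
Local Open Scope classical_set_scope.
Local Open Scope ring_scope.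

(** Why the density exists and satisfies the bounds.

    The idea is to compare the diffusion with a discrete scheme whose steps have
    an explicit density, with a constant that does not depend on the grid, and
    to compute for the scheme with a Brownian motion.

    The Lamperti transform [phi], of derivative the inverse of the diffusion
    coefficient, turns the diffusion into a Brownian motion with a bounded
    drift, and on the line a drift is a gradient. Thus the kernel [Q], a heat
    kernel in the coordinate [phi] times the exponential of a difference of
    values of a primitive of the drift, solves the backward equation up to a
    potential bounded by a constant [CV] ([Q_backward]). One Euler step then
    changes the expectation of [Q] by a relative error at most [CV * d] and an
    absolute error of order [d ^ (3/2)] ([one_step], from the Ito isometry and
    the orthogonality of stochastic integrals to the past). Iterating,
    expectations of [Q] agree over a time [t] up to the factor
    [expR (2 * CV * t)] ([kernel_comparison]), and therefore the pair (Riemann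
    sum of the path, endpoint) has, up to the factor [expR (2 * CV)], the law of
    the scheme with transition density [Q] on the same grid
    ([scheme_comparison]). This is uniform in the grid, and the constants depend
    on the bounds [K] and [alpha] alone, which the rescaled coefficients inherit
    ([exists_diffusion_model]).

    The law of the scheme is a functional of a Brownian motion on the grid, with
    a weight that depends on the endpoint only. By the Cameron-Martin formula
    the path may be shifted along two directions, a tent and a straight line,
    at the price of a Girsanov density ([scheme_girsanov]). Averaging over all
    shifts with a Gaussian weight ([averaged_girsanov]) introduces a planar
    integral for each Brownian path; for a fixed path, the map from the shift
    to the pair (weighted sum, endpoint) is triangular with slopes between
    positive constants, because the tent has a positive mean under the measure
    [mu], which charges the open interval. A change of variables
    ([ge0_integral2_subst_slopes]) leads to an integral over the plane of values
    of the pair, with a density that quadratic estimates bound from above for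
    all paths ([tilt_upper]) and from below for paths of moderate energy
    ([tilt_lower]); the exponential moment of the energy is finite and bounds
    the probability of the other paths. Hence [start_upper] and [start_lower].

    Letting the mesh tend to zero gives the Gaussian bounds for expectations of
    bounded Lipschitz functions of the mean and the endpoint ([law_upper],
    [law_lower]). Such functions approximate indicators in L1, so that the law
    lies between two Gaussian measures ([measure_le_test]); a Radon-Nikodym
    density, clamped between the two bounds, is the required one
    ([density_between]). *)

(** * Gaussian integrals on the line *)

Section change_of_variables.
Context {R : realType}.
Notation leb := (@lebesgue_measure R).

(** The image of the Lebesgue measure under [F], scaled by [m], is dominated by
    the Lebesgue measure: their difference is the Stieltjes measure of the
    nondecreasing function [x - m * G x]. *)
Lemma ge0_integral_subst_le (F G : R -> R) (m : R) (f : R -> \bar R) :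
  0 < m -> cancel F G -> cancel G F ->
  (forall x y, x <= y -> m * (y - x) <= F y - F x) ->
  measurable_fun setT f -> (forall x, (0 <= f x)%E) ->
  (m%:E * \int[leb]_x f (F x) <= \int[leb]_x f x)%E.
Proof.
move=> m0 FG GF Fm mf f0.
have Fnd : {homo F : x y / x <= y}.
  by move=> x y xy; have := Fm _ _ xy; nra.
have mF : measurable_fun setT F by apply: nondecreasing_measurable.
have Gm x y : x <= y -> 0 <= G y - G x /\ m * (G y - G x) <= y - x.
  move=> xy; have [h|h] := leP (G x) (G y).
    by have := Fm _ _ h; rewrite !GF subr_ge0.
  by have := Fm _ _ (ltW h); rewrite !GF; nra.
have Gcont : continuous G.
  move=> x; apply/cvgrPdist_le => e e0; near=> y.
  have [xy|/ltW yx] := leP x y.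
    have [g0 gm] := Gm _ _ xy.
    rewrite distrC ger0_norm// -(ler_pM2l m0) (le_trans gm)//.
    rewrite -[leLHS]ger0_norm ?subr_ge0// distrC; near: y.
    by apply: cvgr_dist_le; [exact: cvg_id|exact: mulr_gt0].
  have [g0 gm] := Gm _ _ yx.
  rewrite ger0_norm// -(ler_pM2l m0) (le_trans gm)//.
  rewrite -[leLHS]ger0_norm ?subr_ge0//; near: y.
  by apply: cvgr_dist_le; [exact: cvg_id|exact: mulr_gt0].
pose H x := x - m * G x.
have Hnd : {homo H : x y / x <= y}.
  by move=> x y xy; have [g0 gm] := Gm _ _ xy; rewrite /H; lra.
have Hrc : right_continuous H.
  move=> x; apply: right_continuousW => //.
  move=> {}x; apply: cvgB; first exact: cvg_id.
  by apply: cvgM; [exact: cvg_cst|exact: Gcont].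
pose cH := isCumulative.Build R _ R H Hnd Hrc.
pose HH : cumulative R R := HB.pack H cH.
pose nu1 : {measure set (measurableTypeR R) -> \bar R} :=
  mscale (NngNum (ltW m0)) (pushforward leb (F : _ -> measurableTypeR R)).
pose nu := measure_add (nu1 mF) (lebesgue_stieltjes_measure HH).
have nuE X : measurable X -> leb X = nu X.
  apply: lebesgue_measure_unique => _ [[a b]] _ <-.
  rewrite [RHS]measure_addE/=.
  have [ab|ba] := leP a b; last first.
    rewrite set_itv_ge ?bnd_simp -?leNgt ?(ltW ba)//.
    by rewrite !measure0 adde0.
  rewrite /= /mscale/= /pushforward.
  have -> : (F : _ -> measurableTypeR R) @^-1` `]a, b] = `]G a, G b]%classic.
    apply/seteqP; split => x /=; rewrite !in_itv/= => /andP[h1 h2].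
      rewrite -(FG x); apply/andP; split; last by have [] := Gm _ _ h2; rewrite FG; lra.
      rewrite lt_neqAle; have [] := Gm _ _ (ltW h1); rewrite FG => g0 _.
      apply/andP; split; last lra.
      by apply/eqP => h3; rewrite -h3 GF ltxx in h1.
    apply/andP; split; last by have := Fnd _ _ h2; rewrite GF.
    rewrite lt_neqAle; have := Fnd _ _ (ltW h1); rewrite GF => ->; rewrite andbT.
    apply/eqP => h3; by rewrite h3 FG ltxx in h1.
  have [g0 gm] := Gm _ _ ab.
  rewrite !lebesgue_measure_itv/=.
  rewrite /lebesgue_stieltjes_measure /measure_extension measurable_mu_extE/=; last exact: is_ocitv.
  rewrite wlength_itv_bnd//.
  have e (u v : R) : u <= v -> (if (u%:E < v%:E)%E then (v%:E - u%:E)%E else 0%E) = (v - u)%:E.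
    by rewrite le_eqVlt lte_fin => /predU1P[->|->]; [rewrite ltxx subrr|rewrite EFinB].
  rewrite !e//; last by rewrite -subr_ge0.
  by rewrite -EFinM -EFinD; congr EFin; rewrite /HH/= /H; ring.
rewrite [leRHS](eq_measure_integral nu); last first.
  by move=> A mA _; exact: nuE.
rewrite /nu ge0_integral_measure_add//=.
rewrite ge0_integral_mscale//=.
rewrite ge0_integral_pushforward//=.
rewrite leeDl//.
by apply: integral_ge0.
Unshelve. all: end_near. 
Qed.

End change_of_variables.
Section gaussian_kernel.
Context {R : realType}.
Notation leb := (@lebesgue_measure R).
Implicit Types (t x y c : R).

(** Both slopes of an affine map are known, so that the previous inequality
    applies to the map and to its inverse. *)
Lemma ge0_integral_affine (c s : R) (f : R -> \bar R) : 0 < s ->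
  measurable_fun [set: R] f -> (forall x, (0 <= f x)%E) ->
  (\int[leb]_x f x = s%:E * \int[leb]_x f (c + s * x)%R)%E.
Proof.
move=> s0 mf f0; apply/eqP; rewrite eq_le; apply/andP; split; last first.
  apply: (@ge0_integral_subst_le _ (fun x => c + s * x) (fun y => (y - c) / s) s) => //.
  - by move=> x; field; rewrite gt_eqF.
  - by move=> x; field; rewrite gt_eqF.
  - by move=> x y _; rewrite le_eqVlt; apply/orP; left; apply/eqP; ring.
have mA : measurable_fun [set: R] (fun x => c + s * x).
  by apply: measurable_funD => //; exact: measurable_funM.
have := @ge0_integral_subst_le R (fun y => (y - c) / s) (fun x => c + s * x) s^-1
  (fun x => f (c + s * x)).
rewrite invr_gt0 => /(_ s0) h.
have {}h : ((s^-1)%:E * \int[leb]_x f x <= \int[leb]_x f (c + s * x)%R)%E.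
  have e x : c + s * ((x - c) / s) = x by field; rewrite gt_eqF.
  rewrite (_ : \int[leb]_x f x = \int[leb]_x f (c + s * ((x - c) / s))%R)%E; last first.
    by apply: eq_integral => x _; rewrite e.
  apply: h => //.
  - by move=> x; field; rewrite gt_eqF.
  - by move=> x y _; rewrite le_eqVlt; apply/orP; left; apply/eqP; field; rewrite gt_eqF.
  - exact: measurableT_comp.
apply: le_trans (lee_wpmul2l _ h); last by rewrite lee_fin ltW.
by rewrite muleA -EFinM divff ?gt_eqF// mul1e.
Qed.

Lemma ge0_integral_shift (c : R) (f : R -> \bar R) :
  measurable_fun [set: R] f -> (forall x, (0 <= f x)%E) ->
  (\int[leb]_x f x = \int[leb]_x f (c + x)%R)%E.
Proof.
move=> mf f0; rewrite (ge0_integral_affine c ltr01 mf f0) mul1e.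
by under eq_integral do rewrite mul1r.
Qed.

(** Density of the centred normal law of variance [t]. *)
Definition gk t x : R := expR (- (x ^+ 2) / (2 * t)) / Num.sqrt (2 * pi * t).

Lemma gk_gt0 t x : 0 < t -> 0 < gk t x.
Proof.
by move=> t0; rewrite divr_gt0 ?expR_gt0// sqrtr_gt0 !mulr_gt0// pi_gt0.
Qed.

Lemma gk_ge0 t x : 0 < t -> 0 <= gk t x.
Proof. by move=> /gk_gt0/ltW. Qed.

Lemma normal_pdf_gk t x : 0 < t -> normal_pdf 0 (Num.sqrt t) x = gk t x.
Proof.
move=> t0; rewrite normal_pdfE ?sqrtr_eq0 -?ltNge//.
rewrite /normal_peak /normal_fun sqr_sqrtr ?ltW// subr0 /gk mulrC.
by congr (expR (_ / _) / Num.sqrt _); ring.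
Qed.

Lemma continuous_gk t : continuous (gk t).
Proof.
move=> x; apply: cvgM; last exact: cvg_cst.
apply: (cvg_comp _ expR); last exact: continuous_expR.
apply: cvgM; last exact: cvg_cst.
apply: cvgN; exact: exprn_continuous.
Qed.

Lemma measurable_gk t : measurable_fun [set: R] (gk t).
Proof. apply: continuous_measurable_fun; exact: continuous_gk. Qed.

Lemma emeasurable_gk t : measurable_fun [set: R] (fun x => (gk t x)%:E).
Proof. by apply/measurable_EFinP; exact: measurable_gk. Qed.

Lemma integral_gk t : 0 < t -> (\int[leb]_x (gk t x)%:E = 1)%E.
Proof.
move=> t0; rewrite -(integral_normal_pdf 0 (Num.sqrt t)).
by apply: eq_integral => x _; rewrite normal_pdf_gk.
Qed.

Lemma integrable_gk t : 0 < t -> leb.-integrable [set: R] (EFin \o gk t).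
Proof.
move=> t0; apply: eq_integrable (integrable_normal_pdf 0 (Num.sqrt t)) => //.
by move=> x _ /=; rewrite normal_pdf_gk.
Qed.

(** [gk t] is a Radon-Nikodym derivative of the normal law, and those are
    determined almost everywhere. *)
Lemma ge0_integral_normal t (f : R -> \bar R) : 0 < t ->
  measurable_fun [set: R] f -> (forall x, (0 <= f x)%E) ->
  (\int[normal_prob 0 (Num.sqrt t)]_x f x = \int[leb]_x (f x * (gk t x)%:E))%E.
Proof.
move=> t0 mf f0.
have dom := @normal_prob_dominates R 0 (Num.sqrt t).
rewrite -(Radon_Nikodym_SigmaFinite.change_of_variables dom)//.
have mRN : measurable_fun [set: R] (Radon_Nikodym_SigmaFinite.f (normal_prob 0 (Num.sqrt t)) leb).
  exact: measurable_int (Radon_Nikodym_SigmaFinite.f_integrable dom).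
apply: ge0_ae_eq_integral => //.
- exact: emeasurable_funM.
- by apply: emeasurable_funM => //; exact: emeasurable_gk.
- by move=> x _; rewrite mule_ge0// Radon_Nikodym_SigmaFinite.f_ge0.
- by move=> x _; rewrite mule_ge0// lee_fin gk_ge0.
apply: ae_eqe_mul2l => /=.
apply: integral_ae_eq => //.
- exact: Radon_Nikodym_SigmaFinite.f_integrable.
- exact: emeasurable_gk.
- move=> E _ mE; rewrite -Radon_Nikodym_SigmaFinite.f_integral//.
  by rewrite /normal_prob; apply: eq_integral => x _; rewrite normal_pdf_gk.
Qed.

Lemma ge0_integral_gk_scale t (f : R -> \bar R) : 0 < t ->
  measurable_fun [set: R] f -> (forall x, (0 <= f x)%E) ->
  (\int[leb]_x (f x * (gk t x)%:E) =
   \int[leb]_x (f (Num.sqrt t * x)%R * (gk 1 x)%:E))%E.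
Proof.
move=> t0 mf f0.
have s0 : 0 < Num.sqrt t by rewrite sqrtr_gt0.
rewrite (ge0_integral_affine 0 s0); last 2 first.
- by apply: emeasurable_funM => //; exact: emeasurable_gk.
- by move=> x; rewrite mule_ge0// lee_fin gk_ge0.
under eq_integral do rewrite add0r.
rewrite -ge0_integralZl//; last 2 first.
- apply: emeasurable_funM; first by apply: measurableT_comp => //; exact: measurable_funM.
  by apply: (measurableT_comp (emeasurable_gk t)); exact: measurable_funM.
- by move=> x _; rewrite mule_ge0// lee_fin gk_ge0.
apply: eq_integral => x _; rewrite muleCA -EFinM; congr (_ * _%:E)%E.
rewrite /gk exprMn sqr_sqrtr ?ltW// mulr1 sqrtrM ?mulr_ge0 ?pi_ge0//.
have -> : - (t * x ^+ 2) / (2 * t) = - x ^+ 2 / 2 by field; rewrite gt_eqF.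
rewrite mulr1; field.
by rewrite !gt_eqF ?sqrtr_gt0 ?mulr_gt0 ?pi_gt0.
Qed.

(** Completing the square turns the exponential weight into a translation. *)
Lemma integral_gk_expR t c : 0 < t ->
  (\int[leb]_x (expR (c * x) * gk t x)%:E = (expR (c ^+ 2 * t / 2))%:E)%E.
Proof.
move=> t0; transitivity (\int[leb]_x ((expR (c ^+ 2 * t / 2))%:E * (gk t (- (c * t) + x)%R)%:E)%E)%E.
  apply: eq_integral => x _; rewrite -EFinM /gk !mulrA -!expRD; congr (expR _ / _)%:E.
  by field; rewrite gt_eqF.
rewrite ge0_integralZl//; last 2 first.
- by apply: (measurableT_comp (emeasurable_gk t)); exact: measurable_funD.
- by move=> x _; rewrite lee_fin gk_ge0.
rewrite -(ge0_integral_shift (- (c * t)) (f := fun x => (gk t x)%:E)) ?integral_gk ?mule1//.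
- exact: emeasurable_gk.
- by move=> x; rewrite lee_fin gk_ge0.
Qed.

Lemma integral_gk_expR_norm t c : 0 < t ->
  (\int[leb]_x (expR (c * `|x|) * gk t x)%:E <= (2 * expR (c ^+ 2 * t / 2))%:E)%E.
Proof.
move=> t0.
have mE a : measurable_fun [set: R] (fun x => (expR (a * x) * gk t x)%:E).
  apply/measurable_EFinP/measurable_funM; last exact: measurable_gk.
  by apply: measurableT_comp => //; exact: measurable_funM.
have g0 a x : (0 <= (expR (a * x) * gk t x)%:E)%E.
  by rewrite lee_fin mulr_ge0 ?expR_ge0 ?gk_ge0.
apply: (@le_trans _ _ (\int[leb]_x ((expR (c * x) * gk t x)%:E + (expR (- c * x) * gk t x)%:E))%E).
  apply: ge0_le_integral => //.
  - by move=> x _; rewrite lee_fin mulr_ge0 ?expR_ge0 ?gk_ge0.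
  - apply/measurable_EFinP/measurable_funM; last exact: measurable_gk.
    by apply: measurableT_comp => //; apply: measurable_funM => //; exact: measurableT_comp.
  - by apply: emeasurable_funD; exact: mE.
  - move=> x _; rewrite -EFinD lee_fin -mulrDl ler_wpM2r ?gk_ge0//.
  by case: ger0P => _; rewrite ?mulrN -?mulNr ?lerDl ?lerDr expR_ge0.
rewrite ge0_integralD//; [|exact: mE..]; rewrite !integral_gk_expR// sqrrN -EFinD lee_fin.
by rewrite mulr_natl mulr2n.
Qed.

(** The weight [expR (q * x ^+ 2)] changes the variance of the kernel; the
    square root is the ratio of the two normalizations. *)
Lemma integral_gk_sqr t q : 0 < t -> 2 * q * t < 1 ->
  (\int[leb]_x (expR (q * x ^+ 2) * gk t x)%:E =
    ((Num.sqrt (1 - 2 * q * t))^-1)%:E)%E.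
Proof.
move=> t0 qt; have d0 : 0 < 1 - 2 * q * t by rewrite subr_gt0.
pose t' := t / (1 - 2 * q * t); have t'0 : 0 < t' by rewrite divr_gt0.
transitivity (\int[leb]_x (((Num.sqrt (1 - 2 * q * t))^-1)%:E * (gk t' x)%:E))%E.
  apply: eq_integral => x _; rewrite -EFinM; congr EFin.
  rewrite /gk mulrA -expRD [RHS]mulrCA.
  have -> : q * x ^+ 2 + - x ^+ 2 / (2 * t) = - x ^+ 2 / (2 * t').
    by rewrite /t'; field; rewrite !gt_eqF.
  congr (_ * _); rewrite -invfM -sqrtrM ?ltW//; congr (Num.sqrt _)^-1.
  by rewrite /t'; field; rewrite gt_eqF.
rewrite ge0_integralZl// ?integral_gk ?mule1//.
- exact: emeasurable_gk.
- by move=> x _; rewrite lee_fin gk_ge0.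
Qed.

End gaussian_kernel.

(** * Derivatives and Taylor bounds *)

Section derivative_rules.
Context {R : realType}.
Implicit Types f g : R -> R.

Lemma derive1_eq f (x a b : R) : is_derive x 1 f a -> a = b -> is_derive x 1 f b.
Proof. by move=> + <-. Qed.

Lemma derive1_cst_fun (x c : R) : is_derive x 1 (fun=> c) 0.
Proof. exact: is_derive_cst. Qed.

Lemma derive1_id_fun (x : R) : is_derive x 1 (fun y => y) 1.
Proof. exact: is_derive_id. Qed.

Lemma derive1_add_fun f g (x a b : R) : is_derive x 1 f a -> is_derive x 1 g b ->
  is_derive x 1 (fun y => f y + g y) (a + b).
Proof. by move=> *; exact: is_deriveD. Qed.

Lemma derive1_opp_fun f (x a : R) : is_derive x 1 f a ->
  is_derive x 1 (fun y => - f y) (- a).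
Proof. by move=> *; exact: is_deriveN. Qed.

Lemma derive1_mul_fun f g (x a b : R) : is_derive x 1 f a -> is_derive x 1 g b ->
  is_derive x 1 (fun y => f y * g y) (a * g x + f x * b).
Proof.
move=> df dg; eapply derive1_eq; first exact: (is_deriveM df dg).
by rewrite /GRing.scale/=; ring.
Qed.

Lemma derive1_exprn_fun f n (x a : R) : is_derive x 1 f a ->
  is_derive x 1 (fun y => f y ^+ n.+1) (n.+1%:R * f x ^+ n * a).
Proof.
move=> df; have h : is_derive (f x) 1 (fun y : R => y ^+ n.+1) (n.+1%:R * f x ^+ n).
  split; first exact: exprn_derivable.
  by rewrite exp_derive /GRing.scale/= mulr1.
exact: (is_derive1_comp h df).
Qed.

Lemma derive1_inv_fun f (x a : R) : f x != 0 -> is_derive x 1 f a ->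
  is_derive x 1 (fun y => (f y)^-1) (- a / f x ^+ 2).
Proof.
move=> f0 df; eapply derive1_eq; first exact: (is_deriveV f0 df).
by rewrite /GRing.scale/= mulrC mulNr mulrN.
Qed.

Lemma derive1_comp_fun f g (x a b : R) : is_derive (g x) 1 f a -> is_derive x 1 g b ->
  is_derive x 1 (fun y => f (g y)) (a * b).
Proof. by move=> df dg; exact: is_derive1_comp. Qed.

Lemma derive1_expR_fun f (x a : R) : is_derive x 1 f a ->
  is_derive x 1 (fun y => expR (f y)) (expR (f x) * a).
Proof. by move=> df; apply: derive1_comp_fun; exact: is_derive_expR. Qed.

End derivative_rules.

(* Computes the derivative of a function given by an explicit expression. *)
Ltac derive_fun :=
  lazymatch goal with
  | |- is_derive _ _ (fun _ => ?c) _ => eapply derive1_cst_fun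
  | |- is_derive _ _ (fun y => y) _ => eapply derive1_id_fun
  | |- is_derive ?x _ (fun y => (@?f y + @?g y)%R) _ =>
      eapply (@derive1_add_fun _ f g x); derive_fun
  | |- is_derive ?x _ (fun y => (- @?f y)%R) _ =>
      eapply (@derive1_opp_fun _ f x); derive_fun
  | |- is_derive ?x _ (fun y => (@?f y * @?g y)%R) _ =>
      eapply (@derive1_mul_fun _ f g x); derive_fun
  | |- is_derive ?x _ (fun y => (@?f y ^+ S ?n)%R) _ =>
      eapply (@derive1_exprn_fun _ f n x); derive_fun
  | |- is_derive ?x _ (fun y => ((@?f y)^-1)%R) _ =>
      eapply (@derive1_inv_fun _ f x); [ | derive_fun ]
  | |- is_derive ?x _ (fun y => expR (@?f y)) _ =>
      eapply (@derive1_expR_fun _ f x); derive_fun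
  | |- is_derive ?x _ (fun y => ?F (@?g y)) _ =>
      first [ solve [eauto with nocore] | eapply (@derive1_comp_fun _ F g x); [solve [eauto with nocore] | derive_fun] ]
  | |- _ => solve [eauto with nocore]
  end.
Ltac derive_to := eapply derive1_eq; [derive_fun | ].

Section taylor.
Context {R : realType}.
Implicit Types f g : R -> R.

Lemma is_derive1_continuous f (df : R -> R) :
  (forall x : R, is_derive x 1 f (df x)) -> continuous f.
Proof.
move=> fd x; apply: differentiable_continuous.
by apply/derivable1_diffP; exact: (@ex_derive _ _ _ _ _ _ _ (fd x)).
Qed.

Lemma mean_value f (df : R -> R) (x y : R) :
  (forall x : R, is_derive x 1 f (df x)) ->
  exists2 c, Num.min x y <= c <= Num.max x y & f y - f x = df c * (y - x).
Proof.
move=> fd; have cf := is_derive1_continuous fd.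
have [xy|yx|<-] := ltgtP x y; last 1 first.
- by exists x; rewrite ?lexx// !subrr mulr0.
- have [|c] := @MVT R f df x y xy (fun z _ => fd z); [exact: continuous_subspaceT|].
  by rewrite in_itv/= => /andP[xc cy] e; exists c => //; rewrite !ltW.
- have [|c] := @MVT R f df y x yx (fun z _ => fd z); [exact: continuous_subspaceT|].
  rewrite in_itv/= => /andP[xc cy] e; exists c => //; rewrite ?(ltW xc) ?(ltW cy)//.
  by rewrite -opprB e -mulrN opprB.
Qed.

Lemma bounded_derive_lip f (df : R -> R) M :
  (forall x : R, is_derive x 1 f (df x)) -> (forall x, `|df x| <= M) ->
  forall x y, `|f y - f x| <= M * `|y - x|.
Proof.
move=> fd dM x y; have [c _ ->] := mean_value x y fd.
by rewrite normrM ler_wpM2r.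
Qed.

(** A bound on a derivative is integrated once: iterating this gives the
    remainders in the Taylor formulas. *)
Lemma derive_bound_pow g (dg : R -> R) M k : g 0 = 0 ->
  (forall x : R, is_derive x 1 g (dg x)) -> (forall x, `|dg x| <= M * `|x| ^+ k) ->
  forall x, `|g x| <= M * `|x| ^+ k.+1.
Proof.
move=> g0 gd dM x; have [c] := mean_value 0 x gd.
rewrite g0 !subr0 => cx ->; rewrite normrM.
have cx' : `|c| <= `|x|.
  case/andP: cx; rewrite ge_min le_max => /orP[]h1 /orP[]h2; rewrite ler_norml.
  - have -> : c = 0 by apply/eqP; rewrite eq_le h1 h2.
    by rewrite oppr_le0 normr_ge0.
  - by rewrite ger0_norm; lra.
  - by rewrite ler0_norm; lra.
  - have -> : c = x by apply/eqP; rewrite eq_le h1 h2.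
    by rewrite -ler_norml.
rewrite exprSr mulrA ler_wpM2r// (le_trans (dM c))//.
rewrite ler_wpM2l// ?lerXn2r ?nnegrE//.
by have := dM 1; rewrite normr1 expr1n mulr1; apply: le_trans.
Qed.

Lemma derive_bound_pow_on g (dg : R -> R) M k b : g 0 = 0 ->
  (forall x : R, 0 <= x <= b -> is_derive x 1 g (dg x)) ->
  (forall x, 0 <= x <= b -> `|dg x| <= M * x ^+ k) ->
  forall x, 0 <= x <= b -> `|g x| <= M * x ^+ k.+1.
Proof.
move=> g0 gd dM x /andP[x0 xb]; move: x0; rewrite le_eqVlt => /predU1P[<-|x0].
  by rewrite g0 normr0 exprS mul0r mulr0.
have gd' (y : R) : y \in `]0, x[ -> is_derive y 1 g (dg y).
  by rewrite in_itv/= => /andP[y0 yx]; apply: gd; rewrite (ltW y0) (le_trans (ltW yx)).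
have [|c] := @MVT R g dg 0 x x0 gd'.
  apply: derivable_within_continuous => y; rewrite in_itv/= => /andP[y0 yx].
  by apply: (@ex_derive _ _ _ _ _ _ _ (gd y _)); rewrite y0 (le_trans yx).
rewrite in_itv/= g0 !subr0 => /andP[c0 cx] ->; rewrite normrM (gtr0_norm x0).
rewrite exprSr mulrA ler_wpM2r ?(ltW x0)// (le_trans (dM c _))//.
  by rewrite (ltW c0) (le_trans (ltW cx)).
rewrite ler_wpM2l// ?lerXn2r ?nnegrE ?(ltW c0) ?(ltW x0) ?(ltW cx)//.
have := dM x; rewrite (ltW x0) xb => /(_ isT) h.
by have := le_trans (normr_ge0 _) h; rewrite pmulr_lge0// exprn_gt0.
Qed.

Lemma taylor2 f f1 f2 M x :
  (forall x : R, is_derive x 1 f (f1 x)) -> (forall x : R, is_derive x 1 f1 (f2 x)) ->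
  (forall x, `|f2 x| <= M) ->
  forall h, `|f (x + h) - f x - f1 x * h| <= M * `|h| ^+ 2.
Proof.
move=> d1 d2 b h.
apply: (@derive_bound_pow (fun h => f (x + h) - f x - f1 x * h)
  (fun h => f1 (x + h) - f1 x) M 1); first by rewrite addr0 mulr0 !subrr.
  move=> {}h; derive_to; rewrite /=; ring.
move=> {}h; rewrite expr1.
by have := bounded_derive_lip d2 b x (x + h); rewrite addrAC subrr add0r.
Qed.

Lemma taylor3 f f1 f2 f3 M x :
  (forall x : R, is_derive x 1 f (f1 x)) -> (forall x : R, is_derive x 1 f1 (f2 x)) ->
  (forall x : R, is_derive x 1 f2 (f3 x)) -> (forall x, `|f3 x| <= M) ->
  forall h, `|f (x + h) - f x - f1 x * h - f2 x * h ^+ 2 / 2| <= M * `|h| ^+ 3.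
Proof.
move=> d1 d2 d3 b h.
apply: (@derive_bound_pow (fun h => f (x + h) - f x - f1 x * h - f2 x * h ^+ 2 / 2)
  (fun h => f1 (x + h) - f1 x - f2 x * h) M 2).
- by rewrite addr0 expr0n/= !mulr0 mul0r !subrr.
- move=> {}h; derive_to; by rewrite /=; field.
- by move=> {}h; have := taylor2 x d2 d3 b h.
Qed.

End taylor.

(** * Moments and Taylor expansion of Gaussian averages *)

Section gaussian_moments.
Context {R : realType}.
Notation leb := (@lebesgue_measure R).
Implicit Types (t x y c : R).

Lemma measurable_expr_norm c : measurable_fun [set: R] (fun x => expR (c * `|x|)).
Proof. by apply: measurableT_comp => //; apply: measurable_funM => //; exact: measurableT_comp. Qed.

(** Everything of at most exponential growth is integrable against [gk t]. *)
Lemma integrable_mul_gk t (h : R -> R) C c : 0 < t -> measurable_fun [set: R] h ->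
  (forall x, `|h x| <= C * expR (c * `|x|)) ->
  leb.-integrable [set: R] (fun x => (h x * gk t x)%:E).
Proof.
move=> t0 mh hC; apply/integrableP; split.
  by apply/measurable_EFinP/measurable_funM => //; exact: measurable_gk.
have C0 : 0 <= C by have := hC 0; rewrite normr0 mulr0 expR0 mulr1; apply: le_trans.
apply: (@le_lt_trans _ _ (\int[leb]_x (C%:E * (expR (c * `|x|) * gk t x)%:E)))%E.
  apply: ge0_le_integral => //.
  - apply: measurableT_comp => //.
    by apply/measurable_EFinP/measurable_funM => //; exact: measurable_gk.
  - apply: emeasurable_funM => //.
    apply/measurable_EFinP/measurable_funM; [exact: measurable_expr_norm|exact: measurable_gk].
  - move=> x _; rewrite abse_EFin -EFinM lee_fin [leRHS]mulrA normrM.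
    by rewrite (ger0_norm (gk_ge0 x t0)) ler_wpM2r// gk_ge0.
have mH : measurable_fun [set: R] (fun x => (expR (c * `|x|) * gk t x)%:E).
  by apply/measurable_EFinP/measurable_funM; [exact: measurable_expr_norm|exact: measurable_gk].
have H0 x : (0 <= (expR (c * `|x|) * gk t x)%:E)%E.
  by rewrite lee_fin mulr_ge0 ?expR_ge0 ?gk_ge0.
rewrite ge0_integralZl//.
apply: lte_mul_pinfty => //.
by apply: le_lt_trans (integral_gk_expR_norm _ t0) _; rewrite ltry.
Qed.

Lemma expr_le_expR n x : `|x| ^+ n.+1 <= n.+1`!%:R * expR (1 * `|x|).
Proof.
rewrite mul1r mulrC -ler_pdivrMr ?ltr0n ?fact_gt0//.
by apply: le_trans (expR_ge1Dxn n (normr_ge0 x)); rewrite lerDr.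
Qed.

Lemma integrable_expr_gk t n : 0 < t ->
  leb.-integrable [set: R] (fun x => (x ^+ n.+1 * gk t x)%:E).
Proof.
move=> t0; apply: (integrable_mul_gk (C := n.+1`!%:R) (c := 1)) => // x.
by rewrite normrX expr_le_expR.
Qed.

Lemma integrable_exprnorm_gk t n : 0 < t ->
  leb.-integrable [set: R] (fun x => (`|x| ^+ n.+1 * gk t x)%:E).
Proof.
move=> t0; apply: (integrable_mul_gk (C := n.+1`!%:R) (c := 1)) => //.
  by apply: measurable_funX; exact: normr_measurable.
by move=> x; rewrite normrX normr_id expr_le_expR.
Qed.

Lemma Rintegral_gk t : 0 < t -> \int[leb]_x gk t x = 1.
Proof. by move=> t0; rewrite /Rintegral integral_gk. Qed.

(** Integrating the tangent-line inequality [1 + c * h <= G c] for a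
    perturbation [G] of the Gaussian determines the integral of [h]. *)
Lemma Rintegral_tangent_gk t c (h : R -> R) (G : R -> R) (I : R) : 0 < t ->
  leb.-integrable [set: R] (fun x => (h x * gk t x)%:E) ->
  measurable_fun [set: R] G ->
  (forall x, 1 + c * h x <= G x) -> (forall x, 0 <= G x) ->
  (\int[leb]_x (G x * gk t x)%:E = I%:E)%E ->
  1 + c * \int[leb]_x (h x * gk t x) <= I.
Proof.
move=> t0 ih mG hG G0 GI.
have iG : leb.-integrable [set: R] (fun x => (G x * gk t x)%:E).
  apply/integrableP; split.
    by apply/measurable_EFinP/measurable_funM => //; exact: measurable_gk.
  under eq_integral do rewrite gee0_abs ?lee_fin ?mulr_ge0 ?gk_ge0//.
  by rewrite GI ltry.
have <- : \int[leb]_x (G x * gk t x) = I by rewrite /Rintegral GI.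
rewrite -(Rintegral_gk t0) -RintegralZl// -RintegralD//; last 2 first.
- exact: integrable_gk.
- exact: (integrableZl measurableT c ih).
apply: le_Rintegral => //.
- exact: (integrableD measurableT (integrable_gk t0) (integrableZl measurableT c ih)).
- by move=> x _; rewrite mulrA -{1}(mul1r (gk t x)) -mulrDl ler_wpM2r ?gk_ge0.
Qed.

(** First moment: the exponential weight [expR (c * x)] has a known integral,
    and the tangent-line inequality identifies its derivative at [c = 0]. *)
Lemma integral_gk_linear t : 0 < t -> \int[leb]_x (x * gk t x) = 0.
Proof.
move=> t0; set m := Rintegral _ _ _.
have key c : 1 + c * m <= expR (c ^+ 2 * t / 2).
  apply: (Rintegral_tangent_gk (h := id) (G := fun x => expR (c * x))) => //.
  - exact: (integrable_expr_gk 0).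
  - by apply: measurableT_comp => //; exact: measurable_funM.
  - by move=> x; exact: expR_ge1Dx.
  - exact: integral_gk_expR.
have key2 c : c ^+ 2 * t <= 1 -> c * m <= c ^+ 2 * t.
  move=> ct; have := key c; have := expR_ge1Dx (- (c ^+ 2 * t / 2)).
  rewrite expRN; set e := expR _ => h1 h2.
  have e0 : 0 < e by exact: expR_gt0.
  have : e * (1 - c ^+ 2 * t / 2) <= 1 by rewrite mulrC -ler_pdivlMr// mul1r.
  set a := c ^+ 2 * t in ct h1 h2 e0 * => ea.
  have a0 : 0 <= a by rewrite mulr_ge0 ?sqr_ge0// ltW.
  have h3 : (1 + c * m) * (1 - a / 2) <= 1.
    by apply: le_trans ea; rewrite ler_wpM2r//; lra.
  by rewrite leNgt; apply/negP => h4; nra.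
have key3 e : 0 < e -> `|m| <= e.
  move=> e0; pose c := Num.min (e / t) (1 / (1 + t)).
  have c0 : 0 < c by rewrite lt_min !divr_gt0// addr_gt0.
  have ce : c * t <= e.
    by rewrite -ler_pdivlMr// /c ge_min lexx.
  have c1 : c * (1 + t) <= 1.
    by rewrite -ler_pdivlMr ?addr_gt0// /c ge_min lexx orbT.
  have ct : c ^+ 2 * t <= 1 by nra.
  have := key2 c ct; have := key2 (- c); rewrite sqrrN => /(_ ct) h1 h2.
  by rewrite ler_norml; apply/andP; split; nra.
apply/eqP; rewrite -normr_le0; apply/ler_addgt0Pr => e e0.
by rewrite add0r key3.
Qed.

(** Second moment, by the same comparison for the weight
    [expR (c * x ^+ 2)]. *)
Lemma integral_gk_square t : 0 < t -> \int[leb]_x (x ^+ 2 * gk t x) = t.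
Proof.
move=> t0; set m := Rintegral _ _ _.
have m0 : 0 <= m by apply: Rintegral_ge0 => x _; rewrite mulr_ge0 ?sqr_ge0 ?gk_ge0.
have key s : -1 < s -> 1 - s * (m / (2 * t)) <= (Num.sqrt (1 + s))^-1.
  move=> s1.
  have -> : - (s * (m / (2 * t))) = (- s / (2 * t)) * m by field; rewrite gt_eqF.
  apply: (Rintegral_tangent_gk (h := fun x => x ^+ 2)
    (G := fun x => expR ((- s / (2 * t)) * x ^+ 2))) => //.
  - exact: (integrable_expr_gk 1).
  - by apply: measurableT_comp => //; apply: measurable_funM => //; exact: measurable_funX.
  - by move=> x; exact: expR_ge1Dx.
  - rewrite integral_gk_sqr//; last by rewrite (_ : _ * t = - s); [lra|field; rewrite gt_eqF].
    by congr (Num.sqrt _)^-1%:E; field; rewrite gt_eqF.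
set r := m / t.
have r0 : 0 <= r by rewrite divr_ge0// ltW.
have key2 s : -1 < s -> s * r <= 2 -> (1 - s * r / 2) ^+ 2 * (1 + s) <= 1.
  move=> s1 sr; have := key s s1.
  have -> : s * (m / (2 * t)) = s * r / 2 by rewrite /r; field; rewrite gt_eqF.
  move=> h; have s1' : 0 < 1 + s by lra.
  have sq0 : 0 < Num.sqrt (1 + s) by rewrite sqrtr_gt0.
  have sqE : Num.sqrt (1 + s) ^+ 2 = 1 + s by rewrite sqr_sqrtr// ltW.
  have h2 : (1 - s * r / 2) * Num.sqrt (1 + s) <= 1 by rewrite -ler_pdivlMr// mul1r.
  by rewrite -sqE -exprMn expr_le1// mulr_ge0 ?(ltW sq0)//; lra.
suff r1 : r = 1 by rewrite -[RHS]mul1r -r1 /r divfK// gt_eqF.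
have key3 e : 0 < e -> `|r - 1| <= e.
  move=> e0; pose v := Num.min (e / (1 + r) ^+ 2) (1 / (2 * (1 + r))).
  have r10 : 0 < 1 + r by lra.
  have v0 : 0 < v by rewrite lt_min !divr_gt0// ?exprn_gt0// mulr_gt0.
  have ve : v * (1 + r) ^+ 2 <= e.
    by rewrite -ler_pdivlMr ?exprn_gt0// /v ge_min lexx.
  have v1 : v * (2 * (1 + r)) <= 1.
    by rewrite -ler_pdivlMr ?mulr_gt0// /v ge_min lexx orbT.
  have v1' : v <= 1 / 2 by nra.
  have vr : v * r <= 1 / 2 by nra.
  have h1 := key2 v ltac:(lra) ltac:(lra).
  have h2 := key2 (- v) ltac:(lra) ltac:(nra).
  rewrite ler_norml; apply/andP; split.
    have : v * ((1 - r) + v * (r ^+ 2 / 4 - r) + v ^+ 2 * r ^+ 2 / 4) <= 0.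
      by move: h1; rewrite (_ : _ * (1 + v) = 1 + v * ((1 - r) + v * (r ^+ 2 / 4 - r) + v ^+ 2 * r ^+ 2 / 4)); [lra|field].
    rewrite pmulr_rle0//; have := sqr_ge0 (v * r); have := sqr_ge0 r; nra.
  have : v * ((r - 1) + v * (r ^+ 2 / 4 - r) - v ^+ 2 * r ^+ 2 / 4) <= 0.
    by move: h2; rewrite (_ : _ * (1 - v) = 1 + v * ((r - 1) + v * (r ^+ 2 / 4 - r) - v ^+ 2 * r ^+ 2 / 4)); [lra|field].
  rewrite pmulr_rle0//; have : v ^+ 2 * r ^+ 2 <= v * r ^+ 2 by have := sqr_ge0 r; nra.
  by have := sqr_ge0 r; nra.
apply/eqP; rewrite -subr_eq0 -normr_le0; apply/ler_addgt0Pr => e e0.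
by rewrite add0r key3.
Qed.

Lemma integral_gk_cube t : 0 < t ->
  \int[leb]_x (`|x| ^+ 3 * gk t x) <= 24 * (t * Num.sqrt t).
Proof.
move=> t0; have s0 : 0 < Num.sqrt t by rewrite sqrtr_gt0.
rewrite -lee_fin fineK; last by apply: integrable_fin_num => //; exact: (integrable_exprnorm_gk 2).
have mX : measurable_fun [set: R] (fun x => `|x| ^+ 3).
  by apply: measurable_funX; exact: normr_measurable.
under eq_integral do rewrite EFinM.
rewrite ge0_integral_gk_scale//; last exact/measurable_EFinP.
have mH : measurable_fun [set: R] (fun x => (expR (1 * `|x|) * gk 1 x)%:E).
  apply/measurable_EFinP/measurable_funM; [exact: measurable_expr_norm|exact: measurable_gk].
apply: (@le_trans _ _ (\int[leb]_x (((6 * (t * Num.sqrt t))%:E) * (expR (1 * `|x|) * gk 1 x)%:E)))%E.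
  apply: ge0_le_integral => //.
  - by move=> x _; rewrite mule_ge0 ?lee_fin ?exprn_ge0 ?gk_ge0.
  - apply: emeasurable_funM; last exact: emeasurable_gk.
    by apply/measurable_EFinP; apply: (measurableT_comp mX); exact: measurable_funM.
  - exact: emeasurable_funM.
  - move=> x _; rewrite -!EFinM lee_fin [leRHS]mulrA ler_wpM2r ?gk_ge0//.
    rewrite normrM (gtr0_norm s0) exprMn.
    have -> : Num.sqrt t ^+ 3 = t * Num.sqrt t by rewrite exprSr sqr_sqrtr// ltW.
    rewrite [leRHS]mulrAC mulrC ler_wpM2r ?mulr_ge0 ?(ltW t0) ?(ltW s0)//.
    by have := expr_le_expR 2 x.
rewrite ge0_integralZl//; last 2 first.
- by move=> x _; rewrite lee_fin mulr_ge0 ?expR_ge0 ?gk_ge0.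
- by rewrite lee_fin !mulr_ge0 ?ltW.
apply: (@le_trans _ _ ((6 * (t * Num.sqrt t))%:E * (2 * expR (1 ^+ 2 * 1 / 2))%:E)%E).
  by rewrite lee_wpmul2l ?lee_fin ?mulr_ge0 ?(ltW t0) ?(ltW s0)// integral_gk_expR_norm.
rewrite -EFinM lee_fin.
have h : expR (1 ^+ 2 * 1 / 2 : R) <= 2.
  have := expR_ge1Dx (- (1 / 2) : R); rewrite expRN expr1n !mul1r.
  set e := expR _ => h; have e0 : 0 < e by exact: expR_gt0.
  have : (1 - 2^-1) * e <= 1 by rewrite -ler_pdivlMr// mul1r.
  by lra.
have : 0 < t * Num.sqrt t by rewrite mulr_gt0.
by nra.
Qed.

(** Second-order expansion of a Gaussian average. *)
Lemma Rintegral_gk_taylor (f f1 f2 f3 : R -> R) (M C s c : R) (x : R) t : 0 < t ->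
  (forall x : R, is_derive x 1 f (f1 x)) -> (forall x : R, is_derive x 1 f1 (f2 x)) ->
  (forall x : R, is_derive x 1 f2 (f3 x)) -> (forall x, `|f3 x| <= M) ->
  (forall x, `|f x| <= C) ->
  `|\int[leb]_w (f (x + (s * w + c)) * gk t w)
    - (f x + f1 x * c + f2 x * (s ^+ 2 * t + c ^+ 2) / 2)|
  <= 4 * M * (24 * `|s| ^+ 3 * (t * Num.sqrt t) + `|c| ^+ 3).
Proof.
move=> t0 d1 d2 d3 f3M fC.
have M0 : 0 <= M by apply: le_trans (f3M 0).
have mf : measurable_fun [set: R] (fun w => f (x + (s * w + c))).
  apply: (measurableT_comp (continuous_measurable_fun (is_derive1_continuous d1))).
  by apply: measurable_funD => //; apply: measurable_funD => //; exact: measurable_funM.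
pose P w := (f x + f1 x * c + f2 x * c ^+ 2 / 2) + (f1 x * s + f2 x * s * c) * w
  + f2 x * s ^+ 2 / 2 * w ^+ 2.
have i0 := integrable_gk t0.
have i1 := integrable_expr_gk 0 t0; have i2 := integrable_expr_gk 1 t0.
have i3 := integrable_exprnorm_gk 2 t0.
have if_ : leb.-integrable [set: R] (fun w => (f (x + (s * w + c)) * gk t w)%:E).
  by apply: (integrable_mul_gk (C := C) (c := 0)) => // w; rewrite mul0r expR0 mulr1.
have iZ a (h : R -> R) : leb.-integrable [set: R] (fun w => (h w)%:E) ->
    leb.-integrable [set: R] (fun w => (a * h w)%:E).
  by move=> ih; exact: (integrableZl measurableT a ih).
have iD (h k : R -> R) : leb.-integrable [set: R] (fun w => (h w)%:E) ->
    leb.-integrable [set: R] (fun w => (k w)%:E) ->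
    leb.-integrable [set: R] (fun w => (h w + k w)%:E).
  by move=> ih ik; exact: (integrableD measurableT ih ik).
have PE w : P w * gk t w = (f x + f1 x * c + f2 x * c ^+ 2 / 2) * gk t w
    + (f1 x * s + f2 x * s * c) * (w ^+ 1 * gk t w) + f2 x * s ^+ 2 / 2 * (w ^+ 2 * gk t w).
  by rewrite /P; ring.
have iP : leb.-integrable [set: R] (fun w => (P w * gk t w)%:E).
  under eq_fun do rewrite PE.
  by apply: (iD); [apply: (iD)|]; apply: (iZ).
have -> : f x + f1 x * c + f2 x * (s ^+ 2 * t + c ^+ 2) / 2 = \int[leb]_w (P w * gk t w).
  under eq_Rintegral do rewrite PE.
  rewrite RintegralD//; [|by apply: iD; apply: iZ|exact: iZ].
  rewrite RintegralD//; [|exact: iZ|exact: iZ].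
  rewrite !RintegralZl// Rintegral_gk// integral_gk_square//.
  by rewrite (integral_gk_linear t0); ring.
rewrite -RintegralB//.
have iB : leb.-integrable [set: R]
    (EFin \o (fun w => f (x + (s * w + c)) * gk t w - P w * gk t w)).
  exact: (integrableB measurableT if_ iP).
apply: le_trans (le_normr_Rintegral measurableT iB) _.
apply: (@le_trans _ _ (\int[leb]_w (4 * M * `|s| ^+ 3 * (`|w| ^+ 3 * gk t w)
    + 4 * M * `|c| ^+ 3 * gk t w))).
  apply: le_Rintegral => //.
  - exact: (integrable_abse iB).
  - by apply: (iD); apply: iZ.
  move=> w _; rewrite -mulrBl normrM (ger0_norm (gk_ge0 w t0)).
  have -> : 4 * M * `|s| ^+ 3 * (`|w| ^+ 3 * gk t w) + 4 * M * `|c| ^+ 3 * gk t w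
      = (M * (4 * (`|s| ^+ 3 * `|w| ^+ 3 + `|c| ^+ 3))) * gk t w by ring.
  rewrite ler_wpM2r ?gk_ge0//.
  have -> : f (x + (s * w + c)) - P w = f (x + (s * w + c)) - f x - f1 x * (s * w + c)
      - f2 x * (s * w + c) ^+ 2 / 2 by rewrite /P; field.
  apply: le_trans (taylor3 x d1 d2 d3 f3M _) _.
  rewrite ler_wpM2l//.
  apply: (@le_trans _ _ ((`|s * w| + `|c|) ^+ 3)).
    by rewrite lerXn2r ?nnegrE ?addr_ge0// ler_normD.
  rewrite -exprMn -normrM; set p := `|s * w|; set q := `|c|.
  have p0 : 0 <= p by exact: normr_ge0.
  have q0 : 0 <= q by exact: normr_ge0.
  have : 0 <= 3 * (p + q) * (p - q) ^+ 2 by rewrite mulr_ge0 ?sqr_ge0// mulr_ge0// addr_ge0.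
  by lra.
rewrite RintegralD//; [|exact: iZ|exact: iZ].
rewrite !RintegralZl// Rintegral_gk// mulr1 mulrDr lerD//.
have h := integral_gk_cube t0.
have -> : 4 * M * (24 * `|s| ^+ 3 * (t * Num.sqrt t)) = 4 * M * `|s| ^+ 3 * (24 * (t * Num.sqrt t)) by ring.
by rewrite ler_wpM2l// !mulr_ge0.
Qed.

End gaussian_moments.

(** * The approximate transition density *)

Section lamperti.
Context {R : realType}.
Notation leb := (@lebesgue_measure R).

(** A diffusion coefficient [sg] and a drift [bt] with their derivatives, the
    Lamperti transform [phi] (which turns [sg] into 1), its inverse, and the
    primitive [Bx] that makes the drift a gradient in the coordinate [phi]. *)
Record diffusion_model (K alpha : R) := DiffusionModel {
  vol : R -> R ; vol1 : R -> R ; vol2 : R -> R ; vol3 : R -> R ;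
  drift : R -> R ; drift1 : R -> R ; drift2 : R -> R ;
  lamp : R -> R ; lampV : R -> R ; gradp : R -> R ;
  alpha_gt0 : 0 < alpha ;
  vol_gt : forall x, alpha < vol x ;
  vol_der : forall x : R, is_derive x 1 vol (vol1 x) ;
  vol1_der : forall x : R, is_derive x 1 vol1 (vol2 x) ;
  vol2_der : forall x : R, is_derive x 1 vol2 (vol3 x) ;
  drift_der : forall x : R, is_derive x 1 drift (drift1 x) ;
  drift1_der : forall x : R, is_derive x 1 drift1 (drift2 x) ;
  vol_le : forall x, `|vol x| <= K ;
  vol1_le : forall x, `|vol1 x| <= K ;
  vol2_le : forall x, `|vol2 x| <= K ;
  vol3_le : forall x, `|vol3 x| <= K ;
  drift_le : forall x, `|drift x| <= K ;
  drift1_le : forall x, `|drift1 x| <= K ;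
  drift2_le : forall x, `|drift2 x| <= K ;
  lamp_der : forall x : R, is_derive x 1 lamp (vol x)^-1 ;
  lamp0 : lamp 0 = 0 ;
  psiK : cancel lampV lamp ;
  phiK : cancel lamp lampV ;
  gradp_der : forall x : R, is_derive x 1 gradp (drift x / vol x ^+ 2 - vol1 x / (2 * vol x)) }.

Variables (K alpha : R) (M : diffusion_model K alpha).

Local Notation sg := (vol M).
Local Notation sg1 := (vol1 M).
Local Notation sg2 := (vol2 M).
Local Notation sg3 := (vol3 M).
Local Notation bt := (drift M).
Local Notation bt1 := (drift1 M).
Local Notation bt2 := (drift2 M).
Local Notation phi := (lamp M).
Local Notation psi := (lampV M).
Local Notation Bx := (gradp M).

Lemma sg_gt0 x : 0 < sg x.
Proof. exact: lt_trans (alpha_gt0 M) (vol_gt M x). Qed.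

Lemma sg_neq0 x : sg x != 0.
Proof. by rewrite gt_eqF ?sg_gt0. Qed.

Lemma sg_leK x : sg x <= K.
Proof. by have := vol_le M x; apply: le_trans; rewrite ler_norm. Qed.

Lemma alpha_ltK : alpha < K.
Proof. exact: lt_le_trans (vol_gt M 0) (sg_leK 0). Qed.

Lemma K_gt0 : 0 < K.
Proof. exact: lt_trans (alpha_gt0 M) alpha_ltK. Qed.

Lemma sgV_le x : (sg x)^-1 <= alpha^-1.
Proof. by rewrite lef_pV2 ?posrE ?sg_gt0 ?(alpha_gt0 M)// ltW ?vol_gt. Qed.

(** The drift of the process in the coordinate [phi] is [ell * sg]; hence a
    primitive of [ell] appears in the exponent of [Q]. *)
Definition ell x := bt x / sg x ^+ 2 - sg1 x / (2 * sg x).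

Definition ell1 x := bt1 x / sg x ^+ 2 - 2 * bt x * sg1 x / sg x ^+ 3
  - sg2 x / (2 * sg x) + sg1 x ^+ 2 / (2 * sg x ^+ 2).

Definition ell2 x := bt2 x / sg x ^+ 2 - 4 * bt1 x * sg1 x / sg x ^+ 3
  - 2 * bt x * sg2 x / sg x ^+ 3 + 6 * bt x * sg1 x ^+ 2 / sg x ^+ 4
  - sg3 x / (2 * sg x) + 3 / 2 * (sg1 x * sg2 x) / sg x ^+ 2
  - sg1 x ^+ 3 / sg x ^+ 3.

Let neq0 (n : nat) x : n.+1%:R * sg x != 0.
Proof. by rewrite mulf_neq0 ?sg_neq0// pnatr_eq0. Qed.

Lemma ell_der (x : R) : is_derive x 1 ell (ell1 x).
Proof.
have h1 := vol_der M; have h2 := vol1_der M; have h3 := drift_der M.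
have n0 := sg_neq0 x.
rewrite /ell; derive_to; rewrite ?expf_neq0 ?(neq0 1)//.
by rewrite /ell1 /=; field; rewrite n0.
Qed.

Lemma ell1_der (x : R) : is_derive x 1 ell1 (ell2 x).
Proof.
have h1 := vol_der M; have h2 := vol1_der M; have h3 := drift_der M.
have h4 := vol2_der M; have h5 := drift1_der M.
have n0 := sg_neq0 x.
rewrite /ell1; derive_to; rewrite ?mulf_neq0 ?expf_neq0 ?pnatr_eq0//.
by rewrite /ell2 /=; field; rewrite n0.
Qed.

Definition LB := K / alpha + K / 2.

Lemma LB_gt0 : 0 < LB.
Proof. by rewrite addr_gt0// divr_gt0// ?K_gt0 ?(alpha_gt0 M). Qed.

Let sgV0 x : 0 <= (sg x)^-1.
Proof. by rewrite invr_ge0 ltW// sg_gt0. Qed.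

Lemma sgV_norm x : `|(sg x)^-1| <= alpha^-1.
Proof. by rewrite ger0_norm ?sgV_le// invr_ge0 ltW ?sg_gt0. Qed.

Lemma ell_le x : `|ell x| <= LB * (sg x)^-1.
Proof.
have -> : ell x = (bt x / sg x - sg1 x / 2) * (sg x)^-1.
  by rewrite /ell; field; rewrite sg_neq0.
rewrite normrM [X in _ * X]ger0_norm// ler_wpM2r//.
rewrite (le_trans (ler_normB _ _))// /LB lerD// !normrM ler_pM// ?drift_le ?vol1_le//.
  exact: sgV_norm.
by rewrite ger0_norm.
Qed.

(** The zeroth-order term left when the gradient factor of [Q] has removed the
    drift. *)
Definition pot x := 1 / 2 * sg x ^+ 2 * (ell x ^+ 2 - ell1 x) - bt x * ell x.

(** The bound on the potential. Like [LB], it involves only [K] and [alpha];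
    the constants of the theorem are built from these two. *)
Definition CV := 1 / 2 * (LB ^+ 2 + (K + 2 * K * K / alpha + K * K)) + K * (LB / alpha).

Lemma pot_le x : `|pot x| <= CV.
Proof.
have n0 := sg_neq0 x.
have e1 : sg x ^+ 2 * ell1 x = bt1 x - 2 * bt x * sg1 x / sg x - sg x * sg2 x / 2 + sg1 x ^+ 2 / 2.
  by rewrite /ell1; field; rewrite n0.
have -> : pot x = 1 / 2 * ((sg x * ell x) ^+ 2 - sg x ^+ 2 * ell1 x) - bt x * ell x.
  by rewrite /pot; ring.
have K0 := K_gt0.
have h1 : `|sg x * ell x| <= LB.
  rewrite normrM (gtr0_norm (sg_gt0 x)) mulrC -ler_pdivlMr ?sg_gt0//; exact: ell_le.
have h2 : `|(sg x * ell x) ^+ 2| <= LB ^+ 2.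
  by rewrite normrX lerXn2r ?nnegrE ?(ltW LB_gt0).
have h3 : `|sg x ^+ 2 * ell1 x| <= K + 2 * K * K / alpha + K * K.
  rewrite e1; have a1 := drift1_le M x.
  have a2 : `|2 * bt x * sg1 x / sg x| <= 2 * K * K / alpha.
    rewrite !normrM ler_pM ?mulr_ge0//; last exact: sgV_norm.
    by rewrite ler_pM ?mulr_ge0 ?vol1_le// ler_pM ?drift_le// ger0_norm.
  have a3 : `|sg x * sg2 x| <= K * K by rewrite normrM ler_pM ?vol_le ?vol2_le.
  have a4 : `|sg1 x ^+ 2| <= K * K by rewrite expr2 normrM ler_pM ?vol1_le.
  move: a1 a2 a3 a4; rewrite !ler_norml => /andP[? ?] /andP[? ?] /andP[? ?] /andP[? ?].
  by apply/andP; split; lra.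
have h4 : `|bt x * ell x| <= K * (LB / alpha).
  rewrite normrM ler_pM ?drift_le// (le_trans (ell_le x))//.
    by rewrite ler_wpM2l ?sgV_le// (ltW LB_gt0).
move: h2 h3 h4; rewrite /CV !ler_norml => /andP[? ?] /andP[? ?] /andP[? ?].
by apply/andP; split; lra.
Qed.

Lemma phi_lip x y : x <= y -> K^-1 * (y - x) <= phi y - phi x <= alpha^-1 * (y - x).
Proof.
move=> xy; have [c _ ->] := mean_value x y (lamp_der M).
have d0 : 0 <= y - x by rewrite subr_ge0.
by rewrite !ler_wpM2r ?sgV_le// lef_pV2 ?posrE ?K_gt0 ?sg_gt0 ?sg_leK.
Qed.

Lemma psi_lip x y : x <= y -> alpha * (y - x) <= psi y - psi x <= K * (y - x).
Proof.
move=> xy; have a0 := alpha_gt0 M; have K0 := K_gt0.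
have h : psi x <= psi y.
  rewrite leNgt; apply/negP => h; have /andP[+ _] := phi_lip (ltW h).
  rewrite !psiK => h1; have : 0 < K^-1 * (psi x - psi y).
    by rewrite mulr_gt0 ?invr_gt0// subr_gt0.
  by lra.
have /andP[] := phi_lip h; rewrite !psiK mulrC ler_pdivrMr// => h1.
rewrite mulrC ler_pdivlMr// => h2.
by apply/andP; split; lra.
Qed.

Lemma psi0 : psi 0 = 0.
Proof. by rewrite -{1}(lamp0 M) phiK. Qed.

Lemma psi_bound y : alpha * `|y| <= `|psi y| <= K * `|y|.
Proof.
have [y0|y0] := leP 0 y.
  by have := psi_lip y0; rewrite psi0 !subr0 => /andP[h1 h2]; rewrite !ger0_norm ?h1//;
    have := alpha_gt0 M; nra.
have := psi_lip (ltW y0); rewrite psi0 !sub0r => /andP[h1 h2]; rewrite !ler0_norm ?h1//.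
  by have := alpha_gt0 M; nra.
exact: ltW.
Qed.

Lemma lip_continuous (f : R -> R) (C : R) : 0 < C ->
  (forall x y, x <= y -> `|f y - f x| <= C * (y - x)) -> continuous f.
Proof.
move=> C0 h x; apply/cvgrPdist_le => e e0; near=> y.
have {}h : `|f x - f y| <= C * `|x - y|.
  have [xy|/ltW yx] := leP x y.
    by rewrite distrC (le_trans (h _ _ xy))// distrC [`|y - x|]ger0_norm// subr_ge0.
  by rewrite (le_trans (h _ _ yx))// [`|x - y|]ger0_norm// subr_ge0.
rewrite (le_trans h)// mulrC -ler_pdivlMr//; near: y.
by apply: cvgr_dist_le; [exact: cvg_id|exact: divr_gt0].
Unshelve. all: by end_near. Qed.

Lemma psi_continuous : continuous psi.
Proof.
apply: (lip_continuous K_gt0) => x y xy; have /andP[h1 h2] := psi_lip xy.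
by rewrite ger0_norm//; have := alpha_gt0 M; nra.
Qed.

Lemma phi_continuous : continuous phi.
Proof. exact: (is_derive1_continuous (lamp_der M)). Qed.

(** The primitive of the drift in the coordinate [phi]. *)
Definition By y := Bx (psi y).

(** Cauchy mean value theorem for [Bx] against [phi], since
    [Bx' = ell] is bounded by [LB * phi']. *)
Lemma Bx_lip x y : `|Bx y - Bx x| <= LB * `|phi y - phi x|.
Proof.
have [c cxy e] : exists2 c, True & (Bx y - Bx x) * (sg c)^-1 = ell c * (phi y - phi x).
  have h1 := gradp_der M; have h2 := lamp_der M.
  pose g u := (Bx y - Bx x) * phi u - (phi y - phi x) * Bx u.
  have gd (u : R) : is_derive u 1 g ((Bx y - Bx x) * (sg u)^-1 - (phi y - phi x) * ell u).
    by rewrite /g; derive_to; rewrite /ell /=; ring.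
  have [xy|xy] := eqVneq x y.
    by exists x; rewrite // xy !subrr mul0r mulr0.
  have [c _] := mean_value x y gd; rewrite (_ : g y - g x = 0); last by rewrite /g; ring.
  move/esym/eqP; rewrite mulf_eq0 orbC subr_eq0 eq_sym (negbTE xy)/= subr_eq0 => /eqP e.
  by exists c => //; rewrite e mulrC.
have s0 := sg_gt0 c.
have : `|Bx y - Bx x| * (sg c)^-1 <= LB * `|phi y - phi x| * (sg c)^-1.
  rewrite -{1}[(sg c)^-1]gtr0_norm ?invr_gt0// -normrM e normrM.
  by rewrite mulrAC ler_wpM2r// ell_le.
by rewrite ler_pM2r ?invr_gt0.
Qed.

Lemma By_lip x y : `|By y - By x| <= LB * `|y - x|.
Proof. by have := Bx_lip (psi x) (psi y); rewrite !psiK. Qed.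

Lemma By_continuous : continuous By.
Proof.
apply: (lip_continuous LB_gt0) => x y xy.
by rewrite (le_trans (By_lip x y))// ger0_norm// subr_ge0.
Qed.

(** The approximate transition density: the heat kernel in the coordinate
    [phi], corrected by the gradient factor [exp (By z - Bx x)]. *)
Definition Q (tau z x : R) := expR (By z - Bx x) * gk tau (z - phi x).

Lemma Q_gt0 tau z x : 0 < tau -> 0 < Q tau z x.
Proof. by move=> t0; rewrite mulr_gt0 ?expR_gt0 ?gk_gt0. Qed.

Definition A1 tau z x := - ell x + (z - phi x) / (tau * sg x).

Definition A2 tau z x := - ell1 x - 1 / (tau * sg x ^+ 2)
  - (z - phi x) * sg1 x / (tau * sg x ^+ 2).

Definition A3 tau z x := - ell2 x + 3 * sg1 x / (tau * sg x ^+ 3)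
  - (z - phi x) * sg2 x / (tau * sg x ^+ 2)
  + 2 * (z - phi x) * sg1 x ^+ 2 / (tau * sg x ^+ 3).

Lemma A1_der tau z (x : R) : 0 < tau -> is_derive x 1 (A1 tau z) (A2 tau z x).
Proof.
move=> t0; have h1 := ell_der; have h2 := lamp_der M; have h3 := vol_der M.
have n0 := sg_neq0 x; have tn0 : tau != 0 by rewrite gt_eqF.
rewrite /A1; derive_to; rewrite ?mulf_neq0//.
by rewrite /A2 /=; field; rewrite n0 tn0.
Qed.

Lemma A2_der tau z (x : R) : 0 < tau -> is_derive x 1 (A2 tau z) (A3 tau z x).
Proof.
move=> t0; have h1 := ell1_der; have h2 := lamp_der M; have h3 := vol_der M.
have h4 := vol1_der M.
have n0 := sg_neq0 x; have tn0 : tau != 0 by rewrite gt_eqF.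
rewrite /A2; derive_to; rewrite ?mulf_neq0 ?expf_neq0//.
by rewrite /A3 /=; field; rewrite n0 tn0.
Qed.

Definition Q1 tau z x := A1 tau z x * Q tau z x.
Definition Q2 tau z x := (A2 tau z x + A1 tau z x ^+ 2) * Q tau z x.
Definition Q3 tau z x :=
  (A3 tau z x + 3 * A1 tau z x * A2 tau z x + A1 tau z x ^+ 3) * Q tau z x.

Lemma Q_der tau z (x : R) : 0 < tau -> is_derive x 1 (Q tau z) (Q1 tau z x).
Proof.
move=> t0; have h1 := gradp_der M; have h2 := lamp_der M.
have n0 := sg_neq0 x; have tn0 : tau != 0 by rewrite gt_eqF.
rewrite /Q /gk; derive_to; rewrite /Q1 /Q /A1 /gk /ell /=.
set e1 := expR _; set e2 := expR _; set sq := (Num.sqrt _)^-1.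
by field; rewrite n0 tn0.
Qed.

Lemma Q1_der tau z (x : R) : 0 < tau -> is_derive x 1 (Q1 tau z) (Q2 tau z x).
Proof.
move=> t0; have h1 x := @A1_der tau z x t0; have h2 x := @Q_der tau z x t0.
by rewrite /Q1; derive_to; rewrite /Q2 /Q1 /=; ring.
Qed.

Lemma Q2_der tau z (x : R) : 0 < tau -> is_derive x 1 (Q2 tau z) (Q3 tau z x).
Proof.
move=> t0; have h1 x := @A1_der tau z x t0; have h2 x := @Q_der tau z x t0.
have h3 x := @A2_der tau z x t0.
by rewrite /Q2; derive_to; rewrite /Q3 /Q1 /=; ring.
Qed.

Definition Qt tau z x :=
  ((z - phi x) ^+ 2 / (2 * tau ^+ 2) - 1 / (2 * tau)) * Q tau z x.
Definition Qtt tau z x :=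
  (((z - phi x) ^+ 2 / (2 * tau ^+ 2) - 1 / (2 * tau)) ^+ 2
   - (z - phi x) ^+ 2 / tau ^+ 3 + 1 / (2 * tau ^+ 2)) * Q tau z x.

Lemma Q_dertime z x (tau : R) : 0 < tau -> is_derive tau 1 (fun tau => Q tau z x) (Qt tau z x).
Proof.
move=> t0; have tn0 : tau != 0 by rewrite gt_eqF.
have dsq (t : R) : 0 < t -> is_derive t 1 (fun t => Num.sqrt (2 * pi * t))
    (Num.sqrt (2 * pi * t) / (2 * t)).
  move=> tt0; have p0 : 0 < 2 * pi * t by rewrite !mulr_gt0 ?pi_gt0.
  have h := is_derive1_sqrt p0.
  eapply derive1_eq; first by eapply (@derive1_comp_fun _ Num.sqrt (fun t => 2 * pi * t)); [exact: h|derive_fun].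
  have : Num.sqrt (2 * pi * t) != 0 by rewrite gt_eqF// sqrtr_gt0.
  have : Num.sqrt (2 * pi * t) ^+ 2 = 2 * pi * t by rewrite sqr_sqrtr// ltW.
  set q := Num.sqrt _ => qE q0; rewrite /=.
  have -> : 2 * pi = q ^+ 2 / t by rewrite qE; field; rewrite gt_eqF.
  by field; rewrite q0 gt_eqF.
have p0 : 0 < 2 * pi * tau by rewrite !mulr_gt0 ?pi_gt0.
have q0 : Num.sqrt (2 * pi * tau) != 0 by rewrite gt_eqF// sqrtr_gt0.
have := dsq _ t0 => dq.
rewrite /Q /gk; derive_to; rewrite ?mulf_neq0//.
rewrite /Qt /Q /gk /=; set e1 := expR _; set e2 := expR _.
set q := Num.sqrt _ in q0 *.
by field; rewrite tn0 q0.
Qed.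

Lemma Qt_dertime z x (tau : R) : 0 < tau -> is_derive tau 1 (fun tau => Qt tau z x) (Qtt tau z x).
Proof.
move=> t0; have tn0 : tau != 0 by rewrite gt_eqF.
have h2 := @Q_dertime z x tau t0.
rewrite /Qt; derive_to; rewrite ?mulf_neq0 ?expf_neq0//.
by rewrite /Qtt /Qt /=; field; rewrite tn0.
Qed.

(** [Q] solves the backward equation up to a bounded zeroth-order term: the
    first-order terms cancel by the choice of [ell]. *)
Lemma Q_backward tau z x : 0 < tau ->
  bt x * Q1 tau z x + sg x ^+ 2 * Q2 tau z x / 2 = Qt tau z x + pot x * Q tau z x.
Proof.
move=> t0; have n0 := sg_neq0 x; have tn0 : tau != 0 by rewrite gt_eqF.
rewrite /Q1 /Q2 /Qt /pot /A1 /A2.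
set q := Q _ _ _; set l1 := ell1 x.
by rewrite /ell; field; rewrite n0 tn0.
Qed.

Section uniform_bounds.
Variables (eps z : R).
Hypothesis eps0 : 0 < eps.

(** Functions of the time and the position growing at most exponentially in
    the distance of [phi x] to [z], uniformly for times in
    [[eps, eps + 1]]; the Gaussian factor of [Q] absorbs this growth. *)
Definition exp_growth (f : R -> R -> R) := exists C c : R,
  [/\ 0 <= C, 0 <= c & forall tau x, eps <= tau <= eps + 1 ->
    `|f tau x| <= C * expR (c * `|z - phi x|)].

Lemma exp_growth_bnd f C : (forall tau x, eps <= tau <= eps + 1 -> `|f tau x| <= C) ->
  exp_growth f.
Proof.
move=> fC; exists C, 0; split => //.
  by apply: le_trans (fC eps 0 _); rewrite ?normr_ge0// lexx lerDl ler01.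
by move=> tau x h; rewrite mul0r expR0 mulr1; exact: fC.
Qed.

Lemma exp_growthD f g : exp_growth f -> exp_growth g ->
  exp_growth (fun tau x => f tau x + g tau x).
Proof.
move=> [C [c [C0 c0 hf]]] [D [e [D0 e0 hg]]]; exists (C + D), (c + e); split.
- exact: addr_ge0.
- exact: addr_ge0.
move=> tau x h; rewrite (le_trans (ler_normD _ _))// mulrDl lerD//.
  rewrite (le_trans (hf _ _ h))// ler_wpM2l// ler_expR ler_wpM2r// lerDl//.
by rewrite (le_trans (hg _ _ h))// ler_wpM2l// ler_expR ler_wpM2r// lerDr.
Qed.

Lemma exp_growthM f g : exp_growth f -> exp_growth g ->
  exp_growth (fun tau x => f tau x * g tau x).
Proof.
move=> [C [c [C0 c0 hf]]] [D [e [D0 e0 hg]]]; exists (C * D), (c + e); split.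
- exact: mulr_ge0.
- exact: addr_ge0.
move=> tau x h; rewrite normrM mulrDl expRD mulrACA.
by rewrite ler_pM// ?hf ?hg.
Qed.

Lemma exp_growthN f : exp_growth f -> exp_growth (fun tau x => - f tau x).
Proof.
by move=> [C [c [C0 c0 hf]]]; exists C, c; split => // tau x h; rewrite normrN hf.
Qed.

Lemma exp_growthX f n : exp_growth f -> exp_growth (fun tau x => f tau x ^+ n.+1).
Proof.
move=> hf; elim: n => [|n ih]; first exact: hf.
exact: (exp_growthM hf ih).
Qed.

Lemma exp_growth_dist : exp_growth (fun _ x => z - phi x).
Proof.
exists 1, 1; split => // tau x _; rewrite !mul1r.
by apply: le_trans (expR_ge1Dx _); rewrite lerDr.
Qed.

Lemma exp_growth_cst (c : R) : exp_growth (fun _ _ => c).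
Proof. exact: (exp_growth_bnd (C := `|c|)). Qed.

Lemma exp_growth_tauV : exp_growth (fun tau _ => tau^-1).
Proof.
apply: (exp_growth_bnd (C := eps^-1)) => tau x /andP[h _].
have t0 := lt_le_trans eps0 h.
by rewrite ger0_norm ?invr_ge0 ?(ltW t0)// lef_pV2.
Qed.

Lemma exp_growth_pos f C : (forall x, `|f x| <= C) -> exp_growth (fun _ => f).
Proof. by move=> h; apply: (exp_growth_bnd (C := C)) => tau x _. Qed.

Lemma exp_growth_sgV : exp_growth (fun _ x => (sg x)^-1).
Proof. exact: exp_growth_pos sgV_norm. Qed.

Ltac growth :=
  first [ apply: exp_growth_cst | apply: exp_growth_dist
        | apply: exp_growth_tauV | apply: exp_growth_sgV
        | apply: (exp_growth_pos (f := sg1)); exact: vol1_le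
        | apply: (exp_growth_pos (f := sg2)); exact: vol2_le
        | apply: (exp_growth_pos (f := sg3)); exact: vol3_le
        | apply: (exp_growth_pos (f := bt)); exact: drift_le
        | apply: (exp_growth_pos (f := bt1)); exact: drift1_le
        | apply: (exp_growth_pos (f := bt2)); exact: drift2_le
        | apply: exp_growthD; growth | apply: exp_growthN; growth
        | apply: exp_growthM; growth | apply: exp_growthX; growth | assumption ].

Lemma exp_growth_eq f g : (forall tau x, eps <= tau -> f tau x = g tau x) ->
  exp_growth f -> exp_growth g.
Proof.
move=> fg [C [c [C0 c0 h]]]; exists C, c; split => // tau x /[dup] ht /andP[t1 _].
by rewrite -fg// h.
Qed.

Let tau_neq0 tau : eps <= tau -> tau != 0.
Proof. by move=> h; rewrite gt_eqF// (lt_le_trans eps0 h). Qed.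

Lemma exp_growth_ell : exp_growth (fun _ x => ell x).
Proof.
apply: (exp_growth_eq (f := fun _ x => bt x * (sg x)^-1 ^+ 2 + - (sg1 x * (2^-1 * (sg x)^-1)))).
  by move=> tau x _; rewrite /ell; field; rewrite sg_neq0.
growth.
Qed.

Lemma exp_growth_ell1 : exp_growth (fun _ x => ell1 x).
Proof.
apply: (exp_growth_eq (f := fun _ x => bt1 x * (sg x)^-1 ^+ 2 + - (2 * bt x * sg1 x * (sg x)^-1 ^+ 3)
  + - (sg2 x * (2^-1 * (sg x)^-1)) + sg1 x ^+ 2 * (2^-1 * (sg x)^-1 ^+ 2))).
  by move=> tau x _; rewrite /ell1; field; rewrite sg_neq0.
growth.
Qed.

Lemma exp_growth_ell2 : exp_growth (fun _ x => ell2 x).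
Proof.
apply: (exp_growth_eq (f := fun _ x => bt2 x * (sg x)^-1 ^+ 2 + - (4 * bt1 x * sg1 x * (sg x)^-1 ^+ 3)
  + - (2 * bt x * sg2 x * (sg x)^-1 ^+ 3) + 6 * bt x * sg1 x ^+ 2 * (sg x)^-1 ^+ 4
  + - (sg3 x * (2^-1 * (sg x)^-1)) + 3 * 2^-1 * (sg1 x * sg2 x) * (sg x)^-1 ^+ 2
  + - (sg1 x ^+ 3 * (sg x)^-1 ^+ 3))).
  by move=> tau x _; rewrite /ell2; field; rewrite sg_neq0.
growth.
Qed.

Lemma exp_growth_A1 : exp_growth (fun tau x => A1 tau z x).
Proof.
have h := exp_growth_ell.
apply: (exp_growth_eq (f := fun tau x => - ell x + (z - phi x) * (tau^-1 * (sg x)^-1))).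
  by move=> tau x /tau_neq0 h'; rewrite /A1; field; rewrite sg_neq0 h'.
growth.
Qed.

Lemma exp_growth_A2 : exp_growth (fun tau x => A2 tau z x).
Proof.
have h := exp_growth_ell1.
apply: (exp_growth_eq (f := fun tau x => - ell1 x + - (tau^-1 * (sg x)^-1 ^+ 2)
  + - ((z - phi x) * sg1 x * (tau^-1 * (sg x)^-1 ^+ 2)))).
  by move=> tau x /tau_neq0 h'; rewrite /A2; field; rewrite sg_neq0 h'.
growth.
Qed.

Lemma exp_growth_A3 : exp_growth (fun tau x => A3 tau z x).
Proof.
have h := exp_growth_ell2.
apply: (exp_growth_eq (f := fun tau x => - ell2 x + 3 * sg1 x * (tau^-1 * (sg x)^-1 ^+ 3)
  + - ((z - phi x) * sg2 x * (tau^-1 * (sg x)^-1 ^+ 2))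
  + 2 * (z - phi x) * sg1 x ^+ 2 * (tau^-1 * (sg x)^-1 ^+ 3))).
  by move=> tau x /tau_neq0 h'; rewrite /A3; field; rewrite sg_neq0 h'.
growth.
Qed.

(** A Gaussian beats every exponential. *)
Lemma Q_absorbs f : exp_growth f -> exists C, forall tau x, eps <= tau <= eps + 1 ->
  `|f tau x * Q tau z x| <= C.
Proof.
move=> [C [c [C0 c0 h]]].
pose D := (Num.sqrt (2 * pi * eps))^-1.
exists (C * D * expR ((c + LB) ^+ 2 * (eps + 1) / 2)) => tau x /[dup] ht /andP[t1 t2].
have t0 := lt_le_trans eps0 t1.
rewrite normrM (gtr0_norm (Q_gt0 _ _ t0)).
set y := z - phi x.
have hB : expR (By z - Bx x) <= expR (LB * `|y|).
  rewrite ler_expR (le_trans (ler_norm _))//.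
  by have := Bx_lip x (psi z); rewrite psiK.
have hD : (Num.sqrt (2 * pi * tau))^-1 <= D.
  rewrite /D lef_pV2 ?posrE ?sqrtr_gt0 ?mulr_gt0 ?pi_gt0//.
  by rewrite ler_sqrt ?mulr_ge0 ?pi_ge0 ?(ltW t0)// ler_wpM2l ?mulr_ge0 ?pi_ge0.
apply: (@le_trans _ _ (C * expR (c * `|y|) * (expR (LB * `|y|) * (expR (- y ^+ 2 / (2 * tau)) * D)))).
  rewrite ler_pM ?h ?mulr_ge0 ?expR_ge0 ?gk_ge0 ?(ltW (Q_gt0 _ _ t0))//.
  rewrite /Q ler_pM ?expR_ge0 ?gk_ge0// /gk ler_pM ?expR_ge0// ?invr_ge0//.
have -> : C * expR (c * `|y|) * (expR (LB * `|y|) * (expR (- y ^+ 2 / (2 * tau)) * D)) =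
    C * D * expR (c * `|y| + LB * `|y| + - y ^+ 2 / (2 * tau)).
  by rewrite !expRD; ring.
rewrite ler_wpM2l ?mulr_ge0 ?invr_ge0// ler_expR.
rewrite -real_normK ?num_real//; set a := `|y|; set b := c + LB.
have -> : c * a + LB * a + - a ^+ 2 / (2 * tau) = (b ^+ 2 * tau ^+ 2 - (a - b * tau) ^+ 2) / (2 * tau).
  by rewrite /b; field; rewrite gt_eqF.
apply: (@le_trans _ _ (b ^+ 2 * tau / 2)).
  rewrite ler_pdivrMr ?mulr_gt0//.
  have -> : b ^+ 2 * tau / 2 * (2 * tau) = b ^+ 2 * tau ^+ 2 by field.
  by rewrite gerBl sqr_ge0.
by rewrite ler_wpM2r// ler_wpM2l// sqr_ge0.
Qed.

Lemma Q_bounded : exists C, forall tau x, eps <= tau <= eps + 1 -> `|Q tau z x| <= C.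
Proof.
have [C h] := Q_absorbs (exp_growth_cst 1).
by exists C => tau x ht; have := h tau x ht; rewrite mul1r.
Qed.

Lemma Q1_bounded : exists C, forall tau x, eps <= tau <= eps + 1 -> `|Q1 tau z x| <= C.
Proof. exact: Q_absorbs exp_growth_A1. Qed.

Lemma Q2_bounded : exists C, forall tau x, eps <= tau <= eps + 1 -> `|Q2 tau z x| <= C.
Proof.
have h1 := exp_growth_A1; have h2 := exp_growth_A2.
by apply: Q_absorbs; growth.
Qed.

Lemma Q3_bounded : exists C, forall tau x, eps <= tau <= eps + 1 -> `|Q3 tau z x| <= C.
Proof.
have h1 := exp_growth_A1; have h2 := exp_growth_A2; have h3 := exp_growth_A3.
by apply: Q_absorbs; growth.
Qed.

Lemma Qt_bounded : exists C, forall tau x, eps <= tau <= eps + 1 -> `|Qt tau z x| <= C.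
Proof.
apply: Q_absorbs.
apply: (exp_growth_eq (f := fun tau x => (z - phi x) ^+ 2 * (2^-1 * tau^-1 ^+ 2) + - (2^-1 * tau^-1))).
  by move=> tau x /tau_neq0 h'; field; rewrite h'.
growth.
Qed.

Lemma Qtt_bounded : exists C, forall tau x, eps <= tau <= eps + 1 -> `|Qtt tau z x| <= C.
Proof.
apply: Q_absorbs.
apply: (exp_growth_eq (f := fun tau x => ((z - phi x) ^+ 2 * (2^-1 * tau^-1 ^+ 2) + - (2^-1 * tau^-1)) ^+ 2
  + - ((z - phi x) ^+ 2 * tau^-1 ^+ 3) + 2^-1 * tau^-1 ^+ 2)).
  by move=> tau x /tau_neq0 h'; field; rewrite h'.
growth.
Qed.

End uniform_bounds.

(** [Qt] is the derivative of [Q] in its time, with a bounded second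
    derivative. *)
Lemma Q_time_taylor eps z : 0 < eps -> exists C, 0 <= C /\ forall tau d x,
  eps <= tau -> 0 <= d -> tau + d <= eps + 1 ->
  `|Q (tau + d) z x - Q tau z x - Qt tau z x * d| <= C * d ^+ 2.
Proof.
move=> e0; have [C hC] := Qtt_bounded z e0.
exists C; split.
  by apply: le_trans (hC eps 0 _); rewrite ?normr_ge0// lexx lerDl ler01.
move=> tau d x t1 d0 t2.
have pos s : 0 <= s <= d -> 0 < tau + s.
  by move=> /andP[s0 _]; rewrite ltr_wpDr// (lt_le_trans e0).
have rng s : 0 <= s <= d -> eps <= tau + s <= eps + 1.
  move=> /andP[s0 sd]; rewrite (le_trans t1) ?lerDl//=.
  by rewrite (le_trans _ t2)// lerD2l.
have step1 s : 0 <= s <= d -> `|Qt (tau + s) z x - Qt tau z x| <= C * s ^+ 1.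
  apply: (@derive_bound_pow_on _ (fun s => Qt (tau + s) z x - Qt tau z x)
    (fun s => Qtt (tau + s) z x) C 0 d); first by rewrite addr0 subrr.
    move=> u hu; have h := @Qt_dertime z x (tau + u) (pos u hu).
    eapply derive1_eq.
      eapply derive1_add_fun; last by derive_fun.
      by eapply (@derive1_comp_fun _ (fun t => Qt t z x) (fun u => tau + u)); [exact: h|derive_fun].
    by rewrite /=; ring.
  by move=> u hu; rewrite expr0 mulr1 hC ?rng.
have h0 : 0 <= d <= d by rewrite d0 lexx.
refine (@derive_bound_pow_on R (fun s => Q (tau + s) z x - Q tau z x - Qt tau z x * s)
  (fun s => Qt (tau + s) z x - Qt tau z x) C 1 d _ _ step1 d h0).
  by rewrite addr0 mulr0 !subrr.
move=> u hu; have h := @Q_dertime z x (tau + u) (pos u hu).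
eapply derive1_eq.
  eapply derive1_add_fun; last by derive_fun.
  eapply derive1_add_fun; last by derive_fun.
  by eapply (@derive1_comp_fun _ (fun t => Q t z x) (fun u => tau + u)); [exact: h|derive_fun].
by rewrite /=; ring.
Qed.

(** One Euler step of length [d] moves the time of [Q] by [d], up to a factor
    [1 + O(d)] governed by the potential and an error of order [d ^ (3/2)]. *)
Lemma Q_euler_step eps z : 0 < eps -> exists C, 0 <= C /\ forall tau d x,
  eps <= tau -> 0 < d -> d <= 1 -> tau + d <= eps + 1 ->
  `|\int[leb]_w (Q tau z (x + (sg x * w + bt x * d)) * gk d w) - Q (tau + d) z x|
  <= CV * d * Q tau z x + C * (d * Num.sqrt d).
Proof.
move=> e0; have K0 := K_gt0.
have [C0 h0] := Q_bounded z e0; have [C2 h2] := Q2_bounded z e0.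
have [C3 h3] := Q3_bounded z e0; have [Ct [Ct0 ht]] := Q_time_taylor z e0.
have r0 : eps <= eps <= eps + 1 by rewrite lexx lerDl ler01.
have C20 : 0 <= C2 by apply: le_trans (h2 eps 0 r0).
have C30 : 0 <= C3 by apply: le_trans (h3 eps 0 r0).
exists (4 * C3 * (25 * K ^+ 3) + (C2 * K ^+ 2 + Ct)); split.
  by rewrite addr_ge0 ?mulr_ge0 ?addr_ge0 ?mulr_ge0 ?exprn_ge0 ?(ltW K0).
move=> tau d x t1 d0 d1 t2.
have t0 : 0 < tau := lt_le_trans e0 t1.
have rt : eps <= tau <= eps + 1 by rewrite t1 (le_trans _ t2)// lerDl ltW.
have s0 : 0 <= Num.sqrt d by [].
have s1 : Num.sqrt d <= 1 by rewrite -sqrtr1 ler_sqrt.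
have sE : Num.sqrt d ^+ 2 = d by rewrite sqr_sqrtr// ltW.
set dd := d * Num.sqrt d.
have d2 : d ^+ 2 <= dd by rewrite /dd expr2 ler_wpM2l ?(ltW d0)// -{1}sE; nra.
have d3 : d ^+ 3 <= dd by apply: le_trans d2; rewrite exprSr ler_piMr ?sqr_ge0.
have dd0 : 0 <= dd by rewrite mulr_ge0// ltW.
have := @Rintegral_gk_taylor R (Q tau z) (Q1 tau z) (Q2 tau z) (Q3 tau z) C3 C0
  (sg x) (bt x * d) x d d0 (fun y => @Q_der tau z y t0) (fun y => @Q1_der tau z y t0)
  (fun y => @Q2_der tau z y t0) (fun y => h3 tau y rt) (fun y => h0 tau y rt).
set I := Rintegral _ _ _ => hI.
have b1 : `|sg x| ^+ 3 <= K ^+ 3 by rewrite lerXn2r ?nnegrE ?(ltW K0)// vol_le.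
have b2 : `|bt x * d| ^+ 3 <= K ^+ 3 * dd.
  rewrite normrM exprMn ler_pM ?exprn_ge0//.
    by rewrite lerXn2r ?nnegrE ?(ltW K0)// drift_le.
  by rewrite gtr0_norm.
have {}hI := le_trans hI _; have {}hI := hI (4 * C3 * (25 * K ^+ 3) * dd).
have {hI}/hI hI : 4 * C3 * (24 * `|sg x| ^+ 3 * dd + `|bt x * d| ^+ 3) <= 4 * C3 * (25 * K ^+ 3) * dd.
  rewrite -[leRHS]mulrA ler_wpM2l ?mulr_ge0//.
  have : `|sg x| ^+ 3 * dd <= K ^+ 3 * dd by rewrite ler_wpM2r.
  by lra.
have := ht tau d x t1 (ltW d0) t2.
have hB := Q_backward z x t0.
have -> : I - Q (tau + d) z x =
  (I - (Q tau z x + Q1 tau z x * (bt x * d) + Q2 tau z x * (sg x ^+ 2 * d + (bt x * d) ^+ 2) / 2))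
  + (Q2 tau z x * (bt x ^+ 2) * d ^+ 2 / 2 + pot x * Q tau z x * d
  - (Q (tau + d) z x - Q tau z x - Qt tau z x * d)).
  have -> : Qt tau z x = bt x * Q1 tau z x + sg x ^+ 2 * Q2 tau z x / 2 - pot x * Q tau z x by rewrite hB; ring.
  by field.
move=> hT; apply: le_trans (ler_normD _ _) _.
have b3 : `|Q2 tau z x * (bt x ^+ 2) * d ^+ 2 / 2| <= C2 * K ^+ 2 * dd.
  rewrite -(mulrA _ (d ^+ 2)) normrM ler_pM//.
    rewrite normrM ler_pM ?h2// normrX lerXn2r ?nnegrE ?(ltW K0)//.
    exact: drift_le.
  rewrite ger0_norm ?divr_ge0 ?sqr_ge0//.
  by have := sqr_ge0 d; lra.
have b4 : `|pot x * Q tau z x * d| <= CV * d * Q tau z x.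
  have := Q_gt0 z x t0; move: (Q tau z x) => q q0.
  rewrite 2!normrM (gtr0_norm d0) (gtr0_norm q0) mulrAC.
  by rewrite ler_wpM2r ?(ltW q0)// ler_wpM2r ?pot_le// ltW.
have b5 : Ct * d ^+ 2 <= Ct * dd by rewrite ler_wpM2l.
have b6 := le_trans (ler_normB (Q2 tau z x * (bt x ^+ 2) * d ^+ 2 / 2 + pot x * Q tau z x * d)
  (Q (tau + d) z x - Q tau z x - Qt tau z x * d)) (lerD (ler_normD _ _) (lexx _)).
apply: le_trans (lerD hI b6) _.
move: hT b3 b4 b5; rewrite -/dd.
set u1 := `| _ |; set u2 := `| _ |; set u3 := `| _ |.
by move=> *; lra.
Qed.

(** Replaces the value of [Q] at the end of a step by the value at its start
    in the relative error of [one_step]. *)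
Lemma Q_time_lip eps z : 0 < eps -> exists C, 0 <= C /\ forall tau d x,
  eps <= tau -> 0 <= d -> d <= 1 -> tau + d <= eps + 1 ->
  `|Q (tau + d) z x - Q tau z x| <= C * d.
Proof.
move=> e0; have [Ct [Ct0 ht]] := Q_time_taylor z e0; have [C hC] := Qt_bounded z e0.
have C0 : 0 <= C by apply: le_trans (hC eps 0 _); rewrite ?normr_ge0// lexx lerDl ler01.
exists (C + Ct); split; first exact: addr_ge0.
move=> tau d x t1 d0 d1 t2; have rt : eps <= tau <= eps + 1 by rewrite t1 (le_trans _ t2)// lerDl.
have := ht tau d x t1 d0 t2; have := hC tau x rt.
move=> a b.
have -> : Q (tau + d) z x - Q tau z x = (Q (tau + d) z x - Q tau z x - Qt tau z x * d) + Qt tau z x * d by ring.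
apply: le_trans (ler_normD _ _) _.
rewrite normrM (ger0_norm d0) addrC mulrDl lerD ?ler_wpM2r//.
by rewrite (le_trans b)// ler_wpM2l// expr2 ler_piMr.
Qed.

End lamperti.

(** * Lamperti transform of the rescaled coefficients *)

Section model_existence.
Context {R : realType}.
Notation leb := (@lebesgue_measure R).

(** Integrals are taken from a base point on the left of both [0] and [x]; by
    additivity its choice does not affect the difference of the integrals up to
    [x] and up to [0]. *)
Lemma exists_primitive (f : R -> R) : continuous f ->
  exists2 F : R -> R, (forall x : R, is_derive x 1 F (f x)) & F 0 = 0.
Proof.
move=> cf.
pose G a x := \int[leb]_(t in `[a, x]) f t.
have intf a b : leb.-integrable `[a, b] (EFin \o f).
  apply: continuous_compact_integrable; first exact: segment_compact.
  exact: continuous_subspaceT.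
have Gd (a x : R) : a < x -> is_derive x 1 (G a) (f x).
  move=> ax.
  have h : x < x + 1 by rewrite ltrDl.
  have [] := @continuous_FTC1 R f (BLeft a) x (x + 1) h (intf a (x + 1)) ax (cf x).
  move=> dG eG. apply: (DeriveDef dG). rewrite -derive1E. exact: eG.
have GB (a b x : R) : a <= b -> b <= x -> G a x = G a b + G b x.
  move=> ab bx.
  have := @Rintegral_itvB R f (BLeft a) (BRight x) b (intf a x).
  rewrite !bnd_simp => /(_ ab bx).
  rewrite Rintegral_itv_obnd_cbnd; last first.
    by apply: integrableS (intf b x) => //; exact: subset_itv_oc_cc.
  by rewrite /G => <-; ring.
pose F x := G (Num.min 0 x - 1) x - G (Num.min 0 x - 1) 0.
have FE (c x : R) : c <= 0 -> c <= x -> F x = G c x - G c 0.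
  move=> c0 cx; rewrite /F; set m := Num.min 0 x - 1.
  have [mc|/ltW cm] := leP m c.
    by rewrite (GB m c x)// (GB m c 0)//; ring.
  have mx : m <= x by rewrite /m lerBlDr ge_min orbC lerDl ler01.
  have m0 : m <= 0 by rewrite /m lerBlDr ge_min lerDl ler01.
  by rewrite (GB c m x)// (GB c m 0)//; ring.
exists F; last by rewrite /F subrr.
move=> x; pose c := Num.min 0 x - 1.
have cx : c < x by rewrite /c ltrBlDr; case: (leP 0 x); lra.
have c0 : c < 0 by rewrite /c; case: (leP 0 x); lra.
have h : is_derive x 1 (fun y => G c y - G c 0) (f x).
  have h := Gd _ _ cx.
  eapply derive1_eq; first by eapply derive1_add_fun; [exact: h|derive_fun].
  by rewrite addr0.
apply: near_eq_is_derive h => //.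
near=> y; rewrite /= (FE c)// ?(ltW c0)//; near: y.
exact: lt_le_nbhsr.
Unshelve. all: end_near. Qed.

(** The intermediate value theorem: a function that grows at a linear rate has
    no bounds. *)
Lemma steep_bijective (F : R -> R) (m : R) : 0 < m -> continuous F ->
  (forall x y, x <= y -> m * (y - x) <= F y - F x) ->
  exists2 G : R -> R, cancel G F & cancel F G.
Proof.
move=> m0 cF incr.
have surj y : exists x, F x = y.
  pose r := `|y - F 0| / m + 1.
  have r0 : 0 <= r by rewrite addr_ge0// divr_ge0// ltW.
  have mr : `|y - F 0| <= m * r by rewrite mulrDr mulr1 mulrC divfK ?gt_eqF// lerDl ltW.
  have h1 : m * r <= F r - F 0 by have := incr 0 r r0; rewrite subr0.
  have h2 : m * r <= F 0 - F (- r).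
    by have := incr (- r) 0; rewrite oppr_le0 r0 sub0r opprK => /(_ isT).
  have /andP[h3 h4] : - (m * r) <= y - F 0 <= m * r by rewrite -ler_norml.
  have rr : - r <= r by rewrite (le_trans _ r0)// oppr_le0.
  have [|c _ <-] := @IVT R F (- r) r y rr (continuous_subspaceT cF); last by exists c.
  by rewrite ge_min le_max; apply/andP; split; apply/orP; [left|right]; lra.
have [G GF] := choice surj.
exists G => // x; apply/eqP; rewrite eq_le; apply/andP; split; rewrite leNgt; apply/negP => h;
  have := incr _ _ (ltW h); rewrite GF subrr leNgt mulr_gt0// subr_gt0//.
Qed.

Lemma primitive_bijective (f F : R -> R) (m : R) : 0 < m -> (forall x, m <= f x) ->
  (forall x : R, is_derive x 1 F (f x)) ->
  exists2 G : R -> R, cancel G F & cancel F G.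
Proof.
move=> m0 fm Fd; apply: (steep_bijective m0); first exact: (is_derive1_continuous Fd).
by move=> x y xy; have [c _ ->] := mean_value x y Fd; rewrite ler_wpM2r ?subr_ge0.
Qed.

Lemma derive1n_rescaled (f : R -> R) (k j i : nat) (x0 c x : R) : Ck k f -> (j < k)%N ->
  is_derive x 1 (fun x => derive1n j f (x0 + x * c) * c ^+ i)
    (derive1n j.+1 f (x0 + x * c) * c ^+ i.+1).
Proof.
move=> [df _] jk.
have h (u : R) : is_derive u 1 (derive1n j f) (derive1n j.+1 f u).
  by apply: (DeriveDef (df j u jk)); rewrite derive1nS derive1E.
by derive_to; rewrite /= ?exprS; ring.
Qed.

(** The rescaled coefficients satisfy the bounds of the original ones, because
    the scaling factor is at most one. *)
Lemma exists_diffusion_model (Theta : set R) (K alpha : R) a b n (x0 theta : R) :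
  assumption_R Theta K alpha a b -> Theta theta -> (1 <= n)%N ->
  exists M : diffusion_model K alpha,
    vol M = rescaled_diffusion a n x0 theta /\ drift M = rescaled_drift b n x0.
Proof.
move=> [_ [_ [_ [_ [Ca _ Cb] [Ba _ Bb] [al0 age]]]]] th n1.
pose c := (Num.sqrt n%:R : R)^-1.
have sn1 : 1 <= Num.sqrt n%:R :> R by rewrite -[leLHS]sqrtr1 ler_sqrt ?ltr0n ?ler1n.
have c0 : 0 <= c by rewrite invr_ge0.
have c1 : c <= 1 by rewrite invf_le1// (lt_le_trans ltr01).
have K0 : 0 <= K by apply: le_trans (Ba _ th 0 0 _).
have ci i : 0 <= c ^+ i <= 1 by rewrite exprn_ge0 ?exprn_ile1.
have bd (y : R) i : `|y| <= K -> `|y * c ^+ i| <= K.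
  move=> yK; have /andP[h1 h2] := ci i.
  by rewrite normrM (ger0_norm h1) -[K]mulr1 ler_pM.
pose s j x := derive1n j (a^~ theta) (x0 + x * c) * c ^+ j.
pose r j x := derive1n j b (x0 + x * c) * c ^+ j.+1.
have sd j (x : R) : (j < 3)%N -> is_derive x 1 (s j) (s j.+1 x).
  by move=> j3; exact: (derive1n_rescaled _ _ _ _ (Ca _ th)).
have rd j (x : R) : (j < 3)%N -> is_derive x 1 (r j) (r j.+1 x).
  by move=> j3; exact: (derive1n_rescaled _ _ _ _ Cb).
have sb j x : (j <= 3)%N -> `|s j x| <= K by move=> j3; exact/bd/(Ba _ th).
have rb j x : (j <= 3)%N -> `|r j x| <= K by move=> j3; exact/bd/Bb.
have sE : s 0 = rescaled_diffusion a n x0 theta.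
  by apply/funext => x; rewrite /s expr0 mulr1.
have rE : r 0 = rescaled_drift b n x0 by apply/funext.
have salpha x : alpha < s 0 x by rewrite sE; exact: age.
have sgt0 x : 0 < s 0 x := lt_trans al0 (salpha x).
have cs j : (j < 3)%N -> continuous (s j).
  by move=> j3; apply: (is_derive1_continuous (df := s j.+1)) => x; exact: sd.
have cr j : (j < 3)%N -> continuous (r j).
  by move=> j3; apply: (is_derive1_continuous (df := r j.+1)) => x; exact: rd.
have csV : continuous (fun x => (s 0 x)^-1).
  by move=> x; apply: cvgV; [rewrite gt_eqF|exact: cs].
have [F Fd F0] := exists_primitive csV.
have [G GF FG] : exists2 G : R -> R, cancel G F & cancel F G.
  apply: (primitive_bijective (m := K^-1)) Fd.
    by rewrite invr_gt0 (lt_le_trans (sgt0 0))// (le_trans (ler_norm _) (sb 0 0 _)).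
  move=> x; rewrite lef_pV2 ?posrE//; last first.
    by rewrite (lt_le_trans (sgt0 0))// (le_trans (ler_norm _) (sb 0 0 _)).
  by rewrite (le_trans (ler_norm _) (sb 0 x _)).
have cl : continuous (fun x => r 0 x / s 0 x ^+ 2 - s 1 x / (2 * s 0 x)).
  move=> x; apply: cvgB; apply: cvgM; [exact: cr| |exact: cs|].
    by apply: cvgV; [rewrite expf_neq0// gt_eqF|apply: cvgM; exact: cs].
  apply: cvgV; first by rewrite mulf_neq0 ?pnatr_eq0// gt_eqF.
  by apply: cvgM; [exact: cvg_cst|exact: cs].
have [H Hd _] := exists_primitive cl.
exists (@DiffusionModel R K alpha (s 0) (s 1) (s 2) (s 3) (r 0) (r 1) (r 2)
  F G H al0 salpha (fun x => sd 0 x isT) (fun x => sd 1 x isT) (fun x => sd 2 x isT)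
  (fun x => rd 0 x isT) (fun x => rd 1 x isT) (fun x => sb 0 x isT) (fun x => sb 1 x isT)
  (fun x => sb 2 x isT) (fun x => sb 3 x isT) (fun x => rb 0 x isT) (fun x => rb 1 x isT)
  (fun x => rb 2 x isT) Fd F0 GF FG Hd).
by split.
Qed.

End model_existence.

(** * Integrals over a probability space *)

Section square_integrable.
Context d (T : measurableType d) (R : realType) (P : probability T R).
Implicit Types f g h : T -> R.

Local Notation "'integ' f" := (P.-integrable [set: T] (fun w => (f w)%:E))
  (at level 10, f at next level).

Lemma integrableD_EFin f g : integ f -> integ g -> integ (fun w => f w + g w).
Proof. by move=> hf hg; exact: (integrableD measurableT hf hg). Qed.

Lemma eq_integ f g : f =1 g -> integ g -> integ f.
Proof. by move=> /funext ->. Qed.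

Lemma Rintegral0 : \int[P]_w (0 : R) = 0.
Proof. by rewrite /Rintegral integral0. Qed.

Lemma Rintegral_cst1 (c : R) : \int[P]_w c = c.
Proof.
transitivity (c * fine (P [set: T])); first exact: Rintegral_cst.
by rewrite probability_setT mulr1.
Qed.

Lemma integrableN_EFin f : integ f -> integ (fun w => - f w).
Proof. by move=> hf; exact: (integrableN hf). Qed.

Lemma integrableB_EFin f g : integ f -> integ g -> integ (fun w => f w - g w).
Proof. by move=> hf hg; apply: integrableD_EFin => //; exact: integrableN_EFin. Qed.

Lemma integrableZ_EFin c f : integ f -> integ (fun w => c * f w).
Proof. by move=> hf; exact: (integrableZl measurableT c hf). Qed.

Lemma integrable_measurable f : integ f -> measurable_fun [set: T] f.
Proof. by move=> /measurable_int /measurable_EFinP. Qed.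

Lemma integrable_dominated f g : measurable_fun [set: T] f -> integ g ->
  (forall w, `|f w| <= g w) -> integ f.
Proof.
move=> mf ig fg; apply: (le_integrable measurableT _ _ ig) => /=.
  exact/measurable_EFinP.
move=> w _; rewrite lee_fin (le_trans (fg w))//; exact: ler_norm.
Qed.

Lemma integrable_bounded f M : measurable_fun [set: T] f ->
  (forall w, `|f w| <= M) -> integ f.
Proof.
move=> mf fM; apply: (integrable_dominated mf (g := fun=> M)) => //.
exact: finite_measure_integrable_cst.
Qed.

Lemma integrable_sum_EFin (I : Type) (r : seq I) (F : I -> T -> R) :
  (forall i, integ (F i)) -> integ (fun w => \sum_(i <- r) F i w).
Proof.
move=> iF; elim: r => [|a r ih].
  under eq_fun do rewrite big_nil.
  by apply: (integrable_bounded (M := 0)) => // w; rewrite normr0.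
under eq_fun do rewrite big_cons.
exact: integrableD_EFin.
Qed.

Lemma Rintegral_sum (I : Type) (r : seq I) (F : I -> T -> R) :
  (forall i, integ (F i)) ->
  \int[P]_w (\sum_(i <- r) F i w) = \sum_(i <- r) \int[P]_w F i w.
Proof.
move=> iF; elim: r => [|a r ih].
  by under eq_Rintegral do rewrite big_nil; rewrite big_nil Rintegral0.
under eq_Rintegral do rewrite big_cons.
rewrite RintegralD//; [|exact: iF|exact: integrable_sum_EFin].
by rewrite ih big_cons.
Qed.

Lemma integral_EFin_Rintegral f : integ f ->
  (\int[P]_w (f w)%:E)%E = (\int[P]_w f w)%:E.
Proof. by move=> hf; rewrite fineK//; exact: integrable_fin_num. Qed.

Lemma ae_eq_Rintegral f g : measurable_fun [set: T] f -> measurable_fun [set: T] g ->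
  {ae P, forall w, f w = g w} -> \int[P]_w f w = \int[P]_w g w.
Proof.
move=> mf mg fg; congr fine; apply: ae_eq_integral => //; [exact/measurable_EFinP..|].
by apply: filterS fg => w fgw _; rewrite fgw.
Qed.

Lemma ae_integrable f g : measurable_fun [set: T] f ->
  {ae P, forall w, f w = g w} -> integ g -> integ f.
Proof.
move=> mf fg ig; have mg := integrable_measurable ig.
apply/integrableP; split; first exact/measurable_EFinP.
rewrite (ae_eq_integral (abse \o (EFin \o g)))//.
- by have /integrableP[] := ig.
- by apply: measurableT_comp => //; exact/measurable_EFinP.
- by apply: measurableT_comp => //; exact/measurable_EFinP.
- by apply: filterS fg => w fgw _; rewrite /= fgw.
Qed.

Lemma ae_le_Rintegral f g : integ f -> integ g ->
  {ae P, forall w, f w <= g w} -> \int[P]_w f w <= \int[P]_w g w.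
Proof.
move=> hf hg fg.
have mf := integrable_measurable hf; have mg := integrable_measurable hg.
rewrite (@ae_eq_Rintegral f (fun w => Num.min (f w) (g w)))//; last 2 first.
- exact: measurable_minr.
- by apply: filterS fg => w fgw; rewrite min_l.
apply: le_Rintegral => //; last by move=> w _; rewrite ge_min lexx orbT.
apply: (integrable_dominated (g := fun w => `|f w| + `|g w|)).
- exact: measurable_minr.
- apply: integrableD_EFin; [exact: (integrable_abse hf)|exact: (integrable_abse hg)].
- by move=> w; rewrite /Num.min; case: ifP => _; rewrite ?lerDl ?lerDr.
Qed.

Lemma integrable_ae_dominated f g : measurable_fun [set: T] f -> integ g ->
  {ae P, forall w, `|f w| <= g w} -> integ f.
Proof.
move=> mf ig fg.
apply: (@ae_integrable f (fun w => Num.max (- g w) (Num.min (f w) (g w)))) => //.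
  apply: filterS fg => w; rewrite ler_norml => /andP[h1 h2].
  by rewrite min_l// max_r.
apply: (integrable_dominated (g := fun w => `|g w|)).
- apply: measurable_maxr; [apply: measurableT_comp => //|apply: measurable_minr => //];
    exact: integrable_measurable.
- exact: (integrable_abse ig).
- move=> w; rewrite ler_norml le_max ge_max ge_min lerN2 ler_norm/=.
  by rewrite orbT andbT -normrN ler_norm.
Qed.

Lemma ler_norm_Rintegral f g : measurable_fun [set: T] f -> integ g ->
  {ae P, forall w, `|f w| <= g w} -> `|\int[P]_w f w| <= \int[P]_w g w.
Proof.
move=> mf ig fg; have i_f := integrable_ae_dominated mf ig fg.
apply: le_trans (le_normr_Rintegral measurableT i_f) _.
by apply: ae_le_Rintegral => //; exact: (integrable_abse i_f).
Qed.

Lemma integral_cst1 (c : R) : (\int[P]_w c%:E = c%:E)%E.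
Proof.
by rewrite integral_EFin_Rintegral ?Rintegral_cst1//; apply: (@integrable_bounded (fun=> c) `|c|).
Qed.

Definition sqint f := measurable_fun [set: T] f /\ integ (fun w => f w ^+ 2).

Lemma sqint_mul f g : sqint f -> sqint g -> integ (fun w => f w * g w).
Proof.
move=> [mf f2] [mg g2].
apply: (integrable_dominated (g := fun w => f w ^+ 2 + g w ^+ 2)).
- exact: measurable_funM.
- exact: integrableD_EFin.
move=> w; rewrite ler_norml; apply/andP; split.
  by have := sqr_ge0 (f w + g w); have := sqr_ge0 (f w); have := sqr_ge0 (g w); rewrite sqrrD; nra.
by have := sqr_ge0 (f w - g w); have := sqr_ge0 (f w); have := sqr_ge0 (g w); rewrite sqrrB; nra.
Qed.

Lemma sqint_bounded f M : measurable_fun [set: T] f -> (forall w, `|f w| <= M) -> sqint f.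
Proof.
move=> mf fM; split => //; apply: (integrable_bounded (M := M ^+ 2)).
  exact: measurable_funX.
by move=> w; rewrite normrX lerXn2r ?nnegrE// (le_trans _ (fM w)).
Qed.

Lemma sqint_integrable f : sqint f -> integ f.
Proof.
move=> hf; have := sqint_mul hf (@sqint_bounded (fun=> 1) 1 _ _).
rewrite normr1 lexx => /(_ (measurable_cst _) (fun=> isT)).
by under eq_fun do rewrite mulr1.
Qed.

Lemma sqintD f g : sqint f -> sqint g -> sqint (fun w => f w + g w).
Proof.
move=> hf hg; split; first by apply: measurable_funD; [exact: hf.1|exact: hg.1].
have -> : (fun w => ((f w + g w) ^+ 2)%:E) = (fun w => ((f w ^+ 2 + (2 * (f w * g w))) + g w ^+ 2)%:E).
  by apply/funext => w; congr EFin; ring.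
apply: integrableD_EFin; last exact: hg.2.
by apply: integrableD_EFin; [exact: hf.2|apply: integrableZ_EFin; exact: sqint_mul].
Qed.

Lemma sqint_mulb f h M : sqint f -> measurable_fun [set: T] h -> (forall w, `|h w| <= M) ->
  sqint (fun w => h w * f w).
Proof.
move=> [mf f2] mh hM; split; first exact: measurable_funM.
apply: (integrable_dominated (g := fun w => M ^+ 2 * f w ^+ 2)).
- by apply: measurable_funX; exact: measurable_funM.
- exact: integrableZ_EFin.
move=> w; rewrite exprMn normrM [`|f w ^+ 2|]ger0_norm ?sqr_ge0// ler_wpM2r ?sqr_ge0//.
by rewrite normrX lerXn2r ?nnegrE// (le_trans _ (hM w)).
Qed.

Lemma sqint_sum (I : Type) (r : seq I) (F : I -> T -> R) :
  (forall i, sqint (F i)) -> sqint (fun w => \sum_(i <- r) F i w).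
Proof.
move=> iF; elim: r => [|a r ih].
  under eq_fun do rewrite big_nil.
  by apply: (@sqint_bounded (fun=> 0) 0) => // w; rewrite normr0.
under eq_fun do rewrite big_cons.
exact: sqintD.
Qed.

End square_integrable.

(** * Brownian increments and stochastic integrals *)

Section brownian_increments.
Context {R : realType} d (T : measurableType d) (P : probability T R).
Variables (F : R -> set (set T)) (W : R -> T -> R).
Hypothesis (filt : filtration F) (bm : brownian_motion P F W).
Notation leb := (@lebesgue_measure R).

Local Notation "'integ' f" := (P.-integrable [set: T] (fun w => (f w)%:E))
  (at level 10, f at next level).

(** The measurable space carried by the information available at time [t]. *)
Definition past t := g_sigma_algebraType (F t).

Lemma past_measurableE t (A : set T) : 0 <= t ->
  measurable (A : set (past t)) = F t A.
Proof.
by move=> t0; rewrite /measurable/= sigma_algebra_id//; have [] := filt; move=> + _ _; exact.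
Qed.

Lemma past_measurable t (A : set T) : 0 <= t -> F t A -> measurable A.
Proof. by move=> t0; have [_ h _] := filt; exact: (h t t0). Qed.

Definition knows t d' (S : measurableType d') (X : T -> S) :=
  measurable_fun [set: past t] (X : past t -> S).

Lemma measurable_wrtP t (X : T -> R) : 0 <= t ->
  measurable_wrt (F t) X <-> knows t X.
Proof.
move=> t0; split => h.
  by move=> _ B mB; rewrite setTI past_measurableE//; exact: h.
by move=> B mB; rewrite -past_measurableE// -[X in measurable X]setTI; exact: h.
Qed.

Lemma knows_measurable t d' (S : measurableType d') (X : T -> S) : 0 <= t ->
  knows t X -> measurable_fun [set: T] X.
Proof.
move=> t0 h _ B mB; rewrite setTI; apply: (past_measurable t0).
by rewrite -past_measurableE// -[X in measurable X]setTI; exact: h.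
Qed.

Lemma knows_mono s t d' (S : measurableType d') (X : T -> S) : 0 <= s -> s <= t ->
  knows s X -> knows t X.
Proof.
move=> s0 st h _ B mB; rewrite setTI past_measurableE ?(le_trans s0)//.
have [_ _ m] := filt; apply: (m s t) => //.
by rewrite -past_measurableE// -[X in measurable X]setTI; exact: h.
Qed.

Lemma knows_comp t d1 d2 (S1 : measurableType d1) (S2 : measurableType d2)
  (f : S1 -> S2) (X : T -> S1) : measurable_fun [set: S1] f -> knows t X ->
  knows t (fun w => f (X w)).
Proof. by move=> mf mX; exact: (measurableT_comp mf mX). Qed.

Lemma knows_pair t d1 d2 (S1 : measurableType d1) (S2 : measurableType d2)
  (X : T -> S1) (Y : T -> S2) : knows t X -> knows t Y -> knows t (fun w => (X w, Y w)).
Proof. by move=> mX mY; exact: measurable_fun_pair. Qed.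

Lemma knows_mul t (X Y : T -> R) : knows t X -> knows t Y -> knows t (fun w => X w * Y w).
Proof. by move=> mX mY; exact: measurable_funM. Qed.

Lemma knows_add t (X Y : T -> R) : knows t X -> knows t Y -> knows t (fun w => X w + Y w).
Proof. by move=> mX mY; exact: measurable_funD. Qed.

Lemma knows_sub t (X Y : T -> R) : knows t X -> knows t Y -> knows t (fun w => X w - Y w).
Proof. by move=> mX mY; exact: measurable_funB. Qed.

Lemma knows_cst t d' (S : measurableType d') (c : S) : knows t (fun=> c).
Proof. exact: measurable_cst. Qed.

Lemma knows_bm s t : 0 <= s -> s <= t -> knows t (W s).
Proof.
move=> s0 st; apply: (knows_mono s0 st); apply/measurable_wrtP => //.
by have [h _ _ _ _] := bm; exact: h.
Qed.

Lemma knows_increment r s t : 0 <= r -> r <= s -> s <= t ->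
  knows t (fun w => W s w - W r w).
Proof.
move=> r0 rs st; apply: knows_sub; apply: knows_bm => //.
- exact: le_trans rs.
- exact: le_trans st.
Qed.

Lemma measurable_bm t : 0 <= t -> measurable_fun [set: T] (W t).
Proof. by move=> t0; apply: (knows_measurable t0); exact: knows_bm. Qed.

Lemma measurable_increment s t : 0 <= s -> 0 <= t ->
  measurable_fun [set: T] (fun w => W t w - W s w).
Proof. by move=> s0 t0; apply: measurable_funB; exact: measurable_bm. Qed.

(** An increment is Gaussian and independent of the past: expectations of
    functions of both are computed by integrating the increment out. *)
Lemma ge0_expectation_increment s t d' (S : measurableType d') (X : T -> S)
    (G : S * R -> \bar R) : 0 <= s -> s < t -> knows s X ->
  measurable_fun [set: S * R] G -> (forall z, (0 <= G z)%E) ->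
  (\int[P]_w G (X w, (W t w - W s w)%R) =
   \int[P]_w \int[leb]_x (G (X w, x) * (gk (t - s) x)%:E))%E.
Proof.
move=> s0 st kX mG G0; have ts0 : 0 < t - s by rewrite subr_gt0.
have mX := knows_measurable s0 kX.
have mD := measurable_increment s0 (le_trans s0 (ltW st)).
pose X' : {mfun T >-> S} := HB.pack X (isMeasurableFun.Build _ _ _ _ X mX).
pose D w : R := W t w - W s w.
have mXD : measurable_fun [set: T] (fun w => (X w, D w)) by exact: measurable_fun_pair.
pose XD : {mfun T >-> (S * R)%type} :=
  HB.pack (fun w => (X w, D w)) (isMeasurableFun.Build _ _ _ _ (fun w => (X w, D w)) mXD).
pose m1 := distribution P X'.
have mid : measurable_fun [set: measurableTypeR R] (idfun : measurableTypeR R -> R).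
  by move=> _ B mB; rewrite setTI.
pose I : {mfun measurableTypeR R >-> R} := HB.pack (idfun : measurableTypeR R -> R)
  (isMeasurableFun.Build _ _ (measurableTypeR R) R _ mid).
pose m2 := distribution (normal_prob 0 (Num.sqrt (t - s))) I.
have E := @product_measure_unique _ _ _ _ _ m1 m2 (distribution P XD).
have {}E : forall A, measurable A -> (m1 \x m2)%E A = distribution P XD A.
  apply: E => A B mA mB; rewrite /m1 /distribution /pushforward/=.
  have [_ _ _ law ind] := bm.
  transitivity (P ((X @^-1` A) `&` increment_in W s t B)); first by congr (P _).
  rewrite ind//; first by rewrite law//.
  by rewrite -past_measurableE// -[X in measurable X]setTI; exact: kX.
transitivity (\int[distribution P XD]_z G z)%E.
  by rewrite ge0_integral_distribution.
transitivity (\int[m1 \x m2]_z G z)%E.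
  by apply/esym/eq_measure_integral => A mA _; exact: E.
rewrite fubini_tonelli1//.
rewrite [LHS]ge0_integral_distribution//; last 2 first.
- exact: measurable_fun_fubini_tonelli_F.
- by move=> y; exact: integral_ge0.
apply: eq_integral => w _ /=; rewrite /fubini_F/= /m2.
have mGX : measurable_fun [set: R] (fun x => G (X w, x)) by exact: (measurable_fun_pair2 _ mG).
rewrite ge0_integral_distribution//.
exact: (ge0_integral_normal ts0 mGX (fun x => G0 _)).
Qed.

(** The special case of a product of a known factor and a function of the
    increment. *)
Lemma ge0_indep_increment s t (Z : T -> R) (h : R -> R) : 0 <= s -> s < t -> knows s Z ->
  measurable_fun [set: R] h -> (forall w, 0 <= Z w) -> (forall x, 0 <= h x) ->
  (\int[P]_w (Z w * h (W t w - W s w))%:E =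
   \int[P]_w (Z w)%:E * \int[leb]_x (h x * gk (t - s) x)%:E)%E.
Proof.
move=> s0 st kZ mh Z0 h0; have ts0 : 0 < t - s by rewrite subr_gt0.
have mhg : measurable_fun [set: R] (fun x => (h x * gk (t - s) x)%:E).
  by apply/measurable_EFinP/measurable_funM => //; exact: measurable_gk.
transitivity (\int[P]_w (`|Z w| * h (W t w - W s w))%:E)%E.
  by apply: eq_integral => w _; rewrite ger0_norm.
have mG : measurable_fun [set: R * R] (fun z : R * R => (`|z.1| * h z.2)%:E).
  apply/measurable_EFinP/measurable_funM.
    by apply: measurableT_comp => //; exact: measurable_fst.
  by apply: (measurableT_comp mh); exact: measurable_snd.
have G0 (z : R * R) : (0 <= (`|z.1| * h z.2)%:E)%E by rewrite lee_fin mulr_ge0.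
rewrite (ge0_expectation_increment s0 st kZ mG G0)/=.
transitivity (\int[P]_w ((Z w)%:E * \int[leb]_x (h x * gk (t - s) x)%:E))%E.
  apply: eq_integral => w _; rewrite -ge0_integralZl//.
  - apply: eq_integral => x _; rewrite ger0_norm// -!EFinM; congr EFin; ring.
  - by move=> x _; rewrite lee_fin mulr_ge0// gk_ge0.
  - by rewrite lee_fin.
rewrite ge0_integralZr//.
- by apply/measurable_EFinP; exact: (knows_measurable s0 kZ).
- by move=> w _; rewrite lee_fin.
- by apply: integral_ge0 => x _; rewrite lee_fin mulr_ge0// gk_ge0.
Qed.

Lemma indep_increment_ge0 s t (Z : T -> R) (h : R -> R) c : 0 <= s -> s < t -> knows s Z ->
  integ Z -> measurable_fun [set: R] h -> (forall x, 0 <= h x) ->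
  (\int[leb]_x (h x * gk (t - s) x)%:E = c%:E)%E ->
  integ (fun w => Z w * h (W t w - W s w)) /\
  \int[P]_w (Z w * h (W t w - W s w)) = \int[P]_w Z w * c.
Proof.
move=> s0 st kZ iZ mh h0 hc.
have mZ := knows_measurable s0 kZ.
have t0 : 0 <= t := le_trans s0 (ltW st).
have mD : measurable_fun [set: T] (fun w => h (W t w - W s w)).
  by apply: (measurableT_comp mh); exact: measurable_increment.
have kabs (Y : T -> R) : knows s Y -> knows s (fun w => `|Y w|).
  by move=> kY; apply: (knows_comp (f := fun x : R => `|x|)).
have key (Y : T -> R) : knows s Y -> integ Y -> (forall w, 0 <= Y w) ->
    integ (fun w => Y w * h (W t w - W s w)) /\
    \int[P]_w (Y w * h (W t w - W s w)) = \int[P]_w Y w * c.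
  move=> kY iY Y0.
  have E := ge0_indep_increment s0 st kY mh Y0 h0.
  rewrite hc (integral_EFin_Rintegral iY) -EFinM in E.
  have i1 : integ (fun w => Y w * h (W t w - W s w)).
    apply/integrableP; split.
      by apply/measurable_EFinP; apply: measurable_funM => //; exact: (knows_measurable s0).
    under eq_integral do rewrite gee0_abs ?lee_fin ?mulr_ge0//.
    by rewrite E ltry.
  split => //; apply: EFin_inj; rewrite -E.
  by rewrite (integral_EFin_Rintegral i1).
have iA : integ (fun w => `|Z w|) by exact: (integrable_abse iZ).
have [i1 e1] := key _ (kabs _ kZ) iA (fun w => normr_ge0 _).
have [||w|i2 e2] := key (fun w => `|Z w| + Z w).
- by apply: knows_add => //; exact: kabs.
- exact: integrableD_EFin.
- by rewrite -lerBlDr sub0r -normrN ler_norm.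
have E w : Z w * h (W t w - W s w) =
    (`|Z w| + Z w) * h (W t w - W s w) - `|Z w| * h (W t w - W s w) by ring.
split; first by apply: (eq_integ E); exact: integrableB_EFin.
under eq_Rintegral do rewrite E.
rewrite RintegralB// e1 e2 (_ : \int[P]_w (`|Z w| + Z w) = \int[P]_w `|Z w| + \int[P]_w Z w); first by ring.
exact: RintegralD.
Qed.

Lemma increment_mean0 s t (Z : T -> R) : 0 <= s -> s < t -> knows s Z -> integ Z ->
  integ (fun w => Z w * (W t w - W s w)) /\ \int[P]_w (Z w * (W t w - W s w)) = 0.
Proof.
move=> s0 st kZ iZ; have ts0 : 0 < t - s by rewrite subr_gt0.
have i1 := integrable_expr_gk 0 ts0; have i2 := integrable_exprnorm_gk 0 ts0.
have e1 : (\int[leb]_x (x * gk (t - s) x)%:E = 0%:E)%E.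
  rewrite -(integral_gk_linear ts0) /Rintegral fineK//.
  exact: (integrable_fin_num _ i1).
pose c := \int[leb]_x (`|x| * gk (t - s) x).
have e2 : (\int[leb]_x (`|x| * gk (t - s) x)%:E = c%:E)%E.
  rewrite /c /Rintegral fineK//.
  exact: (integrable_fin_num _ i2).
have [//|//|i3 e3] := @indep_increment_ge0 s t Z (fun x => `|x|) c s0 st kZ iZ _ _ e2.
have [| |//|i4 e4] := @indep_increment_ge0 s t Z (fun x => `|x| + x) c s0 st kZ iZ.
- exact: measurable_funD.
- by move=> x; rewrite -lerBlDr sub0r -normrN ler_norm.
- transitivity (\int[leb]_x ((`|x| * gk (t - s) x)%:E + (x * gk (t - s) x)%:E))%E.
    by apply: eq_integral => x _; rewrite mulrDl.
  rewrite (integralD measurableT i2 i1).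
  by rewrite [X in (_ + X)%E]e1 [X in (X + _)%E]e2 adde0.
have E w : Z w * (W t w - W s w) =
    Z w * (`|W t w - W s w| + (W t w - W s w)) - Z w * `|W t w - W s w| by ring.
split; first by apply: (eq_integ E); exact: integrableB_EFin.
under eq_Rintegral do rewrite E.
by rewrite RintegralB// e3 e4 subrr.
Qed.

Lemma increment_variance s t (Z : T -> R) : 0 <= s -> s < t -> knows s Z -> integ Z ->
  integ (fun w => Z w * (W t w - W s w) ^+ 2) /\
  \int[P]_w (Z w * (W t w - W s w) ^+ 2) = \int[P]_w Z w * (t - s).
Proof.
move=> s0 st kZ iZ; have ts0 : 0 < t - s by rewrite subr_gt0.
apply: (@indep_increment_ge0 s t Z (fun x => x ^+ 2)) => //.
- by move=> x; exact: sqr_ge0.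
rewrite -[in RHS](integral_gk_square ts0) /Rintegral fineK//.
exact: (integrable_fin_num _ (integrable_expr_gk 1 ts0)).
Qed.

Lemma sqint_increment s t : 0 <= s -> s <= t -> sqint P (fun w => W t w - W s w).
Proof.
move=> s0; rewrite le_eqVlt => /predU1P[->|st].
  by under eq_fun do rewrite subrr; apply: (@sqint_bounded _ _ _ P (fun=> 0) 0) => // w; rewrite normr0.
split; first by apply: measurable_increment => //; rewrite (le_trans s0)// ltW.
have [||] := @increment_variance s t (fun=> 1) s0 st; first exact: knows_cst.
  by apply: (@integrable_bounded _ _ _ P (fun=> 1) 1) => // w; rewrite normr1.
by under eq_fun do rewrite mul1r.
Qed.

Lemma increment_mean0_le s t (Z : T -> R) : 0 <= s -> s <= t -> knows s Z -> integ Z ->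
  \int[P]_w (Z w * (W t w - W s w)) = 0.
Proof.
move=> s0; rewrite le_eqVlt => /predU1P[->|st] kZ iZ; last by have [] := increment_mean0 s0 st kZ iZ.
by under eq_Rintegral do rewrite subrr mulr0; exact: Rintegral0.
Qed.

Lemma increment_variance_le s t (Z : T -> R) : 0 <= s -> s <= t -> knows s Z -> integ Z ->
  \int[P]_w (Z w * (W t w - W s w) ^+ 2) = \int[P]_w Z w * (t - s).
Proof.
move=> s0; rewrite le_eqVlt => /predU1P[->|st] kZ iZ; last by have [] := increment_variance s0 st kZ iZ.
by under eq_Rintegral do rewrite subrr expr0n mulr0; rewrite Rintegral0 subrr mulr0.
Qed.

Definition overlap (a b c d : R) := Num.max 0 (Num.min b d - Num.max a c).

(** Covariation of two elementary integrals: cutting the increments at all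
    endpoints leaves, in expectation, the square of the common increment. *)
Lemma increment_covariation a b c e (Y Z : T -> R) (MY MZ : R) :
  0 <= a -> a <= b -> 0 <= c -> c <= e -> knows a Y -> knows c Z ->
  (forall w, `|Y w| <= MY) -> (forall w, `|Z w| <= MZ) ->
  \int[P]_w ((Y w * (W b w - W a w)) * (Z w * (W e w - W c w))) =
  \int[P]_w (Y w * Z w) * overlap a b c e.
Proof.
wlog ac : a b c e Y Z MY MZ / a <= c.
  move=> h; have [ac|/ltW ca] := leP a c; first exact: (h a b c e Y Z MY MZ).
  move=> a0 ab c0 ce kY kZ bY bZ; have := h c e a b Z Y MZ MY ca c0 ce a0 ab kZ kY bZ bY.
  under eq_Rintegral do rewrite mulrC; move=> ->.
  by rewrite /overlap (minC e) (maxC c); under eq_Rintegral do rewrite mulrC.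
move=> a0 ab c0 ce kY kZ bY bZ.
have kYc : knows c Y := knows_mono a0 ac kY.
have mY := knows_measurable a0 kY; have mZ := knows_measurable c0 kZ.
have mYZ : measurable_fun [set: T] (fun w => Y w * Z w) by exact: measurable_funM.
have bYZ w : `|Y w * Z w| <= MY * MZ by rewrite normrM ler_pM.
have iYZ : integ (fun w => Y w * Z w) := integrable_bounded P mYZ bYZ.
have kYZ : knows c (fun w => Y w * Z w) by exact: knows_mul.
have [bc|/ltW cb] := leP b c.
  rewrite /overlap max_l; last by rewrite subr_le0 le_max !ge_min bc !orbT.
  rewrite mulr0; transitivity (\int[P]_w ((Y w * Z w) * (W b w - W a w) * (W e w - W c w))).
    by apply: eq_Rintegral => w _; ring.
  apply: increment_mean0_le => //.
    by apply: knows_mul => //; exact: knows_increment.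
  apply: sqint_integrable; apply: sqint_mulb bYZ => //; exact: sqint_increment.
have be : overlap a b c e = Num.min b e - c.
  by rewrite /overlap (max_r ac) max_r// subr_ge0 le_min cb ce.
set m := Num.min b e in be *; pose m' := Num.max b e.
have cm : c <= m by rewrite /m le_min cb ce.
have mm' : m <= m' by rewrite /m /m' le_max ge_min lexx.
have m0 : 0 <= m := le_trans c0 cm.
have cm' := le_trans cm mm'.
have q1 : sqint P (fun w => (Y w * Z w) * (W c w - W a w)).
  by apply: sqint_mulb bYZ => //; exact: sqint_increment.
have q2 : sqint P (fun w => (Y w * Z w) * (W m w - W c w)).
  by apply: sqint_mulb bYZ => //; exact: sqint_increment.
transitivity (\int[P]_w ((Y w * Z w) * (W c w - W a w) * (W e w - W c w) +
   ((Y w * Z w) * (W m w - W c w) * (W m' w - W m w) + (Y w * Z w) * (W m w - W c w) ^+ 2))).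
  apply: eq_Rintegral => w _; rewrite /m /m'.
  by case: (leP b e) => _; ring.
have i1 : integ (fun w => (Y w * Z w) * (W c w - W a w) * (W e w - W c w)).
  by apply: sqint_mul => //; exact: sqint_increment.
have i2 : integ (fun w => (Y w * Z w) * (W m w - W c w) * (W m' w - W m w)).
  by apply: sqint_mul => //; exact: sqint_increment.
have i3 : integ (fun w => (Y w * Z w) * (W m w - W c w) ^+ 2).
  have -> : (fun w => ((Y w * Z w) * (W m w - W c w) ^+ 2)%:E) =
    (fun w => ((Y w * Z w) * (W m w - W c w) * (W m w - W c w))%:E).
    by apply/funext => w; congr EFin; ring.
  by apply: sqint_mul => //; exact: sqint_increment.
rewrite RintegralD//; last exact: integrableD_EFin.
rewrite RintegralD// increment_variance_le// be.
rewrite increment_mean0_le ?increment_mean0_le ?add0r//.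
- by apply: knows_mul; [exact: knows_mono kYZ|exact: knows_increment].
- exact: sqint_integrable.
- by apply: knows_mul => //; exact: knows_increment.
- exact: sqint_integrable.
Qed.

(** The integrand [v * 1_(]l, r])] with [v] known at time [l]. *)
Record block := Block { bstart : R ; bstop : R ; bval : T -> R ;
  bstart_ge0 : 0 <= bstart ; bstart_le : bstart <= bstop ; bval_knows : knows bstart bval ;
  bval_bounded : exists M, forall w, `|bval w| <= M }.

Arguments bval_knows : clear implicits.

Lemma measurable_bval p : measurable_fun [set: T] (bval p).
Proof. exact: knows_measurable (bstart_ge0 p) (bval_knows p). Qed.

Lemma sqint_bval p : sqint P (bval p).
Proof. by have [M bM] := bval_bounded p; apply: sqint_bounded bM; exact: measurable_bval. Qed.

Definition ito (l : seq block) w := \sum_(p <- l) bval p w * (W (bstop p) w - W (bstart p) w).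

Definition stp (l : seq block) s w := \sum_(p <- l) bval p w * \1_(`]bstart p, bstop p]) s.

Lemma sqint_block p : sqint P (fun w => bval p w * (W (bstop p) w - W (bstart p) w)).
Proof.
have [M bM] := bval_bounded p; apply: sqint_mulb bM; last exact: measurable_bval.
exact: sqint_increment (bstart_ge0 p) (bstart_le p).
Qed.

Lemma sqint_ito l : sqint P (ito l).
Proof. by apply: sqint_sum => p; exact: sqint_block. Qed.

(** The square is expanded into covariations of pairs of blocks. *)
Lemma ito_sqr l : \int[P]_w (ito l w ^+ 2) =
  \sum_(p <- l) \sum_(q <- l) \int[P]_w (bval p w * bval q w) * overlap (bstart p) (bstop p) (bstart q) (bstop q).
Proof.
under eq_Rintegral do rewrite expr2 big_distrlr/=.
rewrite Rintegral_sum; last first.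
  by move=> p; apply: integrable_sum_EFin => q; exact: sqint_mul (sqint_block p) (sqint_block q).
apply: eq_bigr => p _; rewrite Rintegral_sum; last first.
  by move=> q; exact: sqint_mul (sqint_block p) (sqint_block q).
apply: eq_bigr => q _.
have [M bM] := bval_bounded p; have [M' bM'] := bval_bounded q.
exact: (increment_covariation (bstart_ge0 p) (bstart_le p) (bstart_ge0 q) (bstart_le q) (bval_knows p) (bval_knows q) bM bM').
Qed.

Lemma integral_overlap (a b c e : R) :
  leb.-integrable [set: R] (fun s => ((\1_(`]a, b]) s : R) * \1_(`]c, e]) s)%:E) /\
  (\int[leb]_s ((\1_(`]a, b]) s : R) * \1_(`]c, e]) s)%:E = (overlap a b c e)%:E)%E.
Proof.
have E : (fun s : R => ((\1_(`]a, b]) s : R) * \1_(`]c, e]) s)%:E) =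
    (fun s : R => (\1_(`]Num.max a c, Num.min b e]) s)%:E).
  apply: boolp.funext => s; congr EFin.
  rewrite [LHS](_ : _ = (\1_(`]a, b]) \* \1_(`]c, e])) s)// -indicI.
  congr (\1_ _ _); apply/seteqP; split => x; rewrite /= !in_itv/= gt_max le_min.
    by move=> [/andP[-> ->] /andP[-> ->]].
  by move=> /andP[/andP[-> ->] /andP[-> ->]].
have I : (\int[leb]_s (\1_(`]Num.max a c, Num.min b e]) s)%:E = (overlap a b c e)%:E)%E.
  rewrite integral_indic// setIT; apply: etrans (@lebesgue_measure_itv R _) _.
  rewrite /= lte_fin /overlap; case: ltP => h.
    by rewrite (@max_r _ _ 0)// subr_ge0 ltW.
  by rewrite (@max_l _ _ 0)// subr_le0.
rewrite E; split => //; apply/integrableP; split.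
  by apply/measurable_EFinP; exact: measurable_indic.
by under eq_integral do rewrite gee0_abs ?lee_fin//; rewrite I ltry.
Qed.

Lemma indic_itv_oc (a b s : R) : \1_(`]a, b]) s = ((a < s) && (s <= b))%:R :> R.
Proof. by rewrite indicE mem_setE in_itv. Qed.

(** The same overlaps arise when the square of the integrand is integrated in
    time, whence the isometry. *)
Lemma stp_sqr l w : (\int[leb]_s ((stp l s w) ^+ 2)%:E =
  (\sum_(p <- l) \sum_(q <- l) bval p w * bval q w * overlap (bstart p) (bstop p) (bstart q) (bstop q))%:E)%E.
Proof.
pose f p q s := (bval p w * bval q w * (\1_(`]bstart p, bstop p]) s * \1_(`]bstart q, bstop q]) s) : R)%:E.
have fi p q : leb.-integrable [set: R] (f p q).
  have [h _] := integral_overlap (bstart p) (bstop p) (bstart q) (bstop q).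
  exact: (integrableZl measurableT _ h).
transitivity (\int[leb]_s (\sum_(p <- l) \sum_(q <- l) f p q s))%E.
  apply: eq_integral => s _; rewrite expr2 big_distrlr/= -sumEFin; apply: eq_bigr => p _.
  by rewrite -sumEFin; apply: eq_bigr => q _; rewrite /f; congr EFin; ring.
apply: etrans.
  apply: (@integral_sum _ _ _ leb _ measurableT _ (fun p s => \sum_(q <- l) f p q s)%E).
  by move=> p; apply: integrable_sum.
rewrite -sumEFin; apply: eq_bigr => p _.
apply: etrans; first exact: (@integral_sum _ _ _ leb _ measurableT _ (f p)).
rewrite -sumEFin; apply: eq_bigr => q _.
have [h h'] := integral_overlap (bstart p) (bstop p) (bstart q) (bstop q).
by rewrite /f [LHS](integralZl measurableT h (bval p w * bval q w)) [X in (_ * X)%E]h'.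
Qed.

Lemma ito_isometry l :
  ((\int[P]_w (ito l w ^+ 2))%:E = \int[P]_w \int[leb]_s ((stp l s w) ^+ 2)%:E)%E.
Proof.
have i1 p q : integ (fun w => bval p w * bval q w * overlap (bstart p) (bstop p) (bstart q) (bstop q)).
  apply: (eq_integ (g := fun w => overlap (bstart p) (bstop p) (bstart q) (bstop q) * (bval p w * bval q w))).
    by move=> w; rewrite mulrC.
  apply: integrableZ_EFin; exact: sqint_mul (sqint_bval p) (sqint_bval q).
under [RHS]eq_integral do rewrite stp_sqr.
rewrite integral_EFin_Rintegral; last first.
  by apply: integrable_sum_EFin => p; exact: integrable_sum_EFin.
congr EFin; rewrite ito_sqr Rintegral_sum; last by move=> p; exact: integrable_sum_EFin.
apply: eq_bigr => p _; rewrite Rintegral_sum//; apply: eq_bigr => q _.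
by rewrite RintegralZr//; exact: sqint_mul (sqint_bval p) (sqint_bval q).
Qed.

(** An elementary integrand stopped at a time [t] is again elementary. *)
Lemma cut_knows t p : knows (Num.min (bstart p) t) (fun w => if bstart p <= t then bval p w else 0).
Proof. by case: leP => _; [exact: bval_knows|exact: knows_cst]. Qed.

Lemma cut_bounded t p : exists M, forall w, `|if bstart p <= t then bval p w else 0| <= M.
Proof.
have [M bM] := bval_bounded p; exists M => w; case: ifP => // _.
by rewrite normr0 (le_trans _ (bM w)).
Qed.

Lemma cut_ge0 t p : 0 <= t -> 0 <= Num.min (bstart p) t.
Proof. by move=> t0; rewrite le_min bstart_ge0. Qed.

Lemma cut_le t p : Num.min (bstart p) t <= Num.min (bstop p) t.
Proof. by rewrite le_min !ge_min bstart_le lexx orbT. Qed.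

Definition cut t (t0 : 0 <= t) p : block :=
  Block (cut_ge0 p t0) (cut_le t p) (@cut_knows t p) (cut_bounded t p).

Lemma stp_cut t (t0 : 0 <= t) l s w :
  stp (map (cut t0) l) s w = if s <= t then stp l s w else 0.
Proof.
rewrite /stp big_map; case: leP => st; last first.
  rewrite big1// => p _; rewrite /cut/= indic_itv_oc.
  by rewrite le_min [s <= t]leNgt st/= !andbF mulr0.
apply: eq_bigr => p _; rewrite /cut/= !indic_itv_oc le_min st andbT.
rewrite gt_min; rewrite [t < s]ltNge st orbF; case: (leP (bstart p) t) => // h.
by rewrite [_ < s]ltNge (le_trans st (ltW h))/= !mulr0.
Qed.

(** What an elementary integral adds after time [t] is orthogonal to the past. *)
Lemma ito_cut_orthogonal t (t0 : 0 <= t) l (xi : T -> R) M : knows t xi ->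
  (forall w, `|xi w| <= M) ->
  \int[P]_w (xi w * ito l w) = \int[P]_w (xi w * ito (map (cut t0) l) w).
Proof.
move=> kxi bxi; have mxi := knows_measurable t0 kxi.
have sxi : sqint P xi := sqint_bounded P mxi bxi.
rewrite /ito; under eq_Rintegral do rewrite big_distrr/=.
under [RHS]eq_Rintegral do rewrite big_distrr/=.
rewrite !Rintegral_sum; last 2 first.
- by move=> p; exact: sqint_mul sxi (sqint_block p).
- by move=> p; exact: sqint_mul sxi (sqint_block p).
rewrite big_map; apply: eq_bigr => p _ /=.
case: (leP (bstart p) t) => [blt|tbl].
  have [M' bM'] := bval_bounded p.
  case: (leP (bstop p) t) => // tbr.
  have i1 : integ (fun w => xi w * bval p w) by exact: sqint_mul sxi (sqint_bval p).
  have i2 : sqint P (fun w => xi w * bval p w * (W (bstop p) w - W t w)).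
    apply: (sqint_mulb (M := M * M')).
    + exact: sqint_increment t0 (ltW tbr).
    + exact: measurable_funM mxi (measurable_bval p).
    + by move=> w; rewrite normrM ler_pM.
  have i3 : sqint P (fun w => xi w * bval p w * (W t w - W (bstart p) w)).
    apply: (sqint_mulb (M := M * M')).
    + exact: sqint_increment (bstart_ge0 p) blt.
    + exact: measurable_funM mxi (measurable_bval p).
    + by move=> w; rewrite normrM ler_pM.
  transitivity (\int[P]_w (xi w * bval p w * (W (bstop p) w - W t w) + xi w * bval p w * (W t w - W (bstart p) w))).
    by apply: eq_Rintegral => w _; ring.
  rewrite RintegralD//; try exact: sqint_integrable.
  rewrite increment_mean0_le ?add0r//; last 2 first.
  - exact: ltW.
  - by apply: knows_mul => //; exact: knows_mono (bstart_ge0 p) blt (bval_knows p).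
  by apply: eq_Rintegral => w _; ring.
under [RHS]eq_Rintegral do rewrite mul0r mulr0.
rewrite Rintegral0.
transitivity (\int[P]_w (xi w * bval p w * (W (bstop p) w - W (bstart p) w))).
  by apply: eq_Rintegral => w _; ring.
apply: increment_mean0_le (bstart_ge0 p) (bstart_le p) _ _.
  by apply: knows_mul (bval_knows p); exact: knows_mono t0 (ltW tbl) kxi.
exact: sqint_mul sxi (sqint_bval p).
Qed.

Lemma integral_sqr_le3 d' (S : measurableType d') (nu : {measure set S -> \bar R})
    (g u1 u2 u3 : S -> R) :
  measurable_fun [set: S] g -> measurable_fun [set: S] u1 ->
  measurable_fun [set: S] u2 -> measurable_fun [set: S] u3 ->
  {ae nu, forall z, `|g z| <= `|u1 z| + `|u2 z| + `|u3 z|} ->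
  (\int[nu]_z (g z ^+ 2)%:E <= 3%:E * (\int[nu]_z (u1 z ^+ 2)%:E
     + \int[nu]_z (u2 z ^+ 2)%:E + \int[nu]_z (u3 z ^+ 2)%:E))%E.
Proof.
move=> mg m1 m2 m3 gu.
have mE (u : S -> R) : measurable_fun [set: S] u ->
    measurable_fun [set: S] (fun z => (u z ^+ 2)%:E).
  by move=> mu; apply/measurable_EFinP; exact: measurable_funX.
have pE (u : S -> R) z : (0 <= (u z ^+ 2)%:E)%E by rewrite lee_fin sqr_ge0.
rewrite -!ge0_integralD//; try exact: mE; last 2 first.
- by move=> z _; rewrite adde_ge0.
- by apply: emeasurable_funD; exact: mE.
rewrite -ge0_integralZl//; last 2 first.
- by apply: emeasurable_funD; [apply: emeasurable_funD|]; exact: mE.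
- by move=> z _; rewrite !adde_ge0.
apply: ae_ge0_le_integral => //.
- exact: mE.
- by move=> z _; apply: mule_ge0; [rewrite lee_fin|rewrite !adde_ge0].
- apply: emeasurable_funM => //.
  by apply: emeasurable_funD; [apply: emeasurable_funD|]; exact: mE.
apply: filterS gu => z + _; rewrite -!EFinD -EFinM lee_fin.
rewrite -(real_normK (num_real (g z))) -(real_normK (num_real (u1 z))).
rewrite -(real_normK (num_real (u2 z))) -(real_normK (num_real (u3 z))).
have := normr_ge0 (g z).
move: `|g z| `|u1 z| `|u2 z| `|u3 z| => a b c e a0 h.
have h2 : a ^+ 2 <= (b + c + e) ^+ 2 by rewrite lerXn2r// nnegrE// (le_trans a0).
have := sqr_ge0 (b - c); have := sqr_ge0 (b - e); have := sqr_ge0 (c - e).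
by nra.
Qed.

(** The L2 limit that defines a stochastic integral, with lists of blocks in
    place of simple processes: unlike the latter, blocks can overlap, so that
    sums and differences are mere concatenations. *)
Definition ito_limit tau (H : R -> T -> R) (J : T -> R) :=
  measurable_fun [set: T] J /\
  forall e : R, 0 < e -> exists l,
    [/\ (\int[P]_w \int[leb]_(s in `[0%R, tau]) ((stp l s w - H s w) ^+ 2)%:E <= e%:E)%E,
        (\int[P]_w ((J w - ito l w) ^+ 2)%:E <= e%:E)%E &
        forall s w, ~~ (0 < s <= tau) -> stp l s w = 0].

Lemma simple_process_blocks tau (S : simple_process F tau) : exists l,
  [/\ forall s w, stp l s w = sp_eval S s w, forall w, ito l w = sp_integral S W w &
      forall s w, ~~ (0 < s <= tau) -> stp l s w = 0].
Proof.
have mono k j : (j + k <= sp_size S)%N -> sp_time S j <= sp_time S (j + k).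
  elim: k => [|k ih]; first by rewrite addn0.
  rewrite addnS => h; apply: (le_trans (ih (ltnW h))).
  exact: ltW (@sp_timeS _ _ _ _ _ S (j + k) h).
have t0 (i : nat) : (i <= sp_size S)%N -> 0 <= sp_time S i.
  by move=> h; have := mono i 0; rewrite add0n sp_time0; exact.
have tN (i : nat) : (i <= sp_size S)%N -> sp_time S i <= tau.
  by move=> h; have := mono (sp_size S - i)%N i; rewrite subnKC// sp_timeN; exact.
have kn (i : 'I_(sp_size S)) : knows (sp_time S i) (sp_val S i).
  by apply/measurable_wrtP; [exact: t0 (ltnW (ltn_ord i))|exact: sp_adapted].
pose blk (i : 'I_(sp_size S)) := Block (t0 i (ltnW (ltn_ord i)))
  (ltW (@sp_timeS _ _ _ _ _ S i (ltn_ord i))) (@kn i) (@sp_bounded _ _ _ _ _ S i (ltn_ord i)).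
exists (map blk (enum 'I_(sp_size S))); split.
- by move=> s w; rewrite /stp big_map big_enum.
- by move=> w; rewrite /ito big_map big_enum.
move=> s w hs; rewrite /stp big_map big1// => i _; rewrite /= indic_itv_oc.
suff -> : (sp_time S i < s <= sp_time S i.+1) = false by rewrite mulr0.
apply: contraNF hs => /andP[h1 h2]; apply/andP; split.
  exact: le_lt_trans (t0 _ (ltnW (ltn_ord i))) h1.
exact: le_trans h2 (tN _ (ltn_ord i)).
Qed.

Lemma ereal_cvg0_le (u : nat -> \bar R) (e : R) : u @ \oo --> 0%E -> 0 < e ->
  \forall k \near \oo, (u k <= e%:E)%E.
Proof.
move=> u0 e0; have : nbhs (0%E : \bar R) [set y | (y < e%:E)%E].
  by apply: open_nbhs_nbhs; split; [exact: open_ereal_lt_ereal|rewrite /= lte_fin].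
move=> h; have h' : \forall k \near \oo, (u k < e%:E)%E := u0 _ h.
by near=> k; apply: ltW; near: k.
Unshelve. all: by end_near.
Qed.

Lemma is_ito_limit tau (H H' : R -> T -> R) J :
  (forall s w, 0 <= s <= tau -> H s w = H' s w) ->
  is_ito_integral P F W tau H J -> ito_limit tau H' J.
Proof.
move=> HH' [_ mJ [S [S1 S2]]]; split => // e e0.
have [k [h1 h2]] : exists k, (\int[P]_w \int[leb]_(s in `[0%R, tau])
      ((sp_eval (S k) s w - H s w) ^+ 2)%:E <= e%:E)%E /\
    (\int[P]_w ((sp_integral (S k) W w - J w) ^+ 2)%:E <= e%:E)%E.
  have [k _ hk] : \forall k \near \oo, (\int[P]_w \int[leb]_(s in `[0%R, tau])
      ((sp_eval (S k) s w - H s w) ^+ 2)%:E <= e%:E)%E /\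
    (\int[P]_w ((sp_integral (S k) W w - J w) ^+ 2)%:E <= e%:E)%E.
    by near=> k; split; near: k; exact: ereal_cvg0_le.
  by exists k; exact: (hk k (leqnn k)).
have [l [l1 l2 l3]] := simple_process_blocks (S k); exists l; split; last exact: l3.
  apply: le_trans h1; rewrite le_eqVlt; apply/orP; left; apply/eqP.
  apply: eq_integral => w _; apply: eq_integral => s; rewrite inE/= in_itv/= => hs.
  by rewrite l1 HH'.
apply: le_trans h2; rewrite le_eqVlt; apply/orP; left; apply/eqP.
by apply: eq_integral => w _; rewrite l2 -sqrrN opprB.
Unshelve. all: by end_near. Qed.

(** Iterated integrals over time and scenarios are integrals for [P \x leb]. *)
Lemma integral_time_scenario (a b : R) (ca cb : bool) (g : T * R -> R) :
  measurable_fun [set: T * R] g ->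
  (\int[P]_w \int[leb]_(s in [set` Interval (BSide ca a) (BSide cb b)]) (g (w, s) ^+ 2)%:E =
   \int[P \x leb]_z ((\1_[set` Interval (BSide ca a) (BSide cb b)] z.2 * g z) ^+ 2)%:E)%E.
Proof.
set D := [set` _] => mg.
have mD : measurable D by exact: measurable_itv.
rewrite fubini_tonelli1; last 2 first.
- have mI : measurable_fun [set: R] (\1_D : R -> R) by exact: measurable_indic.
  apply/measurable_EFinP/measurable_funX/measurable_funM => //.
  exact: (measurableT_comp mI measurable_snd).
- by move=> z; rewrite lee_fin sqr_ge0.
apply: eq_integral => w _; rewrite /fubini_F [LHS]integral_mkcond.
apply: eq_integral => s _ /=; rewrite patchE indicE.
by case: ifP => _; rewrite ?mul1r// mul0r expr0n.
Qed.

Lemma measurable_stp l : measurable_fun [set: T * R] (fun z => stp l z.2 z.1).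
Proof.
rewrite /stp; elim: l => [|p l ih]; first by under eq_fun do rewrite big_nil; exact: measurable_cst.
under eq_fun do rewrite big_cons; apply: measurable_funD => //; apply: measurable_funM.
  by apply: (measurableT_comp (measurable_bval p)); exact: measurable_fst.
have mI : measurable_fun [set: R] (\1_(`]bstart p, bstop p]) : R -> R) by exact: measurable_indic.
exact: (measurableT_comp mI measurable_snd).
Qed.

Lemma ito_isometry_prod l :
  ((\int[P]_w (ito l w ^+ 2))%:E = \int[P \x leb]_z ((stp l z.2 z.1) ^+ 2)%:E)%E.
Proof.
rewrite ito_isometry fubini_tonelli1//.
- apply/measurable_EFinP/measurable_funX; exact: measurable_stp.
- by move=> z; rewrite lee_fin sqr_ge0.
Qed.

Lemma integral_ito_sqr l :
  (\int[P]_w (ito l w ^+ 2)%:E = \int[P \x leb]_z ((stp l z.2 z.1) ^+ 2)%:E)%E.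
Proof. by rewrite -ito_isometry_prod integral_EFin_Rintegral//; have [] := sqint_ito l. Qed.

Lemma opp_block_bounded p : exists M, forall w, `|- bval p w| <= M.
Proof. by have [M bM] := bval_bounded p; exists M => w; rewrite normrN. Qed.

Lemma opp_block_knows p : knows (bstart p) (fun w => - bval p w).
Proof. by apply: (knows_comp (f := fun x : R => - x) _ (bval_knows p)); exact: oppr_measurable. Qed.

Definition opp_block p := Block (bstart_ge0 p) (bstart_le p) (@opp_block_knows p) (opp_block_bounded p).

Lemma stp_opp l s w : stp (map opp_block l) s w = - stp l s w.
Proof. by rewrite /stp big_map -sumrN; apply: eq_bigr => p _; rewrite /= mulNr. Qed.

Lemma ito_opp l w : ito (map opp_block l) w = - ito l w.
Proof. by rewrite /ito big_map -sumrN; apply: eq_bigr => p _; rewrite /= mulNr. Qed.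

Lemma sqint_le (f : T -> R) (e : R) : measurable_fun [set: T] f ->
  (\int[P]_w (f w ^+ 2)%:E <= e%:E)%E -> sqint P f.
Proof.
move=> mf fe; split => //; apply/integrableP; split.
  by apply/measurable_EFinP; exact: measurable_funX.
under eq_integral do rewrite gee0_abs ?lee_fin ?sqr_ge0//.
by rewrite (le_lt_trans fe)// ltry.
Qed.

(** Young's inequality with a free parameter: an expectation that is at most
    a multiple of the L2 norm of an arbitrarily small error vanishes. *)
Lemma Rintegral_mul_le (xi f : T -> R) (M e lam : R) : 0 < lam -> 0 <= M ->
  measurable_fun [set: T] xi -> (forall w, `|xi w| <= M) -> measurable_fun [set: T] f ->
  (\int[P]_w (f w ^+ 2)%:E <= e%:E)%E ->
  `|\int[P]_w (xi w * f w)| <= M * (lam + e / lam).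
Proof.
move=> lam0 M0 mxi bxi mf fe; have [_ i2] := sqint_le mf fe.
have ib : integ (fun w => lam + lam^-1 * f w ^+ 2).
  apply: integrableD_EFin; last exact: integrableZ_EFin.
  by apply: (@integrable_bounded _ _ _ P (fun=> lam) `|lam|).
apply: (@le_trans _ _ (\int[P]_w (M * (lam + lam^-1 * f w ^+ 2)))).
  apply: ler_norm_Rintegral.
  - exact: measurable_funM.
  - exact: integrableZ_EFin.
  - apply/aeW => w; rewrite normrM ler_pM//.
    rewrite -(real_normK (num_real (f w))); move: `|f w| => x.
    have -> : lam + lam^-1 * x ^+ 2 = lam^-1 * (lam ^+ 2 + x ^+ 2) by field; rewrite gt_eqF.
    rewrite mulrC ler_pdivlMr//; have := sqr_ge0 (lam - x); have := sqr_ge0 x; have := sqr_ge0 lam; nra.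
rewrite RintegralZl// ler_wpM2l// RintegralD//; last 2 first.
- by apply: (@integrable_bounded _ _ _ P (fun=> lam) `|lam|).
- exact: integrableZ_EFin.
rewrite Rintegral_cst1 lerD2l RintegralZl// mulrC ler_pM2r ?invr_gt0//.
by rewrite -lee_fin -integral_EFin_Rintegral.
Qed.

Section ito_increment.
Variables (t t' : R) (H : R -> T -> R) (J J' : T -> R) (eta : T -> R) (M : R).
Hypotheses (t0 : 0 <= t) (tt' : t <= t').
Hypotheses (mH : measurable_fun [set: T * R] (fun z => H z.2 z.1)).
Hypotheses (itoJ : ito_limit t H J) (itoJ' : ito_limit t' H J').
Hypotheses (keta : knows t eta) (beta : forall w, `|eta w| <= M).

Definition increment_error := (\int[P]_w \int[leb]_(s in `]t, t']) ((H s w - eta w) ^+ 2)%:E)%E.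

Let D w := J' w - J w - eta w * (W t' w - W t w).

Lemma eta_block_bounded : exists M', forall w, `|- eta w| <= M'.
Proof. by exists M => w; rewrite normrN. Qed.

Lemma eta_block_knows : knows t (fun w => - eta w).
Proof. by apply: (knows_comp (f := fun x : R => - x) _ keta); exact: oppr_measurable. Qed.

Let eta_block := Block t0 tt' eta_block_knows eta_block_bounded.

Lemma measurable_increment_ito : measurable_fun [set: T] D.
Proof.
apply: measurable_funB.
  by apply: measurable_funB; [exact: itoJ'.1|exact: itoJ.1].
apply: measurable_funM; first exact: knows_measurable keta.
exact: measurable_increment t0 (le_trans t0 tt').
Qed.

(** One elementary integral approximates [J' - J - eta * (W t' - W t)]; its
    integrand is small before [t] and close to [H - eta] after [t]. *)
Lemma increment_approx e : 0 < e -> exists l1 l2 : T -> R, exists l : seq block,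
  [/\ measurable_fun [set: T] l1 /\ (\int[P]_w (l1 w ^+ 2)%:E <= e%:E)%E,
      measurable_fun [set: T] l2 /\ (\int[P]_w (l2 w ^+ 2)%:E <= e%:E)%E,
      forall w, D w = l1 w - l2 w + ito l w,
      (\int[P]_w (ito l w ^+ 2)%:E <= 3%:E * (e%:E + e%:E + increment_error))%E &
      (\int[P]_w (ito (map (cut t0) l) w ^+ 2)%:E <= (6 * e)%:E)%E].
Proof.
move=> e0.
have [mJ /(_ e e0)[l [a1 a2 a3]]] := itoJ.
have [mJ' /(_ e e0)[l' [b1 b2 b3]]] := itoJ'.
exists (fun w => J' w - ito l' w), (fun w => J w - ito l w).
exists (eta_block :: l' ++ map opp_block l).
pose u1 (z : T * R) := \1_(`[0, t']) z.2 * (stp l' z.2 z.1 - H z.2 z.1).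
pose u2 (z : T * R) := \1_(`[0, t]) z.2 * (stp l z.2 z.1 - H z.2 z.1).
pose u3 (z : T * R) := \1_(`]t, t']) z.2 * (H z.2 z.1 - eta z.1).
have meta : measurable_fun [set: T * R] (fun z : T * R => eta z.1).
  exact: (measurableT_comp (knows_measurable t0 keta) measurable_fst).
have m1 : measurable_fun [set: T * R] (fun z : T * R => stp l' z.2 z.1 - H z.2 z.1).
  by apply: measurable_funB => //; exact: measurable_stp.
have m2 : measurable_fun [set: T * R] (fun z : T * R => stp l z.2 z.1 - H z.2 z.1).
  by apply: measurable_funB => //; exact: measurable_stp.
have m3 : measurable_fun [set: T * R] (fun z : T * R => H z.2 z.1 - eta z.1).
  exact: measurable_funB.
have mi (i : interval R) : measurable_fun [set: T * R] (fun z : T * R => \1_([set` i]) z.2 : R).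
  have mI : measurable_fun [set: R] (\1_([set` i]) : R -> R).
    by apply: measurable_indic; exact: measurable_itv.
  exact: (measurableT_comp mI measurable_snd).
have mu1 : measurable_fun [set: T * R] u1 by exact: measurable_funM.
have mu2 : measurable_fun [set: T * R] u2 by exact: measurable_funM.
have mu3 : measurable_fun [set: T * R] u3 by exact: measurable_funM.
have e1 : (\int[P \x leb]_z (u1 z ^+ 2)%:E <= e%:E)%E.
  by rewrite -(integral_time_scenario 0 t' true false m1).
have e2 : (\int[P \x leb]_z (u2 z ^+ 2)%:E <= e%:E)%E.
  by rewrite -(integral_time_scenario 0 t true false m2).
have e3 : (\int[P \x leb]_z (u3 z ^+ 2)%:E = increment_error)%E.
  by rewrite -(integral_time_scenario t t' false false m3).
have ind a b c f s : \1_[set` Interval (BSide c a) (BSide f b)] s =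
    ((s \in Interval (BSide c a) (BSide f b)))%:R :> R.
  by rewrite indicE mem_setE.
have stpE s w : stp (eta_block :: l' ++ map opp_block l) s w = u1 (w, s) - u2 (w, s) + u3 (w, s).
  rewrite [LHS]/stp big_cons big_cat/= -/(stp l' s w) -/(stp _ s w) stp_opp.
  rewrite indic_itv_oc /u1 /u2 /u3/= !ind !in_itv/=.
  have h1 := a3 s w; have h2 := b3 s w; move: h1 h2.
  case: (ltgtP 0 s) => [s0|s0|<-]/=.
  - case: (leP s t) => /= st.
      by rewrite (le_trans st tt')/= => _ _; ring.
    case: (leP s t') => /= st' h1 h2; first by rewrite h1//; ring.
    by rewrite h1// h2//; ring.
  - rewrite [t < s]ltNge (le_trans (ltW s0) t0)/= => h1 h2.
    by rewrite h1// h2//; ring.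
  - rewrite [t < 0]ltNge t0 (le_trans t0 tt')/= => h1 h2.
    by rewrite h1// h2//; ring.
have zE (z : T * R) : z = (z.1, z.2) by case: z.
have n3 (x y v : R) : `|x - y + v| <= `|x| + `|y| + `|v|.
  by rewrite (le_trans (ler_normD _ _))// lerD2r ler_normB.
split.
- by split => //; apply: measurable_funB => //; have [] := sqint_ito l'.
- by split => //; apply: measurable_funB => //; have [] := sqint_ito l.
- move=> w; rewrite [ito (_ :: _) _]/ito big_cons big_cat/= -/(ito l' w) -/(ito _ w) ito_opp /D.
  by ring.
- rewrite integral_ito_sqr -e3.
  apply: (@le_trans _ _ (3%:E * (\int[P \x leb]_z (u1 z ^+ 2)%:E +
      \int[P \x leb]_z (u2 z ^+ 2)%:E + \int[P \x leb]_z (u3 z ^+ 2)%:E))%E).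
    apply: integral_sqr_le3 => //; first exact: measurable_stp.
    by apply: aeW => z; rewrite {1}[z]zE stpE/= -zE.
  apply: lee_wpmul2l; first by rewrite lee_fin.
  by apply: leeD => //; exact: leeD.
- rewrite integral_ito_sqr.
  apply: (@le_trans _ _ (3%:E * (\int[P \x leb]_z (u1 z ^+ 2)%:E +
      \int[P \x leb]_z (u2 z ^+ 2)%:E + \int[P \x leb]_z ((fun=> 0) z ^+ 2 : R)%:E))%E).
    apply: integral_sqr_le3 => //; first exact: measurable_stp.
    apply: aeW => z; rewrite stp_cut; case: (leP z.2 t) => zt; last by rewrite normr0 !addr_ge0.
    rewrite stpE -zE {1}/u3 ind in_itv/= [t < _]ltNge zt/= mul0r.
    exact: n3.
  have -> : ((6 * e)%:E = 3%:E * (e%:E + e%:E + 0))%E.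
    by rewrite adde0 -EFinD -EFinM; congr EFin; ring.
  apply: lee_wpmul2l; first by rewrite lee_fin.
  apply: leeD; first exact: leeD.
  by under eq_integral do rewrite expr0n; rewrite integral0.
Qed.

(** Ito isometry in the limit, with a lossy constant that comes from splitting
    the approximation error into three parts. *)
Lemma ito_increment_sqr :
  (\int[P]_w (D w ^+ 2)%:E <= 9%:E * increment_error)%E.
Proof.
have B0 : (0 <= increment_error)%E.
  by apply: integral_ge0 => w _; apply: integral_ge0 => s _; rewrite lee_fin sqr_ge0.
apply/lee_addgt0Pr => e e0.
have e'0 : 0 < e / 24 by rewrite divr_gt0.
have [l1 [l2 [l [[m1 h1] [m2 h2] DE hl _]]]] := increment_approx e'0.
apply: (@le_trans _ _ (3%:E * (\int[P]_w (l1 w ^+ 2)%:E + \int[P]_w (l2 w ^+ 2)%:E +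
   \int[P]_w (ito l w ^+ 2)%:E))%E).
  apply: integral_sqr_le3 => //; first exact: measurable_increment_ito.
    by have [] := sqint_ito l.
  by apply: aeW => w; rewrite DE (le_trans (ler_normD _ _))// lerD2r ler_normB.
apply: (@le_trans _ _ (3%:E * ((e / 24)%:E + (e / 24)%:E +
    3%:E * ((e / 24)%:E + (e / 24)%:E + increment_error)))%E).
  by apply: lee_wpmul2l; [rewrite lee_fin|apply: leeD => //; exact: leeD].
case: increment_error B0 => [b _| _|//]; last first.
  by rewrite [X in (_ <= X + _)%E]gt0_muley ?lte_fin// addye// leey.
by rewrite -!(EFinD, EFinM) lee_fin; lra.
Qed.

Lemma sqint_ito_increment : (increment_error < +oo)%E -> sqint P D.
Proof.
move=> fin; have B0 : (0 <= increment_error)%E.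
  by apply: integral_ge0 => w _; apply: integral_ge0 => s _; rewrite lee_fin sqr_ge0.
apply: (@sqint_le _ (9 * fine increment_error)); first exact: measurable_increment_ito.
by rewrite EFinM fineK ?ge0_fin_numE//; exact: ito_increment_sqr.
Qed.

(** The elementary integrals that approximate the increment have small parts
    before time [t], and their later parts are orthogonal to the past. *)
Lemma ito_increment_orthogonal (xi : T -> R) (Mx : R) : (increment_error < +oo)%E ->
  knows t xi -> (forall w, `|xi w| <= Mx) -> \int[P]_w (xi w * D w) = 0.
Proof.
move=> fin kxi bxi; have sD := sqint_ito_increment fin.
have mxi := knows_measurable t0 kxi.
have sxi : sqint P xi := sqint_bounded P mxi bxi.
have Mx0 : 0 <= Mx := le_trans (normr_ge0 _) (bxi point).
apply/eqP; rewrite -normr_le0; apply/ler_addgt0Pr => e e0; rewrite add0r.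
pose lam := e / (11 * (Mx + 1)).
have lam0 : 0 < lam by rewrite divr_gt0// mulr_gt0// ltr_wpDl.
have [l1 [l2 [l [[m1 h1] [m2 h2] DE _ hl]]]] := increment_approx (exprn_gt0 2 lam0).
have i1 : integ (fun w => xi w * l1 w) by apply: sqint_mul => //; exact: sqint_le h1.
have i2 : integ (fun w => xi w * l2 w) by apply: sqint_mul => //; exact: sqint_le h2.
have i3 : integ (fun w => xi w * ito l w) by apply: sqint_mul => //; exact: sqint_ito.
have -> : \int[P]_w (xi w * D w) = \int[P]_w (xi w * l1 w) - \int[P]_w (xi w * l2 w) +
    \int[P]_w (xi w * ito (map (cut t0) l) w).
  rewrite -(ito_cut_orthogonal t0 l kxi bxi) -RintegralB// -RintegralD//; last exact: integrableB_EFin.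
  by apply: eq_Rintegral => w _; rewrite DE; ring.
have b1 := Rintegral_mul_le lam0 Mx0 mxi bxi m1 h1.
have b2 := Rintegral_mul_le lam0 Mx0 mxi bxi m2 h2.
have b3 := Rintegral_mul_le lam0 Mx0 mxi bxi (sqint_ito (map (cut t0) l)).1 hl.
have q1 : lam ^+ 2 / lam = lam by rewrite expr2 mulfK// gt_eqF.
have q2 : 6 * lam ^+ 2 / lam = 6 * lam by rewrite -mulrA q1.
rewrite q1 in b1 b2; rewrite q2 in b3.
rewrite (le_trans (ler_normD _ _))// (le_trans (lerD (ler_normB _ _) (lexx _)))//.
apply: (le_trans (lerD (lerD b1 b2) b3)).
have -> : Mx * (lam + lam) + Mx * (lam + lam) + Mx * (lam + 6 * lam) = Mx * (11 * lam) by ring.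
have -> : e = (Mx + 1) * (11 * lam) by rewrite /lam; field; rewrite gt_eqF// ltr_wpDl.
by rewrite ler_wpM2r ?lerDl// mulr_ge0// ltW.
Qed.

End ito_increment.
End brownian_increments.

(** * Elementary inequalities *)

Section elementary_inequalities.
Context {R : realType}.
Implicit Types a b r : R.

Lemma sqrD_le a b : (a + b) ^+ 2 <= 2 * a ^+ 2 + 2 * b ^+ 2.
Proof. by have := sqr_ge0 (a - b); rewrite sqrrB sqrrD; lra. Qed.

Lemma young_mul r a b : 0 < r -> `|a| * `|b| <= r * a ^+ 2 + r^-1 * b ^+ 2.
Proof.
move=> r0; rewrite -(real_normK (num_real a)) -(real_normK (num_real b)).
move: `|a| `|b| (normr_ge0 a) (normr_ge0 b) => {}a {}b a0 b0.
have -> : r * a ^+ 2 + r^-1 * b ^+ 2 = r^-1 * ((r * a) ^+ 2 + b ^+ 2) by field; rewrite gt_eqF.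
rewrite [leRHS]mulrC ler_pdivlMr// (_ : a * b * r = r * a * b); last by ring.
move: (r * a) => c; have := sqr_ge0 (c - b); have := sqr_ge0 c; have := sqr_ge0 b.
by rewrite sqrrB; lra.
Qed.

Lemma discrete_gronwall (u : nat -> R) (c e : R) m : 0 <= c -> 0 <= e -> 0 <= u 0 ->
  (forall j, (j < m)%N -> u j.+1 <= (1 + c) * u j + e) ->
  u m <= expR (c * m%:R) * (u 0 + m%:R * e).
Proof.
move=> c0 e0 u0; elim: m => [|m ih] h; first by rewrite mulr0 expR0 mul0r addr0 mul1r.
have {}ih := ih (fun j jm => h j (ltnW jm)).
apply: (le_trans (h m (ltnSn m))).
have h1 : (1 + c) * u m <= expR c * (expR (c * m%:R) * (u 0 + m%:R * e)).
  apply: (@le_trans _ _ ((1 + c) * (expR (c * m%:R) * (u 0 + m%:R * e)))).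
    by rewrite ler_wpM2l// addr_ge0.
  by rewrite ler_wpM2r ?expR_ge1Dx// mulr_ge0 ?expR_ge0// addr_ge0// mulr_ge0.
have -> : expR (c * m.+1%:R) = expR c * expR (c * m%:R) by rewrite -expRD -natr1; congr expR; ring.
have h2 : 1 <= expR c * expR (c * m%:R) by rewrite -expRD -expR0 ler_expR addr_ge0// mulr_ge0.
have h3 : e <= expR c * expR (c * m%:R) * e by rewrite ler_peMl.
apply: (le_trans (lerD h1 h3)).
by rewrite -natr1 le_eqVlt; apply/orP; left; apply/eqP; ring.
Qed.

(** Reversal of one step of a relative-error recursion. *)
Lemma reverse_step (y e u v : R) : 0 <= y -> y <= 1 / 2 -> 0 <= e -> 0 <= u ->
  - (y * u + e) <= v - u -> u <= (1 + 2 * y) * v + 2 * e.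
Proof.
move=> y0 y1 e0 u0 h.
have h1 : (1 + 2 * y) * (u * (1 - y)) <= (1 + 2 * y) * (v + e) by rewrite ler_wpM2l//; lra.
have h2 : u <= (1 + 2 * y) * (u * (1 - y)).
  rewrite -subr_ge0 (_ : _ - _ = u * y * (1 - 2 * y)); last by ring.
  by rewrite !mulr_ge0//; lra.
have h3 : (1 + 2 * y) * e <= 2 * e by rewrite ler_wpM2r//; lra.
by rewrite mulrDr in h1; lra.
Qed.

End elementary_inequalities.

(** * Processes with continuous paths *)

Section step_processes.
Context {R : realType} d (T : measurableType d).
Notation leb := (@lebesgue_measure R).

Definition clamp01 (s : R) : R := Num.max 0 (Num.min s 1).

Lemma clamp01_id s : 0 <= s <= 1 -> clamp01 s = s.
Proof. by move=> /andP[s0 s1]; rewrite /clamp01 min_l// max_r. Qed.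

Lemma clamp01_itv s : 0 <= clamp01 s <= 1.
Proof. by rewrite /clamp01 le_max lexx/= ge_max ler01 ge_min lexx orbT. Qed.

Lemma clamp01_continuous : continuous clamp01.
Proof.
apply: (lip_continuous ltr01) => x y xy; rewrite mul1r ler_norml /clamp01.
by rewrite /Num.max /Num.min; case: ifP; case: ifP; case: ifP; case: ifP; rewrite ?ltNge;
  move=> *; apply/andP; split; lra.
Qed.

Lemma clamp01_path_continuous (f : R -> R) : {within `[0, 1], continuous f} ->
  continuous (fun s => f (clamp01 s)).
Proof.
move=> /subspace_continuousP cf s.
have hs : `[0, 1]%classic (clamp01 s) by rewrite /= in_itv/= clamp01_itv.
apply: (@cvg_comp _ _ _ clamp01 f _ (within `[0, 1]%classic (nbhs (clamp01 s)))); last exact: cf.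
move=> U hU; have hV := @clamp01_continuous s _ hU.
suff : nbhs s (clamp01 @^-1` U) by [].
by apply: (@filterS _ (nbhs s) _ _ _ _ hV) => y /=; apply; rewrite in_itv/= clamp01_itv.
Qed.

Definition cell (n j : nat) : set R := `[j%:R / n%:R, j.+1%:R / n%:R[%classic.

(** A number of the interval lies in exactly one cell, so that a sum over the
    cells evaluates [g] at a grid point close to it. *)
Lemma cell_sum (n : nat) (g : nat -> R) s : (0 < n)%N -> 0 <= s <= 1 ->
  exists j : nat, [/\ (j <= n)%N, `|s - j%:R / n%:R| <= n%:R^-1 &
    \sum_(i < n.+1) g i * \1_(cell n i) s = g j].
Proof.
move=> n0 /andP[s0 s1]; have n0' : 0 < n%:R :> R by rewrite ltr0n.
have sn0 : 0 <= s * n%:R by rewrite mulr_ge0// ltW.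
pose j := Num.truncn (s * n%:R).
have /andP[j1 j2] : j%:R <= s * n%:R < j.+1%:R by exact: truncn_itv.
have jn : (j < n.+1)%N.
  by rewrite ltnS -(ler_nat R) (le_trans j1)// ler_piMl// ltW.
have e1 i : \1_(cell n i) s = (i == j)%:R :> R.
  rewrite indicE mem_setE in_itv/= ler_pdivrMr// ltr_pdivlMr//; congr (_%:R); congr nat_of_bool.
  apply/idP/idP => [/andP[h1 h2]|/eqP ->]; last by rewrite j1.
  by rewrite eq_sym /j truncn_eq// h1.
exists j; split => //.
  have -> : s - j%:R / n%:R = (s * n%:R - j%:R) / n%:R by rewrite mulrBl mulfK// gt_eqF.
  rewrite ger0_norm ?divr_ge0 ?subr_ge0//.
  rewrite ler_pdivrMr// mulVf ?gt_eqF// lerBlDl.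
  by rewrite (le_trans (ltW j2))// -natr1.
rewrite (bigD1 (Ordinal jn))//= e1 eqxx mulr1 big1 ?addr0// => i.
by rewrite e1 -val_eqE/= => /negbTE ->; rewrite mulr0.
Qed.

Variable Y : R -> T -> R.
Hypothesis Yclamp : forall s w, Y (clamp01 s) w = Y s w.
Hypothesis mY : forall s, 0 <= s <= 1 -> measurable_fun [set: T] (Y s).
Hypothesis cY : forall w, continuous (Y ^~ w).

Definition step_process n s w :=
  \sum_(i < n.+1) Y (i%:R / n%:R) w * \1_(cell n i) (clamp01 s).

Lemma step_process_cvg s w : step_process n.+1 s w @[n --> \oo] --> Y s w.
Proof.
apply/cvgrPdist_le => e e0; have := @cY w (clamp01 s) => /cvgrPdist_le/(_ e e0).
move=> [r /= r0 hr].
have [m _ hm] : \forall n \near \oo, n.+1%:R^-1 < r.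
  by near=> n; near: n; exact: near_infty_natSinv_lt (PosNum r0).
near=> n; rewrite /step_process -(Yclamp s).
have [j [jn sj ->]] := @cell_sum n.+1 (fun i => Y (i%:R / n.+1%:R) w) (clamp01 s) isT (clamp01_itv s).
apply: hr; rewrite /ball_/= (le_lt_trans sj)//.
by apply: hm; rewrite /=; near: n; exact: nbhs_infty_ge.
Unshelve. all: by end_near. Qed.

Lemma grid_itv (i n : nat) : (i <= n)%N -> 0 <= (i%:R / n%:R : R) <= 1.
Proof.
case: n => [|n]; first by rewrite invr0 mulr0 lexx ler01.
move=> ? ; rewrite divr_ge0//= ler_pdivrMr ?ltr0n// mul1r ler_nat//.
Qed.

(** A process with continuous paths is a limit of step processes, hence jointly
    measurable. *)
Lemma continuous_jointly_measurable : measurable_fun [set: T * R] (fun z => Y z.2 z.1).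
Proof.
apply: (@measurable_fun_cvg _ _ _ _ (fun n z => step_process n.+1 z.2 z.1)); last first.
  by move=> z _; exact: step_process_cvg.
move=> n; apply: measurable_sum => i; apply: measurable_funM.
  apply: (measurableT_comp (mY _)); last exact: measurable_fst.
  by rewrite grid_itv// -ltnS ltn_ord.
have mI : measurable_fun [set: R] (\1_(cell n.+1 i) : R -> R) by apply: measurable_indic; exact: measurable_itv.
apply: (measurableT_comp mI); apply: (measurableT_comp _ measurable_snd).
apply: continuous_measurable_fun; exact: clamp01_continuous.
Qed.

End step_processes.

(** * Short-time comparison for the diffusion *)

Section sde.
Context {R : realType} d (T : measurableType d) (P : probability T R).
Variables (F : R -> set (set T)) (W : R -> T -> R).
Hypothesis (filt : filtration F) (bm : brownian_motion P F W).
Variables (K alpha : R) (M : diffusion_model K alpha) (X0 : R -> T -> R).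
Hypothesis sol : sde_solution P F W 1 (vol M) (drift M) 0 X0.
Notation leb := (@lebesgue_measure R).

Local Notation "'integ' f" := (P.-integrable [set: T] (fun w => (f w)%:E))
  (at level 10, f at next level).
Local Notation sg := (vol M).
Local Notation bt := (drift M).

(** Freezing the solution outside [[0, 1]] makes its paths continuous on the line. *)
Definition X s w := X0 (clamp01 s) w.

Lemma X_id s w : 0 <= s <= 1 -> X s w = X0 s w.
Proof. by move=> h; rewrite /X clamp01_id. Qed.

Lemma X_clamp s w : X (clamp01 s) w = X s w.
Proof. by rewrite /X clamp01_id// clamp01_itv. Qed.

Lemma X_continuous w : continuous (X ^~ w).
Proof. by have [_ h _ _] := sol; exact: (clamp01_path_continuous (h w)). Qed.

Lemma knows_X s t : 0 <= s -> s <= t -> t <= 1 -> knows F t (X s).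
Proof.
move=> s0 st t1; have s1 : 0 <= s <= 1 by rewrite s0 (le_trans st).
apply: (knows_mono filt s0 st); apply/measurable_wrtP => //.
have -> : X s = X0 s by apply/funext => w; exact: X_id.
by have [h _ _ _] := sol; exact: h.
Qed.

Lemma measurable_X s : 0 <= s <= 1 -> measurable_fun [set: T] (X s).
Proof. by move=> /andP[s0 s1]; apply: (knows_measurable filt s0); exact: knows_X. Qed.

Lemma jointly_measurable_X : measurable_fun [set: T * R] (fun z => X z.2 z.1).
Proof.
by apply: continuous_jointly_measurable; [exact: X_clamp|exact: measurable_X|exact: X_continuous].
Qed.

Lemma sg_lip x y : `|sg y - sg x| <= K * `|y - x|.
Proof. exact: bounded_derive_lip (vol_der M) (vol1_le M) x y. Qed.

Lemma bt_lip x y : `|bt y - bt x| <= K * `|y - x|.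
Proof. exact: bounded_derive_lip (drift_der M) (drift1_le M) x y. Qed.

Lemma sg_continuous : continuous sg.
Proof. exact: is_derive1_continuous (vol_der M). Qed.

Lemma bt_continuous : continuous bt.
Proof. exact: is_derive1_continuous (drift_der M). Qed.

Lemma X0_start : {ae P, forall w, X 0 w = 0}.
Proof.
have [_ _ h _] := sol; apply: filterS h => w h0.
by rewrite X_id ?lexx ?ler01.
Qed.

Lemma sde_integral t : 0 <= t <= 1 -> exists J,
  ito_limit P F W t (fun s w => sg (X s w)) J /\
  {ae P, forall w, X t w = X 0 w + J w + \int[leb]_(s in `[0, t]) bt (X s w)}.
Proof.
move=> t01; have [_ _ _ h] := sol; have [J iJ eJ] := h t t01.
have le1 s : 0 <= s <= t -> 0 <= s <= 1.
  by move=> /andP[s0 st]; rewrite s0 (le_trans st)//; case/andP: t01.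
exists J; split.
  by apply: (is_ito_limit filt _ iJ) => s w hs; rewrite X_id// le1.
apply: filterS eJ => w; rewrite X_id// X_id ?lexx ?ler01// => ->; congr (_ + _).
by apply: eq_Rintegral => s; rewrite inE/= in_itv/= => hs; rewrite X_id// le1.
Qed.

Lemma path_integrable (f : R -> R) w a b : continuous f ->
  leb.-integrable `[a, b] (EFin \o (fun s => f (X s w))).
Proof.
move=> cf; apply: continuous_compact_integrable; first exact: segment_compact.
apply: continuous_subspaceT => s; apply: continuous_comp; first exact: X_continuous.
exact: cf.
Qed.

Lemma sde_increment t t' : 0 <= t -> t <= t' -> t' <= 1 -> exists J J',
  [/\ ito_limit P F W t (fun s w => sg (X s w)) J,
      ito_limit P F W t' (fun s w => sg (X s w)) J' &
  {ae P, forall w, X t' w = X t w + (J' w - J w) + \int[leb]_(s in `]t, t']) bt (X s w)}].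
Proof.
move=> t0 tt' t'1.
have [J [iJ eJ]] := @sde_integral t (introT andP (conj t0 (le_trans tt' t'1))).
have [J' [iJ' eJ']] := @sde_integral t' (introT andP (conj (le_trans t0 tt') t'1)).
exists J, J'; split; [exact: iJ|exact: iJ'|]; near=> w.
have e : X t w = X 0 w + J w + \int[leb]_(s in `[0, t]) bt (X s w) by near: w.
have e' : X t' w = X 0 w + J' w + \int[leb]_(s in `[0, t']) bt (X s w) by near: w.
have := @Rintegral_itvB R (fun s => bt (X s w)) (BLeft 0) (BRight t') t (path_integrable w 0 t' bt_continuous).
rewrite !bnd_simp => /(_ t0 tt') => h.
by rewrite e e' -h; ring.
Unshelve. all: by end_near. Qed.

Lemma Rintegral_bound (f : R -> R) (a b C : R) : a <= b ->
  leb.-integrable `]a, b] (EFin \o f) -> (forall s, a < s <= b -> `|f s| <= C) ->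
  `|\int[leb]_(s in `]a, b]) f s| <= C * (b - a).
Proof.
move=> ab fi fC.
have mI : measurable (`]a, b]%classic : set (measurableTypeR R)) by exact: measurable_itv.
apply: le_trans (le_normr_Rintegral mI fi) _.
have E : \int[leb]_(s in `]a, b]) C = C * (b - a).
  rewrite Rintegral_cst//; congr (_ * _).
  rewrite [X in fine X](@lebesgue_measure_itv R) /= lte_fin.
  by move: ab; rewrite le_eqVlt => /predU1P[->|->]//; rewrite ltxx subrr.
rewrite -E; apply: le_Rintegral => //.
- exact: (integrable_abse fi).
- have := continuous_compact_integrable (segment_compact (a := a) (b := b)) (continuous_subspaceT (@cst_continuous R R C)).
  by apply: integrableS => //; exact: subset_itv_oc_cc.
Qed.

Lemma time_scenario_le (t t' C : R) (f : T * R -> R) : t <= t' -> 0 <= C ->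
  measurable_fun [set: T * R] f ->
  (forall s, t < s <= t' -> (\int[P]_w (f (w, s) ^+ 2)%:E <= C%:E)%E) ->
  (\int[P]_w \int[leb]_(s in `]t, t']) (f (w, s) ^+ 2)%:E <= (C * (t' - t))%:E)%E.
Proof.
move=> tt' C0 mf fC; rewrite (integral_time_scenario P t t' false false mf).
set D := [set` _].
have mD : measurable D by exact: measurable_itv.
have mI : measurable_fun [set: R] (\1_D : R -> R) by exact: measurable_indic.
rewrite fubini_tonelli2; last 2 first.
- apply/measurable_EFinP/measurable_funX/measurable_funM => //.
  exact: (measurableT_comp mI measurable_snd).
- by move=> z; rewrite lee_fin sqr_ge0.
have -> : (C * (t' - t))%:E = (\int[leb]_s (C%:E * (\1_D s)%:E))%E.
  rewrite ge0_integralZl//; last first.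
    by apply/measurable_EFinP.
  rewrite integral_indic// setIT [X in (_ * X)%E](@lebesgue_measure_itv R) /= lte_fin.
  move: tt'; rewrite le_eqVlt => /predU1P[->|->].
    by rewrite ltxx subrr mulr0 mule0.
  by rewrite -EFinB EFinM.
apply: ge0_le_integral => //.
- by move=> s _; apply: integral_ge0 => w _; rewrite lee_fin sqr_ge0.
- apply: (measurable_fun_fubini_tonelli_G (m1 := P)); last by move=> z; rewrite lee_fin sqr_ge0.
  apply/measurable_EFinP/measurable_funX/measurable_funM => //.
  exact: (measurableT_comp mI measurable_snd).
- by apply: emeasurable_funM => //; apply/measurable_EFinP.
move=> s _; rewrite /fubini_G /= /D indicE mem_setE in_itv/=.
case: (boolP (t < s <= t')) => hs.
  rewrite mule1; under eq_integral do rewrite mul1r; exact: fC.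
rewrite mule0; under eq_integral do rewrite mul0r expr0n.
by rewrite integral0.
Qed.

Lemma K0 : 0 <= K.
Proof. exact: ltW (K_gt0 M). Qed.

Lemma measurable_gX (f : R -> R) : continuous f ->
  measurable_fun [set: T * R] (fun z : T * R => f (X z.2 z.1)).
Proof.
move=> cf; apply: (measurableT_comp _ jointly_measurable_X).
exact: continuous_measurable_fun.
Qed.

(** The coefficients are bounded, so that an increment of the solution is of
    the order of a Brownian increment in L2. *)
Lemma X_increment_sqr t t' : 0 <= t -> t <= t' -> t' <= 1 ->
  (\int[P]_w ((X t' w - X t w) ^+ 2)%:E <= (30 * K ^+ 2 * (t' - t))%:E)%E.
Proof.
move=> t0 tt' t'1; have [J [J' [iJ iJ' eX]]] := sde_increment t0 tt' t'1.
have msg := measurable_gX sg_continuous.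
have B0 w : `|(fun=> 0 : R) (w : T)| <= 0 by rewrite normr0.
have k0 : knows F t (fun=> 0 : R) by exact: knows_cst.
have h := ito_increment_sqr filt bm t0 tt' msg iJ iJ' k0 B0.
have eB : (increment_error P t t' (fun s w => sg (X s w)) (fun=> 0%R) <= (K ^+ 2 * (t' - t))%:E)%E.
  apply: (time_scenario_le (f := fun z => sg (X z.2 z.1) - 0)) => //.
  - exact: sqr_ge0.
  - exact: measurable_funB.
  move=> s _; apply: (@le_trans _ _ (\int[P]_w (cst (K ^+ 2)%:E w))%E).
    apply: ge0_le_integral => //.
    + by move=> w _; rewrite lee_fin sqr_ge0.
    + apply/measurable_EFinP/measurable_funX/measurable_funB => //.
      exact: (measurable_fun_pair1 s msg).
    + move=> w _; rewrite lee_fin subr0 -(real_normK (num_real (sg _))).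
      by rewrite lerXn2r ?nnegrE ?K0// vol_le.
  by rewrite integral_cst1.
have s1 : 0 <= t' <= 1 by rewrite (le_trans t0).
have s2 : 0 <= t <= 1 by rewrite t0 (le_trans tt').
have d0 : 0 <= t' - t by rewrite subr_ge0.
have d1 : t' - t <= 1 by rewrite lerBlDr (le_trans t'1)// lerDl.
pose Dd w := J' w - J w - 0 * (W t' w - W t w).
apply: (@le_trans _ _ (3%:E * (\int[P]_w (Dd w ^+ 2)%:E + \int[P]_w ((K * (t' - t)) ^+ 2)%:E
   + \int[P]_w ((0 : R) ^+ 2)%:E))%E).
  apply: (integral_sqr_le3 (u2 := fun=> K * (t' - t)) (u3 := fun=> 0)) => //.
  - by apply: measurable_funB; exact: measurable_X.
  - apply: measurable_funB; first by apply: measurable_funB; [exact: iJ'.1|exact: iJ.1].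
    by apply: measurable_funM => //; apply: (measurable_increment filt bm) => //; rewrite (le_trans t0).
  apply: filterS eX => w ->.
  have -> : X t w + (J' w - J w) + \int[leb]_(s in `]t, t']) bt (X s w) - X t w =
    Dd w + \int[leb]_(s in `]t, t']) bt (X s w) by rewrite /Dd; ring.
  rewrite normr0 addr0 (le_trans (ler_normD _ _))// lerD2l.
  rewrite [leRHS]ger0_norm ?mulr_ge0 ?K0//; apply: Rintegral_bound => //.
    by apply: integrableS (path_integrable w t t' bt_continuous) => //; exact: subset_itv_oc_cc.
  by move=> s _; exact: drift_le.
rewrite !integral_cst1 expr0n adde0.
apply: (@le_trans _ _ (3%:E * (9%:E * (K ^+ 2 * (t' - t))%:E + ((K * (t' - t)) ^+ 2)%:E))%E).
  apply: lee_wpmul2l; first by rewrite lee_fin.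
  apply: leeD => //; apply: (le_trans h); apply: lee_wpmul2l => //; by rewrite lee_fin.
rewrite -!(EFinM, EFinD) lee_fin.
have k2 := sqr_ge0 K.
have : (t' - t) ^+ 2 <= t' - t by rewrite expr2 ler_piMr.
rewrite exprMn; set dd := (t' - t) ^+ 2; clear B0 k0 h eB; nra.
Qed.
(** Euler expansion of the solution over [[t, t']]: the remainder splits into a
    part [rJ] of order [d] in L2 that is orthogonal to the past, and a part
    [rD] of order [d ^ (3/2)] in L1. *)
Lemma euler_expansion : exists C : R, 0 <= C /\ forall t t' : R, 0 <= t -> t < t' -> t' <= 1 ->
  exists rJ rD : T -> R,
  [/\ {ae P, forall w, X t' w = X t w + (sg (X t w) * (W t' w - W t w) + bt (X t w) * (t' - t))
                         + rJ w + rD w},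
      sqint P rJ /\ \int[P]_w (rJ w ^+ 2) <= C * (t' - t) ^+ 2,
      forall (xi : T -> R) (Mx : R), knows F t xi -> (forall w, `|xi w| <= Mx) -> \int[P]_w (xi w * rJ w) = 0 &
      integ rD /\ \int[P]_w `|rD w| <= C * ((t' - t) * Num.sqrt (t' - t))].
Proof.
(* the constant of [X_increment_sqr] *)
pose C1 := 30 * K ^+ 2.
have C10 : 0 <= C1 by rewrite mulr_ge0// sqr_ge0.
exists (9 * (K ^+ 2 * C1) + K * (1 + C1)); split.
  by rewrite addr_ge0// ?mulr_ge0 ?sqr_ge0 ?addr_ge0 ?K0.
move=> t t' t0 tt' t'1; have tt := ltW tt'.
have s1 : 0 <= t' <= 1 by rewrite (le_trans t0).
have s2 : 0 <= t <= 1 by rewrite t0 (le_trans tt).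
set e := t' - t; have e0 : 0 < e by rewrite subr_gt0.
set r := Num.sqrt e; have r0 : 0 < r by rewrite sqrtr_gt0.
have rE : r ^+ 2 = e by rewrite sqr_sqrtr// ltW.
have [J [J' [iJ iJ' eX]]] := sde_increment t0 tt t'1.
have msg := measurable_gX sg_continuous.
have mX := jointly_measurable_X.
pose eta w := sg (X t w).
have keta : knows F t eta.
  apply: (knows_comp (f := sg)); last exact: (knows_X t0 (lexx _) (le_trans tt t'1)).
  apply: continuous_measurable_fun; exact: sg_continuous.
have beta w : `|eta w| <= K by exact: vol_le.
have mXt : measurable_fun [set: T] (X t) by exact: measurable_X.
have mXX : measurable_fun [set: T * R] (fun z : T * R => X z.2 z.1 - X t z.1).
  by apply: measurable_funB => //; exact: (measurableT_comp mXt measurable_fst).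
have hZ : (\int[P]_w \int[leb]_(s in `]t, t']) ((X s w - X t w) ^+ 2)%:E <= (C1 * e * e)%:E)%E.
  apply: (time_scenario_le (f := fun z => X z.2 z.1 - X t z.1)) => //.
    by rewrite mulr_ge0// ltW.
  move=> s /andP[ts st']; apply: le_trans (X_increment_sqr t0 (ltW ts) (le_trans st' t'1)) _.
  by rewrite lee_fin -/C1 ler_wpM2l// lerD2r.
have eB : (increment_error P t t' (fun s w => sg (X s w)) eta <= (K ^+ 2 * (C1 * e) * e)%:E)%E.
  apply: (time_scenario_le (f := fun z => sg (X z.2 z.1) - eta z.1)) => //.
  - by rewrite mulr_ge0 ?sqr_ge0// mulr_ge0// ltW.
  - apply: measurable_funB => //.
    exact: (measurableT_comp (knows_measurable filt t0 keta) measurable_fst).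
  move=> s /andP[ts st'].
  apply: (@le_trans _ _ ((K ^+ 2)%:E * (\int[P]_w ((X s w - X t w) ^+ 2)%:E))%E).
    have mXs : measurable_fun [set: T] (X s).
      by apply: measurable_X; rewrite (le_trans t0 (ltW ts)) (le_trans st').
    have m1 : measurable_fun [set: T] (fun w => ((X s w - X t w) ^+ 2)%:E).
      by apply/measurable_EFinP/measurable_funX/measurable_funB.
    rewrite -ge0_integralZl//; last 2 first.
    + by move=> w _; rewrite lee_fin sqr_ge0.
    + by rewrite lee_fin sqr_ge0.
    apply: ge0_le_integral => //.
    + by move=> w _; rewrite lee_fin sqr_ge0.
    + apply/measurable_EFinP/measurable_funX/measurable_funB => //.
        exact: (measurable_fun_pair1 s msg).
      exact: (knows_measurable filt t0 keta).
    + exact: emeasurable_funM.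
    move=> w _; rewrite -EFinM lee_fin -exprMn.
    rewrite -(real_normK (num_real (_ - _))) -[leRHS](real_normK (num_real _)).
    rewrite lerXn2r ?nnegrE// normrM (ger0_norm K0); exact: sg_lip.
  rewrite [X in (_ <= X)%E]EFinM; apply: lee_wpmul2l; first by rewrite lee_fin sqr_ge0.
  apply: le_trans (X_increment_sqr t0 (ltW ts) (le_trans st' t'1)) _.
  by rewrite lee_fin -/C1 ler_wpM2l// lerD2r.
have fB : (increment_error P t t' (fun s w => sg (X s w)) eta < +oo)%E.
  by rewrite (le_lt_trans eB)// ltry.
pose rJ w := J' w - J w - eta w * (W t' w - W t w).
have qJ : sqint P rJ := sqint_ito_increment filt bm t0 tt msg iJ iJ' keta beta fB.
have hJ := ito_increment_sqr filt bm t0 tt msg iJ iJ' keta beta.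
have hJ2 : \int[P]_w (rJ w ^+ 2) <= 9 * (K ^+ 2 * C1) * e ^+ 2.
  rewrite -lee_fin -integral_EFin_Rintegral; last exact: qJ.2.
  apply: (le_trans hJ); apply: (le_trans (lee_wpmul2l _ eB)); first by rewrite lee_fin.
  by rewrite -EFinM lee_fin le_eqVlt; apply/orP; left; apply/eqP; ring.
have mbt : measurable_fun [set: T] (fun w => bt (X t w)).
  by apply: (measurableT_comp _ mXt); apply: continuous_measurable_fun; exact: bt_continuous.
pose rD w := X t' w - X t w - (eta w * (W t' w - W t w) + bt (X t w) * e) - rJ w.
have mrD : measurable_fun [set: T] rD.
  apply: measurable_funB; last exact: qJ.1.
  apply: measurable_funB; first by apply: measurable_funB => //; exact: measurable_X.
  apply: measurable_funD; last exact: measurable_funM.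
  apply: measurable_funM; first exact: (knows_measurable filt t0 keta).
  by apply: (measurable_increment filt bm) => //; rewrite (le_trans t0).
have pI (f : R -> R) w : continuous f -> leb.-integrable `]t, t'] (EFin \o (fun s => f (X s w))).
  move=> cf; apply: integrableS (path_integrable w t t' cf) => //; exact: subset_itv_oc_cc.
pose z w := \int[leb]_(s in `]t, t']) ((X s w - X t w) ^+ 2).
have iz w : leb.-integrable `]t, t'] (fun s => ((X s w - X t w) ^+ 2)%:E).
  apply: (pI (fun x => (x - X t w) ^+ 2)) => x.
  by apply: cvgM; apply: cvgB; try exact: cvg_cst; exact: cvg_id.
have zE w : (z w)%:E = (\int[leb]_(s in `]t, t']) ((X s w - X t w) ^+ 2)%:E)%E.
  by rewrite /z /Rintegral fineK//; apply: integrable_fin_num.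
have z0 w : 0 <= z w by rewrite -lee_fin zE; apply: integral_ge0 => s _; rewrite lee_fin sqr_ge0.
have mz : measurable_fun [set: T] z.
  apply/measurable_EFinP; rewrite (_ : _ \o _ = fun w => (z w)%:E)//.
  under eq_fun do rewrite zE integral_mkcond.
  apply: (@measurable_fun_fubini_tonelli_F _ _ _ _ R leb
    (fun y : T * R => ((fun s => ((X s y.1 - X t y.1) ^+ 2)%:E) \_ `]t, t']) y.2)); last first.
    by move=> y; rewrite patchE; case: ifP; rewrite ?lee_fin ?sqr_ge0.
  rewrite (_ : (fun y => _) = (fun y : T * R => (\1_(`]t, t']) y.2 * (X y.2 y.1 - X t y.1) ^+ 2)%:E)).
    apply/measurable_EFinP/measurable_funM; last exact: measurable_funX.
    have mI : measurable_fun [set: R] (\1_(`]t, t']) : R -> R) by apply: measurable_indic; exact: measurable_itv.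
    exact: (measurableT_comp mI measurable_snd).
  by apply/funext => y; rewrite patchE indicE; case: ifP; rewrite ?mul1r ?mul0r.
have Ez : (\int[P]_w (z w)%:E <= (C1 * e * e)%:E)%E by under eq_integral do rewrite zE.
have igz : integ z.
  apply/integrableP; split; first exact/measurable_EFinP.
  under eq_integral do rewrite gee0_abs ?lee_fin//.
  by rewrite (le_lt_trans Ez)// ltry.
have Ez' : \int[P]_w z w <= C1 * e * e by rewrite -lee_fin -integral_EFin_Rintegral.
have lebD : fine (leb `]t, t']%classic) = e.
  by rewrite [X in fine X](@lebesgue_measure_itv R) /= lte_fin tt'.
have brD : {ae P, forall w, `|rD w| <= K * (e * r + z w / r)}.
  apply: filterS eX => w ex.
  have -> : rD w = \int[leb]_(s in `]t, t']) (bt (X s w) - bt (X t w)).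
    rewrite RintegralB//; last 2 first.
    - exact: pI bt_continuous.
    - by apply: (pI (fun=> bt (X t w)) w); exact: cst_continuous.
    rewrite Rintegral_cst// lebD /rD ex /rJ; ring.
  have mI : measurable (`]t, t']%classic : set (measurableTypeR R)) by exact: measurable_itv.
  have h1 : leb.-integrable `]t, t'] (EFin \o (fun s => bt (X s w) - bt (X t w))).
    apply: (pI (fun x => bt x - bt (X t w))) => x.
    by apply: cvgB; [exact: bt_continuous|exact: cvg_cst].
  apply: le_trans (le_normr_Rintegral mI h1) _.
  have h2 : leb.-integrable `]t, t'] (EFin \o (fun s => K * (r + (X s w - X t w) ^+ 2 / r))).
    apply: (pI (fun x => K * (r + (x - X t w) ^+ 2 / r))) => x.
    apply: cvgM; first exact: cvg_cst.
    apply: cvgD; first exact: cvg_cst.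
    by apply: cvgM; [apply: cvgM; apply: cvgB; try exact: cvg_cst; exact: cvg_id|exact: cvg_cst].
  apply: (@le_trans _ _ (\int[leb]_(s in `]t, t']) (K * (r + (X s w - X t w) ^+ 2 / r)))).
    apply: le_Rintegral => //; first exact: (integrable_abse h1).
    move=> s _; rewrite (le_trans (bt_lip _ _))// ler_wpM2l ?K0//.
    by have := young_mul 1 (X s w - X t w) r0; rewrite normr1 mul1r expr1n mulr1 [r^-1 * _]mulrC.
  have ir : leb.-integrable `]t, t'] (EFin \o (fun=> r)).
    by apply: (pI (fun=> r) w); exact: cst_continuous.
  have izr : leb.-integrable `]t, t'] (EFin \o (fun s => (X s w - X t w) ^+ 2 / r)).
    exact: (integrableZr mI _ (iz w)).
  rewrite RintegralZl//; last exact: (integrableD mI ir izr).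
  rewrite RintegralD//.
  have -> : \int[leb]_(s in `]t, t']) ((X s w - X t w) ^+ 2 / r) = z w / r.
    exact: (RintegralZr r^-1 mI (iz w)).
  by rewrite Rintegral_cst// lebD [r * e]mulrC.
have ibd : integ (fun w => K * (e * r + z w / r)).
  apply: integrableZ_EFin; apply: integrableD_EFin.
    by apply: (@integrable_bounded _ _ _ P (fun=> e * r) `|e * r|).
  by apply: (eq_integ (g := fun w => r^-1 * z w)) => [w|]; [rewrite mulrC|exact: integrableZ_EFin].
exists rJ, rD; split.
- by apply/aeW => w; rewrite /rD /eta; ring.
- split => //; apply: (le_trans hJ2); rewrite ler_wpM2r ?sqr_ge0// lerDl.
  by rewrite mulr_ge0 ?K0// addr_ge0.
- move=> xi Mx kxi bxi.
  exact: (ito_increment_orthogonal filt bm t0 tt msg iJ iJ' keta beta fB kxi bxi).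
have irD : integ rD := integrable_ae_dominated mrD ibd brD.
split => //.
have := @ler_norm_Rintegral _ _ _ P (fun w => `|rD w|) (fun w => K * (e * r + z w / r)) _ ibd _.
rewrite ger0_norm; last by apply: Rintegral_ge0.
move=> h; apply: (le_trans (h _ _)).
- exact: measurableT_comp.
- by apply: filterS brD => w; rewrite normr_id.
rewrite RintegralZl//; last first.
  apply: integrableD_EFin.
    by apply: (@integrable_bounded _ _ _ P (fun=> e * r) `|e * r|).
  by apply: (eq_integ (g := fun w => r^-1 * z w)) => [w|]; [rewrite mulrC|exact: integrableZ_EFin].
rewrite RintegralD//; last 2 first.
- by apply: (@integrable_bounded _ _ _ P (fun=> e * r) `|e * r|).
- by apply: (eq_integ (g := fun w => r^-1 * z w)) => [w|]; [rewrite mulrC|exact: integrableZ_EFin].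
rewrite Rintegral_cst1 RintegralZr//.
apply: (@le_trans _ _ (K * (1 + C1) * (e * r))); last first.
  have er0 : 0 <= e * r by rewrite ltW// mulr_gt0.
  by rewrite ler_wpM2r// lerDr mulr_ge0// mulr_ge0// sqr_ge0.
have -> : K * (1 + C1) * (e * r) = K * (e * r + C1 * e * r) by ring.
rewrite ler_wpM2l ?K0// lerD2l ler_pdivrMr//.
by rewrite -(mulrA _ r r) -expr2 rE.
Qed.

Lemma measurable_Q tau z : 0 < tau -> measurable_fun [set: R] (Q M tau z).
Proof.
move=> t0; apply: continuous_measurable_fun.
by apply: (is_derive1_continuous (df := Q1 M tau z)) => x; exact: Q_der.
Qed.

(** Short-time comparison: the semigroup of the diffusion moves [Q] along its
    time parameter, up to a relative error governed by the potential. *)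
Lemma one_step eps z : 0 < eps -> exists C, 0 <= C /\ forall tau t t' (xi : T -> R),
  0 <= t -> t < t' -> t' <= 1 -> eps <= tau -> tau + (t' - t) <= eps + 1 ->
  knows F t xi -> (forall w, 0 <= xi w <= 1) ->
  `|\int[P]_w (xi w * Q M tau z (X t' w)) - \int[P]_w (xi w * Q M (tau + (t' - t)) z (X t w))|
  <= CV K alpha * (t' - t) * \int[P]_w (xi w * Q M tau z (X t w))
     + C * ((t' - t) * Num.sqrt (t' - t)).
Proof.
move=> eps0.
have [Ce [Ce0 hE]] := Q_euler_step M z eps0.
have [B0 hB0] := Q_bounded M z eps0.
have [B1 hB1] := Q1_bounded M z eps0.
have [B2 hB2] := Q2_bounded M z eps0.
have [Cs [Cs0 hS]] := euler_expansion.
have r0 : eps <= eps <= eps + 1 by rewrite lexx lerDl ler01.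
have B00 : 0 <= B0 := le_trans (normr_ge0 _) (hB0 eps 0 r0).
have B10 : 0 <= B1 := le_trans (normr_ge0 _) (hB1 eps 0 r0).
have B20 : 0 <= B2 := le_trans (normr_ge0 _) (hB2 eps 0 r0).
exists (Ce + (B1 * Cs + B2 * Cs + B2 * (4 * K ^+ 2 + Cs))); split.
  have k2 := sqr_ge0 K; have k1 := K0; do ?[apply: addr_ge0 | apply: mulr_ge0] => //.
move=> tau t t' xi t0 tt' t'1 taue taud kxi bxi.
have tt := ltW tt'; have t1 := le_trans tt t'1; have t'0 := le_trans t0 tt.
set e := t' - t in taud *; have e0 : 0 < e by rewrite subr_gt0.
have e1 : e <= 1 by rewrite lerBlDr (le_trans t'1)// lerDl.
set r := Num.sqrt e; have r0' : 0 < r by rewrite sqrtr_gt0.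
have rE : r ^+ 2 = e by rewrite sqr_sqrtr// ltW.
have tau0 : 0 < tau := lt_le_trans eps0 taue.
have rt : eps <= tau <= eps + 1 by rewrite taue (le_trans _ taud)// lerDl ltW.
have taue0 : 0 < tau + e by rewrite addr_gt0.
have [rJ [rD [eX [qJ eJ] oJ [iD eD]]]] := hS t t' t0 tt' t'1.
have mxi := knows_measurable filt t0 kxi.
have xi1 w : `|xi w| <= 1 by have /andP[? ?] := bxi w; rewrite ger0_norm.
have mXt : measurable_fun [set: T] (X t) by apply: measurable_X; rewrite t0.
have mXt' : measurable_fun [set: T] (X t') by apply: measurable_X; rewrite t'0.
have mQ := measurable_Q z tau0; have mQe := measurable_Q z taue0.
have mQ1 : measurable_fun [set: R] (Q1 M tau z).
  apply: continuous_measurable_fun.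
  by apply: (is_derive1_continuous (df := Q2 M tau z)) => x; exact: Q1_der.
pose D w := W t' w - W t w.
have qD : sqint P D := sqint_increment filt bm t0 tt.
pose Y w := sg (X t w) * D w + bt (X t w) * e.
have msg : measurable_fun [set: T] (fun w => sg (X t w)).
  by apply: (measurableT_comp _ mXt); apply: continuous_measurable_fun; exact: sg_continuous.
have mbt : measurable_fun [set: T] (fun w => bt (X t w)).
  by apply: (measurableT_comp _ mXt); apply: continuous_measurable_fun; exact: bt_continuous.
have mY : measurable_fun [set: T] Y.
  by apply: measurable_funD; apply: measurable_funM => //; exact: qD.1.
have mXY : measurable_fun [set: T] (fun w => X t w + Y w) by exact: measurable_funD.
have cmp (f : R -> R) (Z : T -> R) : measurable_fun [set: R] f -> measurable_fun [set: T] Z ->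
  measurable_fun [set: T] (fun w => f (Z w)) by move=> mf mZ; exact: (measurableT_comp mf mZ).
have ib (f : R -> R) (Z : T -> R) C : measurable_fun [set: R] f -> measurable_fun [set: T] Z ->
    (forall x, `|f x| <= C) -> integ (fun w => xi w * f (Z w)).
  move=> mf mZ fC; apply: (@integrable_bounded _ _ _ P _ C).
    by apply: measurable_funM => //; exact: cmp.
  by move=> w; rewrite normrM -[C]mul1r ler_pM.
have i1 := ib _ _ _ mQ mXt' (fun x => hB0 tau x rt).
have i2 := ib _ _ _ mQ mXY (fun x => hB0 tau x rt).
have i3 := ib _ _ _ mQ mXt (fun x => hB0 tau x rt).
have i4 : integ (fun w => xi w * Q M (tau + e) z (X t w)).
  apply: (ib _ _ B0 mQe mXt) => x; apply: hB0.
  by rewrite taud (le_trans taue)// lerDl ltW.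
have i5 : integ (fun w => xi w * Q1 M tau z (X t w) * rJ w).
  apply: sqint_integrable; apply: (sqint_mulb (M := B1)) => //.
    by apply: measurable_funM => //; exact: cmp.
  by move=> w; rewrite normrM -[B1]mul1r ler_pM// hB1.
have z5 : \int[P]_w (xi w * Q1 M tau z (X t w) * rJ w) = 0.
  apply: (oJ (fun w => xi w * Q1 M tau z (X t w)) B1).
    apply: knows_mul => //; apply: (knows_comp mQ1); exact: knows_X.
  by move=> w; rewrite normrM -[B1]mul1r ler_pM// hB1.
have hA : `|\int[P]_w (xi w * Q M tau z (X t' w)) - \int[P]_w (xi w * Q M tau z (X t w + Y w))|
    <= (B1 * Cs + B2 * Cs + B2 * (4 * K ^+ 2 + Cs)) * (e * r).
  pose g w := B1 * `|rD w| + B2 * rJ w ^+ 2 + B2 * (r * (2 * K ^+ 2 * (D w ^+ 2 + e ^+ 2)) + r^-1 * rJ w ^+ 2).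
  have igD : integ (fun w => r * (2 * K ^+ 2 * (D w ^+ 2 + e ^+ 2))).
    apply: integrableZ_EFin; apply: integrableZ_EFin; apply: integrableD_EFin; first exact: qD.2.
    by apply: (@integrable_bounded _ _ _ P (fun=> e ^+ 2) `|e ^+ 2|).
  have iJ : integ (fun w => r^-1 * rJ w ^+ 2) by apply: integrableZ_EFin; exact: qJ.2.
  have iJ' : integ (fun w => B2 * rJ w ^+ 2) by apply: integrableZ_EFin; exact: qJ.2.
  have iD' : integ (fun w => B1 * `|rD w|) by apply: integrableZ_EFin; exact: (integrable_abse iD).
  have ilast : integ (fun w => B2 * (r * (2 * K ^+ 2 * (D w ^+ 2 + e ^+ 2)) + r^-1 * rJ w ^+ 2)).
    by apply: integrableZ_EFin; exact: integrableD_EFin.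
  have ig : integ g by apply: integrableD_EFin => //; exact: integrableD_EFin.
  have i12 := integrableB_EFin i1 i2.
  have -> : \int[P]_w (xi w * Q M tau z (X t' w)) - \int[P]_w (xi w * Q M tau z (X t w + Y w)) =
    \int[P]_w ((xi w * Q M tau z (X t' w) - xi w * Q M tau z (X t w + Y w))
       - xi w * Q1 M tau z (X t w) * rJ w).
    by rewrite RintegralB// z5 subr0 RintegralB.
  apply: (@le_trans _ _ (\int[P]_w g w)).
    apply: ler_norm_Rintegral => //.
      exact: (integrable_measurable (integrableB_EFin (integrableB_EFin i1 i2) i5)).
    apply: filterS eX => w ->; rewrite /g -/(D w) -/(Y w).
    set x := X t w; set y := Y w; set j := rJ w; set u := rD w.
    have -> : xi w * Q M tau z (x + y + j + u) - xi w * Q M tau z (x + y) - xi w * Q1 M tau z x * j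
      = xi w * ((Q M tau z (x + y + j + u) - Q M tau z (x + y + j))
      + (Q M tau z (x + y + j) - Q M tau z (x + y) - Q1 M tau z (x + y) * j)
      + (Q1 M tau z (x + y) - Q1 M tau z x) * j) by ring.
    rewrite normrM -[leRHS]mul1r ler_pM//.
    rewrite (le_trans (ler_normD _ _))// lerD//.
      rewrite (le_trans (ler_normD _ _))// lerD//.
        have := bounded_derive_lip (fun x => @Q_der _ _ _ M tau z x tau0) (fun x => hB1 tau x rt) (x + y + j) (x + y + j + u).
        by rewrite (_ : x + y + j + u - (x + y + j) = u)//; ring.
      have := taylor2 (x + y) (fun x => @Q_der _ _ _ M tau z x tau0) (fun x => @Q1_der _ _ _ M tau z x tau0) (fun x => hB2 tau x rt) j.
      by rewrite real_normK ?num_real.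
    rewrite normrM.
    have h1 : `|Q1 M tau z (x + y) - Q1 M tau z x| <= B2 * `|y|.
      have := bounded_derive_lip (fun x => @Q1_der _ _ _ M tau z x tau0) (fun x => hB2 tau x rt) x (x + y).
      by rewrite (_ : x + y - x = y)//; ring.
    apply: (le_trans (ler_wpM2r (normr_ge0 _) h1)).
    rewrite -(mulrA B2 `|y|) ler_wpM2l//.
    have h2 : y ^+ 2 <= 2 * K ^+ 2 * (D w ^+ 2 + e ^+ 2).
      rewrite /y /Y; have b1 : sg x ^+ 2 <= K ^+ 2.
        by rewrite -(real_normK (num_real (sg x))) lerXn2r ?nnegrE ?K0// vol_le.
      have b2 : bt x ^+ 2 <= K ^+ 2.
        by rewrite -(real_normK (num_real (bt x))) lerXn2r ?nnegrE ?K0// drift_le.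
      rewrite -/x; apply: (@le_trans _ _ (2 * (sg x ^+ 2 * D w ^+ 2) + 2 * (bt x ^+ 2 * e ^+ 2))).
        by rewrite -!exprMn sqrD_le.
      by rewrite mulrDr -!(mulrA 2) lerD// ler_wpM2l// ler_wpM2r ?sqr_ge0.
    have h3 := young_mul y j r0'.
    by apply: (le_trans h3); rewrite lerD2r ler_wpM2l// ltW.
  have eD2 : \int[P]_w (D w ^+ 2) = e.
    have k1 : knows F t (fun=> 1 : R) by exact: knows_cst.
    have := increment_variance_le filt bm t0 tt k1.
    have j1 : integ (fun=> 1) by apply: (@integrable_bounded _ _ _ P (fun=> 1) 1) => // w; rewrite normr1.
    by move=> /(_ j1); under eq_Rintegral do rewrite mul1r; rewrite Rintegral_cst1 mul1r.
  have ie2 : integ (fun=> e ^+ 2) by apply: (@integrable_bounded _ _ _ P (fun=> e ^+ 2) `|e ^+ 2|).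
  have iDe : integ (fun w => D w ^+ 2 + e ^+ 2) := integrableD_EFin qD.2 ie2.
  have iDe2 : integ (fun w => 2 * K ^+ 2 * (D w ^+ 2 + e ^+ 2)) := integrableZ_EFin _ iDe.
  have q1 : \int[P]_w g w = \int[P]_w (B1 * `|rD w| + B2 * rJ w ^+ 2) +
      \int[P]_w (B2 * (r * (2 * K ^+ 2 * (D w ^+ 2 + e ^+ 2)) + r^-1 * rJ w ^+ 2)).
    exact: (RintegralD measurableT (integrableD_EFin iD' iJ') ilast).
  have q2 : \int[P]_w (B1 * `|rD w| + B2 * rJ w ^+ 2) = B1 * \int[P]_w `|rD w| + B2 * \int[P]_w (rJ w ^+ 2).
    rewrite (RintegralD measurableT iD' iJ').
    by rewrite (RintegralZl B1 measurableT (integrable_abse iD)) (RintegralZl B2 measurableT qJ.2).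
  have q3 : \int[P]_w (B2 * (r * (2 * K ^+ 2 * (D w ^+ 2 + e ^+ 2)) + r^-1 * rJ w ^+ 2)) =
      B2 * (r * (2 * K ^+ 2 * (e + e ^+ 2)) + r^-1 * \int[P]_w (rJ w ^+ 2)).
    rewrite (RintegralZl B2 measurableT (integrableD_EFin igD iJ)) (RintegralD measurableT igD iJ).
    rewrite (RintegralZl r measurableT iDe2) (RintegralZl (2 * K ^+ 2) measurableT iDe).
    by rewrite (RintegralD measurableT qD.2 ie2) Rintegral_cst1 eD2 (RintegralZl r^-1 measurableT qJ.2).
  rewrite q1 q2 q3.
  have er : e ^+ 2 <= e * r.
    rewrite expr2 ler_wpM2l ?(ltW e0)// -rE expr2 ler_piMr ?(ltW r0')//.
    by rewrite -[leRHS]sqrtr1 ler_sqrt.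
  have e2r : r^-1 * e ^+ 2 = e * r by rewrite -rE; field; rewrite gt_eqF.
  move: eJ eD; rewrite -/e -/r.
  set iJ2 := Rintegral _ _ _; set iDD := Rintegral _ _ _ => eJ eD.
  have b1 : B1 * iDD <= B1 * (Cs * (e * r)) by rewrite ler_wpM2l.
  have b2 : B2 * iJ2 <= B2 * (Cs * (e * r)).
    by rewrite ler_wpM2l// (le_trans eJ)// ler_wpM2l.
  have b3 : B2 * (r * (2 * K ^+ 2 * (e + e ^+ 2)) + r^-1 * iJ2) <= B2 * (4 * K ^+ 2 * (e * r) + Cs * (e * r)).
    rewrite ler_wpM2l// lerD//.
      have -> : 4 * K ^+ 2 * (e * r) = r * (2 * K ^+ 2 * (e + e)) by ring.
      have kk0 : 0 <= 2 * K ^+ 2 by rewrite mulr_ge0// sqr_ge0.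
      apply: (ler_wpM2l (ltW r0')); apply: (ler_wpM2l kk0); rewrite lerD2l.
      by rewrite expr2 ler_piMr// ltW.
    by rewrite -e2r mulrCA ler_wpM2l// invr_ge0 ltW.
  by apply: (le_trans (lerD (lerD b1 b2) b3)); rewrite le_eqVlt; apply/orP; left; apply/eqP; ring.
pose I x := \int[leb]_v (Q M tau z (x + (sg x * v + bt x * e)) * gk e v).
have mG : measurable_fun [set: (R * R) * R] (fun y : (R * R) * R =>
    (`|y.1.1| * Q M tau z (y.1.2 + (sg y.1.2 * y.2 + bt y.1.2 * e)))%:E).
  apply/measurable_EFinP; apply: measurable_funM.
    by apply: measurableT_comp => //; exact: (measurableT_comp measurable_fst measurable_fst).
  apply: (measurableT_comp mQ).
  have m12 : measurable_fun [set: (R * R) * R] (fun y : (R * R) * R => y.1.2).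
    exact: (measurableT_comp measurable_snd measurable_fst).
  apply: measurable_funD => //; apply: measurable_funD; apply: measurable_funM => //.
    by apply: (measurableT_comp _ m12); apply: continuous_measurable_fun; exact: sg_continuous.
  by apply: (measurableT_comp _ m12); apply: continuous_measurable_fun; exact: bt_continuous.
have G0 (y : (R * R) * R) : (0 <= (`|y.1.1| * Q M tau z (y.1.2 + (sg y.1.2 * y.2 + bt y.1.2 * e)))%:E)%E.
  by rewrite lee_fin mulr_ge0// ltW// Q_gt0.
have kp : knows F t (fun w => (xi w, X t w)) by apply: knows_pair => //; exact: knows_X.
have iQg x : leb.-integrable [set: R] (fun v => (Q M tau z (x + (sg x * v + bt x * e)) * gk e v)%:E).
  apply: (integrable_mul_gk (C := B0) (c := 0)) => //.
    apply: (measurableT_comp mQ); apply: measurable_funD => //; exact: measurable_funD.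
  by move=> v; rewrite mul0r expR0 mulr1; exact: hB0.
have inner w : (\int[leb]_v ((`|xi w| * Q M tau z (X t w + (sg (X t w) * v + bt (X t w) * e)))%:E * (gk e v)%:E)
    = (xi w * I (X t w))%:E)%E.
  have /andP[x0 _] := bxi w.
  rewrite EFinM /I /Rintegral fineK; last exact: integrable_fin_num.
  rewrite -ge0_integralZl//.
  - by apply: eq_integral => v _; rewrite ger0_norm// -[LHS]EFinM -[RHS]EFinM -[in LHS](mulrA (xi w)).
  - exact: measurable_int (iQg _).
  - by move=> v _; rewrite lee_fin; apply: mulr_ge0; [exact: ltW (Q_gt0 _ _ _ tau0)|exact: gk_ge0].
have hX := ge0_expectation_increment filt bm t0 tt' kp mG G0.
have E2 : (\int[P]_w (xi w * Q M tau z (X t w + Y w))%:E = \int[P]_w (xi w * I (X t w))%:E)%E.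
  transitivity (\int[P]_w (`|xi w| * Q M tau z (X t w + Y w))%:E)%E.
    by apply: eq_integral => w _; have /andP[? _] := bxi w; rewrite ger0_norm.
  by apply: (etrans hX); apply: eq_integral => w _; exact: inner.
have mI : measurable_fun [set: T] (fun w => xi w * I (X t w)).
  apply/measurable_EFinP; rewrite (_ : _ \o _ = fun w => (xi w * I (X t w))%:E)//.
  under eq_fun do rewrite -inner.
  apply: (@measurable_fun_fubini_tonelli_F _ _ _ _ R leb (fun y : T * R =>
    ((`|xi y.1| * Q M tau z (X t y.1 + (sg (X t y.1) * y.2 + bt (X t y.1) * e)))%:E * (gk e y.2)%:E)%E)); last first.
    by move=> y; rewrite mule_ge0// ?lee_fin ?gk_ge0// mulr_ge0// ltW// Q_gt0.
  apply: emeasurable_funM; last first.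
    by apply: (measurableT_comp (emeasurable_gk e)); exact: measurable_snd.
  have mp : measurable_fun [set: T * R] (fun y : T * R => ((xi y.1, X t y.1), y.2)).
    apply: measurable_fun_pair; last exact: measurable_snd.
    by apply: measurable_fun_pair; [exact: (measurableT_comp mxi measurable_fst)|exact: (measurableT_comp mXt measurable_fst)].
  exact: (measurableT_comp mG mp).
have hI x : `|I x - Q M (tau + e) z x| <= CV K alpha * e * Q M tau z x + Ce * (e * r).
  exact: hE.
have i6 : integ (fun w => CV K alpha * e * (xi w * Q M tau z (X t w)) + Ce * (e * r)).
  apply: integrableD_EFin; first exact: integrableZ_EFin.
  by apply: (@integrable_bounded _ _ _ P (fun=> Ce * (e * r)) `|Ce * (e * r)|).
have i7 : integ (fun w => xi w * I (X t w) - xi w * Q M (tau + e) z (X t w)).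
  apply: (integrable_dominated _ i6).
    by apply: measurable_funB => //; exact: integrable_measurable i4.
  move=> w; rewrite -mulrBr normrM; have /andP[x0 x1] := bxi w; rewrite (ger0_norm x0).
  apply: (le_trans (ler_wpM2l x0 (hI _))); rewrite mulrDr mulrCA lerD//.
  by rewrite ler_piMl// mulr_ge0// mulr_ge0// ltW.
have i8 : integ (fun w => xi w * I (X t w)).
  by apply: (eq_integ _ (integrableD_EFin i7 i4)) => w; rewrite subrK.
have hB : `|\int[P]_w (xi w * Q M tau z (X t w + Y w)) - \int[P]_w (xi w * Q M (tau + e) z (X t w))|
    <= CV K alpha * e * \int[P]_w (xi w * Q M tau z (X t w)) + Ce * (e * r).
  have -> : \int[P]_w (xi w * Q M tau z (X t w + Y w)) = \int[P]_w (xi w * I (X t w)).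
    by apply: EFin_inj; rewrite -!integral_EFin_Rintegral.
  rewrite -RintegralB//.
  have -> : CV K alpha * e * \int[P]_w (xi w * Q M tau z (X t w)) + Ce * (e * r) =
    \int[P]_w (CV K alpha * e * (xi w * Q M tau z (X t w)) + Ce * (e * r)).
    rewrite RintegralD//; last 2 first.
    - exact: integrableZ_EFin.
    - by apply: (@integrable_bounded _ _ _ P (fun=> Ce * (e * r)) `|Ce * (e * r)|).
    by rewrite Rintegral_cst1 RintegralZl.
  apply: ler_norm_Rintegral => //; first exact: integrable_measurable i7.
  apply: aeW => w; rewrite -mulrBr normrM; have /andP[x0 x1] := bxi w; rewrite (ger0_norm x0).
  apply: (le_trans (ler_wpM2l x0 (hI _))); rewrite mulrDr mulrCA lerD//.
  by rewrite ler_piMl// mulr_ge0// mulr_ge0// ltW.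
rewrite -(subrKA (\int[P]_w (xi w * Q M tau z (X t w + Y w)))).
apply: (le_trans (ler_normD _ _)); apply: (le_trans (lerD hA hB)).
by rewrite le_eqVlt; apply/orP; left; apply/eqP; ring.
Qed.

Lemma CV_ge0 : 0 <= CV K alpha.
Proof. exact: le_trans (normr_ge0 _) (pot_le M 0). Qed.

Lemma integ_xiQ tau z s (xi : T -> R) : 0 < tau -> 0 <= s <= 1 -> measurable_fun [set: T] xi ->
  (forall w, 0 <= xi w <= 1) -> integ (fun w => xi w * Q M tau z (X s w)).
Proof.
move=> t0 s01 mxi bxi; have [C hC] := Q_bounded M z t0.
have mQX : measurable_fun [set: T] (fun w => Q M tau z (X s w)).
  exact: (measurableT_comp (measurable_Q z t0) (measurable_X s01)).
apply: (@integrable_bounded _ _ _ P _ C); first exact: measurable_funM.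
move=> w; rewrite normrM -[C]mul1r ler_pM//.
  by have /andP[? ?] := bxi w; rewrite ger0_norm.
by apply: hC; rewrite lexx lerDl ler01.
Qed.

(** Short steps are iterated. The errors of order [h ^ (3/2)] of the steps sum
    to a quantity that vanishes with their length [h], and only the factor
    [expR (2 * CV * (t' - t))] remains; it depends on the bounds of the
    coefficients alone, because no derivative of [Q] enters it. *)
Lemma kernel_comparison eps z t t' (xi : T -> R) : 0 < eps -> 0 <= t -> t <= t' -> t' <= 1 ->
  knows F t xi -> (forall w, 0 <= xi w <= 1) ->
  let A := \int[P]_w (xi w * Q M eps z (X t' w)) in
  let B := \int[P]_w (xi w * Q M (eps + (t' - t)) z (X t w)) in
  A <= expR (2 * CV K alpha * (t' - t)) * B /\ B <= expR (2 * CV K alpha * (t' - t)) * A.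
Proof.
move=> eps0 t0 tt' t'1 kxi bxi A B; set D := t' - t.
have c0 := CV_ge0; set c := CV K alpha in c0 *.
move: tt'; rewrite le_eqVlt => /predU1P[tt'|tt'].
  by rewrite /A /B /D -tt' subrr addr0 mulr0 expR0 mul1r; split.
have D0 : 0 < D by rewrite subr_gt0.
have D1 : D <= 1 by rewrite lerBlDr (le_trans t'1)// lerDl.
have [C1 [C10 h1]] := one_step z eps0.
have [C2 [C20 h2]] := Q_time_lip M z eps0.
have mxi := knows_measurable filt t0 kxi.
pose C := c * C2 + C1; have C_0 : 0 <= C by rewrite addr_ge0// mulr_ge0.
(* With [m] steps of length [h], the value of [xi * Q] changes per step by a
   factor [1 + O(h)] and an error [O(h ^ (3/2))]. *)
have main m : (0 < m)%N -> let h := D / m%:R in c * h <= 1 / 2 ->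
    A <= expR (2 * c * D) * (B + C * Num.sqrt h) /\
    B <= expR (2 * c * D) * (A + 2 * C * Num.sqrt h).
  move=> m0 h ch; have m0' : 0 < m%:R :> R by rewrite ltr0n.
  have mh : m%:R * h = D by rewrite mulrC divfK// gt_eqF.
  have h0 : 0 < h by rewrite divr_gt0.
  have hD : h <= D by rewrite ler_pdivrMr// ler_peMr ?(ltW D0)// ler1n.
  have hle1 := le_trans hD D1.
  pose a j := \int[P]_w (xi w * Q M (eps + (m%:R - j%:R) * h) z (X (t + j%:R * h) w)).
  have jh j : (j <= m)%N -> 0 <= (m%:R - j%:R) * h <= D.
    move=> jm; apply/andP; split; first by rewrite mulr_ge0 ?subr_ge0 ?ler_nat// ltW.
    by rewrite -mh ler_wpM2r ?gerBl// ltW.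
  have tj j : (j <= m)%N -> 0 <= t + j%:R * h <= 1.
    move=> jm; apply/andP; split; first by rewrite addr_ge0// mulr_ge0// ltW.
    apply: le_trans t'1; rewrite -lerBrDl -/D -mh.
    by rewrite ler_wpM2r ?ler_nat// ltW.
  have a0 j : (j <= m)%N -> 0 <= a j.
    move=> jm; apply: Rintegral_ge0 => w _; rewrite mulr_ge0//; first by have /andP[] := bxi w.
    by apply: ltW; apply: Q_gt0; have /andP[? _] := jh j jm; rewrite ltr_wpDr.
  pose e := C * (h * Num.sqrt h).
  have e0 : 0 <= e by rewrite mulr_ge0// mulr_ge0// ltW.
  have hh : h ^+ 2 <= h * Num.sqrt h.
    rewrite expr2 ler_wpM2l ?(ltW h0)//.
    rewrite -[leLHS](sqr_sqrtr (ltW h0)) expr2 ler_piMl//.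
    by rewrite -[leRHS]sqrtr1 ler_sqrt.
  have step j : (j < m)%N -> `|a j.+1 - a j| <= c * h * a j + e.
    move=> jm; pose tau := eps + (m%:R - j.+1%:R) * h.
    have /andP[q1 q2] := jh j.+1 jm.
    have tau0 : 0 < tau by rewrite ltr_wpDr.
    have taue : eps <= tau by rewrite lerDl.
    have tauh : tau + h = eps + (m%:R - j%:R) * h by rewrite /tau -natr1; ring.
    have tauh1 : tau + h <= eps + 1.
      by rewrite tauh lerD2l; have /andP[_ h3] := jh j (ltnW jm); exact: le_trans D1.
    have sh : t + j.+1%:R * h - (t + j%:R * h) = h by rewrite -natr1; ring.
    have /andP[s0 s1] := tj j (ltnW jm); have /andP[s0' s1'] := tj j.+1 jm.
    have tk : t <= t + j%:R * h by rewrite lerDl mulr_ge0// ltW.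
    have := h1 tau (t + j%:R * h) (t + j.+1%:R * h) xi s0.
    rewrite sh -subr_gt0 sh => /(_ h0 s1' taue tauh1 (knows_mono filt t0 tk kxi) bxi).
    rewrite tauh -/(a j) -/(a j.+1) => h3; apply: (le_trans h3).
    have i1 := integ_xiQ z tau0 (tj j (ltnW jm)) mxi bxi.
    have i2 : integ (fun w => xi w * Q M (tau + h) z (X (t + j%:R * h) w)).
      by apply: integ_xiQ => //; [exact: addr_gt0|rewrite s0].
    have : \int[P]_w (xi w * Q M tau z (X (t + j%:R * h) w)) <= a j + C2 * h.
      have -> : a j + C2 * h = \int[P]_w (xi w * Q M (tau + h) z (X (t + j%:R * h) w) + C2 * h).
        rewrite RintegralD//; last by apply: (@integrable_bounded _ _ _ P (fun=> C2 * h) `|C2 * h|).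
        by rewrite Rintegral_cst1 tauh.
      apply: le_Rintegral => //.
        apply: integrableD_EFin => //.
        by apply: (@integrable_bounded _ _ _ P (fun=> C2 * h) `|C2 * h|).
      move=> w _; have /andP[x0 x1] := bxi w.
      have := h2 tau h (X (t + j%:R * h) w) taue (ltW h0) hle1 tauh1.
      rewrite ler_norml => /andP[h4 _].
      have : Q M tau z (X (t + j%:R * h) w) <= Q M (tau + h) z (X (t + j%:R * h) w) + C2 * h.
        by move: h4; move: (Q M tau z _) (Q M (tau + h) z _) (C2 * h) => p q r h4; lra.
      move=> h5; apply: (le_trans (ler_wpM2l x0 h5)); rewrite mulrDr lerD2l ler_piMl//.
      by rewrite mulr_ge0// ltW.
    move=> h4; have h5 := ler_wpM2l (mulr_ge0 c0 (ltW h0)) h4.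
    apply: (le_trans (lerD h5 (lexx _))).
    have h6 : c * C2 * h ^+ 2 <= c * C2 * (h * Num.sqrt h) by rewrite ler_wpM2l// mulr_ge0.
    rewrite /e /C; move: h6; set hs := h * Num.sqrt h => h6.
    have -> : c * h * (a j + C2 * h) = c * h * a j + c * C2 * h ^+ 2 by ring.
    by rewrite -addrA lerD2l (mulrDl _ _ hs) lerD2r.
  have am : a m = A.
    rewrite /a /A; apply: eq_Rintegral => w _; rewrite subrr mul0r addr0 mh.
    by rewrite /D addrC subrK.
  have a_0 : a 0%N = B.
    by rewrite /a /B; apply: eq_Rintegral => w _; rewrite subr0 mh mul0r addr0.
  have eD : m%:R * e = C * D * Num.sqrt h.
    by rewrite /e -mh; ring.
  have CDh : C * D * Num.sqrt h <= C * Num.sqrt h.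
    by rewrite ler_wpM2r// ler_piMr.
  have ch0 : 0 <= c * h by rewrite mulr_ge0// ltW.
  have chm : c * h * m%:R = c * D by rewrite -mh; ring.
  have chm2 : 2 * (c * h) * m%:R = 2 * c * D by rewrite -mh; ring.
  split.
    have := @discrete_gronwall _ a (c * h) e m ch0 e0 (a0 0%N isT).
    rewrite am a_0 eD => h3; apply: (le_trans (h3 _)).
      move=> j jm; have := step j jm; rewrite ler_norml => /andP[_ h4].
      have -> : (1 + c * h) * a j + e = c * h * a j + e + a j by ring.
      by rewrite -lerBlDr.
    rewrite ler_pM ?expR_ge0//.
    - by rewrite -a_0 addr_ge0 ?a0// mulr_ge0// mulr_ge0// ltW.
    - rewrite ler_expR chm -(mulrA 2) ler_peMl ?ler1n//.
      by rewrite mulr_ge0// ltW.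
    - by rewrite lerD2l.
  have := @discrete_gronwall _ (fun j => a (m - j)%N) (2 * (c * h)) (2 * e) m (mulr_ge0 _ ch0) (mulr_ge0 _ e0).
  rewrite subn0 subnn am a_0 => h3; apply: (le_trans (h3 _ _ _ _)) => //.
  - by rewrite -am a0.
  - move=> j jm; have jm' : (m - j.+1 < m)%N by rewrite ltn_subrL.
    have := step _ jm'; rewrite -subSn// subSS ler_norml => /andP[h4 _].
    exact: (reverse_step ch0 ch e0 (a0 _ (leq_subr j.+1 m))).
  - rewrite ler_pM ?expR_ge0//.
    + by rewrite -am addr_ge0 ?a0// mulr_ge0// mulr_ge0.
    + by rewrite chm2.
    + by rewrite lerD2l mulrCA eD -(mulrA 2 C) ler_wpM2l.
have c1 : 0 < 2 * (c + 1) by rewrite mulr_gt0// ltr_wpDl.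
set E := expR (2 * c * D) in main *; have E0 : 0 < E by exact: expR_gt0.
have small e : 0 < e -> exists2 m, (0 < m)%N & c * (D / m%:R) <= 1 / 2 /\ E * (2 * C * Num.sqrt (D / m%:R)) <= e.
  move=> e0; pose r := Num.min (2 * (c + 1))^-1 ((e / (E * (2 * C + 1))) ^+ 2).
  have C1' : 0 < 2 * C + 1 by rewrite ltr_wpDl// mulr_ge0.
  have r0 : 0 < r by rewrite lt_min invr_gt0 c1/= exprn_gt0// divr_gt0// mulr_gt0.
  have [m _ hm] := near_infty_natSinv_lt (PosNum r0).
  have {}hm := hm m (leqnn m); exists m.+1 => //.
  have hD : D / m.+1%:R <= r.
    by apply: (@le_trans _ _ m.+1%:R^-1); [rewrite ler_piMl ?invr_ge0|exact: ltW].
  split.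
    apply: (@le_trans _ _ ((c + 1) * (2 * (c + 1))^-1)).
      rewrite ler_pM// ?lerDl//; first by rewrite divr_ge0// ltW.
      by rewrite (le_trans hD)// /r ge_min lexx.
    by rewrite invfM mulrCA divff ?mulr1 ?div1r// gt_eqF// ltr_wpDl.
  have : Num.sqrt (D / m.+1%:R) <= e / (E * (2 * C + 1)).
    rewrite -[leRHS]ger0_norm; last by rewrite divr_ge0 ?(ltW e0)// mulr_ge0 ?ltW.
    rewrite -sqrtr_sqr ler_sqrt ?exprn_ge0//; last by rewrite divr_ge0 ?(ltW e0)// mulr_ge0 ?ltW.
    by rewrite (le_trans hD)// /r ge_min lexx orbT.
  move=> hs; have hs' : E * (2 * C * Num.sqrt (D / m.+1%:R)) <= E * ((2 * C + 1) * (e / (E * (2 * C + 1)))).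
    rewrite ler_wpM2l ?(ltW E0)// ler_pM// ?mulr_ge0//.
    by rewrite lerDl.
  by apply: (le_trans hs'); rewrite le_eqVlt; apply/orP; left; apply/eqP; field; rewrite !gt_eqF.
split; apply/ler_addgt0Pr => e e0; have [m m0 [k1 k2]] := small e e0; have [g1 g2] := main m m0 k1.
  apply: (le_trans g1); rewrite mulrDr lerD2l (le_trans _ k2)// ler_wpM2l ?(ltW E0)//.
  by rewrite -mulrA ler_peMl ?ler1n// mulr_ge0.
by apply: (le_trans g2); rewrite mulrDr lerD2l.
Qed.

End sde.

(** * One step of the discrete scheme *)

Section step_operator.
Context {R : realType}.
Notation leb := (@lebesgue_measure R).
Variables (K alpha : R) (M : diffusion_model K alpha).
Local Notation phi := (lamp M).
Local Notation psi := (lampV M).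
Local Notation By := (By M).
Local Notation LB := (LB K alpha).

(** The test functions. This class is stable under [step] below, and bounded
    Lipschitz functions still determine inequalities between measures. *)
Record bounded_lip (f : R * R -> R) (B L : R) : Prop := BoundedLipschitz {
  bl_meas : measurable_fun [set: R * R] f ;
  bl_ge0 : forall z, 0 <= f z ;
  bl_le : forall z, f z <= B ;
  bl_lip : forall u y u' y', `|f (u, y) - f (u', y')| <= L * (`|u - u'| + `|y - y'|) }.

Lemma bl_bound_ge0 f B L : bounded_lip f B L -> 0 <= B.
Proof. by move=> h; exact: le_trans (bl_ge0 h (0, 0)) (bl_le h (0, 0)). Qed.

Lemma bl_lip_ge0 f B L : bounded_lip f B L -> 0 <= L.
Proof.
move=> h; have := bl_lip h 0 0 1 0.
by rewrite subrr normr0 addr0 sub0r normrN normr1 mulr1; exact: le_trans.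
Qed.

Definition step_integrand (m s : R) (f : R * R -> R) (z : R * R) (h : R) :=
  f (z.1 + m * psi (z.2 + s * h), z.2 + s * h) * expR (By (z.2 + s * h) - By z.2).

(** Conditional expectation of [f] after one step of time length [s ^ 2] of the
    process with density [Q]; [m] is the mass that the measure puts at the end
    of the step. *)
Definition step m s (f : R * R -> R) (z : R * R) :=
  \int[leb]_h (step_integrand m s f z h * gk 1 h).

Lemma LB_ge0 : 0 <= LB.
Proof. exact: ltW (LB_gt0 M). Qed.

Lemma expR_sub_le (a b c : R) : a <= c -> b <= c -> `|expR a - expR b| <= expR c * `|a - b|.
Proof.
move=> ac bc; wlog ab : a b ac bc / b <= a.
  by move=> h; have [/h->//|/ltW/h h'] := leP b a; rewrite distrC (distrC a) h'.
rewrite ger0_norm ?subr_ge0 ?ler_expR// ger0_norm ?subr_ge0//.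
have -> : expR a - expR b = expR a * (1 - expR (b - a)).
  by rewrite mulrBr mulr1 -expRD; congr (_ - expR _); ring.
have h : 1 - expR (b - a) <= a - b by have := expR_ge1Dx (b - a); lra.
by apply: (le_trans (ler_wpM2l (expR_ge0 a) h)); rewrite ler_wpM2r ?subr_ge0 ?ler_expR.
Qed.

Lemma psi_lip_abs x y : `|psi y - psi x| <= K * `|y - x|.
Proof.
wlog xy : x y / x <= y.
  by move=> h; have [/h//|/ltW/h h'] := leP x y; rewrite distrC (distrC y).
have /andP[h1 h2] := psi_lip M xy; rewrite [X in _ * X]ger0_norm ?subr_ge0// ger0_norm//.
by apply: le_trans h1; rewrite mulr_ge0 ?subr_ge0// ltW// (alpha_gt0 M).
Qed.

Lemma By_move_le z s h : 0 <= s -> s <= 2 -> By (z + s * h) - By z <= 2 * LB * `|h|.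
Proof.
move=> s0 s2; apply: le_trans (ler_norm _) _; apply: (le_trans (By_lip M _ _)).
rewrite (_ : z + s * h - z = s * h); last by ring.
by rewrite normrM (ger0_norm s0) mulrCA mulrA ler_wpM2r// ler_wpM2r// LB_ge0.
Qed.

Lemma step_integrand_lip m s s' f B L z z' h : bounded_lip f B L -> 0 <= m -> m <= 1 ->
  0 <= s -> s <= 2 -> 0 <= s' -> s' <= 2 ->
  `|step_integrand m s f z h - step_integrand m s' f z' h| <=
  (L * (2 + K) + 2 * B * LB) * (`|z.1 - z'.1| + `|z.2 - z'.2| + `|s - s'|)
    * expR ((2 * LB + 1) * `|h|).
Proof.
move=> bf m0 m1 s0 s2 s'0 s'2; have L0 := bl_lip_ge0 bf; have B0 := bl_bound_ge0 bf.
have LB0 := LB_ge0; have K0 := ltW (K_gt0 M).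
case: z z' => [u y] [u' y'] /=; rewrite /step_integrand /=.
set w := y + s * h; set w' := y' + s' * h.
set e := `|u - u'| + `|y - y'| + `|s - s'|.
have e0 : 0 <= e by rewrite !addr_ge0.
have hw : `|w - w'| <= `|y - y'| + `|s - s'| * `|h|.
  by rewrite (_ : w - w' = (y - y') + (s - s') * h) ?(le_trans (ler_normD _ _)) ?normrM// /w /w'; ring.
have h1 : 1 <= 1 + `|h| by rewrite lerDl.
have hwe : `|w - w'| <= e * (1 + `|h|).
  apply: (le_trans hw); rewrite mulrDr mulr1 lerD//.
    by rewrite /e addrAC lerDr addr_ge0.
  by rewrite ler_wpM2r// /e lerDr addr_ge0.
have hue : `|u - u'| <= e * (1 + `|h|).
  by apply: (le_trans _ (ler_peMr e0 h1)); rewrite /e -addrA lerDl addr_ge0.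
have hye : `|y - y'| <= e * (1 + `|h|).
  by apply: (le_trans _ (ler_peMr e0 h1)); rewrite /e addrAC lerDr addr_ge0.
have eh : (1 + `|h|) * expR (2 * LB * `|h|) <= expR ((2 * LB + 1) * `|h|).
  have -> : (2 * LB + 1) * `|h| = `|h| + 2 * LB * `|h| by ring.
  by rewrite expRD ler_wpM2r ?expR_ge0// expR_ge1Dx.
set Eh := e * (1 + `|h|) in hwe hue hye; have Eh0 : 0 <= Eh by rewrite mulr_ge0// addr_ge0.
have f1 : `|f (u + m * psi w, w) - f (u' + m * psi w', w')| <= L * (2 + K) * Eh.
  apply: (le_trans (bl_lip bf _ _ _ _)); rewrite -(mulrA L) ler_wpM2l//.
  have hp1 : m * `|psi w - psi w'| <= K * Eh.
    rewrite (le_trans (ler_wpM2l m0 (psi_lip_abs w' w)))// mulrCA ler_wpM2l//.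
    by rewrite (le_trans _ hwe)// ler_piMl.
  have h2 : `|u + m * psi w - (u' + m * psi w')| <= Eh + K * Eh.
    rewrite (_ : u + m * psi w - (u' + m * psi w') = (u - u') + m * (psi w - psi w')); last by ring.
    by rewrite (le_trans (ler_normD _ _))// lerD// normrM (ger0_norm m0).
  by apply: (le_trans (lerD h2 hwe)); rewrite le_eqVlt; apply/orP; left; apply/eqP; ring.
set E := expR (2 * LB * `|h|) in eh *.
have a1 : By w - By y <= 2 * LB * `|h| by exact: By_move_le.
have a2 : By w' - By y' <= 2 * LB * `|h| by exact: By_move_le.
have e12 : `|expR (By w - By y) - expR (By w' - By y')| <= 2 * LB * Eh * E.
  apply: (le_trans (expR_sub_le a1 a2)); rewrite -/E mulrC ler_wpM2r ?expR_ge0//.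
  rewrite (_ : By w - By y - (By w' - By y') = (By w - By w') - (By y - By y')); last by ring.
  have b1 := ler_wpM2l LB0 hwe; have b2 := ler_wpM2l LB0 hye.
  apply: (le_trans (ler_normB _ _)).
  apply: (le_trans (lerD (le_trans (By_lip M w' w) b1) (le_trans (By_lip M y' y) b2))).
  by rewrite le_eqVlt; apply/orP; left; apply/eqP; ring.
have -> : f (u + m * psi w, w) * expR (By w - By y) - f (u' + m * psi w', w') * expR (By w' - By y') =
  (f (u + m * psi w, w) - f (u' + m * psi w', w')) * expR (By w - By y) +
  f (u' + m * psi w', w') * (expR (By w - By y) - expR (By w' - By y')) by ring.
apply: (le_trans (ler_normD _ _)); rewrite !normrM.
have g1 : `|f (u + m * psi w, w) - f (u' + m * psi w', w')| * `|expR (By w - By y)| <= L * (2 + K) * Eh * E.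
  by rewrite ler_pM// ger0_norm ?expR_ge0// ler_expR.
have g2 : `|f (u' + m * psi w', w')| * `|expR (By w - By y) - expR (By w' - By y')| <= B * (2 * LB * Eh * E).
  by rewrite ler_pM// ger0_norm ?(bl_le bf)// (bl_ge0 bf).
apply: (le_trans (lerD g1 g2)).
have -> : L * (2 + K) * Eh * E + B * (2 * LB * Eh * E) = (L * (2 + K) + 2 * B * LB) * e * ((1 + `|h|) * E).
  by rewrite /Eh; ring.
have c0 : 0 <= L * (2 + K) + 2 * B * LB.
  by rewrite addr_ge0// !mulr_ge0// addr_ge0.
by rewrite ler_wpM2l// mulr_ge0.
Qed.

Lemma step_integrand_ge0 m s f B L z h : bounded_lip f B L -> 0 <= step_integrand m s f z h.
Proof. by move=> bf; rewrite mulr_ge0 ?expR_ge0// (bl_ge0 bf). Qed.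

Lemma step_integrand_le m s f B L z h : bounded_lip f B L -> 0 <= s -> s <= 2 ->
  step_integrand m s f z h <= B * expR (2 * LB * `|h|).
Proof.
move=> bf s0 s2; rewrite ler_pM ?expR_ge0 ?(bl_ge0 bf) ?(bl_le bf)//.
by rewrite ler_expR By_move_le.
Qed.

Lemma measurable_By : measurable_fun [set: R] By.
Proof. apply: continuous_measurable_fun; exact: By_continuous. Qed.

Lemma measurable_psi : measurable_fun [set: R] psi.
Proof. apply: continuous_measurable_fun; exact: psi_continuous. Qed.

Lemma measurable_step_integrand m s f B L : bounded_lip f B L ->
  measurable_fun [set: (R * R) * R] (fun x : (R * R) * R => step_integrand m s f x.1 x.2).
Proof.
move=> bf.
have m1 : measurable_fun [set: (R * R) * R] (fun x : (R * R) * R => x.1.1).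
  exact: (measurableT_comp measurable_fst measurable_fst).
have m2 : measurable_fun [set: (R * R) * R] (fun x : (R * R) * R => x.1.2).
  exact: (measurableT_comp measurable_snd measurable_fst).
have m3 : measurable_fun [set: (R * R) * R] (fun x : (R * R) * R => x.1.2 + s * x.2).
  apply: measurable_funD => //; apply: measurable_funM => //; exact: measurable_snd.
apply: measurable_funM.
  apply: (measurableT_comp (bl_meas bf)); apply: measurable_fun_pair => //.
  apply: measurable_funD => //; apply: measurable_funM => //.
  exact: (measurableT_comp measurable_psi m3).
apply: measurableT_comp => //; apply: measurable_funB.
  exact: (measurableT_comp measurable_By m3).
exact: (measurableT_comp measurable_By m2).
Qed.

Lemma step_integrable m s f B L z : bounded_lip f B L -> 0 <= s -> s <= 2 ->
  leb.-integrable [set: R] (fun h => (step_integrand m s f z h * gk 1 h)%:E).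
Proof.
move=> bf s0 s2; apply: (integrable_mul_gk (C := B) (c := 2 * LB)) => //.
  exact: (measurable_fun_pair2 z (measurable_step_integrand m s bf)).
by move=> h; rewrite ger0_norm ?(step_integrand_ge0 m s z h bf)// (step_integrand_le m z h bf).
Qed.

Lemma step_EFin m s f B L z : bounded_lip f B L -> 0 <= s -> s <= 2 ->
  ((step m s f z)%:E = \int[leb]_h (step_integrand m s f z h * gk 1 h)%:E)%E.
Proof.
move=> bf s0 s2; rewrite /step /Rintegral fineK//.
exact: (integrable_fin_num _ (step_integrable m z bf s0 s2)).
Qed.

Definition E1 := expR ((2 * LB + 1) ^+ 2 / 2) * 2.

Lemma Rintegral_growth : leb.-integrable [set: R] (fun h => (expR ((2 * LB + 1) * `|h|) * gk 1 h)%:E) /\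
  \int[leb]_h (expR ((2 * LB + 1) * `|h|) * gk 1 h) <= E1.
Proof.
have i1 : leb.-integrable [set: R] (fun h => (expR ((2 * LB + 1) * `|h|) * gk 1 h)%:E).
  apply: (integrable_mul_gk (C := 1) (c := 2 * LB + 1)) => //; first exact: measurable_expr_norm.
  by move=> h; rewrite mul1r ger0_norm ?expR_ge0.
split => //; rewrite -lee_fin /Rintegral fineK; last exact: (integrable_fin_num _ i1).
apply: (le_trans (integral_gk_expR_norm (2 * LB + 1) ltr01)).
by rewrite lee_fin /E1 mulr1 mulrC.
Qed.

(** Lipschitz dependence on the point, and also on the scale [s]: the latter
    makes the smoothing parameter of [smoothed_step] removable. *)
Lemma step_lip m s s' f B L z z' : bounded_lip f B L -> 0 <= m -> m <= 1 ->
  0 <= s -> s <= 2 -> 0 <= s' -> s' <= 2 ->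
  `|step m s f z - step m s' f z'| <=
  (L * (2 + K) + 2 * B * LB) * E1 * (`|z.1 - z'.1| + `|z.2 - z'.2| + `|s - s'|).
Proof.
move=> bf m0 m1 s0 s2 s'0 s'2.
have [ig hg] := Rintegral_growth.
have L0 := bl_lip_ge0 bf; have B0 := bl_bound_ge0 bf.
have LB0 := LB_ge0; have K0 := ltW (K_gt0 M).
set C := L * (2 + K) + 2 * B * LB; set e := `|z.1 - z'.1| + _ + _.
have e0 : 0 <= e by rewrite !addr_ge0.
have c0 : 0 <= C by rewrite addr_ge0// !mulr_ge0// addr_ge0.
have i1 := step_integrable m z bf s0 s2; have i2 := step_integrable m z' bf s'0 s'2.
rewrite /step -(RintegralB measurableT i1 i2).
apply: le_trans (le_normr_Rintegral measurableT (integrableB measurableT i1 i2)) _.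
have i3 : leb.-integrable [set: R] (fun h => ((C * e) * (expR ((2 * LB + 1) * `|h|) * gk 1 h))%:E).
  exact: (integrableZl measurableT (C * e) ig).
apply: (@le_trans _ _ (\int[leb]_h ((C * e) * (expR ((2 * LB + 1) * `|h|) * gk 1 h)))).
  apply: le_Rintegral => //; first exact: (integrable_abse (integrableB measurableT i1 i2)).
  move=> h _; rewrite -mulrBl normrM (ger0_norm (gk_ge0 h ltr01)) mulrA.
  by apply: (ler_wpM2r (gk_ge0 h ltr01)); exact: (step_integrand_lip z z' h bf).
rewrite (RintegralZl (C * e) measurableT ig) -(mulrA C e) -(mulrA C E1).
by apply: (ler_wpM2l c0); rewrite [leLHS]mulrC ler_wpM2r.
Qed.

Lemma step_bl m s f B L : bounded_lip f B L -> 0 <= m -> m <= 1 -> 0 <= s -> s <= 2 ->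
  exists B' L', bounded_lip (step m s f) B' L'.
Proof.
move=> bf m0 m1 s0 s2; have [ig hg] := Rintegral_growth.
have LB0 := LB_ge0; have B0 := bl_bound_ge0 bf.
exists (B * E1), ((L * (2 + K) + 2 * B * LB) * E1); split.
- apply/measurable_EFinP; rewrite (_ : _ \o _ = fun z => (step m s f z)%:E)//.
  under eq_fun do rewrite (step_EFin m _ bf s0 s2).
  apply: (@measurable_fun_fubini_tonelli_F _ _ _ _ R leb
    (fun x : (R * R) * R => (step_integrand m s f x.1 x.2 * gk 1 x.2)%:E)).
    apply/measurable_EFinP/measurable_funM; first exact: measurable_step_integrand bf.
    by apply: (measurableT_comp (measurable_gk 1)); exact: measurable_snd.
  by move=> x; rewrite lee_fin mulr_ge0 ?gk_ge0 ?(step_integrand_ge0 m s x.1 x.2 bf).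
- by move=> z; apply: Rintegral_ge0 => h _; rewrite mulr_ge0 ?gk_ge0 ?(step_integrand_ge0 m s z h bf).
- move=> z; apply: (@le_trans _ _ (\int[leb]_h (B * (expR ((2 * LB + 1) * `|h|) * gk 1 h)))).
    apply: le_Rintegral => //; first exact: step_integrable bf s0 s2.
      exact: (integrableZl measurableT B ig).
    move=> h _; rewrite mulrA ler_wpM2r ?gk_ge0//.
    rewrite (le_trans (step_integrand_le m z h bf s0 s2))// ler_wpM2l// ler_expR.
    by rewrite ler_wpM2r// lerDl.
  by rewrite (RintegralZl B measurableT ig) ler_wpM2l.
- move=> u y u' y'; have := step_lip (u, y) (u', y') bf m0 m1 s0 s2 s0 s2.
  by rewrite /= subrr normr0 addr0.
Qed.

Lemma step0 m f B L z : bounded_lip f B L -> step m 0 f z = f (z.1 + m * psi z.2, z.2).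
Proof.
move=> bf; rewrite /step /step_integrand.
under eq_Rintegral do rewrite mul0r addr0 subrr expR0 mulr1.
by rewrite (RintegralZl _ measurableT (integrable_gk ltr01)) Rintegral_gk// mulr1.
Qed.

(** The step operator integrates [f] against the kernel [Q]. *)
Lemma step_Q m tau f B L u x : bounded_lip f B L -> 0 < tau -> tau <= 2 ->
  (\int[leb]_z (f (u + m * psi z, z) * Q M tau z x)%:E = (step m (Num.sqrt tau) f (u, phi x))%:E)%E.
Proof.
move=> bf t0 t2; set s := Num.sqrt tau.
have s0 : 0 <= s by exact: sqrtr_ge0.
have s2 : s <= 2.
  have h2 : (2 : R) = Num.sqrt (2 ^+ 2) by rewrite sqrtr_sqr ger0_norm.
  by rewrite h2 ler_sqrt ?(le_trans t2)// expr2; lra.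
rewrite (step_EFin m _ bf s0 s2).
pose g z : \bar R := (f (u + m * psi z, z) * Q M tau z x)%:E.
have mfz : measurable_fun [set: R] (fun z => f (u + m * psi z, z)).
  apply: (measurableT_comp (bl_meas bf)); apply: measurable_fun_pair => //.
  by apply: measurable_funD => //; apply: measurable_funM => //; exact: measurable_psi.
have mgk c : measurable_fun [set: R] (fun z => gk tau (z - c)).
  by apply: (measurableT_comp (measurable_gk tau)); exact: measurable_funB.
have mg : measurable_fun [set: R] g.
  apply/measurable_EFinP/measurable_funM => //; apply: measurable_funM => //.
  apply: measurableT_comp => //; apply: measurable_funB => //; exact: measurable_By.
have g0 z : (0 <= g z)%E by rewrite lee_fin mulr_ge0 ?(bl_ge0 bf)// ltW// Q_gt0.
rewrite (ge0_integral_shift (phi x) mg g0).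
pose k w : \bar R := (f (u + m * psi (phi x + w), phi x + w) * expR (By (phi x + w) - By (phi x)))%:E.
transitivity (\int[leb]_w (k w * (gk tau w)%:E))%E.
  have ByE : By (phi x) = gradp M x := congr1 (gradp M) (phiK M x).
  apply: eq_integral => w _; rewrite /g /k -EFinM /Q ByE.
  by congr EFin; rewrite (_ : phi x + w - phi x = w) ?mulrA//; ring.
rewrite ge0_integral_gk_scale//; last 2 first.
- have ms : measurable_fun [set: R] (fun w => phi x + w) by exact: measurable_funD.
  apply/measurable_EFinP/measurable_funM; first exact: (measurableT_comp mfz ms).
  apply: measurableT_comp => //; apply: measurable_funB => //.
  exact: (measurableT_comp measurable_By ms).
- by move=> w; rewrite lee_fin mulr_ge0 ?expR_ge0 ?(bl_ge0 bf).
Qed.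

End step_operator.

Section discrete_scheme.
Context {R : realType} d (T : measurableType d) (P : probability T R).
Variables (F : R -> set (set T)) (W : R -> T -> R).
Hypothesis (filt : filtration F) (bm : brownian_motion P F W).
Variables (K alpha : R) (M : diffusion_model K alpha) (X0 : R -> T -> R).
Hypothesis sol : sde_solution P F W 1 (vol M) (drift M) 0 X0.
Notation leb := (@lebesgue_measure R).
Local Notation "'integ' f" := (P.-integrable [set: T] (fun w => (f w)%:E))
  (at level 10, f at next level).
Local Notation phi := (lamp M).
Local Notation psi := (lampV M).
Local Notation X := (X X0).
Local Notation CV := (CV K alpha).

Lemma measurable_phi : measurable_fun [set: R] phi.
Proof. apply: continuous_measurable_fun; exact: phi_continuous. Qed.

Lemma measurable_pair_phi (U : T -> R) t : measurable_fun [set: T] U -> 0 <= t <= 1 ->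
  measurable_fun [set: T] (fun w => (U w, phi (X t w))).
Proof.
move=> mU t01; apply: measurable_fun_pair => //.
exact: (measurableT_comp measurable_phi (measurable_X filt sol t01)).
Qed.

Lemma integ_bl f B L (U : T -> R) t : bounded_lip f B L -> measurable_fun [set: T] U -> 0 <= t <= 1 ->
  integ (fun w => f (U w, phi (X t w))).
Proof.
move=> bf mU t01; apply: (@integrable_bounded _ _ _ P _ B).
  exact: (measurableT_comp (bl_meas bf) (measurable_pair_phi mU t01)).
by move=> w; rewrite ger0_norm ?(bl_ge0 bf) ?(bl_le bf).
Qed.

Lemma measurable_fQ tau f B L m t (U : T -> R) : bounded_lip f B L -> 0 <= t <= 1 ->
  measurable_fun [set: T] U ->
  measurable_fun [set: R * T] (fun y : R * T => (f (U y.2 + m * psi y.1, y.1) * Q M tau y.1 (X t y.2))%:E).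
Proof.
move=> bf t01 mU; have mX := measurable_X filt sol t01.
have m1 : measurable_fun [set: R * T] (fun y : R * T => U y.2) := measurableT_comp mU measurable_snd.
have m2 : measurable_fun [set: R * T] (fun y : R * T => X t y.2) := measurableT_comp mX measurable_snd.
have m3 : measurable_fun [set: R * T] (fun y : R * T => psi y.1) :=
  measurableT_comp (measurable_psi M) measurable_fst.
have m4 : measurable_fun [set: R * T] (fun y : R * T => phi (X t y.2)) := measurableT_comp measurable_phi m2.
have m5 : measurable_fun [set: R * T] (fun y : R * T => By M y.1) :=
  measurableT_comp (measurable_By M) measurable_fst.
have mB : measurable_fun [set: R] (gradp M).
  apply: continuous_measurable_fun; exact: is_derive1_continuous (gradp_der M).
have m6 : measurable_fun [set: R * T] (fun y : R * T => gradp M (X t y.2)) := measurableT_comp mB m2.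
apply/measurable_EFinP; apply: measurable_funM.
  apply: (measurableT_comp (bl_meas bf)); apply: measurable_fun_pair; last exact: measurable_fst.
  by apply: measurable_funD => //; exact: measurable_funM.
apply: measurable_funM.
  by apply: measurableT_comp => //; exact: measurable_funB.
by apply: (measurableT_comp (measurable_gk tau)); apply: measurable_funB => //; exact: measurable_fst.
Qed.

Lemma sqrt_le2 (x : R) : x <= 2 -> Num.sqrt x <= 2.
Proof.
move=> x2; have h2 : (2 : R) = Num.sqrt (2 ^+ 2) by rewrite sqrtr_sqr ger0_norm.
by rewrite h2 ler_sqrt ?exprn_gt0// (le_trans x2)// expr2; lra.
Qed.

Lemma comparison_perturb (E C a a' p p' r : R) : 0 < E -> `|a - p| <= C * r ->
  `|p' - a'| <= C * r -> p <= E * p' -> p' <= E * p ->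
  a <= E * a' + (C + E * C) * r /\ a' <= E * a + (C + E * C) * r.
Proof.
move=> E0; rewrite !ler_norml => /andP[q1 q2] /andP[q3 q4] q5 q6.
split.
  have : E * p' <= E * (a' + C * r) by rewrite ler_wpM2l ?(ltW E0)//; lra.
  by rewrite mulrDr; lra.
have : E * p <= E * (a + C * r) by rewrite ler_wpM2l ?(ltW E0)//; lra.
by rewrite mulrDr; lra.
Qed.

Lemma EFin_comparison (E a a' : R) (j j' : \bar R) : j = a%:E -> j' = a'%:E ->
  (j <= E%:E * j')%E -> (j' <= E%:E * j)%E -> a <= E * a' /\ a' <= E * a.
Proof. by move=> -> ->; rewrite -!EFinM !lee_fin. Qed.

(** Integrating the test function against [Q] at time [t'], and moving the
    kernel back to time [t] under the integral sign. *)
Lemma smoothed_step eps f B L m t t' (U : T -> R) : bounded_lip f B L -> 0 <= m -> m <= 1 ->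
  0 < eps -> eps <= 1 -> 0 <= t -> t <= t' -> t' <= 1 -> knows F t U ->
  let A := \int[P]_w step M m (Num.sqrt eps) f (U w, phi (X t' w)) in
  let B := \int[P]_w step M m (Num.sqrt (eps + (t' - t))) f (U w, phi (X t w)) in
  A <= expR (2 * CV * (t' - t)) * B /\ B <= expR (2 * CV * (t' - t)) * A.
Proof.
move=> bf m0 m1 e0 e1 t0 tt' t'1 kU A A'.
have B0 := bl_bound_ge0 bf.
have mU := knows_measurable filt t0 kU.
have t01 : 0 <= t <= 1 by rewrite t0 (le_trans tt').
have t'01 : 0 <= t' <= 1 by rewrite (le_trans t0).
have d0 : 0 <= t' - t by rewrite subr_ge0.
have d1 : t' - t <= 1 by rewrite lerBlDr (le_trans t'1)// lerDl.
have ed0 : 0 < eps + (t' - t) by rewrite ltr_wpDr.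
have ed2 : eps + (t' - t) <= 2 by rewrite (le_trans (lerD e1 d1)).
set E := expR _; have E0 : 0 <= E by exact: expR_ge0.
pose J tau s := (\int[leb]_z \int[P]_w (f (U w + m * psi z, z) * Q M tau z (X s w))%:E)%E.
have JE tau s : 0 < tau -> tau <= 2 -> 0 <= s <= 1 ->
    J tau s = (\int[P]_w step M m (Num.sqrt tau) f (U w, phi (X s w)))%:E.
  move=> tau0 tau2 s01.
  have s0' : 0 <= Num.sqrt tau by exact: sqrtr_ge0.
  have s2 : Num.sqrt tau <= 2.
    have h2 : (2 : R) = Num.sqrt (2 ^+ 2) by rewrite sqrtr_sqr ger0_norm.
    by rewrite h2 ler_sqrt ?(le_trans tau2)// expr2; lra.
  have [B' [L' bS]] := step_bl M bf m0 m1 s0' s2.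
  rewrite -integral_EFin_Rintegral; last exact: (integ_bl bS mU s01).
  rewrite /J (@fubini_tonelli _ _ _ _ _ leb P (fun y : R * T =>
    (f (U y.2 + m * psi y.1, y.1) * Q M tau y.1 (X s y.2))%:E)); last 2 first.
  - exact: measurable_fQ bf s01 mU.
  - by move=> y; rewrite lee_fin; apply: mulr_ge0; [exact: bl_ge0 bf _|exact: ltW (Q_gt0 _ _ _ tau0)].
  by apply: eq_integral => w _; exact: (step_Q M m (U w) (X s w) bf tau0 tau2).
have J0 tau s z : 0 < tau -> (0 <= \int[P]_w (f (U w + m * psi z, z) * Q M tau z (X s w))%:E)%E.
  move=> tau0; apply: integral_ge0 => w _; rewrite lee_fin.
  by apply: mulr_ge0; [exact: bl_ge0 bf _|exact: ltW (Q_gt0 _ _ _ tau0)].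
have mJ tau s : 0 < tau -> 0 <= s <= 1 ->
    measurable_fun [set: R] (fun z => \int[P]_w (f (U w + m * psi z, z) * Q M tau z (X s w))%:E)%E.
  move=> tau0 s01; apply: (@measurable_fun_fubini_tonelli_F _ _ _ _ R P (fun y : R * T =>
    (f (U y.2 + m * psi y.1, y.1) * Q M tau y.1 (X s y.2))%:E)); first exact: measurable_fQ bf s01 mU.
  by move=> y; rewrite lee_fin; apply: mulr_ge0; [exact: bl_ge0 bf _|exact: ltW (Q_gt0 _ _ _ tau0)].
have cmp z : (\int[P]_w (f (U w + m * psi z, z) * Q M eps z (X t' w))%:E <=
     E%:E * \int[P]_w (f (U w + m * psi z, z) * Q M (eps + (t' - t)) z (X t w))%:E)%E /\
   (\int[P]_w (f (U w + m * psi z, z) * Q M (eps + (t' - t)) z (X t w))%:E <=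
     E%:E * \int[P]_w (f (U w + m * psi z, z) * Q M eps z (X t' w))%:E)%E.
  pose c := B + 1; have c0 : 0 < c by rewrite ltr_wpDl.
  pose xi w := c^-1 * f (U w + m * psi z, z).
  have mf : measurable_fun [set: R] (fun u => c^-1 * f (u + m * psi z, z)).
    apply: measurable_funM => //; apply: (measurableT_comp (bl_meas bf)).
    by apply: measurable_fun_pair => //; exact: measurable_funD.
  have kxi : knows F t xi by exact: (knows_comp mf kU).
  have bxi w : 0 <= xi w <= 1.
    have c0' := ltW c0; apply/andP; split.
      by apply: mulr_ge0; [rewrite invr_ge0|exact: bl_ge0 bf _].
    by rewrite /xi mulrC ler_pdivrMr// mul1r (le_trans (bl_le bf _))// lerDl.
  have mxi := knows_measurable filt t0 kxi.
  have conv tau s : 0 < tau -> 0 <= s <= 1 ->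
      (\int[P]_w (f (U w + m * psi z, z) * Q M tau z (X s w))%:E = (c * \int[P]_w (xi w * Q M tau z (X s w)))%:E)%E.
    move=> tau0 s01; have ii := integ_xiQ filt sol z tau0 s01 mxi bxi.
    rewrite EFinM -(integral_EFin_Rintegral ii) -ge0_integralZl//.
    - apply: eq_integral => w _; rewrite -[RHS]EFinM /xi; congr EFin.
      move: (f _) (Q M tau z (X s w)) => p q.
      have cV : c * c^-1 = 1 by rewrite divff// gt_eqF.
      have -> : c * (c^-1 * p * q) = c * c^-1 * (p * q) by ring.
      by rewrite cV mul1r.
    - exact: measurable_int ii.
    - move=> w _; rewrite lee_fin; apply: mulr_ge0; first by have /andP[] := bxi w.
      exact: ltW (Q_gt0 _ _ _ tau0).
    - by rewrite lee_fin ltW.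
  rewrite (conv eps t' e0 t'01) (conv (eps + (t' - t)) t ed0 t01) -!EFinM !lee_fin.
  have [k1 k2] := kernel_comparison filt bm sol z e0 t0 tt' t'1 kxi bxi.
  by split; rewrite mulrCA ler_pM2l.
have hA : J eps t' = A%:E by apply: JE => //; rewrite (le_trans e1)// ler1n.
have hA' : J (eps + (t' - t)) t = A'%:E by exact: JE.
apply: (EFin_comparison hA hA').
  rewrite [X in (_ <= X)%E](_ : _ = \int[leb]_z (E%:E * \int[P]_w (f (U w + m * psi z, z) * Q M (eps + (t' - t)) z (X t w))%:E))%E.
    apply: ge0_le_integral => //.
    - by move=> z _; exact: J0.
    - exact: mJ.
    - by apply: emeasurable_funM => //; exact: mJ.
    - by move=> z _; have [] := cmp z.
  by rewrite ge0_integralZl//; [exact: mJ|move=> z _; exact: J0].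
rewrite [X in (_ <= X)%E](_ : _ = \int[leb]_z (E%:E * \int[P]_w (f (U w + m * psi z, z) * Q M eps z (X t' w))%:E))%E.
  apply: ge0_le_integral => //.
  - by move=> z _; exact: J0.
  - exact: mJ.
  - by apply: emeasurable_funM => //; exact: mJ.
  - by move=> z _; have [] := cmp z.
by rewrite ge0_integralZl//; [exact: mJ|move=> z _; exact: J0].
Qed.

(** The limit of [smoothed_step] for vanishing smoothing. *)
Lemma exact_step f B L m t t' (U : T -> R) : bounded_lip f B L -> 0 <= m -> m <= 1 ->
  0 <= t -> t <= t' -> t' <= 1 -> knows F t U ->
  let A := \int[P]_w f (U w + m * X t' w, phi (X t' w)) in
  let B := \int[P]_w step M m (Num.sqrt (t' - t)) f (U w, phi (X t w)) in
  A <= expR (2 * CV * (t' - t)) * B /\ B <= expR (2 * CV * (t' - t)) * A.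
Proof.
move=> bf m0 m1 t0 tt' t'1 kU A A'.
have B0 := bl_bound_ge0 bf; have L0 := bl_lip_ge0 bf.
have mU := knows_measurable filt t0 kU.
have t01 : 0 <= t <= 1 by rewrite t0 (le_trans tt').
have t'01 : 0 <= t' <= 1 by rewrite (le_trans t0).
have d0 : 0 <= t' - t by rewrite subr_ge0.
have d1 : t' - t <= 1 by rewrite lerBlDr (le_trans t'1)// lerDl.
set E := expR _; have E0 : 0 < E by exact: expR_gt0.
pose C := (L * (2 + K) + 2 * B * LB K alpha) * E1 K alpha.
have C0 : 0 <= C.
  have LB0 := LB_ge0 M; have K0 := ltW (K_gt0 M).
  by rewrite /C mulr_ge0 ?mulr_ge0 ?expR_ge0// addr_ge0// !mulr_ge0// addr_ge0.
have close s s' u : 0 <= s -> s <= 2 -> 0 <= s' -> s' <= 2 -> 0 <= u <= 1 ->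
    `|\int[P]_w step M m s f (U w, phi (X u w)) - \int[P]_w step M m s' f (U w, phi (X u w))| <= C * `|s - s'|.
  move=> s0 s2 s'0 s'2 u01.
  have [B1 [L1 bS]] := step_bl M bf m0 m1 s0 s2.
  have [B2 [L2 bS']] := step_bl M bf m0 m1 s'0 s'2.
  have i1 := integ_bl bS mU u01; have i2 := integ_bl bS' mU u01.
  rewrite -(RintegralB measurableT i1 i2) -[leRHS](@Rintegral_cst1 _ _ _ P).
  apply: ler_norm_Rintegral.
  - exact: (integrable_measurable (integrableB_EFin i1 i2)).
  - exact: (@integrable_bounded _ _ _ P (fun=> C * `|s - s'|) `|C * `|s - s'| |).
  apply: aeW => w; apply: (le_trans (step_lip M _ _ bf m0 m1 s0 s2 s'0 s'2)).
  by rewrite /= !subrr normr0 !add0r.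
have AE : A = \int[P]_w step M m 0 f (U w, phi (X t' w)).
  by apply: eq_Rintegral => w _; rewrite (step0 M m _ bf)/= phiK.
have main r : 0 < r -> r <= 1 -> A <= E * A' + (C + E * C) * r /\ A' <= E * A + (C + E * C) * r.
  move=> r0 r1; pose eps := r ^+ 2.
  have e0 : 0 < eps by rewrite exprn_gt0.
  have e1 : eps <= 1 by rewrite exprn_ile1// ltW.
  have se : Num.sqrt eps = r by rewrite sqrtr_sqr ger0_norm// ltW.
  have [k1 k2] := smoothed_step bf m0 m1 e0 e1 t0 tt' t'1 kU.
  rewrite se in k1 k2.
  have r2 : r <= 2 by rewrite (le_trans r1)// ler1n.
  have c1 := close 0 r t' (lexx _) (ler0n _ _) (ltW r0) r2 t'01.
  rewrite -AE sub0r normrN (gtr0_norm r0) in c1.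
  have s2 : Num.sqrt (eps + (t' - t)) <= 2 by apply: sqrt_le2; rewrite (le_trans (lerD e1 d1)).
  have s2' : Num.sqrt (t' - t) <= 2 by apply: sqrt_le2; rewrite (le_trans d1)// ler1n.
  have c2 := close _ _ t (sqrtr_ge0 _) s2 (sqrtr_ge0 _) s2' t01.
  have hs : `|Num.sqrt (eps + (t' - t)) - Num.sqrt (t' - t)| <= r.
    rewrite ger0_norm; last by rewrite subr_ge0; apply: ler_wsqrtr; rewrite lerDr ltW.
    rewrite lerBlDl -[leRHS]ger0_norm; last by rewrite addr_ge0 ?sqrtr_ge0// ltW.
    rewrite -sqrtr_sqr; apply: ler_wsqrtr; rewrite sqrrD sqr_sqrtr//.
    rewrite [leLHS]addrC -/eps lerD2r lerDl; apply: mulrn_wge0; apply: mulr_ge0; [exact: sqrtr_ge0|exact: ltW].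
  have {}c2 := le_trans c2 (ler_wpM2l C0 hs).
  exact: (comparison_perturb E0 c1 c2 k1 k2).
have CE0 : 0 < C + E * C + 1 by rewrite ltr_wpDl// addr_ge0// mulr_ge0// ltW.
have small e : 0 < e -> exists2 r, 0 < r <= 1 & (C + E * C) * r <= e.
  move=> e0; exists (Num.min 1 (e / (C + E * C + 1))).
    by rewrite lt_min ltr01 divr_gt0//= ge_min lexx.
  apply: (@le_trans _ _ ((C + E * C + 1) * (e / (C + E * C + 1)))).
    apply: ler_pM; rewrite ?lerDl//.
    - by rewrite addr_ge0// mulr_ge0// ltW.
    - by rewrite le_min ler01 divr_ge0// ltW.
    - by rewrite ge_min lexx orbT.
  by rewrite mulrC divfK// gt_eqF.
split; apply/ler_addgt0Pr => e e0; have [r /andP[r0 r1] re] := small e e0; have [g1 g2] := main r r0 r1.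
  by apply: (le_trans g1); rewrite lerD2l.
by apply: (le_trans g2); rewrite lerD2l.
Qed.

End discrete_scheme.

(** * The discrete scheme and its change of measure *)

Section iterated_scheme.
Context {R : realType} d (T : measurableType d) (P : probability T R).
Variables (F : R -> set (set T)) (W : R -> T -> R).
Hypothesis (filt : filtration F) (bm : brownian_motion P F W).
Variables (K alpha : R) (M : diffusion_model K alpha) (X0 : R -> T -> R).
Hypothesis sol : sde_solution P F W 1 (vol M) (drift M) 0 X0.
Variables (n : nat) (m : nat -> R).
Hypotheses (n0 : (0 < n)%N) (m01 : forall i, 0 <= m i <= 1).
Notation leb := (@lebesgue_measure R).
Local Notation phi := (lamp M).
Local Notation psi := (lampV M).
Local Notation By := (By M).
Local Notation X := (X X0).
Local Notation CV := (CV K alpha).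

Let dt : R := n%:R^-1.
Let s : R := Num.sqrt dt.

Lemma dt_gt0 : 0 < n%:R^-1 :> R.
Proof. by rewrite invr_gt0 ltr0n. Qed.

Lemma dt_le1 : n%:R^-1 <= 1 :> R.
Proof. by rewrite invf_le1 ?ltr0n// ler1n. Qed.

Lemma s_ge0 : 0 <= s. Proof. exact: sqrtr_ge0. Qed.

Lemma s_le2 : s <= 2.
Proof. by apply: sqrt_le2; rewrite (le_trans dt_le1)// ler1n. Qed.

(** [back f j] is [f] integrated over the last [j] steps of the scheme. *)
Fixpoint back (f : R * R -> R) (j : nat) : R * R -> R :=
  if j is j'.+1 then step M (m (n - j')) (Num.sqrt n%:R^-1) (back f j') else f.

Lemma back_bl f B L j : bounded_lip f B L -> exists B' L', bounded_lip (back f j) B' L'.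
Proof.
move=> bf; elim: j => [|j [B' [L' ih]]]; first by exists B, L.
have /andP[h1 h2] := m01 (n - j).
exact: (step_bl M ih h1 h2 s_ge0 s_le2).
Qed.

Definition partial_sum k w := \sum_(i < k.+1) m i * X (i%:R / n%:R) w.

Lemma partial_sumS k w :
  partial_sum k.+1 w = partial_sum k w + m k.+1 * X (k.+1%:R / n%:R) w.
Proof. by rewrite /partial_sum big_ord_recr. Qed.

Lemma gridS k : k.+1%:R / n%:R - k%:R / n%:R = n%:R^-1 :> R.
Proof. by rewrite -mulrBl -natr1 addrC addKr mul1r. Qed.

Lemma grid_le k l : (k <= l)%N -> k%:R / n%:R <= l%:R / n%:R :> R.
Proof. by move=> kl; rewrite ler_wpM2r ?ler_nat// ltW// dt_gt0. Qed.

Lemma knows_partial_sum k : (k <= n)%N -> knows F (k%:R / n%:R) (partial_sum k).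
Proof.
elim: k => [|k ih] kn.
  rewrite (_ : partial_sum 0 = fun w => m 0 * X (0%:R / n%:R) w); last first.
    by apply/funext => w; rewrite /partial_sum big_ord1.
  apply: knows_mul; first exact: knows_cst.
  by apply: (knows_X filt sol) => //; rewrite mul0r.
rewrite (_ : partial_sum k.+1 = fun w => partial_sum k w + m k.+1 * X (k.+1%:R / n%:R) w); last first.
  by apply/funext => w; exact: partial_sumS.
have /andP[g0 g1] := @grid_itv R _ _ kn.
have /andP[g0' g1'] := @grid_itv R _ _ (ltnW kn).
apply: knows_add.
  by apply: (knows_mono filt g0' (grid_le (leqnSn k))); exact: ih (ltnW kn).
by apply: knows_mul; [exact: knows_cst|exact: (knows_X filt sol)].
Qed.

Lemma back_comparison f B L j k : bounded_lip f B L -> (k + j = n)%N ->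
  let A := \int[P]_w f (partial_sum n w, phi (X 1 w)) in
  let A' := \int[P]_w back f j (partial_sum k w, phi (X (k%:R / n%:R) w)) in
  A <= expR (2 * CV * (j%:R / n%:R)) * A' /\ A' <= expR (2 * CV * (j%:R / n%:R)) * A.
Proof.
move=> bf; elim: j k => [|j ih] k kj.
  have -> : k = n by rewrite -kj addn0.
  rewrite /= divff ?mul0r ?mulr0 ?expR0 ?mul1r; first by split.
  by rewrite pnatr_eq0 -lt0n.
have kj' : (k.+1 + j = n)%N by rewrite addSnnS.
have kn : (k.+1 <= n)%N by rewrite -kj' leq_addr.
have [h1 h2] := ih _ kj'.
have [B' [L' bj]] := back_bl j bf.
have nj : (n - j = k.+1)%N by rewrite -kj' addnK.
have /andP[m0 m1] := m01 k.+1.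
have /andP[g0 g1] := @grid_itv R _ _ kn.
have /andP[g0' g1'] := @grid_itv R _ _ (ltnW kn).
have [k1 k2] := exact_step filt bm sol bj m0 m1 g0' (grid_le (leqnSn k)) g1 (knows_partial_sum (ltnW kn)).
have e1 : \int[P]_w back f j (partial_sum k w + m k.+1 * X (k.+1%:R / n%:R) w, phi (X (k.+1%:R / n%:R) w))
  = \int[P]_w back f j (partial_sum k.+1 w, phi (X (k.+1%:R / n%:R) w)).
  by apply: eq_Rintegral => w _; rewrite partial_sumS.
rewrite e1 gridS in k1 k2; rewrite [back f j.+1]/= nj.
have eE : expR (2 * CV * (j.+1%:R / n%:R)) = expR (2 * CV * (j%:R / n%:R)) * expR (2 * CV * n%:R^-1).
  by rewrite -expRD -natr1; congr expR; ring.
rewrite eE; split.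
  apply: (le_trans h1); rewrite -(mulrA (expR (2 * CV * (j%:R / n%:R)))).
  by apply: ler_wpM2l; [exact: expR_ge0|exact: k1].
apply: (le_trans k2); rewrite (mulrC (expR (2 * CV * (j%:R / n%:R)))).
rewrite -(mulrA (expR (2 * CV * n%:R^-1))).
by apply: ler_wpM2l; [exact: expR_ge0|exact: h2].
Qed.

(** The factors of the [n] steps multiply to [expR (2 * CV)] whatever [n] is:
    the bounds obtained for the scheme pass to the diffusion uniformly in the
    grid. *)
Lemma scheme_comparison f B L : bounded_lip f B L ->
  let A := \int[P]_w f (partial_sum n w, phi (X 1 w)) in
  A <= expR (2 * CV) * back f n (0, 0) /\ back f n (0, 0) <= expR (2 * CV) * A.
Proof.
move=> bf; have [] := back_comparison bf (add0n n).
rewrite divff ?mulr1; last by rewrite pnatr_eq0 -lt0n.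
have -> : \int[P]_w back f n (partial_sum 0 w, phi (X (0%:R / n%:R) w)) = back f n (0, 0).
  have [B' [L' bb]] := back_bl n bf.
  rewrite -[RHS](@Rintegral_cst1 _ _ _ P); apply: ae_eq_Rintegral.
  - have g0 : 0 <= (0%:R / n%:R : R) <= 1 by rewrite mul0r lexx ler01.
    have mU : measurable_fun [set: T] (partial_sum 0).
      by apply: (knows_measurable filt _ (knows_partial_sum (leq0n n))); rewrite mul0r.
    exact: (measurableT_comp (bl_meas bb) (measurable_pair_phi filt sol mU g0)).
  - exact: measurable_cst.
  - apply: filterS (X0_start sol) => w x0.
    by rewrite /partial_sum big_ord1 mul0r x0 mulr0 lamp0.
by move=> *; split.
Qed.

Variable a : nat -> R.
Hypothesis a0 : a 0%N = 0.

Let c k := a k.+1 - a k.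
Let incr k w := W (k.+1%:R / n%:R) w - W (k%:R / n%:R) w.

Definition shifted_bm k w := W (k%:R / n%:R) w - W 0 w + a k.

Definition shifted_sum k w := \sum_(i < k.+1) m i * psi (shifted_bm i w).

(** Girsanov density of the shift [a] along the grid. *)
Definition girsanov k w := expR (\sum_(i < k) (- (c i * n%:R) * incr i w - c i ^+ 2 * n%:R / 2)).

(** A translation of the Gaussian variable of one step produces the factor of
    the Girsanov density that belongs to this step. *)
Lemma step_shift f B L mu v y b : bounded_lip f B L -> 0 <= mu -> mu <= 1 ->
  ((step M mu s f (v, y) * expR (By y))%:E = \int[leb]_x
    ((f (v + mu * psi (y + b + x), y + b + x) * expR (By (y + b + x))
       * expR (- (b * n%:R) * x - b ^+ 2 * n%:R / 2))%:E * (gk n%:R^-1 x)%:E))%E.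
Proof.
move=> bf mu0 mu1; have dt0 := dt_gt0.
pose k x : \bar R := (f (v + mu * psi (y + x), y + x) * expR (By (y + x)))%:E.
have ms : measurable_fun [set: R] (fun w => y + w) by exact: measurable_funD.
have mk : measurable_fun [set: R] k.
  apply/measurable_EFinP/measurable_funM.
    apply: (measurableT_comp (bl_meas bf)); apply: measurable_fun_pair => //.
    apply: measurable_funD => //; apply: measurable_funM => //.
    exact: (measurableT_comp (measurable_psi M) ms).
  by apply: measurableT_comp => //; exact: (measurableT_comp (measurable_By M) ms).
have k0 x : (0 <= k x)%E by rewrite lee_fin mulr_ge0 ?expR_ge0 ?(bl_ge0 bf).
transitivity (\int[leb]_x (k x * (gk n%:R^-1 x)%:E))%E.
  rewrite (ge0_integral_gk_scale dt0 mk k0).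
  rewrite EFinM (step_EFin M mu _ bf s_ge0 s_le2) -ge0_integralZr//.
  - apply: eq_integral => x _; rewrite /k /step_integrand /= -!EFinM; congr EFin.
    rewrite -/s.
    have -> : expR (By (y + s * x)) = expR (By (y + s * x) - By y) * expR (By y) by rewrite -expRD subrK.
    ring.
  - exact: measurable_int (step_integrable M mu (v, y) bf s_ge0 s_le2).
  - move=> x _; rewrite lee_fin mulr_ge0 ?gk_ge0//.
    exact: step_integrand_ge0 bf.
have mkg : measurable_fun [set: R] (fun x => k x * (gk n%:R^-1 x)%:E)%E.
  by apply: emeasurable_funM => //; exact: emeasurable_gk.
rewrite (ge0_integral_shift b mkg); last first.
  by move=> x; apply: mule_ge0; [exact: k0|rewrite lee_fin gk_ge0].
apply: eq_integral => x _; rewrite /k -!EFinM addrA; congr EFin.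
have -> : gk n%:R^-1 (b + x) = expR (- (b * n%:R) * x - b ^+ 2 * n%:R / 2) * gk n%:R^-1 x.
  rewrite /gk mulrA -expRD; congr (expR _ / _); field.
  by rewrite pnatr_eq0 -lt0n.
ring.
Qed.

Lemma shifted_bmS k w : shifted_bm k.+1 w = shifted_bm k w + c k + incr k w.
Proof. by rewrite /shifted_bm /c /incr; ring. Qed.

Lemma shifted_sumS k w :
  shifted_sum k.+1 w = shifted_sum k w + m k.+1 * psi (shifted_bm k.+1 w).
Proof. by rewrite /shifted_sum big_ord_recr. Qed.

Lemma girsanovS k w : girsanov k.+1 w =
  girsanov k w * expR (- (c k * n%:R) * incr k w - c k ^+ 2 * n%:R / 2).
Proof. by rewrite /girsanov big_ord_recr/= expRD. Qed.

Lemma knows_bm_grid i k : (i <= k)%N -> knows F (k%:R / n%:R) (W (i%:R / n%:R)).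
Proof.
move=> ik; apply: (knows_bm filt bm (s := i%:R / n%:R)); last exact: grid_le.
by rewrite divr_ge0.
Qed.

Lemma knows_shifted_bm i k : (i <= k)%N -> knows F (k%:R / n%:R) (shifted_bm i).
Proof.
move=> ik; apply: knows_add; last exact: knows_cst.
apply: knows_sub; first exact: knows_bm_grid.
by have := knows_bm_grid (leq0n k); rewrite mul0r.
Qed.

Lemma knows_shifted_sum k : knows F (k%:R / n%:R) (shifted_sum k).
Proof.
have h (i : nat) : (i <= k)%N -> knows F (k%:R / n%:R) (fun w => m i * psi (shifted_bm i w)).
  move=> ik; apply: knows_mul; first exact: knows_cst.
  apply: (knows_comp (f := psi)); last exact: knows_shifted_bm.
  exact: measurable_psi.
suff gen l : (l <= k)%N -> knows F (k%:R / n%:R) (shifted_sum l) by exact: gen.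
rewrite /shifted_sum; elim: l => [|l ih] lk.
  by under eq_fun do rewrite big_ord1; exact: h.
under eq_fun do rewrite big_ord_recr/=; apply: knows_add; last exact: h.
exact: ih (ltnW lk).
Qed.

Lemma knows_girsanov k : knows F (k%:R / n%:R) (girsanov k).
Proof.
apply: (knows_comp (f := @expR R)) => //.
suff gen l : (l <= k)%N -> knows F (k%:R / n%:R)
    (fun w => \sum_(i < l) (- (c i * n%:R) * incr i w - c i ^+ 2 * n%:R / 2)) by exact: gen.
elim: l => [|l ih] lk.
  by under eq_fun do rewrite big_ord0; exact: knows_cst.
under eq_fun do rewrite big_ord_recr/=; apply: knows_add; first exact: ih (ltnW lk).
apply: knows_sub; last exact: knows_cst.
apply: knows_mul; first exact: knows_cst.
by apply: knows_sub; [exact: (knows_bm_grid lk)|exact: (knows_bm_grid (ltnW lk))].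
Qed.

(** One step of the scheme is an average over an increment that is independent
    of the values already known. *)
Lemma girsanov_step f B L j k : bounded_lip f B L -> (k + j.+1 = n)%N ->
  (\int[P]_w (back f j.+1 (shifted_sum k w, shifted_bm k w)
      * expR (By (shifted_bm k w)) * girsanov k w)%:E =
   \int[P]_w (back f j (shifted_sum k.+1 w, shifted_bm k.+1 w)
      * expR (By (shifted_bm k.+1 w)) * girsanov k.+1 w)%:E)%E.
Proof.
move=> bf kj.
have [B' [L' bj]] := back_bl j bf.
have nj : (n - j = k.+1)%N by rewrite -kj addnS -addSn addnK.
have /andP[m0 m1] := m01 k.+1.
have g0 : 0 <= k%:R / n%:R :> R by rewrite divr_ge0.
have g1 : k%:R / n%:R < k.+1%:R / n%:R :> R.
  by rewrite -subr_gt0 gridS dt_gt0.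
pose g (z : R * R) x := back f j (z.1 + m k.+1 * psi (z.2 + c k + x), z.2 + c k + x)
  * expR (By (z.2 + c k + x)) * expR (- (c k * n%:R) * x - c k ^+ 2 * n%:R / 2).
have g_ge0 z x : 0 <= g z x.
  by rewrite /g mulr_ge0 ?expR_ge0// mulr_ge0 ?expR_ge0// (bl_ge0 bj).
have mg : measurable_fun [set: (R * R) * R] (fun y : (R * R) * R => g y.1 y.2).
  have q1 : measurable_fun [set: (R * R) * R] (fun y : (R * R) * R => y.1.1).
    exact: (measurableT_comp measurable_fst measurable_fst).
  have q2 : measurable_fun [set: (R * R) * R] (fun y : (R * R) * R => y.1.2 + c k + y.2).
    apply: measurable_funD; last exact: measurable_snd.
    by apply: measurable_funD => //; exact: (measurableT_comp measurable_snd measurable_fst).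
  apply: measurable_funM; last first.
    apply: measurableT_comp => //; apply: measurable_funB => //.
    by apply: measurable_funM => //; exact: measurable_snd.
  apply: measurable_funM; last first.
    by apply: measurableT_comp => //; exact: (measurableT_comp (measurable_By M) q2).
  apply: (measurableT_comp (bl_meas bj)); apply: measurable_fun_pair => //.
  apply: measurable_funD => //; apply: measurable_funM => //.
  exact: (measurableT_comp (measurable_psi M) q2).
pose G (y : ((R * R) * R) * R) : \bar R := (`|y.1.2| * g y.1.1 y.2)%:E.
have mG : measurable_fun [set: ((R * R) * R) * R] G.
  apply/measurable_EFinP/measurable_funM.
    by apply: measurableT_comp => //; exact: (measurableT_comp measurable_snd measurable_fst).
  have q : measurable_fun [set: ((R * R) * R) * R] (fun y : ((R * R) * R) * R => (y.1.1, y.2)).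
    apply: measurable_fun_pair; last exact: measurable_snd.
    exact: (measurableT_comp measurable_fst measurable_fst).
  exact: (measurableT_comp mg q).
have G0 y : (0 <= G y)%E by rewrite lee_fin mulr_ge0.
have kX : knows F (k%:R / n%:R) (fun w => ((shifted_sum k w, shifted_bm k w), girsanov k w)).
  by apply: knows_pair; [apply: knows_pair; [exact: knows_shifted_sum|exact: knows_shifted_bm]|exact: knows_girsanov].
have E := ge0_expectation_increment filt bm g0 g1 kX mG G0.
transitivity (\int[P]_w G (((shifted_sum k w, shifted_bm k w), girsanov k w), incr k w))%E; last first.
  apply: eq_integral => w _; rewrite /G /= /g /= ger0_norm ?expR_ge0//.
  by rewrite girsanovS shifted_sumS shifted_bmS; congr EFin; ring.
rewrite [RHS]E; apply: eq_integral => w _; rewrite gridS.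
rewrite [back f j.+1]/= nj EFinM -/dt -/s.
rewrite (step_shift (shifted_sum k w) (shifted_bm k w) (c k) bj m0 m1) -ge0_integralZr//.
- apply: eq_integral => x _; rewrite /G /= ger0_norm ?expR_ge0//.
  by rewrite -!EFinM; congr EFin; rewrite /g /=; ring.
- apply: emeasurable_funM; last exact: emeasurable_gk.
  apply/measurable_EFinP; exact: (measurable_fun_pair2 (shifted_sum k w, shifted_bm k w) mg).
- move=> x _; rewrite mule_ge0 ?lee_fin ?gk_ge0 ?dt_gt0//.
  exact: (g_ge0 (shifted_sum k w, shifted_bm k w)).
- by rewrite lee_fin expR_ge0.
Qed.

(** Shifting the Brownian motion along the grid: the value of the scheme is an
    expectation over a shifted Brownian path, for every shift. *)
Lemma scheme_girsanov f B L : bounded_lip f B L ->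
  ((back f n (0, 0) * expR (By 0))%:E = \int[P]_w (f (shifted_sum n w, shifted_bm n w)
      * expR (By (shifted_bm n w)) * girsanov n w)%:E)%E.
Proof.
move=> bf.
have main j k : (k + j = n)%N -> (\int[P]_w (back f j (shifted_sum k w, shifted_bm k w)
      * expR (By (shifted_bm k w)) * girsanov k w)%:E =
   \int[P]_w (f (shifted_sum n w, shifted_bm n w)
      * expR (By (shifted_bm n w)) * girsanov n w)%:E)%E.
  elim: j k => [|j ih] k kj; first by rewrite -kj addn0.
  by rewrite (girsanov_step bf kj) ih// addSnnS.
rewrite -(main n 0%N)//; under eq_integral => w _.
  have -> : shifted_bm 0 w = 0 by rewrite /shifted_bm mul0r a0 subrr addr0.
  have -> : shifted_sum 0 w = 0.
    by rewrite /shifted_sum big_ord1 /shifted_bm mul0r a0 subrr addr0 psi0 mulr0.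
  rewrite /girsanov big_ord0 expR0 mulr1; over.
by rewrite integral_cst1.
Qed.

End iterated_scheme.

(** * Change of variables in the plane *)

Section planar_lebesgue.
Context {R : realType}.
Notation leb := (@lebesgue_measure R).

(** A named copy of the planar Lebesgue measure, which carries the
    sigma-finiteness that Tonelli's theorem requires. *)
Definition leb2 := (leb \x leb)%E.
HB.instance Definition _ := Measure.on leb2.

Lemma leb2_sigma_finite : sigma_finite setT leb2.
Proof.
have /sigma_finiteP[G [TG ndG Goo]] := sigma_finiteT leb.
exists (fun n => G n `*` G n).
  rewrite -setXTT TG predeqE => -[x y]; split.
    move=> [/= [n _ Fnx] [k _ Gky]]; exists (maxn n k) => //; split.
    - by move: x Fnx; exact/subsetPset/ndG/leq_maxl.
    - by move: y Gky; exact/subsetPset/ndG/leq_maxr.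
  by move=> [n _ []/= ? ?]; split; exists n.
move=> k; have [? ?] := Goo k.
split; first exact: measurableX.
by rewrite [leb2 _]product_measure1E// lte_mul_pinfty// ge0_fin_numE.
Qed.
HB.instance Definition _ := Measure_isSigmaFinite.Build _ _ _ leb2 leb2_sigma_finite.

Lemma integral_leb2 (k : R * R -> \bar R) : measurable_fun setT k -> (forall z, (0 <= k z)%E) ->
  (\int[leb2]_z k z = \int[leb]_y \int[leb]_x k (x, y))%E.
Proof.
move=> mk k0; rewrite /leb2 (@fubini_tonelli1 _ _ _ _ _ leb leb k mk k0).
exact: (@fubini_tonelli _ _ _ _ _ leb leb k mk k0).
Qed.

Definition slopes (s S : R) (F : R -> R) :=
  forall x y, x <= y -> s * (y - x) <= F y - F x <= S * (y - x).

Lemma slopes_continuous (s S : R) F : 0 < s -> 0 < S -> slopes s S F -> continuous F.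
Proof.
move=> s0 S0 h; apply: (lip_continuous S0) => x y xy; have /andP[h1 h2] := h _ _ xy.
by rewrite ger0_norm// (le_trans _ h1)// mulr_ge0 ?subr_ge0// ltW.
Qed.

(** One inequality is the change of variables for [F], the other one is that
    for its inverse. *)
Lemma ge0_integral_subst_slopes (s S : R) F (k : R -> \bar R) : 0 < s -> 0 < S -> slopes s S F ->
  measurable_fun setT k -> (forall x, (0 <= k x)%E) ->
  (s%:E * \int[leb]_x k (F x) <= \int[leb]_x k x)%E /\
  (\int[leb]_x k x <= S%:E * \int[leb]_x k (F x))%E.
Proof.
move=> s0 S0 h mk k0; have cF := slopes_continuous s0 S0 h.
have hs x y : x <= y -> s * (y - x) <= F y - F x by move=> /h/andP[].
have [G GF FG] := steep_bijective s0 cF hs.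
split; first exact: (ge0_integral_subst_le s0 FG GF hs mk k0).
have mF : measurable_fun setT F by exact: continuous_measurable_fun.
have hS x y : x <= y -> S^-1 * (y - x) <= G y - G x.
  move=> xy; have Gxy : G x <= G y.
    by rewrite leNgt; apply/negP => g; have := hs _ _ (ltW g); rewrite !GF; nra.
  have /andP[_] := h _ _ Gxy; rewrite !GF => e.
  by rewrite mulrC ler_pdivrMr// mulrC.
have iS0 : 0 < S^-1 by rewrite invr_gt0.
have := ge0_integral_subst_le iS0 GF FG hS (measurableT_comp mk mF : measurable_fun setT (k \o F))
  (fun x => k0 (F x)).
under eq_integral do rewrite /= GF.
move=> e; rewrite -[leLHS]mul1e -(@divff _ S) ?gt_eqF// EFinM -muleA.
by apply: lee_wpmul2l => //; rewrite lee_fin ltW.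
Qed.

(** The map [(x, y) -> (U (x, y), V y)] is triangular, so that Tonelli's
    theorem reduces it to two changes of variables on the line. *)
Lemma ge0_integral2_subst_slopes (s S s' S' : R) (U : R * R -> R) (V : R -> R) (k : R * R -> \bar R) :
  0 < s -> 0 < S -> 0 < s' -> 0 < S' ->
  (forall e, slopes s S (fun x => U (x, e))) -> slopes s' S' V -> measurable_fun setT U ->
  measurable_fun setT k -> (forall z, (0 <= k z)%E) ->
  ((s * s')%:E * \int[leb2]_e k (U e, V e.2) <= \int[leb2]_z k z)%E /\
  (\int[leb2]_z k z <= (S * S')%:E * \int[leb2]_e k (U e, V e.2))%E.
Proof.
move=> s0 S0 s'0 S'0 hU hV mU mk k0.
have mV : measurable_fun setT V.
  by apply: continuous_measurable_fun; exact: (slopes_continuous s'0 S'0 hV).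
have mUV : measurable_fun setT (fun e : R * R => (U e, V e.2)).
  apply: (@measurable_fun_pair _ _ _ _ _ _ U (V \o snd)) => //.
  exact: (measurableT_comp mV measurable_snd).
have mkUV : measurable_fun setT (fun e : R * R => k (U e, V e.2)) by exact: (measurableT_comp mk mUV).
rewrite !integral_leb2//.
pose q v := (\int[leb]_u k (u, v))%E.
have mq : measurable_fun setT q by exact: (@measurable_fun_fubini_tonelli_G _ _ _ _ _ leb).
have q0 v : (0 <= q v)%E by exact: integral_ge0.
have mkv v : measurable_fun setT (fun u => k (u, v)).
  exact: (measurableT_comp mk (measurable_pair2 _)).
pose r y := (\int[leb]_x k (U (x, y), V y))%E.
have mr : measurable_fun setT r.
  by have := @measurable_fun_fubini_tonelli_G _ _ _ _ _ leb _ mkUV; apply.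
have r0 y : (0 <= r y)%E by exact: integral_ge0.
have inner y : (s%:E * r y <= q (V y))%E /\ (q (V y) <= S%:E * r y)%E.
  exact: (ge0_integral_subst_slopes s0 S0 (hU y) (mkv (V y)) (fun x => k0 (x, V y))).
have [ou ol] := ge0_integral_subst_slopes s'0 S'0 hV mq q0.
have rZ (c : R) : 0 < c -> (\int[leb]_y (c%:E * r y) = c%:E * \int[leb]_y r y)%E.
  by move=> c0; apply: ge0_integralZl => //; rewrite lee_fin ltW.
have mqV : measurable_fun setT (fun y => q (V y)) by exact: (measurableT_comp mq mV).
split.
  apply: le_trans ou; rewrite mulrC EFinM -muleA; apply: lee_wpmul2l; first by rewrite lee_fin ltW.
  rewrite -(rZ _ s0); apply: ge0_le_integral => //.
  - by move=> y _; rewrite mule_ge0// lee_fin ltW.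
  - exact: (measurable_funeM _ mr).
  - by move=> y _; have [] := inner y.
apply: (le_trans ol); rewrite mulrC EFinM -muleA; apply: lee_wpmul2l; first by rewrite lee_fin ltW.
rewrite -(rZ _ S0); apply: ge0_le_integral => //.
- exact: (measurable_funeM _ mr).
- by move=> y _; have [] := inner y.
Qed.

End planar_lebesgue.

(** * Convexity and quadratic exponents *)

Section convexity.
Context {R : realType}.

(** Jensen's inequality for finite weights: the tangent line at the mean lies
    below the convex function. *)
Lemma weighted_tangent (N : nat) (p x : nat -> R) (f : R -> R) (a : R) :
  let xb := \sum_(i < N) p i * x i in
  (forall i, 0 <= p i) -> \sum_(i < N) p i = 1 ->
  (forall y, f xb + a * (y - xb) <= f y) ->
  f xb <= \sum_(i < N) p i * f (x i).
Proof.
move=> xb p0 p1 tg.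
have e : \sum_(i < N) p i * (f xb + a * (x i - xb)) = f xb.
  transitivity (\sum_(i < N) (p i * (f xb - a * xb) + a * (p i * x i))).
    by apply: eq_bigr => i _; ring.
  by rewrite big_split/= -mulr_suml p1 -mulr_sumr -/xb; ring.
by rewrite -[leLHS]e; apply: ler_sum => i _; apply: ler_wpM2l.
Qed.

Lemma weighted_sqr_le (N : nat) (p x : nat -> R) :
  (forall i, 0 <= p i) -> \sum_(i < N) p i = 1 ->
  (\sum_(i < N) p i * x i) ^+ 2 <= \sum_(i < N) p i * x i ^+ 2.
Proof.
move=> p0 p1; set xb := \sum_(i < N) p i * x i.
apply: (@weighted_tangent N p x (fun y => y ^+ 2) (2 * xb)) => // y.
by rewrite -/xb; have := sqr_ge0 (y - xb); nra.
Qed.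

Lemma weighted_expR_le (N : nat) (p x : nat -> R) :
  (forall i, 0 <= p i) -> \sum_(i < N) p i = 1 ->
  expR (\sum_(i < N) p i * x i) <= \sum_(i < N) p i * expR (x i).
Proof.
move=> p0 p1; set xb := \sum_(i < N) p i * x i.
apply: (@weighted_tangent N p x expR (expR xb)) => // y.
rewrite -/xb -[X in X + _]mulr1 -mulrDr -[leRHS](_ : expR xb * expR (y - xb) = _).
  by apply: ler_wpM2l; [exact: expR_ge0|exact: expR_ge1Dx].
by rewrite -expRD addrC subrK.
Qed.

End convexity.

(** The exponents that occur after the change of measure are quadratic forms
    in the shift [(x, y)] and in the values [p], [r] of the path at one half
    and at one; the Gaussian weight of the shift absorbs the cross terms. *)
Section exponents.
Context {R : realType}.

Lemma exponent_upper (K L S x y p r u v B0 B : R) : 0 < K -> 0 <= L -> 0 <= S ->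
  B - B0 <= L * `|r + y| ->
  u ^+ 2 <= K ^+ 2 * (3 * (S + x ^+ 2 + y ^+ 2)) -> v ^+ 2 <= K ^+ 2 * (r + y) ^+ 2 ->
  B + (- x * (2 * p - r) - y * r - (x ^+ 2 + y ^+ 2) / 2) - 82 * (x ^+ 2 + y ^+ 2) <=
  B0 + 7 * L ^+ 2 - (100 * K ^+ 2)^-1 * (u ^+ 2 + v ^+ 2) + (S + p ^+ 2 + r ^+ 2) / 8.
Proof.
move=> K0 L0 S0 hB hu hv; have K20 : 0 < 100 * K ^+ 2 by rewrite mulr_gt0// exprn_gt0.
have h1 : (100 * K ^+ 2)^-1 * (u ^+ 2 + v ^+ 2) <=
    (3 * (S + x ^+ 2 + y ^+ 2) + (r + y) ^+ 2) / 100.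
  by rewrite mulrC ler_pdivrMr//; apply: (le_trans (lerD hu hv)); lra.
have h2 : L * `|r + y| <= 7 * L ^+ 2 + (r + y) ^+ 2 / 28.
  by rewrite -[in leRHS](@real_normK _ (r + y)) ?num_real//; have := sqr_ge0 (14 * L - `|r + y|); nra.
have h3 : - x * (2 * p - r) <= 17 * x ^+ 2 + p ^+ 2 / 8 + r ^+ 2 / 36.
  by have := sqr_ge0 (8 * x + p); have := sqr_ge0 (18 * x - r); nra.
have h4 : - (y * r) <= 17 * y ^+ 2 + r ^+ 2 / 36 by have := sqr_ge0 (18 * y + r); nra.
have h5 : (r + y) ^+ 2 / 100 <= (r ^+ 2) / 50 + y ^+ 2 / 50.
  by have := sqr_ge0 (r - y); nra.
have h6 : (r + y) ^+ 2 / 28 <= (r ^+ 2) * (21 / 560) + y ^+ 2 by have := sqr_ge0 (r - 20 * y); nra.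
have := sqr_ge0 x; have := sqr_ge0 y; have := sqr_ge0 r; lra.
Qed.

Definition lower_y (al : R) := 2 / al ^+ 2 + 48.

Definition lower_x (K al m : R) := (2 + 4 * K ^+ 2 * (24 + lower_y al)) / (al * m) ^+ 2.

Definition lower_rate (K al m L : R) := L ^+ 2 + 100 + 90 * (lower_x K al m + lower_y al).

(** Here the shift is bounded by the point [(u, v)] that it reaches: [y] since
    [v] dominates [al * (r + y)], and then [x] since [u] differs from the value
    [w] without tent shift by at least [al * m * x]. *)
Lemma exponent_lower (K al m L S x y p r u v w B0 B : R) :
  0 < al -> 0 < m -> 0 < K -> 0 <= L -> 0 <= S -> S + p ^+ 2 + r ^+ 2 <= 24 ->
  B0 - B <= L * `|r + y| ->
  al ^+ 2 * (r + y) ^+ 2 <= v ^+ 2 ->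
  (al * m) ^+ 2 * x ^+ 2 <= (u - w) ^+ 2 -> w ^+ 2 <= K ^+ 2 * (2 * (S + y ^+ 2)) ->
  B0 - lower_rate K al m L * (1 + u ^+ 2 + v ^+ 2) <=
  B + (- x * (2 * p - r) - y * r - (x ^+ 2 + y ^+ 2) / 2) - 82 * (x ^+ 2 + y ^+ 2).
Proof.
move=> al0 m0 K0 L0 S0 PS hB hv hu hw; rewrite /lower_rate; set C2 := lower_y al; set C1 := lower_x K al m.
have al20 : 0 < al ^+ 2 by rewrite exprn_gt0.
have am0 : 0 < (al * m) ^+ 2 by rewrite exprn_gt0// mulr_gt0.
have C20 : 48 <= C2 by rewrite /C2 /lower_y lerDr divr_ge0// ltW.
have K20 := sqr_ge0 K; have C10 : 0 <= C1.
  by rewrite /C1 /lower_x -/C2 divr_ge0 ?(ltW am0)// addr_ge0// !mulr_ge0//; lra.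
set q := 1 + u ^+ 2 + v ^+ 2.
have u20 := sqr_ge0 u; have v20 := sqr_ge0 v; have q1 : 1 <= q by rewrite /q; lra.
have p20 := sqr_ge0 p; have r20 := sqr_ge0 r.
have hy : y ^+ 2 <= C2 * q.
  have ry : (r + y) ^+ 2 <= v ^+ 2 / al ^+ 2 by rewrite ler_pdivlMr// mulrC.
  have h1 : y ^+ 2 <= 2 * (v ^+ 2 / al ^+ 2) + 48.
    by have := sqr_ge0 (2 * r + y); move: ry; clear -PS S0 p20; nra.
  have h2 : 2 / al ^+ 2 * v ^+ 2 <= 2 / al ^+ 2 * q.
    by apply: ler_wpM2l; [rewrite divr_ge0// ltW|rewrite /q; lra].
  rewrite /C2 /lower_y [in leRHS]mulrDl (le_trans h1)// (_ : 2 * (v ^+ 2 / al ^+ 2) = 2 / al ^+ 2 * v ^+ 2).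
    by lra.
  by ring.
have hw' : w ^+ 2 <= 2 * K ^+ 2 * (24 + C2) * q.
  apply: (le_trans hw).
  have : S + y ^+ 2 <= (24 + C2) * q by clear -q1 hy PS p20 r20 S0; nra.
  by move=> /(ler_wpM2l K20); lra.
have hx : x ^+ 2 <= C1 * q.
  rewrite /C1 /lower_x -/C2 mulrAC ler_pdivlMr// mulrC (le_trans hu)//.
  have : (u - w) ^+ 2 <= 2 * u ^+ 2 + 2 * w ^+ 2 by have := sqr_ge0 (u + w); nra.
  by rewrite /q in hw' *; lra.
have hL : L * `|r + y| <= L ^+ 2 + r ^+ 2 / 2 + y ^+ 2 / 2.
  have : L * `|r + y| <= L ^+ 2 + (r + y) ^+ 2 / 4.
    by rewrite -[in leRHS](@real_normK _ (r + y)) ?num_real//; have := sqr_ge0 (2 * L - `|r + y|); nra.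
  by have := sqr_ge0 (r - y); nra.
have h1 : x * (2 * p - r) <= 3 / 2 * x ^+ 2 + p ^+ 2 + r ^+ 2 / 2.
  by have := sqr_ge0 (x - p); have := sqr_ge0 (x + r); nra.
have h2 : y * r <= y ^+ 2 / 2 + r ^+ 2 / 2 by have := sqr_ge0 (y - r); nra.
have L20 := sqr_ge0 L.
have h3 : L ^+ 2 + 36 <= (L ^+ 2 + 100) * q by clear -q1 L20; nra.
have h4 : 84 * (x ^+ 2 + y ^+ 2) <= 90 * (C1 + C2) * q.
  have : 0 <= C1 * q by rewrite mulr_ge0//; lra.
  have : 0 <= C2 * q by rewrite mulr_ge0//; lra.
  by clear -hx hy; lra.
have x20 := sqr_ge0 x; have y20 := sqr_ge0 y.
rewrite (mulrDl (L ^+ 2 + 100)); clear -h1 h2 h3 h4 hL hB PS S0 x20 y20 p20 r20.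
lra.
Qed.

End exponents.

(** * Gaussian bounds for the discrete scheme *)

Section gaussian_bounds.
Context {R : realType} d (T : measurableType d) (P : probability T R).
Variables (F : R -> set (set T)) (W : R -> T -> R).
Hypothesis (filt : filtration F) (bm : brownian_motion P F W).
Variables (K alpha : R) (M : diffusion_model K alpha).
Variables (h : nat) (m : nat -> R).
Local Notation n := (h + h)%N.
Hypotheses (h0 : (0 < h)%N) (m01 : forall i, 0 <= m i <= 1)
  (m1 : \sum_(i < n.+1) m i = 1).
Notation leb := (@lebesgue_measure R).
Local Notation phi := (lamp M).
Local Notation psi := (lampV M).
Local Notation By := (By M).

Definition hat (i : nat) : R := Num.min (i%:R / n%:R) (1 - i%:R / n%:R).

Definition bpath i w := W (i%:R / n%:R) w - W 0 w.

(** The two shapes along which the path is shifted: the tent moves the weighted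
    sum without moving the endpoint, the straight line moves the endpoint. *)
Definition shift (e : R * R) (i : nat) := e.1 * hat i + e.2 * (i%:R / n%:R).

Lemma n_gt0 : 0 < n%:R :> R.
Proof. by rewrite ltr0n addn_gt0 h0. Qed.

Lemma half_n : h%:R / n%:R = 2^-1 :> R.
Proof.
have h00 : h%:R != 0 :> R by rewrite pnatr_eq0 -lt0n.
have -> : n%:R = h%:R * 2 :> R by rewrite natrD; ring.
by rewrite invfM mulrA divff// mul1r.
Qed.

Lemma hat_low i : (i <= h)%N -> hat i = i%:R / n%:R.
Proof.
move=> ih; rewrite /hat; apply: min_l.
have : i%:R / n%:R <= h%:R / n%:R :> R by rewrite ler_pM2r ?invr_gt0 ?n_gt0// ler_nat.
by rewrite half_n; lra.
Qed.

Lemma hat_high i : (h <= i)%N -> hat i = 1 - i%:R / n%:R.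
Proof.
move=> ih; rewrite /hat; apply: min_r.
have : h%:R / n%:R <= i%:R / n%:R :> R by rewrite ler_pM2r ?invr_gt0 ?n_gt0// ler_nat.
by rewrite half_n; lra.
Qed.

Lemma grid_end : n%:R / n%:R = 1 :> R.
Proof. by rewrite divff// gt_eqF// n_gt0. Qed.

Lemma hat_itv i : (i <= n)%N -> 0 <= hat i <= 1.
Proof.
move=> iN; have /andP[g0 g1] := @grid_itv R _ _ iN.
by rewrite /hat le_min g0 subr_ge0 g1 ge_min g1.
Qed.

Lemma shift0 e : shift e 0 = 0.
Proof. by rewrite /shift hat_low// mul0r !mulr0 addr0. Qed.

Lemma shift_end e : shift e n = e.2.
Proof. by rewrite /shift hat_high ?leq_addr// grid_end subrr mulr0 add0r mulr1. Qed.

(** The increments are multiplied by [e.2 + e.1] on the first half of the grid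
    and by [e.2 - e.1] on the second one, and they telescope on each half. *)
Lemma girsanov_shift e w : girsanov W n (shift e) n w =
  expR (- e.1 * (2 * bpath h w - bpath n w) - e.2 * bpath n w - (e.1 ^+ 2 + e.2 ^+ 2) / 2).
Proof.
have n0 := n_gt0; have nn : n%:R != 0 :> R by rewrite gt_eqF.
rewrite /girsanov; congr expR; rewrite big_split_ord/=.
pose half k e' := \sum_(i < h) (- e' * (W ((k + i).+1%:R / n%:R) w - W ((k + i)%:R / n%:R) w)
    - e' ^+ 2 / n%:R / 2).
have low (i : 'I_h) : shift e i.+1 - shift e i = (e.1 + e.2) / n%:R.
  rewrite /shift !hat_low ?(ltnW (ltn_ord i))//; rewrite -natr1; ring.
have high (i : 'I_h) : shift e (h + i).+1 - shift e (h + i) = (e.2 - e.1) / n%:R.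
  rewrite /shift !hat_high ?leq_addr//; last by rewrite (leq_trans (leq_addr i h)).
  have -> : (h + i).+1%:R = (h + i)%N%:R + 1 :> R by rewrite natr1.
  by ring.
have halfE k e' : half k e' = - e' * (W ((k + h)%:R / n%:R) w - W (k%:R / n%:R) w) - e' ^+ 2 / 4.
  rewrite /half sumrB -mulr_sumr sumr_const card_ord; congr (_ * _ - _).
    rewrite -(big_mkord xpredT (fun i => W ((k + i).+1%:R / n%:R) w - W ((k + i)%:R / n%:R) w)).
    under eq_bigr do rewrite -addnS.
    by rewrite (telescope_sumr (fun i => W ((k + i)%:R / n%:R) w))// addn0.
  rewrite -mulr_natl -[RHS]mulr1 -(mulfV nn) !natrD.
  field; rewrite -natrD; exact: nn.
have k1 (z : R) : - (z / n%:R * n%:R) = - z by rewrite divfK.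
have k2 (z : R) : (z / n%:R) ^+ 2 * n%:R / 2 = z ^+ 2 / n%:R / 2.
  have -> : (z / n%:R) ^+ 2 * n%:R = z ^+ 2 / n%:R * (n%:R^-1 * n%:R) by ring.
  by rewrite mulVf// mulr1.
transitivity (half 0%N (e.1 + e.2) + half h (e.2 - e.1)).
  congr (_ + _); apply: eq_bigr => i _; by rewrite ?add0n ?low ?high k1 k2.
rewrite !halfE add0n mul0r /bpath.
set p := W (h%:R / n%:R) w; set q := W (n%:R / n%:R) w; set r := W 0 w.
by field.
Qed.

Definition path_sum (e : R * R) w := \sum_(i < n.+1) m i * psi (bpath i w + shift e i).

Definition path_end (e : R * R) w := psi (bpath n w + e.2).

Definition tent_mass := \sum_(i < n.+1) m i * hat i.

Definition sqr_sum w := \sum_(i < n.+1) m i * bpath i w ^+ 2.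

(** The values of the path on which the density of the shifted path depends. *)
Definition energy w := sqr_sum w + bpath h w ^+ 2 + bpath n w ^+ 2.

Let m_ge0 i : 0 <= m i. Proof. by have /andP[] := m01 i. Qed.

Let ord_le (i : 'I_n.+1) : (i <= n)%N. Proof. by rewrite -ltnS ltn_ord. Qed.

Lemma tent_mass_ge0 : 0 <= tent_mass.
Proof. by apply: sumr_ge0 => i _; rewrite mulr_ge0//; have /andP[] := hat_itv (ord_le i). Qed.

Lemma tent_mass_le1 : tent_mass <= 1.
Proof.
rewrite -m1; apply: ler_sum => i _; rewrite -[leRHS]mulr1; apply: ler_wpM2l => //.
by have /andP[] := hat_itv (ord_le i).
Qed.

Lemma sqr_sum_ge0 w : 0 <= sqr_sum w.
Proof. by apply: sumr_ge0 => i _; rewrite mulr_ge0// sqr_ge0. Qed.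

Lemma path_sum_slopes w y : slopes (alpha * tent_mass) (K * tent_mass) (fun x => path_sum (x, y) w).
Proof.
move=> x1 x2 x12; rewrite -sumrB.
have e (c : R) : c * tent_mass * (x2 - x1) = \sum_(i < n.+1) m i * (c * (hat i * (x2 - x1))).
  by rewrite /tent_mass mulr_sumr mulr_suml; apply: eq_bigr => i _; ring.
have hi (i : 'I_n.+1) : alpha * (hat i * (x2 - x1)) <=
    psi (bpath i w + shift (x2, y) i) - psi (bpath i w + shift (x1, y) i) <= K * (hat i * (x2 - x1)).
  have /andP[t0 t1] := hat_itv (ord_le i).
  have le : bpath i w + shift (x1, y) i <= bpath i w + shift (x2, y) i.
    by rewrite lerD2l /shift/= lerD2r ler_wpM2r.
  have -> : hat i * (x2 - x1) = (bpath i w + shift (x2, y) i) - (bpath i w + shift (x1, y) i).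
    by rewrite /shift/=; ring.
  exact: (psi_lip M le).
rewrite !e; apply/andP; split; apply: ler_sum => i _; rewrite -mulrBr; apply: ler_wpM2l => //;
  by have /andP[] := hi i.
Qed.

Lemma path_sum_slopes_mu0 mu0 w y : mu0 <= tent_mass ->
  slopes (alpha * mu0) K (fun x => path_sum (x, y) w).
Proof.
move=> tm x1 x2 x12; have /andP[h1 h2] := path_sum_slopes w y x12.
have x0 : 0 <= x2 - x1 by rewrite subr_ge0.
apply/andP; split.
  by apply: le_trans h1; rewrite ler_wpM2r// ler_wpM2l// ltW// (alpha_gt0 M).
by apply: (le_trans h2); rewrite ler_wpM2r// ler_piMr ?tent_mass_le1// ltW// (K_gt0 M).
Qed.

Lemma path_end_slopes w x : slopes alpha K (fun y => path_end (x, y) w).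
Proof.
move=> y1 y2 y12; rewrite /path_end/=.
have -> : y2 - y1 = (bpath n w + y2) - (bpath n w + y1) by ring.
by apply: (psi_lip M); rewrite lerD2l.
Qed.

(** Jensen's inequality for the weights [m], and [psi] is [K]-Lipschitz. *)
Lemma path_sum_sqr (e : R * R) w (c q : R) :
  (forall i, (i <= n)%N -> (bpath i w + shift e i) ^+ 2 <= c * bpath i w ^+ 2 + q) ->
  path_sum e w ^+ 2 <= K ^+ 2 * (c * sqr_sum w + q).
Proof.
move=> hi; apply: (le_trans (weighted_sqr_le (fun i => psi (bpath i w + shift e i)) m_ge0 m1)).
have -> : K ^+ 2 * (c * sqr_sum w + q) = \sum_(i < n.+1) m i * (K ^+ 2 * (c * bpath i w ^+ 2 + q)).
  have -> : \sum_(i < n.+1) m i * (K ^+ 2 * (c * bpath i w ^+ 2 + q)) =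
      \sum_(i < n.+1) (K ^+ 2 * c * (m i * bpath i w ^+ 2) + K ^+ 2 * q * m i).
    by apply: eq_bigr => i _; ring.
  by rewrite big_split/= -!mulr_sumr m1 /sqr_sum; ring.
apply: ler_sum => i _; apply: ler_wpM2l => //.
apply: (@le_trans _ _ (K ^+ 2 * (bpath i w + shift e i) ^+ 2)).
  have /andP[_ le] := psi_bound M (bpath i w + shift e i).
  rewrite -(real_normK (num_real (psi _))) -(real_normK (num_real (_ + shift e i))) -exprMn.
  by rewrite lerXn2r ?nnegrE ?mulr_ge0 ?(ltW (K_gt0 M)).
by apply: ler_wpM2l; [exact: sqr_ge0|exact: hi].
Qed.

Lemma path_sum_sqr_le (e : R * R) w :
  path_sum e w ^+ 2 <= K ^+ 2 * (3 * (sqr_sum w + e.1 ^+ 2 + e.2 ^+ 2)).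
Proof.
have -> : 3 * (sqr_sum w + e.1 ^+ 2 + e.2 ^+ 2) = 3 * sqr_sum w + 3 * (e.1 ^+ 2 + e.2 ^+ 2) by ring.
apply: path_sum_sqr => i iN; rewrite /shift.
have /andP[t0 t1] := hat_itv iN; have /andP[g0 g1] := @grid_itv R _ _ iN.
have sq (p q r : R) : (p + (q + r)) ^+ 2 <= 3 * p ^+ 2 + 3 * (q ^+ 2 + r ^+ 2).
  by have := sqr_ge0 (p - q); have := sqr_ge0 (p - r); have := sqr_ge0 (q - r); nra.
apply: (le_trans (sq _ _ _)); rewrite lerD2l ler_pM2l// lerD//;
  by rewrite exprMn ler_piMr ?sqr_ge0// exprn_ile1.
Qed.

Lemma unshifted_sum_sqr_le (y : R) w :
  path_sum (0, y) w ^+ 2 <= K ^+ 2 * (2 * (sqr_sum w + y ^+ 2)).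
Proof.
rewrite mulrDr; apply: path_sum_sqr => i iN; rewrite /shift /= mul0r add0r.
have /andP[g0 g1] := @grid_itv R _ _ iN.
apply: (le_trans (sqrD_le _ _)); rewrite ?mulrDr lerD2l ler_pM2l//.
by rewrite exprMn ler_piMr ?sqr_ge0// exprn_ile1.
Qed.

Lemma path_sum_shift_sqr (x y : R) w :
  (alpha * tent_mass) ^+ 2 * x ^+ 2 <= (path_sum (x, y) w - path_sum (0, y) w) ^+ 2.
Proof.
have am0 : 0 <= alpha * tent_mass by rewrite mulr_ge0 ?tent_mass_ge0// ltW// (alpha_gt0 M).
rewrite -exprMn; have [x0|/ltW x0] := leP 0 x.
  have /andP[le _] := path_sum_slopes w y x0; rewrite subr0 in le.
  have z0 : 0 <= alpha * tent_mass * x by exact: mulr_ge0.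
  by rewrite lerXn2r// nnegrE (le_trans z0).
have /andP[le _] := path_sum_slopes w y x0; rewrite sub0r in le.
rewrite -sqrrN -[leRHS]sqrrN -mulrN opprB.
have z0 : 0 <= alpha * tent_mass * - x by rewrite mulr_ge0// oppr_ge0.
by rewrite lerXn2r// nnegrE (le_trans z0).
Qed.

Lemma path_end_sqr (e : R * R) w :
  alpha ^+ 2 * (bpath n w + e.2) ^+ 2 <= path_end e w ^+ 2 <= K ^+ 2 * (bpath n w + e.2) ^+ 2.
Proof.
have /andP[le1 le2] := psi_bound M (bpath n w + e.2).
rewrite -(real_normK (num_real (path_end _ _))) -(real_normK (num_real (_ + e.2))) -!exprMn.
by rewrite !lerXn2r ?nnegrE ?mulr_ge0 ?(ltW (K_gt0 M)) ?(ltW (alpha_gt0 M)).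
Qed.

(** Gaussian weight of the shifts, of a variance small enough for the term
    [- 82 * (x ^+ 2 + y ^+ 2)] to dominate the others in [exponent_upper]. *)
Definition weight (e : R * R) := gk 164^-1 e.1 * gk 164^-1 e.2.

Definition weight_scale : R := (Num.sqrt (2 * pi * 164^-1) ^+ 2)^-1.

Lemma weight_scale_gt0 : 0 < weight_scale.
Proof. by rewrite invr_gt0 exprn_gt0// sqrtr_gt0 !mulr_gt0// pi_gt0. Qed.

Lemma weightE e : weight e = weight_scale * expR (- 82 * (e.1 ^+ 2 + e.2 ^+ 2)).
Proof.
rewrite /weight /gk /weight_scale mulrACA -expRD mulrC -invfM -expr2; congr (_ * expR _).
by field.
Qed.

Lemma weight_ge0 e : 0 <= weight e.
Proof. by rewrite mulr_ge0// gk_ge0. Qed.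

Lemma measurable_weight : measurable_fun [set: R * R] weight.
Proof.
apply: measurable_funM; [exact: (measurableT_comp (measurable_gk _) measurable_fst)|].
exact: (measurableT_comp (measurable_gk _) measurable_snd).
Qed.

Lemma integral_weight : (\int[leb2]_e (weight e)%:E = 1)%E.
Proof.
have t0 : 0 < 164^-1 :> R by [].
rewrite integral_leb2; first last.
- by move=> e; rewrite lee_fin weight_ge0.
- by apply/measurable_EFinP; exact: measurable_weight.
rewrite -[RHS](integral_gk t0); apply: eq_integral => y _; rewrite /weight/=.
under eq_integral do rewrite mulrC EFinM.
rewrite ge0_integralZl//.
- by rewrite integral_gk// mule1.
- exact: emeasurable_gk.
- by move=> x _; rewrite lee_fin gk_ge0.
- by rewrite lee_fin gk_ge0.
Qed.

(** The weighted density of the shifted path with respect to the original one. *)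
Definition tilt (e : R * R) w :=
  expR (By (bpath n w + e.2)) * girsanov W n (shift e) n w * weight e.

Lemma tilt_ge0 e w : 0 <= tilt e w.
Proof. by rewrite !mulr_ge0 ?expR_ge0 ?weight_ge0. Qed.

Lemma tiltE e w : tilt e w = weight_scale *
  expR (By (bpath n w + e.2) + (- e.1 * (2 * bpath h w - bpath n w) - e.2 * bpath n w
    - (e.1 ^+ 2 + e.2 ^+ 2) / 2) - 82 * (e.1 ^+ 2 + e.2 ^+ 2)).
Proof.
rewrite /tilt girsanov_shift weightE [in RHS]expRD [in RHS]expRD mulrCA mulNr.
by congr (_ * (_ * expR _)); rewrite ?mulNr.
Qed.

Let By_dist (z : R) : `|By z - By 0| <= LB K alpha * `|z|.
Proof. by have := By_lip M 0 z; rewrite subr0. Qed.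

Definition upper_rate : R := (100 * K ^+ 2)^-1.

Lemma tilt_upper e w : tilt e w <= weight_scale * expR (By 0 + 7 * LB K alpha ^+ 2) *
  expR (energy w / 8) * expR (- upper_rate * (path_sum e w ^+ 2 + path_end e w ^+ 2)).
Proof.
rewrite tiltE -!(mulrA weight_scale); apply: ler_wpM2l; first exact: ltW weight_scale_gt0.
rewrite -!expRD ler_expR.
have /andP[_ pe] := path_end_sqr e w.
have Bz : By (bpath n w + e.2) - By 0 <= LB K alpha * `|bpath n w + e.2|.
  by rewrite (le_trans (ler_norm _))// By_dist.
have := exponent_upper (bpath h w) (K_gt0 M) (ltW (LB_gt0 M)) (sqr_sum_ge0 w) Bz
  (path_sum_sqr_le e w) pe.
by rewrite -/upper_rate -/(energy w); lra.
Qed.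

(** The lower bound cannot hold for all paths: a path of large energy has to be
    shifted far to reach a given point. *)
Lemma tilt_lower mu0 e w : 0 < mu0 -> mu0 <= tent_mass -> energy w <= 24 ->
  weight_scale * expR (By 0 - lower_rate K alpha mu0 (LB K alpha) *
    (1 + path_sum e w ^+ 2 + path_end e w ^+ 2)) <= tilt e w.
Proof.
case: e => x y mu00 tm e24; rewrite tiltE; apply: ler_wpM2l; first exact: ltW weight_scale_gt0.
rewrite ler_expR.
have /andP[pe _] := path_end_sqr (x, y) w.
have Bz : By 0 - By (bpath n w + y) <= LB K alpha * `|bpath n w + y|.
  by rewrite (le_trans _ (By_dist _))// distrC ler_norm.
have ps : (alpha * mu0) ^+ 2 * x ^+ 2 <= (path_sum (x, y) w - path_sum (0, y) w) ^+ 2.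
  apply: le_trans (path_sum_shift_sqr x y w); apply: ler_wpM2r; first exact: sqr_ge0.
  have a0 := alpha_gt0 M; have am : 0 <= alpha * mu0 by rewrite ltW// mulr_gt0.
  by rewrite lerXn2r ?nnegrE ?ler_pM2l// mulr_ge0 ?(ltW a0)// tent_mass_ge0.
exact: (exponent_lower (alpha_gt0 M) mu00 (K_gt0 M) (ltW (LB_gt0 M)) (sqr_sum_ge0 w) e24 Bz pe ps
  (unshifted_sum_sqr_le y w)).
Qed.

Lemma measurable_bpath i : measurable_fun [set: T] (bpath i).
Proof. by apply: (measurable_increment filt bm) => //; rewrite divr_ge0. Qed.

Lemma measurable_path_sum : measurable_fun [set: T * (R * R)] (fun z => path_sum z.2 z.1).
Proof.
apply: measurable_sum => i; apply: measurable_funM => //.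
apply: (measurableT_comp (measurable_psi M)); apply: measurable_funD.
  exact: (measurableT_comp (measurable_bpath i) measurable_fst).
have m2 : measurable_fun [set: T * (R * R)] (snd : T * (R * R) -> R * R) by exact: measurable_snd.
apply: measurable_funD; apply: measurable_funM => //.
  exact: (measurableT_comp measurable_fst m2).
exact: (measurableT_comp measurable_snd m2).
Qed.

Lemma measurable_end_shift : measurable_fun [set: T * (R * R)] (fun z => bpath n z.1 + z.2.2).
Proof.
apply: measurable_funD; first exact: (measurableT_comp (measurable_bpath n) measurable_fst).
have m2 : measurable_fun [set: T * (R * R)] (snd : T * (R * R) -> R * R) by exact: measurable_snd.
exact: (measurableT_comp measurable_snd m2).
Qed.

Lemma measurable_path_end : measurable_fun [set: T * (R * R)] (fun z => path_end z.2 z.1).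
Proof. exact: (measurableT_comp (measurable_psi M) measurable_end_shift). Qed.

Lemma measurable_tilt : measurable_fun [set: T * (R * R)] (fun z => tilt z.2 z.1).
Proof.
have m2 : measurable_fun [set: T * (R * R)] (snd : T * (R * R) -> R * R) by exact: measurable_snd.
have mE : measurable_fun [set: R] (expR : R -> R) by exact: measurable_expR.
apply: measurable_funM; last exact: (measurableT_comp measurable_weight m2).
apply: measurable_funM.
  have mB : measurable_fun [set: T * (R * R)] (fun z => By (bpath n z.1 + z.2.2)).
    exact: (measurableT_comp (measurable_By M) measurable_end_shift).
  exact: (measurableT_comp mE mB).
under eq_fun do rewrite girsanov_shift.
have mb i : measurable_fun [set: T * (R * R)] (fun z => bpath i z.1).
  exact: (measurableT_comp (measurable_bpath i) measurable_fst).
have me1 : measurable_fun [set: T * (R * R)] (fun z => z.2.1) by exact: (measurableT_comp measurable_fst m2).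
have me2 : measurable_fun [set: T * (R * R)] (fun z => z.2.2) by exact: (measurableT_comp measurable_snd m2).
apply: (measurableT_comp mE); apply: measurable_funB; last first.
  by apply: measurable_funM => //; apply: measurable_funD; exact: measurable_funX.
apply: measurable_funB; last exact: measurable_funM.
have mN : measurable_fun [set: R] (-%R : R -> R) by exact: oppr_measurable.
apply: measurable_funM; first exact: (measurableT_comp mN me1).
by apply: measurable_funB => //; exact: measurable_funM.
Qed.

Let pick (k : nat) (f : nat -> R) : (k <= n)%N -> \sum_(i < n.+1) (i == k :> nat)%:R * f i = f k.
Proof.
move=> kn; rewrite (bigD1 (Ordinal (kn : (k < n.+1)%N)))//= eqxx mul1r big1 ?addr0// => i ik.
by case: eqP => [e|]; [case/eqP: ik; exact: val_inj|rewrite mul0r].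
Qed.

Let p (i : nat) : R := (m i + (i == h)%:R + (i == n)%:R) / 3.

Let energyE (f : nat -> R) :
  \sum_(i < n.+1) p i * f i = (\sum_(i < n.+1) m i * f i + f h + f n) / 3.
Proof.
rewrite -(pick f (leq_addr h h)) -(pick f (leqnn n)) -!big_split/= mulr_suml.
by apply: eq_bigr => i _; rewrite /p; ring.
Qed.

Lemma expectation_exp_sqr i : (i <= n)%N ->
  (\int[P]_w (expR (3 / 8 * bpath i w ^+ 2))%:E <= 2%:E)%E.
Proof.
move=> iN; have /andP[g0 g1] := @grid_itv R _ _ iN.
have [->|i0] := eqVneq i 0%N.
  under eq_integral do rewrite /bpath mul0r subrr expr0n mulr0 expR0.
  by rewrite integral_cst1 lee_fin ler1n.
have t0 : 0 < i%:R / n%:R :> R by rewrite divr_gt0 ?n_gt0// ltr0n lt0n.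
have mh : measurable_fun [set: R] (fun x : R => expR (3 / 8 * x ^+ 2)).
  have mE : measurable_fun [set: R] (expR : R -> R) by exact: measurable_expR.
  by apply: (measurableT_comp mE); apply: measurable_funM => //; exact: measurable_funX.
have := ge0_indep_increment filt bm (lexx 0) t0 (knows_cst (1 : R)) mh (fun=> ler01)
  (fun x => expR_ge0 _).
under eq_integral do rewrite mul1r.
rewrite subr0 => ->.
have q1 : 2 * (3 / 8) * (i%:R / n%:R) < 1 :> R by rewrite (_ : 2 * (3 / 8) = 3 / 4); lra.
rewrite (integral_gk_sqr t0 q1) integral_cst1 mul1e lee_fin.
have s2 : 2^-1 <= Num.sqrt (1 - 2 * (3 / 8) * (i%:R / n%:R)) :> R.
  rewrite -[leLHS]ger0_norm// -sqrtr_sqr ler_sqrt; last by lra.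
  by rewrite (_ : 2^-1 ^+ 2 = 4^-1); [lra|field].
by rewrite -[leRHS]invrK lef_pV2 ?posrE// (lt_le_trans _ s2).
Qed.

Lemma measurable_energy : measurable_fun [set: T] energy.
Proof.
apply: measurable_funD; last by apply: measurable_funX; exact: measurable_bpath.
apply: measurable_funD; last by apply: measurable_funX; exact: measurable_bpath.
apply: measurable_sum => i; apply: measurable_funM => //.
by apply: measurable_funX; exact: measurable_bpath.
Qed.

Lemma measurable_exp_energy : measurable_fun [set: T] (fun w => expR (energy w / 8)).
Proof.
have mE : measurable_fun [set: R] (expR : R -> R) by exact: measurable_expR.
by apply: (measurableT_comp mE); apply: measurable_funM => //; exact: measurable_energy.
Qed.

(** The energy is three times a weighted mean of squares of Gaussian variables
    of variance at most one, so that Jensen's inequality reduces the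
    exponential moment to that of a single square. *)
Lemma expectation_exp_energy : (\int[P]_w (expR (energy w / 8))%:E <= 2%:E)%E.
Proof.
have p0 i : 0 <= p i by rewrite divr_ge0// !addr_ge0.
have p1 : \sum_(i < n.+1) p i = 1.
  have := energyE (fun=> 1); under eq_bigr do rewrite mulr1.
  by move=> ->; under eq_bigr do rewrite mulr1; rewrite m1; field.
have mE : measurable_fun [set: R] (expR : R -> R) by exact: measurable_expR.
have mb i : measurable_fun [set: T] (fun w => expR (3 / 8 * bpath i w ^+ 2)).
  apply: (measurableT_comp mE); apply: measurable_funM => //.
  by apply: measurable_funX; exact: measurable_bpath.
apply: (@le_trans _ _ (\int[P]_w (\sum_(i < n.+1) p i * expR (3 / 8 * bpath i w ^+ 2))%:E)%E).
  apply: ge0_le_integral => //.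
  - by apply/measurable_EFinP; exact: measurable_exp_energy.
  - by apply/measurable_EFinP; apply: measurable_sum => i; exact: measurable_funM.
  - move=> w _; rewrite lee_fin.
    have -> : energy w / 8 = \sum_(i < n.+1) p i * (3 / 8 * bpath i w ^+ 2).
      rewrite (energyE (fun i => 3 / 8 * bpath i w ^+ 2)) /energy /sqr_sum.
      under [in RHS]eq_bigr do rewrite mulrCA.
      by rewrite -mulr_sumr; field.
    exact: (weighted_expR_le (fun i => 3 / 8 * bpath i w ^+ 2) p0 p1).
under eq_integral do rewrite -sumEFin.
rewrite ge0_integral_sum//; first last.
- by move=> i w _; rewrite lee_fin mulr_ge0// expR_ge0.
- by move=> i; apply/measurable_EFinP; exact: measurable_funM.
apply: (@le_trans _ _ (\sum_(i < n.+1) (p i)%:E * 2%:E)%E); last first.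
  under eq_bigr do rewrite -EFinM.
  by rewrite sumEFin -mulr_suml p1 mul1r.
apply: lee_sum => i _; under eq_integral do rewrite EFinM.
rewrite ge0_integralZl//.
- by apply: lee_wpmul2l; [rewrite lee_fin|apply: expectation_exp_sqr; exact: ord_le].
- by apply/measurable_EFinP; exact: mb.
- by rewrite lee_fin.
Qed.

Section test_function.
Variable g : R * R -> R.
Hypotheses (mg : measurable_fun setT g) (g0 : forall z, 0 <= g z).
Variables (B L : R).
Hypothesis bg : bounded_lip (fun z => g (z.1, psi z.2)) B L.
Let start := back M n m (fun z => g (z.1, psi z.2)) n (0, 0).

Let mpath : measurable_fun [set: T * (R * R)] (fun z => (path_sum z.2 z.1, path_end z.2 z.1)).
Proof. by apply: measurable_fun_pair; [exact: measurable_path_sum|exact: measurable_path_end]. Qed.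

Let mgt : measurable_fun [set: T * (R * R)]
  (fun z => g (path_sum z.2 z.1, path_end z.2 z.1) * tilt z.2 z.1).
Proof. by apply: measurable_funM; [exact: (measurableT_comp mg mpath)|exact: measurable_tilt]. Qed.

(** Averaging the change of measure over all shifts replaces the expectation
    by an integral over the plane of shifts, path by path. *)
Lemma averaged_girsanov : ((start * expR (By 0))%:E =
  \int[P]_w \int[leb2]_e (g (path_sum e w, path_end e w) * tilt e w)%:E)%E.
Proof.
have c0 : 0 <= start * expR (By 0).
  have n0 : (0 < n)%N by rewrite addn_gt0 h0.
  have [B' [L' bb]] := back_bl M n0 m01 n bg.
  by rewrite mulr_ge0 ?expR_ge0 ?(bl_ge0 bb).
rewrite (@fubini_tonelli _ _ _ _ _ P leb2
    (fun z : T * (R * R) => (g (path_sum z.2 z.1, path_end z.2 z.1) * tilt z.2 z.1)%:E)); first last.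
- by move=> z; rewrite lee_fin mulr_ge0// tilt_ge0.
- by apply/measurable_EFinP; exact: mgt.
transitivity (\int[leb2]_e ((start * expR (By 0))%:E * (weight e)%:E))%E.
  rewrite ge0_integralZl//.
  - by rewrite integral_weight mule1.
  - by apply/measurable_EFinP; exact: measurable_weight.
  - by move=> e _; rewrite lee_fin weight_ge0.
apply: eq_integral => e _.
have n0 : (0 < n)%N by rewrite addn_gt0 h0.
rewrite (scheme_girsanov filt bm M n0 m01 (shift0 e) bg) muleC.
have me : measurable_fun [set: T] (fun w => (w, e) : T * (R * R)) by exact: measurable_pair2.
have endE w : shifted_bm W n (shift e) n w = bpath n w + e.2 by rewrite /shifted_bm shift_end.
rewrite -ge0_integralZl//.
- apply: eq_integral => w _; rewrite -EFinM; congr EFin; rewrite endE /tilt/=.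
  by rewrite mulrC !mulrA.
- apply/measurable_EFinP.
  have w0 : 0 < weight e by rewrite mulr_gt0// gk_gt0.
  have -> : (fun w => g (shifted_sum W M n m (shift e) n w, psi (shifted_bm W n (shift e) n w)) *
       expR (By (shifted_bm W n (shift e) n w)) * girsanov W n (shift e) n w) =
     (fun w => g (path_sum e w, path_end e w) * tilt e w * (weight e)^-1).
    apply/funext => w; rewrite endE /tilt -/(path_end e w) -/(path_sum e w) -[RHS]mulrA -(mulrA _ (weight e)).
    by rewrite divff ?gt_eqF// mulr1 mulrA.
  by apply: measurable_funM => //; exact: (measurableT_comp mgt me).
- by move=> w _; rewrite lee_fin !mulr_ge0 ?expR_ge0.
- by rewrite lee_fin weight_ge0.
Qed.

Definition gauss_integral (c : R) : \bar R :=
  (\int[leb2]_z (g z * expR (- c * (z.1 ^+ 2 + z.2 ^+ 2)))%:E)%E.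

Let mgauss c : measurable_fun [set: R * R]
  (fun z => (g z * expR (- c * (z.1 ^+ 2 + z.2 ^+ 2)))%:E).
Proof.
have mE : measurable_fun [set: R] (expR : R -> R) by exact: measurable_expR.
apply/measurable_EFinP; apply: measurable_funM => //; apply: (measurableT_comp mE).
apply: measurable_funM => //; apply: measurable_funD; apply: measurable_funX.
  exact: measurable_fst.
exact: measurable_snd.
Qed.

Lemma gauss_integral_ge0 c : (0 <= gauss_integral c)%E.
Proof. by apply: integral_ge0 => z _; rewrite lee_fin mulr_ge0// expR_ge0. Qed.

Let mpathw w : measurable_fun [set: R * R] (fun e => (path_sum e w, path_end e w)).
Proof. exact: (measurableT_comp mpath (measurable_pair1 w)). Qed.

Let mtiltw w : measurable_fun [set: R * R]
  (fun e => (g (path_sum e w, path_end e w) * tilt e w)%:E).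
Proof. by apply/measurable_EFinP; exact: (measurableT_comp mgt (measurable_pair1 w)). Qed.

Let inner w := (\int[leb2]_e (g (path_sum e w, path_end e w) * tilt e w)%:E)%E.

Let minner : measurable_fun [set: T] inner.
Proof.
have mz : measurable_fun [set: T * (R * R)]
   (fun z => (g (path_sum z.2 z.1, path_end z.2 z.1) * tilt z.2 z.1)%:E).
  by apply/measurable_EFinP.
have := @measurable_fun_fubini_tonelli_F _ _ _ _ _ leb2 _ mz; apply.
by move=> z; rewrite lee_fin mulr_ge0// tilt_ge0.
Qed.

Let inner_ge0 w : (0 <= inner w)%E.
Proof. by apply: integral_ge0 => e _; rewrite lee_fin mulr_ge0// tilt_ge0. Qed.

Variable mu0 : R.
Hypotheses (mu0_gt0 : 0 < mu0) (mu0_le : mu0 <= tent_mass).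

Let change c w :
  ((alpha * mu0 * alpha)%:E * \int[leb2]_e (g (path_sum e w, path_end e w)
     * expR (- c * (path_sum e w ^+ 2 + path_end e w ^+ 2)))%:E <= gauss_integral c)%E /\
  (gauss_integral c <= (K * K)%:E * \int[leb2]_e (g (path_sum e w, path_end e w)
     * expR (- c * (path_sum e w ^+ 2 + path_end e w ^+ 2)))%:E)%E.
Proof.
have am : 0 < alpha * mu0 by rewrite mulr_gt0// (alpha_gt0 M).
have mU : measurable_fun [set: R * R] (fun e => path_sum e w).
  exact: (measurableT_comp measurable_fst (mpathw w)).
have := ge0_integral2_subst_slopes am (K_gt0 M) (alpha_gt0 M) (K_gt0 M)
  (fun y => path_sum_slopes_mu0 w y mu0_le) (path_end_slopes w 0) mU (mgauss c)
  (fun z => _ : (0 <= _)%E).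
by apply=> z; rewrite lee_fin mulr_ge0// expR_ge0.
Qed.

(** For each path, the tilt is bounded by a Gaussian in the point reached by the
    shifted path, and changing variables from the shift to this point turns the
    inner integral into one against a Gaussian. *)
Lemma start_upper : (start%:E <=
  (2 * weight_scale * expR (7 * LB K alpha ^+ 2) / (alpha * mu0 * alpha))%:E
    * gauss_integral upper_rate)%E.
Proof.
set I := gauss_integral _; have I0 : (0 <= I)%E := gauss_integral_ge0 _.
set s := alpha * mu0 * alpha.
have s0 : 0 < s by rewrite !mulr_gt0// (alpha_gt0 M).
have ws := weight_scale_gt0.
pose A := weight_scale * expR (By 0 + 7 * LB K alpha ^+ 2).
have A0 : 0 < A by rewrite mulr_gt0// expR_gt0.
have up w : (inner w <= (A * expR (energy w / 8) / s)%:E * I)%E.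
  have [ch _] := change upper_rate w.
  have -> : ((A * expR (energy w / 8) / s)%:E * I = (A * expR (energy w / 8))%:E * (s^-1%:E * I))%E.
    by rewrite muleA -EFinM.
  apply: (@le_trans _ _ ((A * expR (energy w / 8))%:E * \int[leb2]_e (g (path_sum e w, path_end e w)
     * expR (- upper_rate * (path_sum e w ^+ 2 + path_end e w ^+ 2)))%:E)%E); last first.
    apply: lee_wpmul2l; first by rewrite lee_fin mulr_ge0 ?expR_ge0 ?ltW.
    by rewrite lee_pdivlMl.
  have mk := measurableT_comp (mgauss upper_rate) (mpathw w).
  rewrite -ge0_integralZl//.
  - apply: ge0_le_integral => //.
    + by move=> e _; rewrite lee_fin mulr_ge0// tilt_ge0.
    + exact: mtiltw.
    + exact: (measurable_funeM _ mk).
    + move=> e _; rewrite -EFinM lee_fin [leRHS]mulrCA; apply: ler_wpM2l => //.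
      exact: tilt_upper.
  - by move=> e _; rewrite lee_fin mulr_ge0// expR_ge0.
  - by rewrite lee_fin mulr_ge0 ?expR_ge0 ?ltW.
have key : ((start * expR (By 0))%:E <= (2 * A / s)%:E * I)%E.
  rewrite averaged_girsanov.
  apply: (@le_trans _ _ (\int[P]_w ((A / s)%:E * I * (expR (energy w / 8))%:E))%E).
    apply: ge0_le_integral => //.
    - by move=> w _; exact: inner_ge0.
    - by apply: measurable_funeM; apply/measurable_EFinP; exact: measurable_exp_energy.
    - move=> w _; apply: (le_trans (up w)).
      by rewrite muleAC -EFinM mulrAC.
  rewrite ge0_integralZl//.
  - have -> : ((2 * A / s)%:E * I = (A / s)%:E * I * 2%:E)%E.
      by rewrite muleAC -EFinM; congr (_%:E * _)%E; ring.
    apply: lee_wpmul2l; last exact: expectation_exp_energy.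
    by rewrite mule_ge0// lee_fin divr_ge0 ?ltW.
  - by apply/measurable_EFinP; exact: measurable_exp_energy.
  - by rewrite mule_ge0// lee_fin divr_ge0 ?ltW.
have E0 := expR_gt0 (By 0).
have -> : start%:E = ((expR (By 0))^-1%:E * (start * expR (By 0))%:E)%E.
  by rewrite -EFinM mulrC mulfK ?gt_eqF.
apply: (le_trans (lee_wpmul2l _ key)); first by rewrite lee_fin invr_ge0 expR_ge0.
have e : (expR (By 0))^-1 * (2 * A / s) = 2 * weight_scale * expR (7 * LB K alpha ^+ 2) / s.
  rewrite /A expRD -[RHS](mulKf (lt0r_neq0 E0)).
  by congr (_ * _); ring.
by rewrite muleA -EFinM e.
Qed.

(** A function of the path that is supported by energies at most [24]. It is
    at least [1 - q / 4] with [q = expR (energy / 8)] of mean at most [2], so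
    that its own mean is at least one half. *)
Let calm w : R := Num.max 0 (1 - expR (energy w / 8) / 4).

Let measurable_calm : measurable_fun [set: T] calm.
Proof.
apply: measurable_maxr => //; apply: measurable_funB => //.
by apply: measurable_funM => //; exact: measurable_exp_energy.
Qed.

Let calm_ge0 w : 0 <= calm w. Proof. by rewrite le_max lexx. Qed.

Lemma expectation_calm : ((2^-1)%:E <= \int[P]_w (calm w)%:E)%E.
Proof.
set r := (\int[P]_w _)%E.
have h1 : (1 <= r + (2^-1)%:E)%E.
  apply: (@le_trans _ _ (\int[P]_w (calm w + expR (energy w / 8) / 4)%:E)%E).
    rewrite -(integral_cst1 P 1); apply: ge0_le_integral => //.
    - apply/measurable_EFinP; apply: measurable_funD => //; apply: measurable_funM => //.
      exact: measurable_exp_energy.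
    - move=> w _; rewrite lee_fin -lerBlDr /calm le_max; apply/orP; right; lra.
  under eq_integral do rewrite EFinD.
  rewrite ge0_integralD//; first last.
  - by apply/measurable_EFinP; apply: measurable_funM => //; exact: measurable_exp_energy.
  - by apply/measurable_EFinP.
  - by move=> w _; rewrite lee_fin.
  apply: leeD => //; under eq_integral do rewrite mulrC EFinM.
  rewrite ge0_integralZl//; first last.
  - by apply/measurable_EFinP; exact: measurable_exp_energy.
  apply: (le_trans (lee_wpmul2l _ expectation_exp_energy)); first by rewrite lee_fin invr_ge0.
  by rewrite -EFinM lee_fin; lra.
have r0 : (0 <= r)%E by apply: integral_ge0 => w _; rewrite lee_fin.
case: r h1 r0 => [r| |] h1 r0.
- by move: h1; rewrite -EFinD !lee_fin; lra.
- by rewrite leey.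
- by move: r0; rewrite leNgt ltNyr.
Qed.

Local Notation rate := (lower_rate K alpha mu0 (LB K alpha)).

(** The same change of variables, restricted to the paths of moderate energy. *)
Lemma start_lower :
  ((weight_scale * expR (- rate) / (2 * (K * K)))%:E * gauss_integral rate <= start%:E)%E.
Proof.
set I := gauss_integral _; have I0 : (0 <= I)%E := gauss_integral_ge0 _.
have s0 : 0 < K * K by rewrite mulr_gt0// (K_gt0 M).
have ws := weight_scale_gt0.
pose A := weight_scale * expR (By 0 - rate).
have A0 : 0 < A by rewrite mulr_gt0// expR_gt0.
have low w : energy w <= 24 -> ((A / (K * K))%:E * I <= inner w)%E.
  move=> e24; have [_ ch] := change rate w.
  rewrite EFinM -muleA.
  apply: (@le_trans _ _ (A%:E * \int[leb2]_e (g (path_sum e w, path_end e w)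
     * expR (- rate * (path_sum e w ^+ 2 + path_end e w ^+ 2)))%:E)%E).
    by apply: lee_wpmul2l; [rewrite lee_fin ltW|rewrite lee_pdivrMl].
  have mk := measurableT_comp (mgauss rate) (mpathw w).
  rewrite -ge0_integralZl//.
  - apply: ge0_le_integral => //.
    + by move=> e _; rewrite -EFinM lee_fin !mulr_ge0// ?expR_ge0// ltW.
    + exact: (measurable_funeM _ mk).
    + exact: mtiltw.
    + move=> e _; rewrite -EFinM lee_fin [leLHS]mulrCA; apply: ler_wpM2l => //.
      rewrite /A -mulrA -expRD.
      apply: le_trans (tilt_lower e mu0_gt0 mu0_le e24).
      by apply: ler_wpM2l; [exact: ltW|rewrite ler_expR; lra].
  - by move=> e _; rewrite lee_fin mulr_ge0// expR_ge0.
  - by rewrite lee_fin ltW.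
have calmlow w : ((A / (K * K))%:E * I * (calm w)%:E <= inner w)%E.
  have [c0|c0] := leP (1 - expR (energy w / 8) / 4) 0.
    by rewrite /calm (max_l c0) mule0.
  have e24 : energy w <= 24 by have := expR_ge1Dx (energy w / 8); lra.
  apply: le_trans (low _ e24); rewrite -[leRHS]mule1; apply: lee_wpmul2l.
    by rewrite mule_ge0// lee_fin divr_ge0 ?ltW.
  by rewrite lee_fin /calm ge_max ler01 gerBl divr_ge0// expR_ge0.
have key : ((A / (2 * (K * K)))%:E * I <= (start * expR (By 0))%:E)%E.
  rewrite averaged_girsanov.
  apply: (@le_trans _ _ (\int[P]_w ((A / (K * K))%:E * I * (calm w)%:E))%E); last first.
    apply: ge0_le_integral => //.
    - by move=> w _; rewrite mule_ge0 ?lee_fin// mule_ge0// lee_fin divr_ge0 ?ltW.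
    - by apply: measurable_funeM; apply/measurable_EFinP.
  have AI : (0 <= (A / (K * K))%:E * I)%E by rewrite mule_ge0// lee_fin divr_ge0 ?ltW.
  rewrite ge0_integralZl//.
  - have -> : ((A / (2 * (K * K)))%:E * I = (A / (K * K))%:E * I * (2^-1)%:E)%E.
      by rewrite muleAC -EFinM invfM mulrA (mulrAC A).
    by apply: lee_wpmul2l => //; exact: expectation_calm.
  - by apply/measurable_EFinP.
  - by move=> w _; rewrite lee_fin.
have E0 := expR_gt0 (By 0).
have -> : start%:E = ((expR (By 0))^-1%:E * (start * expR (By 0))%:E)%E.
  by rewrite -EFinM mulrC mulfK ?gt_eqF.
apply: le_trans (lee_wpmul2l _ key); last by rewrite lee_fin invr_ge0 expR_ge0.
have e : (expR (By 0))^-1 * (A / (2 * (K * K))) = weight_scale * expR (- rate) / (2 * (K * K)).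
  rewrite /A expRD -[RHS](mulKf (lt0r_neq0 E0)).
  by congr (_ * _); ring.
by rewrite muleA -EFinM e.
Qed.

End test_function.
End gaussian_bounds.

(** * Comparison of measures on the plane *)

Section lipschitz_approximation.
Context {R : realType}.
Variable m : {measure set (measurableTypeR R * measurableTypeR R)%type -> \bar R}.
Hypothesis mfin : (m setT < +oo)%E.

Lemma small_tail (B : nat -> set (R * R)) (e : R) : 0 < e ->
  (forall n, measurable (B n)) -> (forall n, B n.+1 `<=` B n) -> \bigcap_n B n = set0 ->
  exists n, (m (B n) <= e%:E)%E.
Proof.
move=> e0 mB dB B0.
have nB : nonincreasing_seq B by apply/nonincreasing_seqP => n; exact/subsetPset.
have fin0 : (m (B 0%N) < +oo)%E.
  apply: le_lt_trans mfin; apply: le_measure; rewrite ?inE.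
  - exact: (mB 0%N).
  - exact: measurableT.
  - by [].
have cv : m (B n) @[n --> \oo] --> 0%E.
  rewrite -(measure0 m) -B0; apply: nonincreasing_cvg_mu => //.
  by rewrite B0.
have [N _ hN] := ereal_cvg0_le cv e0.
by exists N; exact: (hN N (leqnn N)).
Qed.

Definition l1 (A : set (R * R)) (g : R * R -> R) := (\int[m]_z (`|\1_A z - g z|)%:E)%E.

(** Inequalities between measures are not preserved by complements, so that a
    Dynkin argument does not apply to them; they follow for sets that can be
    approximated, and those form a sigma-algebra. *)
Definition approximable (A : set (R * R)) := measurable A /\
  forall e : R, 0 < e -> exists g L, bounded_lip g 1 L /\ (l1 A g <= e%:E)%E.

Lemma bl_opp1 g L : bounded_lip g 1 L -> bounded_lip (fun z => 1 - g z : R) 1 L.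
Proof.
move=> bg; split=> [|z|z|u y u' y'].
- by apply: measurable_funB => //; exact: (bl_meas bg).
- by rewrite subr_ge0 (bl_le bg).
- by rewrite gerBl (bl_ge0 bg).
- rewrite (_ : 1 - _ - _ = - (g (u, y) - g (u', y'))); last by ring.
  by rewrite normrN (bl_lip bg).
Qed.

Lemma bl_mul1 g L g' L' : bounded_lip g 1 L -> bounded_lip g' 1 L' -> bounded_lip (fun z => g z * g' z : R) 1 (L + L').
Proof.
move=> bg bg'; have n1 z : `|g z| <= 1 by rewrite ger0_norm ?(bl_ge0 bg)// (bl_le bg).
have n1' z : `|g' z| <= 1 by rewrite ger0_norm ?(bl_ge0 bg')// (bl_le bg').
split=> [|z|z|u y u' y'].
- by apply: measurable_funM; [exact: (bl_meas bg)|exact: (bl_meas bg')].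
- by rewrite mulr_ge0 ?(bl_ge0 bg) ?(bl_ge0 bg').
- by rewrite mulr_ile1 ?(bl_ge0 bg) ?(bl_ge0 bg') ?(bl_le bg) ?(bl_le bg').
- rewrite (_ : _ - _ = (g (u, y) - g (u', y')) * g' (u, y) + g (u', y') * (g' (u, y) - g' (u', y'))); last by ring.
  rewrite (le_trans (ler_normD _ _))// (mulrDl L) lerD// normrM.
    by rewrite (le_trans _ (bl_lip bg _ _ _ _))// ler_piMr.
  by rewrite (le_trans _ (bl_lip bg' _ _ _ _))// ler_piMl.
Qed.

Let ind01 (A : set (R * R)) z : 0 <= (\1_A z : R) <= 1.
Proof. by rewrite indicE; case: (z \in A); rewrite /= ?ler01 ?lexx. Qed.

Let mind (A : set (R * R)) : measurable A -> measurable_fun [set: R * R] (\1_A : R * R -> R).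
Proof. by move=> mA; exact: measurable_indic. Qed.

Let ml1 A (g : R * R -> R) : measurable A -> measurable_fun [set: R * R] g ->
  measurable_fun [set: R * R] (fun z => (`|\1_A z - g z|)%:E).
Proof.
move=> mA mg; apply/measurable_EFinP; apply: measurableT_comp => //.
by apply: measurable_funB => //; exact: mind.
Qed.

(** Errors add up: the distance to [g] is controlled by two other errors. *)
Let l1_le2 A (g F1 F2 : R * R -> R) (e1 e2 : R) :
  measurable A -> measurable_fun setT g -> measurable_fun setT F1 -> measurable_fun setT F2 ->
  (forall z, 0 <= F1 z) -> (forall z, 0 <= F2 z) ->
  (forall z, `|\1_A z - g z| <= F1 z + F2 z) ->
  (\int[m]_z (F1 z)%:E <= e1%:E)%E -> (\int[m]_z (F2 z)%:E <= e2%:E)%E ->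
  (l1 A g <= (e1 + e2)%:E)%E.
Proof.
move=> mA mg m1 m2 F10 F20 le h1 h2; rewrite EFinD; apply: le_trans (leeD h1 h2).
rewrite -ge0_integralD//; first last.
- by apply/measurable_EFinP.
- by move=> z _; rewrite lee_fin.
- by apply/measurable_EFinP.
- by move=> z _; rewrite lee_fin.
apply: ge0_le_integral => //.
- exact: ml1.
- by apply: emeasurable_funD; exact/measurable_EFinP.
- by move=> z _; rewrite -EFinD lee_fin.
Qed.

Let mdist A (g : R * R -> R) : measurable A -> measurable_fun setT g ->
  measurable_fun [set: R * R] (fun z => `|\1_A z - g z| : R).
Proof. by move=> mA mg; apply/measurable_EFinP; exact: ml1. Qed.

Lemma approximable_setC A : approximable A -> approximable (~` A).
Proof.
move=> [mA hA]; split; first exact: measurableC.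
move=> e e0; have [g [L [bg le]]] := hA e e0.
exists (fun z => 1 - g z), L; split; first exact: bl_opp1.
apply: le_trans le; rewrite le_eqVlt; apply/orP; left; apply/eqP; rewrite /l1.
apply: eq_integral => z _; congr EFin; rewrite -[RHS]normrN; congr `|_|.
by rewrite !indicE in_setC; case: (z \in A) => /=; ring.
Qed.

Lemma approximable_setI A B : approximable A -> approximable B -> approximable (A `&` B).
Proof.
move=> [mA hA] [mB hB]; split; first exact: measurableI.
move=> e e0; have e20 : 0 < e / 2 by rewrite divr_gt0.
have [g [L [bg le]]] := hA _ e20; have [g' [L' [bg' le']]] := hB _ e20.
exists (fun z => g z * g' z), (L + L'); split; first exact: bl_mul1.
rewrite [e]splitr; have mg := bl_meas bg; have mg' := bl_meas bg'.
apply: (l1_le2 (measurableI _ _ mA mB) _ (mdist mA mg) (mdist mB mg') _ _ _ le le') => //.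
  exact: measurable_funM.
move=> z; have -> : \1_(A `&` B) z = \1_A z * \1_B z :> R by rewrite !indicE in_setI; case: (z \in A); case: (z \in B); rewrite /= ?mul1r ?mul0r.
rewrite (_ : _ - _ = (\1_A z - g z) * \1_B z + g z * (\1_B z - g' z)); last by ring.
have /andP[i0 i1] := ind01 B z.
rewrite (le_trans (ler_normD _ _))// lerD// normrM.
  by rewrite ler_piMr// ger0_norm.
by rewrite ler_piMl// ger0_norm ?(bl_ge0 bg)// (bl_le bg).
Qed.

Lemma approximable_set0 : approximable set0.
Proof.
split => // e e0; exists (fun=> 0), 0; split.
  by split=> [||z|u y u' y'] //=; rewrite ?subrr ?normr0 ?mul0r.
rewrite /l1; under eq_integral do rewrite indic0 subrr normr0.
by rewrite integral0 lee_fin ltW.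
Qed.

Lemma approximable_bigcup (F : nat -> set (R * R)) :
  (forall n, approximable (F n)) -> approximable (\bigcup_n F n).
Proof.
move=> hF; have mU : measurable (\bigcup_n F n) by apply: bigcup_measurable => n _; have [] := hF n.
split => // e e0; have e20 : 0 < e / 2 by rewrite divr_gt0.
pose V N := \bigcup_(k < N) F k.
have hV N : approximable (V N).
  elim: N => [|N ih]; first by rewrite /V bigcup_mkord big_ord0; exact: approximable_set0.
  rewrite /V bigcup_mkord big_ord_recr/= -bigcup_mkord -[_ `|` _]setCK setCU.
  by apply: approximable_setC; apply: approximable_setI; apply: approximable_setC.
have [N hN] : exists N, (m ((\bigcup_n F n) `\` V N) <= (e / 2)%:E)%E.
  apply: small_tail => //.
  - by move=> n; apply: measurableD => //; have [] := hV n.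
  - move=> n z [Uz nV]; split=> // -[k kn Fk]; apply: nV; exists k => //.
    exact: (leq_trans kn).
  - rewrite -subset0 => z hz; have [[k _ Fk] _] := hz 0%N I.
    by have [_] := hz k.+1 I; apply; exists k => //=.
have [mV hVN] := hV N; have [g [L [bg le]]] := hVN _ e20.
exists g, L; split=> //; rewrite [e]splitr.
have mD : measurable ((\bigcup_n F n) `\` V N) by exact: measurableD.
have mg := bl_meas bg.
apply: (l1_le2 mU mg (mdist mV mg) (mind mD) _ _ _ le) => //.
- move=> z; have VU : V N `<=` \bigcup_n F n by move=> x [k _ Fk]; exists k.
  have -> : \1_(\bigcup_n F n) z = \1_(V N) z + \1_((\bigcup_n F n) `\` V N) z :> R.
    rewrite !indicE in_setD; have [zV|zV] := boolP (z \in V N); last first.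
      by rewrite andbT add0r.
    by rewrite andbF addr0 mem_set//; apply: VU; rewrite inE in zV.
  rewrite addrAC (le_trans (ler_normD _ _))// lerD2l.
  by have /andP[i0 _] := ind01 ((\bigcup_n F n) `\` V N) z; rewrite ger0_norm.
- by rewrite integral_indic// setIT.
Qed.

Lemma clamp01_lip (x y : R) : `|clamp01 x - clamp01 y| <= `|x - y|.
Proof.
wlog xy : x y / x <= y.
  by move=> h; have [/h//|/ltW /h] := leP x y; rewrite distrC (distrC y).
have [c1 c2] : clamp01 x <= clamp01 y /\ clamp01 y - clamp01 x <= y - x.
  by rewrite /clamp01 /Num.max /Num.min; split; repeat case: ifPn => //; rewrite ?ltNge ?negbK; lra.
by rewrite distrC ger0_norm ?subr_ge0// distrC ger0_norm ?subr_ge0.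
Qed.

Lemma clamp01_le0 (x : R) : x <= 0 -> clamp01 x = 0.
Proof. by move=> x0; rewrite /clamp01 max_l// ge_min x0. Qed.

Lemma clamp01_ge1 (x : R) : 1 <= x -> clamp01 x = 1.
Proof. by move=> x1; rewrite /clamp01 min_r// max_r. Qed.

(** The indicator of a half-plane is approximated by ramps. *)
Lemma approximable_ray (pr : R * R -> R) (a : R) : measurable_fun setT pr ->
  (forall u y u' y', `|pr (u, y) - pr (u', y')| <= `|u - u'| + `|y - y'|) ->
  approximable [set z | a < pr z].
Proof.
move=> mpr lip.
have mset (b : R) : measurable [set z | b < pr z].
  rewrite (_ : [set z | _] = [set: R * R] `&` pr @^-1` `]b, +oo[%classic); first exact: mpr.
  by rewrite setTI; apply/seteqP; split=> z /=; rewrite in_itv/= andbT.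
split => // e e0.
pose B k := [set z | a < pr z] `&` ~` [set z | (k.+1)%:R^-1 + a < pr z].
have [N hN] : exists N, (m (B N) <= e%:E)%E.
  apply: small_tail => //.
  - by move=> n; apply: measurableI => //; exact: measurableC.
  - move=> n z [z1 z2]; split=> // z3; apply: z2 => /=; apply: le_lt_trans z3.
    by rewrite lerD2r lef_pV2 ?posrE ?ltr0n// ler_nat.
  - rewrite -subset0 => z hz; have [/= az _] := hz 0%N I.
    have [k hk] := ltr_add_invr az.
    have [_] := hz k I; apply => /=.
    by rewrite addrC.
pose g z := clamp01 (N.+1%:R * (pr z - a)).
have g01 z : 0 <= g z <= 1 by exact: clamp01_itv.
have mg : measurable_fun setT g.
  apply: (measurableT_comp (continuous_measurable_fun clamp01_continuous)).
  by apply: measurable_funM => //; exact: measurable_funB.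
exists g, N.+1%:R; split.
  split=> // [z|z|u y u' y']; [by have /andP[] := g01 z|by have /andP[] := g01 z|].
  rewrite (le_trans (clamp01_lip _ _))// -mulrBr normrM ger0_norm//.
  by apply: ler_wpM2l => //; rewrite opprB addrA subrK.
have mB : measurable (B N) by apply: measurableI => //; exact: measurableC.
apply: le_trans hN; rewrite (_ : m (B N) = \int[m]_z (\1_(B N) z)%:E)%E; last first.
  by rewrite integral_indic// setIT.
apply: ge0_le_integral => //.
- exact: ml1.
- by apply/measurable_EFinP; exact: mind.
- move=> z _; rewrite lee_fin !indicE in_setI in_setC.
  have n0 : 0 < N.+1%:R :> R by rewrite ltr0n.
  have [az|az] := ltP a (pr z); last first.
    rewrite memNset/=; last by apply/negP; rewrite -leNgt.
    by rewrite /g clamp01_le0 ?subrr ?normr0// mulr_ge0_le0 ?subr_le0.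
  rewrite mem_set//=; have [bz|bz] := ltP (N.+1%:R^-1 + a) (pr z).
    rewrite mem_set//= /g clamp01_ge1 ?subrr ?normr0//.
    by rewrite -ler_pdivrMl// mulr1 lerBrDr ltW.
  rewrite memNset/=; last by apply/negP; rewrite -leNgt.
  by have /andP[g0 g1] := g01 z; rewrite ger0_norm ?subr_ge0// gerBl.
Qed.

Let sub_approx (pr : R * R -> R) (B : set R) : measurable_fun setT pr ->
  (forall u y u' y', `|pr (u, y) - pr (u', y')| <= `|u - u'| + `|y - y'|) ->
  measurable B -> approximable (pr @^-1` B).
Proof.
move=> mpr lip; apply: (@smallest_sub _ _ _ [set B : set R | approximable (pr @^-1` B)]).
  split=> [|A hA|A hA].
  - by rewrite /= preimage_set0; exact: approximable_set0.
  - by rewrite /= setTD preimage_setC; exact: approximable_setC.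
  - by rewrite /= preimage_bigcup; exact: approximable_bigcup.
move=> _ [[a b] _ <-] /=.
have -> : pr @^-1` [set` `]a, b]] = [set z | a < pr z] `&` ~` [set z | b < pr z].
  apply/seteqP; split=> z /=; rewrite in_itv/=.
    by move=> /andP[-> zb]; split=> //; apply/negP; rewrite -leNgt.
  by move=> [-> /negP]; rewrite -leNgt.
by apply: approximable_setI; [exact: approximable_ray|apply: approximable_setC; exact: approximable_ray].
Qed.

Lemma approximable_measurable A : measurable A -> approximable A.
Proof.
rewrite measurable_prod_measurableType; apply: smallest_sub.
  split=> [|B hB|B hB].
  - exact: approximable_set0.
  - by rewrite setTD; exact: approximable_setC.
  - exact: approximable_bigcup.
move=> _ [B mB [C mC <-]].
rewrite (_ : B `*` C = fst @^-1` B `&` snd @^-1` C)//.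
apply: approximable_setI; apply: sub_approx => //.
- by move=> u y u' y' /=; rewrite lerDl.
- by move=> u y u' y' /=; rewrite lerDr.
Qed.

End lipschitz_approximation.

Section comparison_of_measures.
Context {R : realType}.

Lemma measure_indic (nu : {measure set (measurableTypeR R * measurableTypeR R)%type -> \bar R})
    (A : set (R * R)) : measurable A -> nu A = (\int[nu]_z (\1_A z)%:E)%E.
Proof. by move=> mA; rewrite integral_indic// setIT. Qed.

Variables (nu1 nu2 : {measure set (measurableTypeR R * measurableTypeR R)%type -> \bar R}).
Hypotheses (fin1 : (nu1 setT < +oo)%E) (fin2 : (nu2 setT < +oo)%E).

(** The approximation is made for the sum of both measures at once. *)
Lemma measure_le_test : (forall g L, bounded_lip g 1 L ->
    (\int[nu1]_z (g z)%:E <= \int[nu2]_z (g z)%:E)%E) ->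
  forall A, measurable A -> (nu1 A <= nu2 A)%E.
Proof.
move=> le A mA; pose m := measure_add nu1 nu2.
have finm : (m setT < +oo)%E by rewrite /m measure_addE lte_add_pinfty.
have [_ hA] := approximable_measurable finm mA.
apply/lee_addgt0Pr => e e0; have e20 : 0 < e / 2 by rewrite divr_gt0.
have [g [L [bg l]]] := hA _ e20; have mg := bl_meas bg.
have mI : measurable_fun [set: R * R] (\1_A : R * R -> R) by exact: measurable_indic.
have md : measurable_fun [set: R * R] (fun z => (`|\1_A z - g z|)%:E).
  by apply/measurable_EFinP; apply: measurableT_comp => //; exact: measurable_funB.
have d0 (nu : {measure set (measurableTypeR R * measurableTypeR R)%type -> \bar R}) : (0 <= \int[nu]_z (`|\1_A z - g z|)%:E)%E.
  by apply: integral_ge0.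
have [l1 l2] : (\int[nu1]_z (`|\1_A z - g z|)%:E <= (e / 2)%:E)%E /\
    (\int[nu2]_z (`|\1_A z - g z|)%:E <= (e / 2)%:E)%E.
  rewrite /l1 ge0_integral_measure_add// in l.
  by split; apply: le_trans l; [rewrite leeDl|rewrite leeDr].
have tri (nu : {measure set (measurableTypeR R * measurableTypeR R)%type -> \bar R}) (f h : R * R -> R) : measurable_fun setT f ->
    measurable_fun setT h -> (forall z, 0 <= f z) -> (forall z, 0 <= h z) ->
    (forall z, f z <= h z + `|\1_A z - g z|) ->
    (\int[nu]_z (`|\1_A z - g z|)%:E <= (e / 2)%:E)%E ->
    (\int[nu]_z (f z)%:E <= \int[nu]_z (h z)%:E + (e / 2)%:E)%E.
  move=> mf mh f0 h0 fh le2; apply: (@le_trans _ _ (\int[nu]_z ((h z)%:E + (`|\1_A z - g z|)%:E))%E).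
    apply: ge0_le_integral => //.
    - by move=> z _; rewrite lee_fin.
    - exact/measurable_EFinP.
    - by apply: emeasurable_funD => //; exact/measurable_EFinP.
    - by move=> z _; rewrite -EFinD lee_fin.
  rewrite ge0_integralD//.
  - exact: leeD.
  - by move=> z _; rewrite lee_fin.
  - exact/measurable_EFinP.
rewrite (measure_indic nu1 mA) (measure_indic nu2 mA) [e]splitr EFinD addeA.
have i0 z : 0 <= \1_A z :> R by rewrite indicE ler0n.
apply: (@le_trans _ _ (\int[nu1]_z (g z)%:E + (e / 2)%:E)%E).
  apply: tri => //; first by move=> z; exact: (bl_ge0 bg).
  by move=> z; rewrite -lerBlDl ler_norm.
apply: leeD => //; apply: (le_trans (le _ _ bg)).
apply: tri => //; first by move=> z; exact: (bl_ge0 bg).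
by move=> z; rewrite -lerBlDl distrC ler_norm.
Qed.

End comparison_of_measures.

Section planar_gaussian.
Context {R : realType}.
Notation leb := (@lebesgue_measure R).

(** The Gaussian bounds in the form of measures: an integral against a product
    of normal laws is an integral against its density. *)
Definition planar_normal (t : R) := (normal_prob (0:R) (Num.sqrt t) \x normal_prob (0:R) (Num.sqrt t))%E.
HB.instance Definition _ t := Measure.on (planar_normal t).

Lemma ge0_integral_planar_normal (t : R) (k : R * R -> \bar R) : 0 < t ->
  measurable_fun setT k -> (forall z, (0 <= k z)%E) ->
  (\int[planar_normal t]_z k z = \int[leb2]_z (k z * (gk t z.1 * gk t z.2)%:E))%E.
Proof.
move=> t0 mk k0; pose N := normal_prob (0 : R) (Num.sqrt t).
have g0 (x : R) : (0 <= (gk t x)%:E)%E by rewrite lee_fin gk_ge0.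
have mkk : measurable_fun setT (fun z : R * R => k z * (gk t z.1 * gk t z.2)%:E)%E.
  apply: emeasurable_funM => //; apply/measurable_EFinP; apply: measurable_funM.
    exact: (measurableT_comp (measurable_gk t) measurable_fst).
  exact: (measurableT_comp (measurable_gk t) measurable_snd).
rewrite /planar_normal (@fubini_tonelli1 _ _ _ _ _ N N k mk k0).
rewrite /leb2 (@fubini_tonelli1 _ _ _ _ _ leb leb _ mkk); last first.
  by move=> z; rewrite mule_ge0// lee_fin mulr_ge0// gk_ge0.
have mF := @measurable_fun_fubini_tonelli_F _ _ _ _ _ N k mk k0.
rewrite ge0_integral_normal//; last by move=> x; exact: integral_ge0.
apply: eq_integral => x _; rewrite /fubini_F.
have mkx : measurable_fun setT (fun y => k (x, y)) by exact: (measurableT_comp mk (measurable_pair1 x)).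
have mkg : measurable_fun [set: R] (fun y => k (x, y) * (gk t y)%:E)%E.
  by apply: emeasurable_funM => //; exact: emeasurable_gk.
rewrite ge0_integral_normal// muleC -ge0_integralZl//; last by move=> y _; rewrite mule_ge0.
by apply: eq_integral => y _; rewrite /= EFinM muleCA.
Qed.

Lemma planar_normal_fin (t : R) : (planar_normal t setT < +oo)%E.
Proof.
pose N := normal_prob (0 : R) (Num.sqrt t).
have N1 : N [set: measurableTypeR R] = 1%E by exact: probability_setT.
have -> : planar_normal t setT = (N setT * N setT)%E; last by rewrite N1 mule1 ltry.
by rewrite /planar_normal -setXTT; exact: product_measure1E.
Qed.

Lemma gk2E (c : R) (z : R * R) : 0 < c -> expR (- c * (z.1 ^+ 2 + z.2 ^+ 2)) =
  (pi / c) * (gk (2 * c)^-1 z.1 * gk (2 * c)^-1 z.2).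
Proof.
move=> c0; have c20 : 2 * c != 0 by rewrite mulf_neq0// gt_eqF.
have pc : 2 * pi * (2 * c)^-1 = pi / c by field; rewrite gt_eqF.
have p0 : 0 < pi / c by rewrite divr_gt0// pi_gt0.
have ss : Num.sqrt (pi / c) * Num.sqrt (pi / c) = pi / c by rewrite -expr2 sqr_sqrtr// ltW.
have e (a : R) : - a ^+ 2 / (2 * (2 * c)^-1) = - c * a ^+ 2 by field; rewrite gt_eqF.
rewrite /gk pc !e mulrDr expRD -[LHS]mulr1 -[X in _ * X = _](mulfV (lt0r_neq0 p0)) -{2}ss invfM.
by ring.
Qed.

Variables (nu : {measure set (measurableTypeR R * measurableTypeR R)%type -> \bar R}).
Hypothesis nufin : (nu setT < +oo)%E.

Let gaussian_test (c : R) (g : R * R -> R) : 0 < c -> measurable_fun setT g -> (forall z, 0 <= g z) ->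
  (\int[leb2]_z (g z * expR (- c * (z.1 ^+ 2 + z.2 ^+ 2)))%:E =
   (pi / c)%:E * \int[planar_normal (2 * c)^-1]_z (g z)%:E)%E.
Proof.
move=> c0 mg g0; have t0 : 0 < (2 * c)^-1 by rewrite invr_gt0 mulr_gt0.
have g2 z : 0 <= gk (2 * c)^-1 z.1 * gk (2 * c)^-1 z.2 by rewrite mulr_ge0 ?gk_ge0.
rewrite ge0_integral_planar_normal//; last exact/measurable_EFinP.
rewrite -ge0_integralZl//.
- by apply: eq_integral => z _; rewrite gk2E// -!EFinM; congr EFin; ring.
- apply: emeasurable_funM; first exact/measurable_EFinP.
  apply/measurable_EFinP; apply: measurable_funM.
    exact: (measurableT_comp (measurable_gk _) measurable_fst).
  exact: (measurableT_comp (measurable_gk _) measurable_snd).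
- by move=> z _; rewrite mule_ge0// lee_fin.
- by rewrite lee_fin divr_ge0 ?pi_ge0 ?ltW.
Qed.

Definition gaussian_density (C c : R) (z : R * R) := C * expR (- c * (z.1 ^+ 2 + z.2 ^+ 2)).

Lemma measurable_gaussian_density C c : measurable_fun [set: R * R] (gaussian_density C c).
Proof.
have mE : measurable_fun [set: R] (expR : R -> R) by exact: measurable_expR.
apply: measurable_funM => //; apply: (measurableT_comp mE).
apply: measurable_funM => //; apply: measurable_funD; apply: measurable_funX.
  exact: measurable_fst.
exact: measurable_snd.
Qed.

Let planar_scaleE (a t : R) (a0 : 0 <= a) A :
  mscale (NngNum a0) (planar_normal t) A = (a%:E * planar_normal t A)%E.
Proof. by []. Qed.

Let gaussian_set (C c : R) A (C0 : 0 <= C) (c0 : 0 < c) (pc : 0 <= C * (pi / c)) : measurable A ->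
  mscale (NngNum pc) (planar_normal (2 * c)^-1) A = (\int[leb2]_(z in A) (gaussian_density C c z)%:E)%E.
Proof.
move=> mA; have mI : measurable_fun [set: R * R] (\1_A : R * R -> R) by exact: measurable_indic.
have I0 z : 0 <= \1_A z :> R by rewrite indicE ler0n.
rewrite planar_scaleE (measure_indic _ mA) EFinM -muleA -(gaussian_test c0 mI I0) [RHS]integral_mkcond -ge0_integralZl//.
- apply: eq_integral => z _; rewrite /gaussian_density patchE indicE.
  by case: (z \in A); rewrite ?mul1r ?mul0r ?mule0// EFinM.
- apply/measurable_EFinP; apply: measurable_funM => //.
  by have := measurable_gaussian_density 1 c; rewrite /gaussian_density; under eq_fun do rewrite mul1r.
Qed.

(** An upper bound tested on bounded Lipschitz functions holds for all sets. *)
Lemma gaussian_upper (C c : R) : 0 <= C -> 0 < c ->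
  (forall g L, bounded_lip g 1 L -> (\int[nu]_z (g z)%:E <=
     C%:E * \int[leb2]_z (g z * expR (- c * (z.1 ^+ 2 + z.2 ^+ 2)))%:E)%E) ->
  forall A, measurable A -> (nu A <= \int[leb2]_(z in A) (gaussian_density C c z)%:E)%E.
Proof.
move=> C0 c0 le A mA; have pc : 0 <= C * (pi / c) by rewrite mulr_ge0// divr_ge0 ?pi_ge0 ?ltW.
rewrite -(gaussian_set C0 c0 pc)//; apply: measure_le_test => //.
  apply: (@le_lt_trans _ _ ((C * (pi / c))%:E * planar_normal (2 * c)^-1 setT)%E); first exact: lexx.
  by rewrite lte_mul_pinfty// planar_normal_fin.
move=> g L bg; apply: (le_trans (le _ _ bg)); rewrite (gaussian_test c0 (bl_meas bg) (bl_ge0 bg)).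
rewrite ge0_integral_mscale//; first by rewrite muleA.
- by apply/measurable_EFinP; exact: bl_meas bg.
- by move=> z _; rewrite lee_fin (bl_ge0 bg).
Qed.

Lemma gaussian_lower (C c : R) : 0 <= C -> 0 < c ->
  (forall g L, bounded_lip g 1 L -> (C%:E * \int[leb2]_z (g z * expR (- c * (z.1 ^+ 2 + z.2 ^+ 2)))%:E
     <= \int[nu]_z (g z)%:E)%E) ->
  forall A, measurable A -> (\int[leb2]_(z in A) (gaussian_density C c z)%:E <= nu A)%E.
Proof.
move=> C0 c0 le A mA; have pc : 0 <= C * (pi / c) by rewrite mulr_ge0// divr_ge0 ?pi_ge0 ?ltW.
rewrite -(gaussian_set C0 c0 pc)//; apply: measure_le_test => //.
  apply: (@le_lt_trans _ _ ((C * (pi / c))%:E * planar_normal (2 * c)^-1 setT)%E); first exact: lexx.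
  by rewrite lte_mul_pinfty// planar_normal_fin.
move=> g L bg; apply: le_trans (le _ _ bg); rewrite (gaussian_test c0 (bl_meas bg) (bl_ge0 bg)).
rewrite ge0_integral_mscale//; first by rewrite muleA.
- by apply/measurable_EFinP; exact: bl_meas bg.
- by move=> z _; rewrite lee_fin (bl_ge0 bg).
Qed.

End planar_gaussian.

(** * Densities between two bounds *)

Section density_between.
Context {R : realType}.
Variable nu : {finite_measure set (measurableTypeR R * measurableTypeR R)%type -> \bar R}.

Definition density_of (p : R * R -> R) := [/\ measurable_fun setT p, (forall z, 0 <= p z) &
  forall A, measurable A -> nu A = (\int[leb2]_(z in A) (p z)%:E)%E].

(** A density may be replaced on a set [N] by any function that gives the right
    measure to all subsets of [N]. *)
Lemma density_patch (p q r : R * R -> R) (N : set (R * R)) : density_of p ->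
  measurable_fun setT r -> (forall z, 0 <= r z) -> measurable N ->
  (forall z, N z -> r z = q z) -> (forall z, ~ N z -> r z = p z) ->
  (forall A, measurable A -> A `<=` N -> nu A = (\int[leb2]_(z in A) (q z)%:E)%E) ->
  density_of r.
Proof.
move=> [mp p0 pE] mr r0 mN rN rNC hq; split=> // A mA.
have mAN : measurable (A `&` N) by exact: measurableI.
have mAC : measurable (A `\` N) by exact: measurableD.
have AE : A = (A `&` N) `|` (A `\` N) by rewrite setUIDK.
have dis : (A `&` N) `&` (A `\` N) = set0.
  by rewrite -subset0 => z [[_ zN] [_ nN]]; exact: nN.
have mrA (B : set (R * R)) : measurable_fun B (fun z => (r z)%:E).
  by apply: measurable_funTS; exact/measurable_EFinP.
rewrite [in RHS]AE ge0_integral_setU//; last exact/disj_set2P.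
  rewrite [in LHS]AE measureU//; congr (_ + _)%E.
  - transitivity (\int[leb2]_(z in A `&` N) (q z)%:E)%E; first by apply: hq => // z [].
    by apply: eq_integral => z; rewrite inE => -[_ zN]; rewrite rN.
  - transitivity (\int[leb2]_(z in A `\` N) (p z)%:E)%E; first exact: pE.
    by apply: eq_integral => z; rewrite inE => -[_ zN]; rewrite rNC.
- exact: mrA.
- by move=> z _; rewrite lee_fin.
Qed.

Let measurable_lt_set (p q : R * R -> R) : measurable_fun setT p -> measurable_fun setT q ->
  measurable [set z | p z < q z].
Proof.
move=> mp mq; have md : measurable_fun setT (fun z => q z - p z) by exact: measurable_funB.
rewrite (_ : [set z | _] = [set: R * R] `&` (fun z => q z - p z) @^-1` `]0, +oo[%classic).
  by apply: md => //; exact: measurable_itv.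
by rewrite setTI; apply/seteqP; split=> z /=; rewrite in_itv/= andbT subr_gt0.
Qed.

(** A density exists by domination; clamping it between the two bounds changes
    it only where the bounds determine the measure. *)
Lemma density_between (q1 q2 : R * R -> R) :
  measurable_fun setT q1 -> measurable_fun setT q2 -> (forall z, 0 <= q1 z) ->
  (forall z, q1 z <= q2 z) ->
  (forall A, measurable A -> (\int[leb2]_(z in A) (q1 z)%:E <= nu A)%E) ->
  (forall A, measurable A -> (nu A <= \int[leb2]_(z in A) (q2 z)%:E)%E) ->
  exists p, density_of p /\ forall z, q1 z <= p z <= q2 z.
Proof.
move=> mq1 mq2 q10 q12 lo hi.
have q20 z : 0 <= q2 z by exact: le_trans (q12 z).
have meq (q : R * R -> R) (B : set (R * R)) : measurable_fun setT q -> measurable_fun B (fun z => (q z)%:E).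
  by move=> mq; apply: measurable_funTS; exact/measurable_EFinP.
have dom : nu `<< leb2.
  apply/null_content_dominatesP => A mA A0; apply/eqP; rewrite eq_le measure_ge0 andbT.
  apply: (le_trans (hi A mA)); rewrite null_set_integral//; exact: meq.
have [f [f0 ffin fint fE]] := radon_nikodym_sigma_finite dom.
pose p z := fine (f z).
have pf z : (p z)%:E = f z by rewrite /p fineK.
have dp : density_of p.
  split=> [|z|A mA].
  - apply/measurable_EFinP; rewrite (_ : EFin \o p = f); first exact: measurable_int fint.
    by apply/funext => z; exact: pf.
  - by rewrite -lee_fin pf.
  - by rewrite fE//; apply: eq_integral => z _; rewrite pf.
have sub (q r : R * R -> R) (A : set (R * R)) : measurable A -> measurable_fun setT q ->
    measurable_fun setT r -> (forall z, 0 <= q z) -> (forall z, 0 <= r z) ->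
    (forall z, A z -> q z <= r z) ->
    (\int[leb2]_(z in A) (q z)%:E <= \int[leb2]_(z in A) (r z)%:E)%E.
  move=> mA mq mr q0 r0 qr; apply: ge0_le_integral => //.
  - by move=> z _; rewrite lee_fin.
  - exact: meq.
  - exact: meq.
have [mp p0 pE] := dp.
have d1 : density_of (fun z => Num.max (p z) (q1 z)).
  have mr : measurable_fun setT (fun z => Num.max (p z) (q1 z)) by exact: measurable_maxr.
  apply: (@density_patch p q1 _ [set z | p z < q1 z]) => //.
  - by move=> z; rewrite le_max p0.
  - exact: measurable_lt_set.
  - by move=> z /= /ltW; exact: max_r.
  - by move=> z /= /negP; rewrite -leNgt; exact: max_l.
  - move=> A mA AN; apply/eqP; rewrite eq_le lo// andbT pE//.
    by apply: sub => // z /AN /ltW.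
have [mr r0 rE] := d1.
exists (fun z => Num.min (Num.max (p z) (q1 z)) (q2 z)); split; last first.
  by move=> z; rewrite le_min le_max lexx orbT q12 ge_min lexx orbT.
apply: (@density_patch _ q2 _ [set z | q2 z < Num.max (p z) (q1 z)] d1).
- exact: measurable_minr.
- by move=> z; rewrite le_min r0 q20.
- exact: measurable_lt_set.
- by move=> z /= /ltW; exact: min_r.
- by move=> z /= /negP; rewrite -leNgt; exact: min_l.
- move=> A mA AN; apply/eqP; rewrite eq_le hi//= rE//.
  by apply: sub => // z /AN /ltW.
Qed.

End density_between.

(** * Averages over the time interval *)

Section bounded_convergence.
Context d (T : measurableType d) (R : realType) (P : probability T R).

Lemma bounded_convergence (f_ : nat -> T -> R) (f : T -> R) (B : R) :
  (forall n, measurable_fun [set: T] (f_ n)) -> (forall n w, `|f_ n w| <= B) ->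
  (forall w, f_ n w @[n --> \oo] --> f w) ->
  \int[P]_w f_ n w @[n --> \oo] --> \int[P]_w f w.
Proof.
move=> mf fB fcv.
have mlim : measurable_fun [set: T] f by apply: (@measurable_fun_cvg _ _ _ _ f_) => // w _.
have limB w : `|f w| <= B.
  apply: (cvgr_to_le (cvg_norm (fcv w))); near=> n; exact: fB.
have ilim := integrable_bounded P mlim limB.
have cv : (\int[P]_w (f_ n w)%:E)%E @[n --> \oo] --> (\int[P]_w (f w)%:E)%E.
  apply: (@dominated_cvg _ _ _ P setT measurableT (fun n w => (f_ n w)%:E) (fun w => (f w)%:E)
    (fun=> B%:E)).
  - by move=> n; exact/measurable_EFinP.
  - by move=> w _; apply: cvg_EFin => //; [exact: nearW|exact: fcv].
  - by [].
  - exact: finite_measure_integrable_cst.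
  - by move=> n w _; rewrite /= lee_fin.
rewrite integral_EFin_Rintegral// in cv; exact: (fine_cvg cv).
Unshelve. all: by end_near. Qed.

End bounded_convergence.

Section time_average.
Context {R : realType} (mu : probability R R).

(** The mass of a cell, for the image of [mu] under the clamping to the unit
    interval: then the masses sum to one without a null set to discard. *)
Definition grid_weight (n i : nat) : R := \int[mu]_s \1_(cell n i) (clamp01 s).

Let mcell n i : measurable_fun [set: R] (fun s => \1_(cell n i) (clamp01 s) : R).
Proof.
have mI : measurable_fun [set: R] (\1_(cell n i) : R -> R).
  by apply: measurable_indic; exact: measurable_itv.
exact: (measurableT_comp mI (continuous_measurable_fun clamp01_continuous)).
Qed.

Let cell01 n i (s : R) : 0 <= (\1_(cell n i) s : R) <= 1.
Proof. by rewrite indicE; case: (s \in _); rewrite /= ?ler01 ?lexx. Qed.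

Let icell n i : mu.-integrable setT (fun s => (\1_(cell n i) (clamp01 s))%:E).
Proof.
apply: (integrable_bounded mu (M := 1)) => // s.
by have /andP[c0 c1] := cell01 n i (clamp01 s); rewrite ger0_norm.
Qed.

Lemma grid_weight_itv n i : 0 <= grid_weight n i <= 1.
Proof.
apply/andP; split.
  by apply: Rintegral_ge0 => s _; have /andP[] := cell01 n i (clamp01 s).
rewrite -[leRHS](Rintegral_cst1 mu); apply: ae_le_Rintegral => //.
  exact: finite_measure_integrable_cst.
by apply: aeW => s; have /andP[] := cell01 n i (clamp01 s).
Qed.

Lemma grid_weight_sum n (g : nat -> R) : \sum_(i < n.+1) grid_weight n i * g i =
  \int[mu]_s (\sum_(i < n.+1) g i * \1_(cell n i) (clamp01 s)).
Proof.
rewrite Rintegral_sum.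
  apply: eq_bigr => i _; rewrite mulrC /grid_weight; apply: esym.
  exact: (RintegralZl (mu := mu) (g i) measurableT (icell n i)).
by move=> i; exact: (integrableZl measurableT (g i) (icell n i)).
Qed.

Lemma grid_weight_total n : (0 < n)%N -> \sum_(i < n.+1) grid_weight n i = 1.
Proof.
move=> n0; transitivity (\sum_(i < n.+1) grid_weight n i * 1).
  by apply: eq_bigr => i _; rewrite mulr1.
rewrite (grid_weight_sum n (fun=> 1)) -[RHS](Rintegral_cst1 mu).
apply: eq_Rintegral => s _.
by have [j [_ _ ->]] := @cell_sum R n (fun=> 1) (clamp01 s) n0 (clamp01_itv s).
Qed.

Definition tent (s : R) := Num.min (clamp01 s) (1 - clamp01 s).

Definition tent_mean : R := \int[mu]_s tent s.

Let tent_continuous : continuous tent.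
Proof.
move=> s; apply: (@continuous_min R R clamp01 (fun s => 1 - clamp01 s) s).
  exact: clamp01_continuous.
by apply: cvgB; [exact: cvg_cst|exact: clamp01_continuous].
Qed.

Let tent_itv s : 0 <= tent s <= 1.
Proof.
have /andP[c0 c1] := clamp01_itv s.
by rewrite /tent le_min c0 subr_ge0 c1 ge_min c1.
Qed.

Let itent : mu.-integrable setT (fun s => (tent s)%:E).
Proof.
apply: (integrable_bounded mu (M := 1)).
  exact: (continuous_measurable_fun tent_continuous).
by move=> s; have /andP[c0 c1] := tent_itv s; rewrite ger0_norm.
Qed.

(** This is where the mass of [mu] inside the interval is used: were it
    concentrated at the endpoints, the tent would not move the mean, and the
    pair would have no density. *)
Lemma tent_mean_gt0 : (0 < mu `]0%R, 1%R[%classic)%E -> 0 < tent_mean.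
Proof.
move=> mu_int; rewrite lt_neqAle; apply/andP; split; last first.
  by apply: Rintegral_ge0 => s _; have /andP[] := tent_itv s.
apply/eqP => t0; move: mu_int; rewrite lt_neqAle => /andP[/eqP + _]; apply.
have mt : measurable_fun [set: R] (fun s => (tent s)%:E).
  by apply/measurable_EFinP; exact: (continuous_measurable_fun tent_continuous).
have i0 : (\int[mu]_(s in setT) `|(tent s)%:E| = 0)%E.
  under eq_integral => s _.
    rewrite gee0_abs; last by rewrite lee_fin; have /andP[] := tent_itv s.
    over.
  by rewrite integral_EFin_Rintegral// -/tent_mean -t0.
have [h _] := ae_eq_integral_abs mu measurableT mt.
have ae0 := h i0.
apply: esym; apply/negligibleP; first exact: measurable_itv.
apply: negligibleS ae0 => s /=; rewrite in_itv/= => /andP[s0 s1] tE.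
have := tE I => -[]; rewrite /tent clamp01_id ?ltW//.
by apply/eqP; rewrite gt_eqF// lt_min s0 subr_gt0 s1.
Qed.

(** Riemann sums of the tent, which is 1-Lipschitz, converge at the speed of
    the mesh. *)
Lemma tent_mass_ge h : (0 < h)%N -> (h + h)%:R^-1 <= tent_mean / 2 ->
  tent_mean / 2 <= tent_mass h (grid_weight (h + h)).
Proof.
move=> h0 hn; have n0 : (0 < h + h)%N by rewrite addn_gt0 h0.
rewrite /tent_mass grid_weight_sum.
have ge (s : R) : tent s - (h + h)%:R^-1 <=
    \sum_(i < (h + h).+1) hat h i * \1_(cell (h + h) i) (clamp01 s).
  have [j [jn sj ->]] := @cell_sum R (h + h) (hat h) (clamp01 s) n0 (clamp01_itv s).
  move: sj; rewrite ler_distl /tent /hat => /andP[s1 s2].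
  rewrite le_min; apply/andP; split; rewrite lerBlDr ge_min.
    by apply/orP; left; lra.
  by apply/orP; right; lra.
apply: (@le_trans _ _ (\int[mu]_s (tent s - (h + h)%:R^-1))).
  rewrite RintegralB//; last exact: finite_measure_integrable_cst.
  by rewrite (Rintegral_cst1 mu) -/tent_mean; lra.
apply: ae_le_Rintegral.
- by under eq_fun do rewrite EFinB; apply: integrableB => //; exact: finite_measure_integrable_cst.
- under eq_fun do rewrite -sumEFin.
  by apply: integrable_sum => // i _; exact: (integrableZl measurableT (hat h i) (icell (h + h) i)).
- exact: aeW.
Qed.

End time_average.

(** * The law of the mean and the endpoint *)

Section gaussian_constants.
Context {R : realType}.

Definition upper_const (K alpha mu0 : R) : R := expR (2 * CV K alpha) *
  (2 * weight_scale * expR (7 * LB K alpha ^+ 2) / (alpha * mu0 * alpha)).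

Definition lower_const (K alpha mu0 : R) : R := (expR (2 * CV K alpha))^-1 *
  (weight_scale * expR (- lower_rate K alpha mu0 (LB K alpha)) / (2 * (K * K))).

Variables (K alpha mu0 : R).
Hypotheses (K0 : 0 < K) (alpha0 : 0 < alpha) (mu00 : 0 < mu0).

Lemma upper_const_gt0 : 0 < upper_const K alpha mu0.
Proof.
apply: mulr_gt0; first exact: expR_gt0.
apply: divr_gt0; last by rewrite !mulr_gt0.
by rewrite !mulr_gt0 ?expR_gt0// weight_scale_gt0.
Qed.

Lemma lower_const_gt0 : 0 < lower_const K alpha mu0.
Proof.
apply: mulr_gt0; first by rewrite invr_gt0 expR_gt0.
apply: divr_gt0; last by rewrite !mulr_gt0.
by rewrite mulr_gt0 ?expR_gt0// weight_scale_gt0.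
Qed.

Lemma upper_rate_gt0 : 0 < upper_rate K.
Proof. by rewrite invr_gt0 mulr_gt0// exprn_gt0. Qed.

Lemma lower_rate_gt0 (L : R) : 0 < lower_rate K alpha mu0 L.
Proof.
have y0 : 0 < lower_y alpha by rewrite addr_gt0// divr_gt0// exprn_gt0.
have x0 : 0 <= lower_x K alpha mu0.
  apply: divr_ge0; last exact: sqr_ge0.
  have k0 := sqr_ge0 K; have : 0 <= K ^+ 2 * lower_y alpha by rewrite mulr_ge0// ltW.
  by lra.
by have := sqr_ge0 L; rewrite /lower_rate; lra.
Qed.

Lemma EFin_muleA (x y : R) (I : \bar R) : ((x * y)%:E * I = x%:E * (y%:E * I))%E.
Proof. by rewrite EFinM muleA. Qed.

End gaussian_constants.

Section law_bounds.
Context {R : realType} d (T : measurableType d) (P : probability T R).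
Variables (F : R -> set (set T)) (W : R -> T -> R).
Hypothesis (filt : filtration F) (bm : brownian_motion P F W).
Variables (K alpha : R) (M : diffusion_model K alpha) (X0 : R -> T -> R).
Hypothesis sol : sde_solution P F W 1 (vol M) (drift M) 0 X0.
Variable mu : probability R R.
Hypotheses (mu01 : mu `[0, 1]%classic = 1%E) (mu_int : (0 < mu `]0%R, 1%R[%classic)%E).
Local Notation phi := (lamp M).
Local Notation psi := (lampV M).
Local Notation X := (X X0).
Local Notation mu0 := (tent_mean mu / 2).

Definition time_mean w := \int[mu]_(s in `[0, 1]) X0 s w.

Let path_bounded w : exists B, forall s, `|X s w| <= B.
Proof.
have c : continuous (fun s => `|X s w|).
  by move=> s; apply: cvg_norm; exact: (X_continuous sol).
have [s0 _ hs0] := EVT_max (@ler01 R) (continuous_subspaceT c).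
by exists `|X s0 w| => s; rewrite -X_clamp; apply: hs0; rewrite in_itv/= clamp01_itv.
Qed.

Let measurable_path w : measurable_fun [set: R] (X ^~ w).
Proof. by apply: continuous_measurable_fun => s; exact: (X_continuous sol). Qed.

Lemma time_meanE w : time_mean w = \int[mu]_s X s w.
Proof.
have [B hB] := path_bounded w.
have iX := integrable_bounded mu (measurable_path w) hB.
have mD : measurable (`[0%R, 1%R]%classic : set R) by exact: measurable_itv.
have muN : mu (~` `[0%R, 1%R]%classic) = 0%E by rewrite probability_setC// mu01 subee.
rewrite /Rintegral; congr fine.
rewrite (negligible_integral _ _ iX muN)//; last exact: measurableC.
rewrite setTD setCK; apply: eq_integral => s; rewrite inE /= in_itv/= => s01.
by rewrite X_id.
Qed.

(** For each scenario the mean in time is a limit of Riemann sums. *)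
Lemma partial_sum_cvg w :
  partial_sum X0 (h.+1 + h.+1) (grid_weight mu (h.+1 + h.+1)) (h.+1 + h.+1) w @[h --> \oo]
    --> time_mean w.
Proof.
rewrite time_meanE; have [B hB] := path_bounded w.
have pE n : partial_sum X0 n (grid_weight mu n) n w = \int[mu]_s step_process X n s w.
  by rewrite /partial_sum (grid_weight_sum mu n (fun i => X (i%:R / n%:R) w)).
under eq_fun do rewrite pE.
apply: (@bounded_convergence _ _ _ mu (fun h s => step_process X (h.+1 + h.+1) s w) (X ^~ w) B).
- move=> h; apply: measurable_sum => i; apply: measurable_funM => //.
  have mI : measurable_fun [set: R] (\1_(cell (h.+1 + h.+1) i) : R -> R).
    by apply: measurable_indic; exact: measurable_itv.
  exact: (measurableT_comp mI (continuous_measurable_fun clamp01_continuous)).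
- move=> h s; rewrite /step_process.
  by have [j [_ _ ->]] := @cell_sum R (h.+1 + h.+1) (fun i => X (i%:R / (h.+1 + h.+1)%:R) w)
    (clamp01 s) isT (clamp01_itv s).
- move=> s; have cv := @step_process_cvg _ _ _ X (fun s w => X_clamp X0 s w) (fun w => X_continuous sol (w := w)) s w.
  apply: (@cvg_comp _ _ _ (fun h => (h + h.+1)%N) (fun n => step_process X n.+1 s w) _ \oo _ _ cv).
  by move=> A [N _ hN]; exists N => // h Nh; apply: hN; rewrite /= (leq_trans Nh) ?leq_addr.
Qed.

Let grid_itv01 n i : 0 <= grid_weight mu n i <= 1 := grid_weight_itv mu n i.

Let X1 w : X 1 w = X0 1 w. Proof. by rewrite X_id// ler01 lexx. Qed.

Let measurable_X1 : measurable_fun [set: T] (X 1).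
Proof. by apply: (measurable_X filt sol); rewrite ler01 lexx. Qed.

Let measurable_psum n : (0 < n)%N ->
  measurable_fun [set: T] (partial_sum X0 n (grid_weight mu n) n).
Proof.
move=> n0; apply: (knows_measurable filt _ (knows_partial_sum filt sol _ (leqnn n))).
by rewrite divr_ge0.
Qed.

Lemma measurable_time_mean : measurable_fun [set: T] time_mean.
Proof.
apply: (@measurable_fun_cvg _ _ _ _ (fun h => partial_sum X0 (h.+1 + h.+1)
  (grid_weight mu (h.+1 + h.+1)) (h.+1 + h.+1))) => [h|w _]; first exact: measurable_psum.
exact: partial_sum_cvg.
Qed.

Section test_function.
Variables (g : R * R -> R) (L : R).
Hypothesis bg : bounded_lip g 1 L.

Let L0 : 0 <= L := bl_lip_ge0 bg.

Let bg_psi : bounded_lip (fun z => g (z.1, psi z.2)) 1 (L * (1 + K)).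
Proof.
have K0 := K_gt0 M; split=> [|z|z|u y u' y'].
- apply: (measurableT_comp (bl_meas bg)).
  apply: (@measurable_fun_pair _ _ _ _ _ _ fst (psi \o snd)) => //.
  exact: (measurableT_comp (measurable_psi M) measurable_snd).
- exact: (bl_ge0 bg).
- exact: (bl_le bg).
- rewrite (le_trans (bl_lip bg _ _ _ _))//= -mulrA; apply: ler_wpM2l => //.
  have h : `|psi y - psi y'| <= K * `|y - y'|.
    wlog yy : y y' / y' <= y.
      by move=> h; have [/h//|/ltW /h] := leP y' y; rewrite distrC (distrC y).
    have /andP[h1 h2] := psi_lip M yy; have a0 := alpha_gt0 M.
    by rewrite !ger0_norm ?subr_ge0//; rewrite -subr_ge0 (le_trans _ h1)// mulr_ge0 ?subr_ge0// ltW.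
  by have := normr_ge0 (u - u'); have := normr_ge0 (y - y'); nra.
Qed.

Let E h := \int[P]_w g (partial_sum X0 (h.+1 + h.+1) (grid_weight mu (h.+1 + h.+1)) (h.+1 + h.+1) w, X 1 w).

Let E_cvg : E h @[h --> \oo] --> \int[P]_w g (time_mean w, X0 1 w).
Proof.
apply: (@bounded_convergence _ _ _ P _ _ 1) => [h|h w|w].
- apply: (measurableT_comp (bl_meas bg)).
  by apply: measurable_fun_pair; [exact: measurable_psum|exact: measurable_X1].
- by rewrite ger0_norm ?(bl_ge0 bg)// (bl_le bg).
- rewrite -X1; apply/cvgrPdist_le => e e0.
  have e1 : 0 < e / (L + 1) by rewrite divr_gt0// ltr_wpDl.
  have := @partial_sum_cvg w => /cvgrPdist_le/(_ _ e1); apply: filterS => h hh.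
  rewrite (le_trans (bl_lip bg _ _ _ _))// subrr normr0 addr0.
  rewrite (le_trans (ler_wpM2l L0 hh))// mulrA ler_pdivrMr ?ltr_wpDl//.
  by rewrite mulrC ler_pM2l// lerDl.
Qed.

Let fine_grid : \forall h \near \oo, mu0 <= tent_mass h.+1 (grid_weight mu (h.+1 + h.+1)).
Proof.
have m0 : 0 < mu0 by rewrite divr_gt0// tent_mean_gt0.
have := near_infty_natSinv_lt (PosNum m0); apply: filterS => h /= hh.
apply: tent_mass_ge => //; apply: (le_trans _ (ltW hh)).
by rewrite lef_pV2 ?posrE ?ltr0n// ler_nat leq_addr.
Qed.

Let comparison h : let b := back M (h.+1 + h.+1) (grid_weight mu (h.+1 + h.+1))
    (fun z => g (z.1, psi z.2)) (h.+1 + h.+1) (0, 0) in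
  E h <= expR (2 * CV K alpha) * b /\ b <= expR (2 * CV K alpha) * E h.
Proof.
have := scheme_comparison filt bm sol (n := (h.+1 + h.+1)) (m := grid_weight mu (h.+1 + h.+1)) isT (grid_itv01 _) bg_psi.
rewrite /= /E; have -> : (fun w => g (partial_sum X0 (h.+1 + h.+1) (grid_weight mu (h.+1 + h.+1)) (h.+1 + h.+1) w, psi (phi (X 1 w)))) =
  (fun w => g (partial_sum X0 (h.+1 + h.+1) (grid_weight mu (h.+1 + h.+1)) (h.+1 + h.+1) w, X 1 w)).
  by apply/funext => w; rewrite phiK.
by [].
Qed.

(** The bound for the scheme holds on every fine grid with the same constants,
    and the law of the scheme converges to that of the mean and the endpoint. *)
Lemma law_upper : ((\int[P]_w g (time_mean w, X0 1 w))%:E <=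
  (upper_const K alpha mu0)%:E * gauss_integral g (upper_rate K))%E.
Proof.
have m0 : 0 < mu0 by rewrite divr_gt0// tent_mean_gt0.
have key : \forall h \near \oo, ((E h)%:E <= (upper_const K alpha mu0)%:E * gauss_integral g (upper_rate K))%E.
  apply: filterS fine_grid => h fh; have [h1 _] := comparison h.
  apply: (@le_trans _ _ (expR (2 * CV K alpha) * back M (h.+1 + h.+1) (grid_weight mu (h.+1 + h.+1))
    (fun z => g (z.1, psi z.2)) (h.+1 + h.+1) (0, 0))%:E); first by rewrite lee_fin.
  rewrite /upper_const EFin_muleA [leLHS]EFinM; apply: lee_wpmul2l; first by rewrite lee_fin expR_ge0.
  exact: (start_upper filt bm (h := h.+1) isT (grid_itv01 _) (grid_weight_total mu (isT : (0 < h.+1 + h.+1)%N))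
    (bl_meas bg) (bl_ge0 bg) bg_psi m0 fh).
move: key; case: (_ * _)%E => [r| |] key; [|by rewrite leey|]; last first.
  have [h hh] := filter_ex key; by move: hh; rewrite leNgt ltNyr.
by rewrite lee_fin; apply: (cvgr_to_le E_cvg); apply: filterS key => h; rewrite lee_fin.
Qed.

Lemma law_lower : ((lower_const K alpha mu0)%:E *
   gauss_integral g (lower_rate K alpha mu0 (LB K alpha)) <=
  (\int[P]_w g (time_mean w, X0 1 w))%:E)%E.
Proof.
have m0 : 0 < mu0 by rewrite divr_gt0// tent_mean_gt0.
have key : \forall h \near \oo, ((lower_const K alpha mu0)%:E *
   gauss_integral g (lower_rate K alpha mu0 (LB K alpha)) <= (E h)%:E)%E.
  apply: filterS fine_grid => h fh; have [_ h2] := comparison h.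
  have e0 := expR_gt0 (2 * CV K alpha).
  apply: (@le_trans _ _ ((expR (2 * CV K alpha))^-1 * back M (h.+1 + h.+1) (grid_weight mu (h.+1 + h.+1))
    (fun z => g (z.1, psi z.2)) (h.+1 + h.+1) (0, 0))%:E); last first.
    by rewrite lee_fin ler_pdivrMl.
  rewrite /lower_const EFin_muleA [leRHS]EFinM; apply: lee_wpmul2l; first by rewrite lee_fin invr_ge0 expR_ge0.
  exact: (start_lower filt bm (h := h.+1) isT (grid_itv01 _) (grid_weight_total mu (isT : (0 < h.+1 + h.+1)%N))
    (bl_meas bg) (bl_ge0 bg) bg_psi m0 fh).
move: key; case: (_ * _)%E => [r| |] key; [| |by rewrite leNye]; last first.
  have [h hh] := filter_ex key; by move: hh; rewrite leNgt ltry.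
by rewrite lee_fin; apply: (cvgr_to_ge E_cvg); apply: filterS key => h; rewrite lee_fin.
Qed.

End test_function.

(** The test-function bounds become bounds between measures, and then bounds on
    a density. *)
Lemma law_density (c1 c2 : R) : 0 < c2 -> c2 < c1 ->
  c2 <= upper_rate K -> c2 <= (upper_const K alpha mu0)^-1 ->
  lower_rate K alpha mu0 (LB K alpha) <= c1 -> (lower_const K alpha mu0)^-1 <= c1 ->
  exists p : R * R -> R, has_density P (fun w => (time_mean w, X0 1 w)) p /\
    forall u v : R, c1^-1 * expR (- c1 * (u ^+ 2 + v ^+ 2)) <= p (u, v) /\
      p (u, v) <= c2^-1 * expR (- c2 * (u ^+ 2 + v ^+ 2)).
Proof.
move=> c20 c21 cu Cu cl Cl; have c10 := lt_trans c20 c21.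
have m0 : 0 < mu0 by rewrite divr_gt0// tent_mean_gt0.
have Cu0 := upper_const_gt0 K (alpha_gt0 M) m0.
have Cl0 := @lower_const_gt0 R K alpha mu0 (K_gt0 M).
have ru0 := upper_rate_gt0 (K_gt0 M).
have rl0 := lower_rate_gt0 K mu0 (alpha_gt0 M) (LB K alpha).
pose Z w := (time_mean w, X0 1 w) : measurableTypeR R * measurableTypeR R.
have mZ : measurable_fun [set: T] Z.
  apply: (@measurable_fun_pair _ _ _ _ _ _ time_mean (X0 1)); first exact: measurable_time_mean.
  by have := measurable_X1; rewrite (_ : X 1 = X0 1)//; apply/funext => w; exact: X1.
pose Z' : {mfun T >-> (measurableTypeR R * measurableTypeR R)%type} :=
  HB.pack Z (isMeasurableFun.Build _ _ _ _ Z mZ).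
pose nu := distribution P Z'.
have nufin : (nu setT < +oo)%E by rewrite /nu /distribution /pushforward/= preimage_setT probability_setT ltry.
have nuE g L : bounded_lip g 1 L -> (\int[nu]_z (g z)%:E = (\int[P]_w g (time_mean w, X0 1 w))%:E)%E.
  move=> bg; rewrite /nu ge0_integral_distribution//; first last.
  - by move=> z; rewrite lee_fin (bl_ge0 bg).
  - by apply/measurable_EFinP; exact: bl_meas bg.
  rewrite -integral_EFin_Rintegral//; apply: (integrable_bounded P (M := 1)).
    exact: (measurableT_comp (bl_meas bg) mZ).
  by move=> w; rewrite ger0_norm ?(bl_ge0 bg)// (bl_le bg).
have gle (C C' c c' : R) z : 0 <= C -> C <= C' -> c' <= c -> gaussian_density C c z <= gaussian_density C' c' z.
  move=> C0 CC cc; rewrite /gaussian_density; apply: ler_pM; [by []|exact: expR_ge0|by []|].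
  by rewrite ler_expR ler_wpM2r ?lerN2// addr_ge0// sqr_ge0.
have gsub (C C' c c' : R) A : 0 <= C -> C <= C' -> c' <= c -> measurable A ->
    (\int[leb2]_(z in A) (gaussian_density C c z)%:E <= \int[leb2]_(z in A) (gaussian_density C' c' z)%:E)%E.
  move=> C0 CC cc mA; have mg (D e : R) : measurable_fun A (fun z => (gaussian_density D e z)%:E).
    by apply: measurable_funTS; apply/measurable_EFinP; exact: measurable_gaussian_density.
  apply: ge0_le_integral => //.
  - by move=> z _; rewrite lee_fin mulr_ge0// expR_ge0.
  - by move=> z _; rewrite lee_fin gle.
have ic1 : c1^-1 <= lower_const K alpha mu0 by rewrite -[leRHS]invrK lef_pV2// posrE invr_gt0.
have ic2 : upper_const K alpha mu0 <= c2^-1 by rewrite -[leLHS]invrK lef_pV2// posrE invr_gt0.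
have ic10 : 0 <= c1^-1 by rewrite invr_ge0 ltW.
have [p [[mp p0 pE] pq]] : exists p, density_of nu p /\
    forall z, gaussian_density c1^-1 c1 z <= p z <= gaussian_density c2^-1 c2 z.
  apply: density_between.
  - exact: measurable_gaussian_density.
  - exact: measurable_gaussian_density.
  - by move=> z; rewrite mulr_ge0// expR_ge0.
  - by move=> z; apply: gle => //; [rewrite lef_pV2// ltW|exact: ltW].
  - move=> A mA; apply: (le_trans (gsub _ _ _ _ A ic10 ic1 cl mA)).
    apply: (gaussian_lower nufin (ltW Cl0) rl0) => // g L bg.
    by rewrite (nuE g L bg); exact: (law_lower bg).
  - move=> A mA; apply: le_trans (gsub _ _ _ _ A (ltW Cu0) ic2 cu mA).
    apply: (gaussian_upper nufin (ltW Cu0) ru0) => // g L bg.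
    by rewrite (nuE g L bg); exact: (law_upper bg).
exists p; split; last by move=> u v; have /andP[] := pq (u, v).
by split.
Qed.

End law_bounds.

Theorem theorem4 (R : realType) (mu : probability R R)
  (mu01 : mu `[0, 1]%classic = 1%E) (mu_int : (0 < mu `]0%R, 1%R[%classic)%E)
  (K alpha : R) :
  exists c1 c2 : R, [/\ 0 < c2, c2 < c1 &
    forall (t0 t1 : R) (a : R -> R -> R) (b : R -> R),
      t0 <= t1 -> assumption_R `[t0, t1]%classic K alpha a b ->
    forall (d : measure_display) (T : measurableType d) (P : probability T R)
      (F : R -> set (set T)) (W : R -> T -> R),
      filtration F -> brownian_motion P F W ->
    forall (n : nat) (x0 theta : R) (X : R -> T -> R),
      (1 <= n)%N -> theta \in `[t0, t1] ->
      sde_solution P F W 1 (rescaled_diffusion a n x0 theta)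
        (rescaled_drift b n x0) 0 X ->
    exists p : R * R -> R,
      has_density P
        (fun omega => (\int[mu]_(s in `[0, 1]) X s omega, X 1 omega)) p /\
      forall u v : R,
        c1^-1 * expR (- c1 * (u ^+ 2 + v ^+ 2)) <= p (u, v) /\
        p (u, v) <= c2^-1 * expR (- c2 * (u ^+ 2 + v ^+ 2))].
Proof.
pose mu0 := tent_mean mu / 2.
pose cu := upper_rate K; pose Cu := upper_const K alpha mu0.
pose cl := lower_rate K alpha mu0 (LB K alpha); pose Cl := lower_const K alpha mu0.
pose c2 := Num.min cu Cu^-1.
pose c1 := Num.max (Num.max cl Cl^-1) (c2 + 1).
(* [c2] is positive as soon as some coefficients satisfy the assumption;
   otherwise the claim is vacuous and any two constants do. *)
have [c20|c20] := ltP 0 c2; last first.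
  exists 2, 1; split=> [||t0 t1 a b _ R4 d T P F W filt bm n x0 theta X n1 th sol]; [lra|lra|].
  have [M _] := exists_diffusion_model (b := b) x0 R4 th n1.
  have m0 : 0 < mu0 by rewrite divr_gt0// tent_mean_gt0.
  move: c20; rewrite leNgt lt_min (upper_rate_gt0 (K_gt0 M)) invr_gt0.
  by rewrite (upper_const_gt0 K (alpha_gt0 M) m0).
exists c1, c2; split=> [//||t0 t1 a b _ R4 d T P F W filt bm n x0 theta X n1 th sol].
  by rewrite lt_max ltrDl ltr01 orbT.
have [M [volE driftE]] := exists_diffusion_model (b := b) x0 R4 th n1.
rewrite -volE -driftE in sol.
apply: (law_density filt bm sol mu01 mu_int c20).
- by rewrite lt_max ltrDl ltr01 orbT.
- by rewrite ge_min lexx.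
- by rewrite ge_min lexx orbT.
- by rewrite !le_max lexx.
- by rewrite !le_max lexx orbT.
Qed.
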